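(* Let $N\ge 2$, let $\mathbb{B}^2\subset\mathbb{R}^2$ be the open unit disk, let $\Omega=\{y\in\mathbb{R}^N:|y|<1\}$ be the solid unit ball, and let $$X_\Omega=\{u\in H^1(\mathbb{B}^2,\mathbb{R}^N):\ u(x)\notin\Omega \text{ for a.e. } x\in\mathbb{B}^2\}.$$ Let $u\in X_\Omega$ be critical in $X_\Omega$ with respect to the Dirichlet energy $D(u)=\int_{\mathbb{B}^2}|\nabla u|^2$. Then $u\in C^{1,\alpha}_{loc}(\mathbb{B}^2,\mathbb{R}^N)$ for every $\alpha\in(0,1)$.
   Context: For $u\in X_\Omega$ put $\lambda=|u|\ge 1$ and $v=u/|u|$, so that $u=\lambda v$, $\lambda\in H^1(\mathbb{B}^2)$, $v\in H^1(\mathbb{B}^2,\mathbb{S}^{N-1})$ and $|\nabla u|^2=|\nabla\lambda|^2+\lambda^2|\nabla v|^2$ a.e. The map $u$ is called critical in $X_\Omega$ with respect to $D$ if both of the following hold: (i) $\frac{d}{d\varepsilon}\big|_{\varepsilon=0^+}D\big((\lambda+\varepsilon\varphi)v\big)\ge 0$ for every $\varphi\in H^1_0(\mathbb{B}^2)$ such that, for all sufficiently small $\varepsilon>0$, $\lambda+\varepsilon\varphi\ge 1$ a.e. in $\mathbb{B}^2$ and $(\lambda+\varepsilon\varphi)v\in H^1(\mathbb{B}^2,\mathbb{R}^N)$; (ii) $\frac{d}{d\varepsilon}\big|_{\varepsilon=0}D\Big(\lambda\,\frac{v+\varepsilon\psi}{|v+\varepsilon\psi|}\Big)=0$ for every $\psi\in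 C_c^\infty(\mathbb{B}^2,\mathbb{R}^N)$. *)

(* Defs.v *)
From HB Require Import structures.
From mathcomp Require Import all_boot all_order all_algebra.
From mathcomp Require Import all_classical all_reals all_analysis.

Set Implicit Arguments.
Unset Strict Implicit.
Unset Printing Implicit Defensive.

Import Order.TTheory GRing.Theory Num.Theory.
Import numFieldNormedType.Exports.

Local Open Scope classical_set_scope.
Local Open Scope ring_scope.

Section EuclideanNorms.
Context {R : realType}.

(* The library norms on 'rV[R]_N and on R * R are sup norms. *)
Definition enorm (N : nat) (y : 'rV[R]_N) : R :=
  Num.sqrt (\sum_(j < N) y ord0 j ^+ 2).

Definition enorm2 (x : R * R) : R := Num.sqrt (x.1 ^+ 2 + x.2 ^+ 2).

Definition normalize (N : nat) (y : 'rV[R]_N) : 'rV[R]_N :=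
  (enorm y)^-1 *: y.

Definition disk : set (R * R) := [set x | enorm2 x < 1].

Definition solid_ball (N : nat) : set 'rV[R]_N := [set y | enorm y < 1].

Definition leb2 := (@lebesgue_measure R \x @lebesgue_measure R)%E.

End EuclideanNorms.

Arguments solid_ball {R} N.

Section ClassicalSmoothness.
Context {R : realType} {V : normedModType R}.
Implicit Types (f : R * R -> V) (U : set (R * R)).

Definition dir (i : 'I_2) : R * R := ((i == 0)%:R, (i == 1)%:R).

(* U is meant to be open. *)
Fixpoint Ck_on U (k : nat) f : Prop :=
  {in U, continuous f} /\
  (if k is k'.+1 then
     forall i : 'I_2,
       {in U, forall x, derivable f x (dir i)} /\ Ck_on U k' ('D_(dir i) f)
   else True).

(* C_c^oo(disk, V), each function being extended by 0 to the plane. *)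
Definition Ccinfty_disk f : Prop :=
  (forall k, Ck_on setT k f) /\
  exists K : set (R * R),
    [/\ compact K, K `<=` disk & forall x, ~ K x -> f x = 0].

End ClassicalSmoothness.

Section Sobolev.
Context {R : realType}.
Implicit Types (f g : R * R -> R).

(* Representatives are Borel measurable; every Lebesgue measurable function
   agrees a.e. with a Borel one, so no class of L^2 is lost. *)
Definition L2_disk f : Prop :=
  measurable_fun disk f /\
  leb2.-integrable disk (fun x => (f x ^+ 2)%:E).

Definition is_weak_partial (i : 'I_2) f g : Prop :=
  forall phi : R * R -> R, Ccinfty_disk phi ->
    (\int[leb2]_(x in disk) (f x * 'D_(dir i) phi x) =
     - \int[leb2]_(x in disk) (g x * phi x))%R.

(* A representative in L^2 of the i-th weak derivative (it is unique up to
   equality a.e. in the disk), and the constant 0 when there is none. *)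
Definition weak_partial (i : 'I_2) f : R * R -> R :=
  xget (fun=> 0) [set g | L2_disk g /\ is_weak_partial i f g].

Definition H1 f : Prop :=
  L2_disk f /\ forall i, exists2 g, L2_disk g & is_weak_partial i f g.

Definition grad_sq f (x : R * R) : R := \sum_(i < 2) weak_partial i f x ^+ 2.

Definition H1_norm_sq f : R :=
  (\int[leb2]_(x in disk) (f x ^+ 2 + grad_sq f x))%R.

(* The closure of C_c^oo in H^1. *)
Definition H10 f : Prop :=
  H1 f /\ exists2 phi : nat -> R * R -> R, (forall n, Ccinfty_disk (phi n)) &
    (fun n => H1_norm_sq (phi n \- f)) @ \oo --> (0 : R).

Section Vector.
Context {N : nat}.
Implicit Types (u : R * R -> 'rV[R]_N) (j : 'I_N).

Definition component u j : R * R -> R := fun x => u x ord0 j.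

Definition H1v u : Prop := forall j, H1 (component u j).

Definition Dirichlet u : R :=
  (\int[leb2]_(x in disk) (\sum_(j < N) grad_sq (component u j) x))%R.

Definition X_space (Omega : set 'rV[R]_N) u : Prop :=
  H1v u /\ {ae leb2, forall x, disk x -> ~ Omega (u x)}.

Definition admissible u (phi : R * R -> R) : Prop :=
  H10 phi /\
  \forall e \near (0 : R)^'+,
    {ae leb2, forall x, disk x -> 1 <= enorm (u x) + e * phi x} /\
    H1v (fun x => (enorm (u x) + e * phi x) *: normalize (u x)).

(* For small e (e > 0 in the first clause) both families stay in H1v when u is
   in X_space (solid_ball N), so the default value of weak_partial plays no
   role in either derivative at 0. *)
Definition critical u : Prop :=
  (forall phi, admissible u phi ->
     let E (e : R) :=
       Dirichlet (fun x => (enorm (u x) + e * phi x) *: normalize (u x)) in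
     exists2 l : R, (E e - E 0) / e @[e --> (0 : R)^'+] --> l & 0 <= l) /\
  (forall psi : R * R -> 'rV[R]_N, Ccinfty_disk psi ->
     let E (e : R) :=
       Dirichlet (fun x =>
         enorm (u x) *: normalize (normalize (u x) + e *: psi x)) in
     is_derive (0 : R) (1 : R) E 0).

Definition C1alpha_loc (alpha : R) u : Prop :=
  Ck_on disk 1 u /\
  forall K : set (R * R), compact K -> K `<=` disk ->
    exists C : R, forall (i : 'I_2) (x y : R * R), K x -> K y ->
      enorm ('D_(dir i) u x - 'D_(dir i) u y) <= C * enorm2 (x - y) `^ alpha.

End Vector.
End Sobolev.

(* Main.v *)
(* Write u = lambda v. Radial variations -eta G(lambda) with G(1) = 0 show that lambda is subharmonic, hence
 locally bounded. Tangential variations give div (lambda^2 Dv) = - lambda^2 |Dv|^2 v, so that the fields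
 lambda^2 (v_j Dv_k - v_k Dv_j) are divergence free, and as |v| = 1 the right-hand side is a sum of products of
 such a field with Dv_k. A trilinear div-curl estimate, obtained by telescoping over averages on dyadic squares,
 then yields a hole-filling inequality: the integral of |Dv|^2 over a square of side 2^-j is at most C q^j.
 Radial variations phi (1 +- v_j) bound |Delta u_j| by the measure lambda |Dv|^2. Averaging u against Laplacians
 of truncated logarithms, consecutive dyadic averages differ by an integral of Delta u against a bounded
 kernel, so the decay rate q controls the oscillation of u by q^j; the Caccioppoli inequality improves q to q^2, down
 to q = 2^-(1+alpha), and at that rate the gradients of the averages converge to a Hoelder continuous limit. *)
Require Import Defs.
From HB Require Import structures.
From mathcomp Require Import all_boot all_order all_algebra.
From mathcomp Require Import all_classical all_reals all_analysis.
From mathcomp Require Import measurable_realfun ring lra.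
Set Implicit Arguments.
Unset Strict Implicit.
Unset Printing Implicit Defensive.
Import Order.TTheory GRing.Theory Num.Theory.
Import numFieldNormedType.Exports.
Local Open Scope classical_set_scope.
Local Open Scope ring_scope.

(** Three obstacles shape the proof. As [u] may touch the ball, radial variations give only an
    inequality; a two-sided bound on [Delta u_j] is recovered because [phi (1 + v_j)] and
    [phi (1 - v_j)] are nonnegative, hence both outward variations and legitimate tests of
    subharmonicity. Next, in dimension two an H^1 function need not be bounded, so the merely
    integrable [lambda^2 |Dv|^2] cannot be paired naively with it: what saves the trilinear form is
    that the increments of dyadic averages of an H^1 function have sup norms that are square
    summable over the scales, by the mean value theorem and the almost orthogonality of squares of
    different sizes. Finally, the oscillation estimate behind the Caccioppoli step needs a rate
    [q > 1/2], so squaring reaches every rate above [1/4] and not [1/4] itself; the rates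
    [2^-(1+alpha)] with [alpha < 1] are just within reach. Functions on the disk are handled as
    functions on the plane, extended by zero or cut off, so that translations, difference quotients
    and convolutions apply without boundary terms. *)

Local Notation letr y := (@le_trans _ _ y).

(** * Real-valued integration on the plane: L^1, L^2 and the Cauchy-Schwarz inequality *)

Section Toolkit.
Context {R : realType}.
Implicit Types (f g : R * R -> R).

Lemma le_normD (a b c : R) : `|a| + `|b| <= c -> `|a + b| <= c.
exact: le_trans (ler_normD _ _). Qed.
Lemma le_normB (a b c : R) : `|a| + `|b| <= c -> `|a - b| <= c.
exact: le_trans (ler_normB _ _). Qed.

Global Instance leb2_ae_filter : Filter (almost_everywhere (@leb2 R)).
exact: (ae_filter_ringOfSetsType (@lebesgue_measure R \x @lebesgue_measure R)%E).
Qed.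

Definition I f : R := \int[leb2]_x f x.
Definition L1 f : Prop := leb2.-integrable setT (EFin \o f).
Definition mf f : Prop := measurable_fun setT f.

Lemma L1_mf f : L1 f -> mf f.
by move=> /measurable_int/measurable_EFinP. Qed.

Lemma mfD f g : mf f -> mf g -> mf (fun x=> f x + g x).
exact: measurable_funD. Qed.
Lemma mfB f g : mf f -> mf g -> mf (fun x=> f x - g x).
exact: measurable_funB. Qed.
Lemma mfM f g : mf f -> mf g -> mf (fun x=> f x * g x).
exact: measurable_funM. Qed.
Lemma mfN f : mf f -> mf (fun x=> - f x).
by move=> h;apply: measurableT_comp. Qed.
Lemma mfc (c : R) : mf (fun=> c).
exact: measurable_cst. Qed.
Lemma mfZ c f : mf f -> mf (fun x=> c * f x).
by move=> h;apply: mfM=> //;apply: mfc. Qed.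
Lemma mfX f n : mf f -> mf (fun x=> f x ^+ n).
by move=> h;apply: measurable_funX. Qed.
Lemma mf_abs f : mf f -> mf (fun x=> `|f x|).
by move=> h;apply: measurableT_comp. Qed.
Lemma mf_sum n (F : 'I_n -> R * R -> R) : (forall i, mf (F i)) ->
 mf (fun x=> \sum_(i < n) F i x).
by move=> h;apply: measurable_sum. Qed.

Lemma L1_le f g : mf f -> L1 g -> (forall x, `|f x| <= g x) -> L1 f.
move=> hf hg fg;apply: (le_integrable measurableT _ _ hg).
 exact/measurable_EFinP.
move=> x _ /=;rewrite lee_fin;apply: le_trans (fg x) _;exact: ler_norm.
Qed.

Lemma L1D f g : L1 f -> L1 g -> L1 (fun x=> f x + g x).
by move=> hf hg;apply: (integrableD measurableT hf hg). Qed.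
Lemma L1B f g : L1 f -> L1 g -> L1 (fun x=> f x - g x).
by move=> hf hg;apply: (integrableB measurableT hf hg). Qed.
Lemma L1Z c f : L1 f -> L1 (fun x=> c * f x).
by move=> hf;apply: (integrableZl measurableT c hf). Qed.
Lemma L1N f : L1 f -> L1 (fun x=> - f x).
by move=> hf;apply: (integrableN hf). Qed.
Lemma L10 : L1 (fun=> 0).
exact: integrable0. Qed.
Lemma L1_abs f : L1 f -> L1 (fun x=> `|f x|).
by move=> hf;apply: integrable_norm. Qed.
Lemma L1_sum n (F : 'I_n -> R * R -> R) : (forall i, L1 (F i)) ->
 L1 (fun x=> \sum_(i < n) F i x).
move=> h;elim: n F h=> [|n IH] F h.
 by under eq_fun do rewrite big_ord0;exact: L10.
by under eq_fun do rewrite big_ord_recl;apply: L1D=> //;apply: IH.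
Qed.

Lemma L1_bM f g (M : R) : mf f -> (forall x, `|f x| <= M) -> L1 g ->
 L1 (fun x=> f x * g x).
move=> hf hM hg;apply: (@L1_le _ (fun x=> M * `|g x|)).
- by apply: mfM=> //;apply: L1_mf.
- by apply: L1Z;apply: L1_abs.
- by move=> x;rewrite normrM ler_wpM2r.
Qed.

Lemma eq_I f g : (forall x, f x = g x) -> I f = I g.
by move=> h;congr I;apply/funext. Qed.
Lemma ID f g : L1 f -> L1 g -> I (fun x=> f x + g x) = I f + I g.
exact: RintegralD. Qed.
Lemma IB f g : L1 f -> L1 g -> I (fun x=> f x - g x) = I f - I g.
exact: RintegralB. Qed.
Lemma IZ c f : L1 f -> I (fun x=> c * f x) = c * I f.
exact: RintegralZl. Qed.
Lemma IN f : L1 f -> I (fun x=> - f x) = - I f.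
by move=> h;rewrite -[RHS]mulN1r -IZ//;apply: eq_I=> x;rewrite mulN1r.
Qed.
Lemma I0 : I (fun=> 0) = 0.
by rewrite /I /Rintegral integral0. Qed.
Lemma I_sum n (F : 'I_n -> R * R -> R) : (forall i, L1 (F i)) ->
 I (fun x=> \sum_(i < n) F i x) = \sum_(i < n) I (F i).
move=> h;elim: n F h=> [|n IH] F h.
 by rewrite big_ord0 -[RHS]I0;apply: eq_I=> x;rewrite big_ord0.
rewrite big_ord_recl -IH// -ID//;last exact: L1_sum.
by apply: eq_I=> x;rewrite big_ord_recl.
Qed.
Lemma I_le f g : L1 f -> L1 g -> (forall x, f x <= g x) -> I f <= I g.
by move=> hf hg h;apply: le_Rintegral. Qed.
Lemma I_ge0 f : (forall x, 0 <= f x) -> 0 <= I f.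
by move=> h;apply: Rintegral_ge0. Qed.
Lemma I_abs f : L1 f -> `|I f| <= I (fun x=> `|f x|).
by move=> h;apply: le_normr_Rintegral. Qed.
Lemma I_absle f g : mf f -> L1 g -> (forall x, `|f x| <= g x) -> `|I f| <= I g.
move=> hf hg h;have hf1 := L1_le hf hg h.
by apply: le_trans (I_abs hf1) _;apply: I_le=> //;apply: L1_abs.
Qed.
Lemma EFin_I f : L1 f -> (I f)%:E = (\int[leb2]_x (f x)%:E)%E.
by move=> h;rewrite /I /Rintegral fineK//;apply: integrable_fin_num. Qed.

Lemma L1_ae f g : mf f -> L1 g -> {ae leb2, forall x, f x = g x} -> L1 f.
move=> hf hg /= fg.
have hf' : measurable_fun setT (EFin \o f) by exact/measurable_EFinP.
apply/integrableP;split=> //.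
rewrite (_ : (\int[_]_(_ in _) _)%E = (\int[leb2]_x `|(g x)%:E|)%E).
 by move/integrableP : hg=> [].
apply: ae_eq_integral=> //.
- exact: measurableT_comp.
- by apply: measurableT_comp=> //;exact: measurable_int hg.
- by apply: filterS fg=> x /= -> _.
Qed.
Lemma I_ae f g : mf f -> mf g -> {ae leb2, forall x, f x = g x} -> I f = I g.
move=> hf hg fg;rewrite /I /Rintegral;congr fine;apply: ae_eq_integral=> //.
- exact/measurable_EFinP.
- exact/measurable_EFinP.
- by apply: filterS fg=> x /= -> _.
Qed.
Lemma I_eq0 f : L1 f -> (forall x, 0 <= f x) -> I f = 0 ->
 {ae leb2, forall x, f x = 0}.
move=> hf f0 h.
have : (\int[leb2]_x `|(f x)%:E| = 0)%E.
 rewrite -[RHS]/(0%:E) -h EFin_I//;apply: eq_integral=> x _.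
 by rewrite gee0_abs ?lee_fin.
move/(ae_eq_integral_abs leb2 measurableT (measurable_int _ hf)).
by apply: filterS=> x /= /(_ Logic.I) [].
Qed.

Definition L2 f : Prop := mf f /\ L1 (fun x=> f x ^+ 2).
Definition nsq f : R := I (fun x=> f x ^+ 2).

Lemma L2_mf f : L2 f -> mf f. Proof. by case. Qed.
Lemma L2M f g : L2 f -> L2 g -> L1 (fun x=> f x * g x).
move=> [mf1 hf] [mg hg].
apply: (@L1_le _ (fun x=> f x ^+ 2 + g x ^+ 2)).
- exact: mfM.
- exact: L1D.
- move=> x;rewrite ler_norml;apply/andP;split;nra.
Qed.
Lemma L2D f g : L2 f -> L2 g -> L2 (fun x=> f x + g x).
move=> hf hg;split;first by apply: mfD;apply: L2_mf.
rewrite (_ : (fun x=> _) = fun x=> f x ^+2 + 2 * (f x * g x) + g x ^+ 2).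
 apply: L1D;last exact: hg.2.
 by apply: L1D;[exact: hf.2|apply: L1Z;exact: L2M].
by apply/funext=> x;ring.
Qed.
Lemma L2Z c f : L2 f -> L2 (fun x=> c * f x).
move=> [mf1 hf];split;first exact: mfZ.
rewrite (_ : (fun x=> _) = fun x=> c ^+ 2 * f x ^+ 2);first exact: L1Z.
by apply/funext=> x;ring.
Qed.
Lemma L2N f : L2 f -> L2 (fun x=> - f x).
move=> /(L2Z (-1));rewrite (_ : (fun x=> _) = fun x=> - f x)//.
by apply/funext=> x;ring.
Qed.
Lemma L2B f g : L2 f -> L2 g -> L2 (fun x=> f x - g x).
by move=> hf hg;apply: L2D=> //;apply: L2N. Qed.
Lemma L20 : L2 (fun=> 0).
split;first exact: mfc.
by rewrite (_ : (fun x=> _) = fun=> 0);[exact: L10|apply/funext=> x;ring].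
Qed.
Lemma L2_sum n (F : 'I_n -> R * R -> R) : (forall i, L2 (F i)) ->
 L2 (fun x=> \sum_(i < n) F i x).
move=> h;elim: n F h=> [|n IH] F h.
 by under eq_fun do rewrite big_ord0;exact: L20.
by under eq_fun do rewrite big_ord_recl;apply: L2D=> //;apply: IH.
Qed.
Lemma L2_bM f g (M : R) : mf f -> (forall x, `|f x| <= M) -> L2 g ->
 L2 (fun x=> f x * g x).
move=> hf hM [mg hg];split;first exact: mfM.
rewrite (_ : (fun x=> _) = fun x=> f x ^+ 2 * g x ^+ 2);last first.
 by apply/funext=> x;ring.
apply: (@L1_bM _ _ (M ^+ 2))=> //;first exact: mfX.
by move=> x;rewrite normrX lerXn2r ?nnegrE// (le_trans _ (hM x)).
Qed.
Lemma L2_le f g : mf f -> L2 g -> (forall x, `|f x| <= `|g x|) -> L2 f.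
move=> hf [mg hg] h;split=> //;apply: (L1_le _ hg);first exact: mfX.
by move=> x;rewrite normrX -[leRHS]real_normK ?num_real// lerXn2r ?nnegrE.
Qed.
Lemma L2_ae f g : mf f -> L2 g -> {ae leb2, forall x, f x = g x} -> L2 f.
move=> hf [mg hg] h;split=> //;apply: L1_ae hg _;first exact: mfX.
by apply: filterS h=> x /= ->.
Qed.
Lemma nsq_ge0 f : 0 <= nsq f.
by apply: I_ge0=> x;exact: sqr_ge0. Qed.

(** The quadratic polynomial [t -> nsq (t f + g)] is nonnegative. Its value at [- b / a] gives the
    bound; if [a = 0] and [b] were nonzero, the chosen [t] would make it equal to [-1]. *)
Lemma CS f g : L2 f -> L2 g -> (I (fun x=> f x * g x)) ^+ 2 <= nsq f * nsq g.
move=> hf hg.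
set a := nsq f;set b := I _;set c := nsq g.
have key (t : R) : 0 <= a * t ^+ 2 + 2 * b * t + c.
 have -> : a * t ^+ 2 + 2 * b * t + c = nsq (fun x=> t * f x + g x).
  rewrite /nsq (_ : (fun x=> _) =
   fun x=> (t ^+ 2 * f x ^+ 2 + (2 * t) * (f x * g x)) + g x ^+ 2).
   rewrite ID;[|by apply: L1D;apply: L1Z;[exact: hf.2|exact: L2M]|exact: hg.2].
   rewrite ID;[|by apply: L1Z;exact: hf.2|by apply: L1Z;exact: L2M].
   rewrite IZ;last exact: hf.2.
   rewrite IZ;last exact: L2M.
   by rewrite /a /b /c /nsq;ring.
  by apply/funext=> x;ring.
 exact: nsq_ge0.
have a0 : 0 <= a by exact: nsq_ge0.
have c0 : 0 <= c by exact: nsq_ge0.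
have [a_eq0|a_neq0] := eqVneq a 0.
 have [->|bn0] := eqVneq b 0;first by rewrite expr0n/= mulr_ge0.
 have := key (- (c + 1) / (2 * b));rewrite a_eq0 mul0r add0r.
 have -> : 2 * b * (- (c + 1) / (2 * b)) = - (c + 1) by field.
 by move=> h;exfalso;lra.
have ap : 0 < a by rewrite lt_neqAle eq_sym a_neq0.
have := key (- b / a).
rewrite (_ : _ + c = (a * c - b ^+ 2) / a);last by field.
by rewrite ler_pdivlMr// mul0r subr_ge0.
Qed.

Definition nrm f := Num.sqrt (nsq f).
Lemma nrm_ge0 f : 0 <= nrm f. Proof. exact: sqrtr_ge0. Qed.
Lemma nrm_sq f : nrm f ^+ 2 = nsq f.
by rewrite sqr_sqrtr// nsq_ge0. Qed.
Lemma CSn f g : L2 f -> L2 g -> `|I (fun x=> f x * g x)| <= nrm f * nrm g.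
move=> hf hg;rewrite -ler_sqr ?nnegrE ?mulr_ge0 ?nrm_ge0//.
by rewrite real_normK ?num_real// exprMn !nrm_sq;exact: CS.
Qed.
Lemma CSabs f g : L2 f -> L2 g -> I (fun x=> `|f x * g x|) <= nrm f * nrm g.
move=> hf hg.
have h (k : R * R -> R) : L2 k -> L2 (fun x=> `|k x|).
 by move=> hk;apply: (L2_le _ hk);
 [apply: mf_abs;apply: L2_mf|move=> x;rewrite normr_id].
have e (k : R * R -> R) : nrm (fun x=> `|k x|) = nrm k.
 by rewrite /nrm;congr Num.sqrt;apply: eq_I=> x;rewrite real_normK ?num_real.
rewrite -(e f) -(e g);apply: le_trans (CSn (h _ hf) (h _ hg)).
rewrite (eq_I (g := fun x=> `|f x| * `|g x|)) ?ler_norm// => x.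
by rewrite normrM.
Qed.
Lemma nrmZ c f : L2 f -> nrm (fun x=> c * f x) = `|c| * nrm f.
move=> hf;rewrite /nrm /nsq (eq_I (g := fun x=> c ^+ 2 * f x ^+ 2));last first.
 by move=> x;ring.
rewrite IZ;last exact: hf.2.
by rewrite sqrtrM ?sqr_ge0// sqrtr_sqr.
Qed.
Lemma nrmN f : nrm (fun x=> - f x) = nrm f.
by rewrite /nrm;congr Num.sqrt;apply: eq_I=> x;ring. Qed.
Lemma nrmD f g : L2 f -> L2 g -> nrm (fun x=> f x + g x) <= nrm f + nrm g.
move=> hf hg.
rewrite -ler_sqr ?nnegrE ?addr_ge0 ?nrm_ge0// nrm_sq /nsq.
rewrite (eq_I (g := fun x=> (f x ^+ 2 + 2 * (f x * g x)) + g x ^+ 2));last first.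
 by move=> x;ring.
have hfg := L2M hf hg.
rewrite ID;[|by apply: L1D;[exact: hf.2|exact: L1Z]|exact: hg.2].
rewrite ID;[|exact: hf.2|exact: L1Z].
rewrite IZ// -!/(nsq _) sqrrD !nrm_sq.
have := le_trans (ler_norm _) (CSn hf hg).
by rewrite -mulr_natl;lra.
Qed.
Lemma nrm_le f g : L2 f -> L2 g -> (forall x, `|f x| <= `|g x|) -> nrm f <= nrm g.
move=> hf hg h;rewrite /nrm ler_sqrt;last exact: nsq_ge0.
apply: I_le;[exact: hf.2|exact: hg.2|move=> x].
by rewrite -[leLHS]real_normK ?num_real// -[leRHS]real_normK ?num_real// lerXn2r ?nnegrE.
Qed.
Lemma nrmB f g : L2 f -> L2 g -> nrm (fun x=> f x - g x) <= nrm f + nrm g.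
by move=> hf hg;rewrite -(nrmN g);apply: nrmD=> //;exact: L2N. Qed.
Lemma nrm_sum n (F : 'I_n -> R * R -> R) : (forall i, L2 (F i)) ->
 nrm (fun x=> \sum_(i < n) F i x) <= \sum_(i < n) nrm (F i).
move=> h;elim: n F h=> [|n IH] F h.
 rewrite big_ord0;under [X in nrm X]eq_fun do rewrite big_ord0.
 by rewrite /nrm /nsq (eq_I (g := fun=> 0)) ?I0 ?sqrtr0// => x;ring.
under [X in nrm X]eq_fun do rewrite big_ord_recl.
rewrite big_ord_recl;apply: le_trans (nrmD _ _) _=> //;first exact: L2_sum.
by rewrite lerD2l;apply: IH.
Qed.
Lemma nrm_eq0 f : L2 f -> nrm f = 0 -> {ae leb2, forall x, f x = 0}.
move=> hf h;have : nsq f = 0 by rewrite -nrm_sq h expr0n.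
move/(I_eq0 hf.2 (fun x=> sqr_ge0 (f x)));apply: filterS=> x /eqP.
by rewrite sqrf_eq0=> /eqP.
Qed.
End Toolkit.

Local Notation "\I_ x F" := (I (fun x=> F)) (at level 10, x name, F at level 9, format "\I_ x  F").

(** * Squares, their measure, and sigma-finiteness *)

Section Box.
Context {R : realType}.
Implicit Types (c : R * R).
Definition box c (r : R) : set (R * R) :=
 [set x | `|x.1 - c.1| <= r /\ `|x.2 - c.2| <= r].

Lemma boxE c r : box c r = `[c.1 - r, c.1 + r]%classic `*` `[c.2 - r, c.2 + r]%classic.
have h (a b : R) : (`|a - b| <= r) = (a \in `[b - r, b + r]%R).
 by rewrite in_itv/= ler_distl.
by apply/seteqP;split=> x;rewrite /box/= !h.
Qed.
Lemma measurable_box c r : measurable (box c r).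
by rewrite boxE;apply: measurableX. Qed.

Lemma leb2_box c r : 0 <= r -> leb2 (box c r) = (4 * r ^+ 2)%:E.
move=> r0;rewrite boxE /leb2 product_measure1E//.
transitivity ((2 * r)%:E * (2 * r)%:E)%E;last by rewrite -EFinM;congr EFin;ring.
have h (a : R) : lebesgue_measure (`[a - r, a + r]%classic : set R) = (2 * r)%:E.
 rewrite lebesgue_measure_itv/= lte_fin.
 case: ltP=> h;first by rewrite -EFinB;congr EFin;ring.
 by congr EFin;lra.
by congr (_ * _)%E;exact: h.
Qed.

Lemma box0E (r : R) (x : R * R) : box 0 r x = (`|x.1| <= r /\ `|x.2| <= r).
transitivity (`|x.1 - 0| <= r /\ `|x.2 - 0| <= r);first by [].
by rewrite !subr0.
Qed.

Lemma leb2_sigma_finite : sigma_finite setT (@leb2 R).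
exists (fun n=> box 0 n%:R)=> [|n].
 apply/seteqP;split=> // x _.
 have [n hn] : exists n : nat, `|x.1| + `|x.2| <= n%:R.
  exists (Num.truncn (`|x.1| + `|x.2|)).+1;apply: ltW;exact: truncnS_gt.
 exists n=> //;rewrite box0E;split;apply: le_trans hn.
  by rewrite lerDl.
 by rewrite lerDr.
split;first exact: measurable_box.
by rewrite leb2_box ?ltry.
Qed.
End Box.
(** [leb2] is a defined constant: the measure structure of the product is copied onto it, and
    sigma-finiteness is registered because Fubini asks for it. *)
HB.instance Definition _ (R : realType) := Measure.copy (@leb2 R)
 (@lebesgue_measure R \x @lebesgue_measure R)%E.
HB.instance Definition _ (R : realType) := Measure_isSigmaFinite.Build _ _ _ (@leb2 R) (@leb2_sigma_finite R).
#[global] Hint Resolve measurable_box : core.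

(** * Translations and reflections, dominated convergence, Fubini *)

Section Translation.
Context {R : realType}.
Implicit Types (f g : R * R -> R) (v : R * R).

Lemma mfst : mf (fst : R * R -> R).
exact: measurable_fst. Qed.
Lemma msnd : mf (snd : R * R -> R).
exact: measurable_snd. Qed.

Lemma measurable_affine (s : R) v :
 measurable_fun setT (fun x : R * R=> s *: x + v).
apply/measurable_fun_pairP;split=> /=.
- rewrite (_ : _ \o _ = fun x=> s * x.1 + v.1)//.
 by apply: mfD;[apply: mfZ;exact: mfst|exact: mfc].
- rewrite (_ : _ \o _ = fun x=> s * x.2 + v.2)//.
 by apply: mfD;[apply: mfZ;exact: msnd|exact: mfc].
Qed.

(** Only two slopes occur: [1] for translations and [-1] for the reflection behind the symmetry of
    convolution. The translation case is the uniqueness of the measure with the right values on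
    intervals. *)
Lemma lebesgue_measure_affine (s a : R) (A : set R) : (s = 1) \/ (s = -1) ->
 measurable A ->
 lebesgue_measure ((fun t : R=> s * t + a) @^-1` A) = lebesgue_measure A.
move=> hs mA.
have ms : measurable_fun setT (fun t : R=> s * t + a : measurableTypeR R).
 by apply: measurable_funD=> //;apply: measurable_funM.
have mshift : measurable_fun setT (fun t : R=> t + a : measurableTypeR R).
 by apply: measurable_funD.
have h1 B : measurable B -> pushforward lebesgue_measure
  (fun t : R=> t + a : measurableTypeR R) B = lebesgue_measure B.
 move=> mB;apply/esym.
 pose m' := pushforward (@lebesgue_measure R) (fun t : R=> t + a : measurableTypeR R).
 apply: (@lebesgue_measure_unique R m')=> // _ [[p q]] _ <-.
 transitivity (lebesgue_measure `]p - a, q - a]%classic).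
  rewrite !lebesgue_measure_itv/= !lte_fin ltrD2r.
  by case: ifP=> // _;rewrite -!EFinB;congr EFin;ring.
 rewrite /= /m' /pushforward;congr (lebesgue_measure _).
 by apply/seteqP;split=> t /=;rewrite !in_itv/= ltrBlDr lerBrDr.
case: hs=> ->.
 rewrite -[RHS]h1// /pushforward;congr lebesgue_measure.
 by apply/seteqP;split=> t /=;rewrite mul1r.
rewrite -[RHS]h1// -[RHS]lebesgue_measureN;last first.
 by rewrite -[X in measurable X]setTI;apply: mshift.
rewrite /pushforward;congr lebesgue_measure.
by apply/seteqP;split=> t /=;rewrite mulN1r.
Qed.

Lemma leb2_affine (s : R) v (X : set (R * R)) : (s = 1) \/ (s = -1) ->
 measurable X -> leb2 ((fun x=> s *: x + v) @^-1` X) = leb2 X.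
move=> hs mX;apply/esym.
have mp := measurable_affine s v.
pose m'' : {measure set (measurableTypeR R * measurableTypeR R) -> \bar R} :=
 pushforward (@lebesgue_measure R \x @lebesgue_measure R)%E
  (fun x=> s *: x + v : measurableTypeR R * measurableTypeR R).
have := @product_measure_unique _ _ _ _ _ (@lebesgue_measure R) (@lebesgue_measure R) (m'' mp).
rewrite /leb2=> -> // A B mA mB.
transitivity (leb2 (((fun t=> s * t + v.1) @^-1` A) `*` ((fun t=> s * t + v.2) @^-1` B)));first by [].
rewrite /leb2.
rewrite product_measure1E//.
- by congr (_ * _)%E;apply: lebesgue_measure_affine.
- by rewrite -[X in measurable X]setTI;apply: measurable_funD=> //;apply: measurable_funM.
- by rewrite -[X in measurable X]setTI;apply: measurable_funD=> //;apply: measurable_funM.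
Qed.

Lemma mf_aff (s : R) v f : mf f -> mf (fun x=> f (s *: x + v)).
by move=> hf;apply: measurableT_comp (measurable_affine s v). Qed.

Lemma integral_aff (s : R) v f : (s = 1) \/ (s = -1) -> mf f ->
 (forall x, 0 <= f x) ->
 (\int[leb2]_x (f (s *: x + v))%:E = \int[leb2]_x (f x)%:E)%E.
move=> hs hf f0.
have := @ge0_integral_pushforward _ _ (measurableTypeR R * measurableTypeR R)%type
 (measurableTypeR R * measurableTypeR R)%type _ _ (measurable_affine s v)
 (@lebesgue_measure R \x @lebesgue_measure R)%E setT (EFin \o f) measurableT.
move=> <-;last 2 first.
- exact/measurable_EFinP.
- by move=> x _;rewrite lee_fin.
apply: eq_measure_integral;first exact: measurable_affine.
by move=> ? A mA _;apply: leb2_affine.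
Qed.

Lemma L1_aff (s : R) v f : (s = 1) \/ (s = -1) -> L1 f ->
 L1 (fun x=> f (s *: x + v)).
move=> hs hf;have hm := L1_mf hf;apply/integrableP;split.
 by apply/measurable_EFinP;exact: mf_aff.
rewrite (_ : integral _ _ _ = \int[leb2]_x `|(f x)%:E|)%E.
 by case/integrableP : hf.
by rewrite -(@integral_aff s v (fun x=> `|f x|))//;exact: mf_abs.
Qed.

Lemma I_aff (s : R) v f : (s = 1) \/ (s = -1) -> L1 f ->
 \I_x (f (s *: x + v)) = I f.
move=> hs hf;have hm := L1_mf hf.
have h0 g : L1 g -> (forall x, 0 <= g x) -> \I_x (g (s *: x + v)) = I g.
 move=> hg g0;apply: EFin_inj;rewrite !EFin_I//;last exact: L1_aff.
 by apply: integral_aff=> //;exact: L1_mf.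
(* Writing [f] as [(|f| + f) - |f|] reduces the claim to nonnegative integrands. *)
have hp : L1 (fun x=> `|f x| + f x) by apply: L1D=> //;exact: L1_abs.
have hm1 : L1 (fun x=> `|f x|) by exact: L1_abs.
have e1 : I f = \I_x (`|f x| + f x) - \I_x (`|f x|).
 by rewrite -IB//;apply: eq_I=> x;ring.
have a1 := @L1_aff s v _ hs hp;have a2 := @L1_aff s v _ hs hm1.
rewrite e1 -(h0 _ hm1)// -(h0 _ hp).
 by rewrite -IB//;apply: eq_I=> x;ring.
by move=> x;rewrite -lerBlDr sub0r;apply: le_trans (ler_norm _) _;rewrite normrN.
Qed.

Lemma mf_sh v f : mf f -> mf (fun x=> f (x + v)).
by move=> /(mf_aff 1 v);under eq_fun do rewrite scale1r. Qed.
Lemma L1_sh v f : L1 f -> L1 (fun x=> f (x + v)).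
by move=> /(L1_aff v (or_introl erefl));under eq_fun do rewrite scale1r.
Qed.
Lemma I_sh v f : L1 f -> \I_x (f (x + v)) = I f.
move=> /(I_aff v (or_introl erefl)) <-.
by apply: eq_I=> x;rewrite scale1r.
Qed.
Lemma L2_sh v f : L2 f -> L2 (fun x=> f (x + v)).
move=> [mf1 hf];split;first exact: mf_sh.
exact: (@L1_sh v (fun x=> f x ^+ 2)).
Qed.
Lemma nsq_sh v f : L2 f -> nsq (fun x=> f (x + v)) = nsq f.
by move=> [_ hf];exact: (I_sh v hf). Qed.
Lemma nrm_sh v f : L2 f -> nrm (fun x=> f (x + v)) = nrm f.
by move=> hf;rewrite /nrm nsq_sh. Qed.
Lemma mf_op v f : mf f -> mf (fun x=> f (v - x)).
move=> /(mf_aff (-1) v);congr mf;apply/funext=> x.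
by rewrite scaleN1r addrC.
Qed.
Lemma L1_op v f : L1 f -> L1 (fun x=> f (v - x)).
move=> /(L1_aff v (or_intror erefl));congr L1;apply/funext=> x.
by rewrite scaleN1r addrC.
Qed.
Lemma I_op v f : L1 f -> \I_x (f (v - x)) = I f.
move=> /(I_aff v (or_intror erefl)) <-.
by apply: eq_I=> x;rewrite scaleN1r addrC.
Qed.
Lemma L2_op v f : L2 f -> L2 (fun x=> f (v - x)).
by move=> [m hf];split;[exact: mf_op|exact: (L1_op v hf)]. Qed.
Lemma I_dct (F : nat -> R * R -> R) f g : (forall n, mf (F n)) -> mf f -> L1 g ->
 (forall n x, `|F n x| <= g x) -> (forall x, F n x @[n --> \oo] --> f x) ->
 \I_x (`|F n x - f x|) @[n --> \oo] --> (0 : R).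
move=> mF hf hg Fg Ff.
have fg x : `|f x| <= g x.
 have h : `|F n x| @[n --> \oo] --> `|f x| by apply: cvg_norm;exact: Ff.
 rewrite -(cvg_lim (@norm_hausdorff _ _) h).
 by apply: limr_le;[apply/cvg_ex;exists (`|f x|) |apply: nearW=> n;exact: Fg].
have Ff' : {ae (@lebesgue_measure R \x @lebesgue_measure R)%E,
  forall x, setT x -> (EFin \o F n) x @[n --> \oo] --> (EFin \o f) x}.
 apply: aeW=> x _;apply/fine_cvgP;split;first by apply: nearW.
 exact: Ff.
have Fg' : {ae (@lebesgue_measure R \x @lebesgue_measure R)%E,
  forall x n, setT x -> (`|(EFin \o F n) x| <= (EFin \o g) x)%E}.
 by apply: aeW=> x n _;rewrite lee_fin.
have [_ + _] := @dominated_convergence _ (measurableTypeR R * measurableTypeR R)%type R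
 (@lebesgue_measure R \x @lebesgue_measure R)%E setT measurableT
 (fun n=> EFin \o F n) (EFin \o f) (EFin \o g)
 (fun n=> (measurable_EFinP setT (F n)).2 (mF n)) ((measurable_EFinP setT f).2 hf)
 Ff' hg
 Fg'.
by move=> /fine_cvgP[_].
Unshelve. all: by end_near.
Qed.

(** The hypotheses are shaped for convolutions: the slices in [x] are integrable and their L^1 norms
    are dominated by an integrable [G], so Tonelli gives joint integrability. The slices in [y] are
    then integrable only for almost every [x], hence the passage through [fubini_F]. *)
Lemma I_swap (F : R * R -> R * R -> R) (G : R * R -> R) :
 measurable_fun setT (fun z : (R * R) * (R * R)=> F z.1 z.2) ->
 (forall y, L1 (fun x=> F x y)) ->
 L1 G -> (forall y, \I_x (`|F x y|) <= G y) ->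
 [/\ mf (fun y=> \I_x (F x y)), mf (fun x=> \I_y (F x y)),
   L1 (fun x=> \I_y (F x y)) &
   \I_x (\I_y (F x y)) = \I_y (\I_x (F x y))].
move=> mF hF hG FG.
pose T2 := (measurableTypeR R * measurableTypeR R)%type.
pose M2 := @leb2 R.
pose FE (z : T2 * T2) := (F z.1 z.2)%:E.
have mFE : measurable_fun setT FE by exact/measurable_EFinP.
have iF : (M2 \x M2)%E.-integrable setT FE.
 apply: (proj2 (@integrable21ltyP _ _ T2 T2 R (@leb2 R) (@leb2 R) _ mFE)).
 apply: (@le_lt_trans _ _ (\int[leb2]_y (G y)%:E)%E);last first.
  by rewrite -EFin_I// ltry.
 apply: (@ge0_le_integral _ T2 R (@leb2 R) setT measurableT).
 - by move=> ? ?;apply: integral_ge0=> ? ?;rewrite lee_fin.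
 - apply: (measurable_fun_fubini_tonelli_G (abse \o FE))=> //=.
  exact: measurableT_comp.
 - by apply: (proj2 (measurable_EFinP _ _));exact: L1_mf hG.
 - move=> y _;rewrite (_ : (\int[_]_x _)%E = (\I_x (`|F x y|))%:E) ?lee_fin//.
  by rewrite EFin_I//;apply: L1_abs.
have mI1 : mf (fun y=> \I_x (F x y)).
 by apply: measurableT_comp=> //;exact: (measurable_fubini_G iF).
have mI2 : mf (fun x=> \I_y (F x y)).
 by apply: measurableT_comp=> //;exact: (measurable_fubini_F iF).
have ae1 := ae_integrable1 iF.
have iFF := integrable_fubini_F iF.
have aeE : {ae leb2, forall x, (\I_y (F x y))%:E = fubini_F M2 FE x}.
 by apply: filterS ae1=> x /= hx;rewrite EFin_I.
have hL1 : L1 (fun x=> \I_y (F x y)).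
 apply/integrableP;split;first exact/measurable_EFinP.
 rewrite (_ : integral _ _ _ = \int[leb2]_x `|fubini_F M2 FE x|)%E.
  by case/integrableP : iFF.
 apply: ae_eq_integral=> //.
 - by apply: measurableT_comp=> //;exact/measurable_EFinP.
 - by apply: measurableT_comp=> //;case/integrableP : iFF.
 - by apply: filterS aeE=> x /= <- _.
split;[exact: mI1|exact: mI2|exact: hL1|].
apply: EFin_inj;rewrite (EFin_I hL1).
have hL1' : L1 (fun y=> \I_x (F x y)).
 apply: (L1_le mI1 hG)=> y;apply: le_trans (FG y);exact: I_abs.
rewrite (EFin_I hL1').
transitivity (\int[leb2]_x fubini_F M2 FE x)%E.
 apply: ae_eq_integral.
 - exact: measurableT.
 - by apply: (proj2 (measurable_EFinP _ _)).
 - by case/integrableP : iFF.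
 - by apply: filterS aeE=> x /= <- _.
rewrite (Fubini iF);apply: eq_integral=> y _.
by rewrite (EFin_I (hF y)).
Qed.

End Translation.

(** * Continuity of translations in L^1: Lipschitz functions and rectangles *)

Section TranslationContinuity.
Context {R : realType}.
Implicit Types (f g : R * R -> R) (v c : R * R).

Lemma mf_ind (A : set (R * R)) : measurable A -> mf (\1_A : R * R -> R).
by move=> mA;apply: measurable_indic. Qed.
Lemma ind01 (A : set (R * R)) x : 0 <= (\1_A x : R) <= 1.
by rewrite indicE;case: (x \in A);rewrite !lexx ler01. Qed.
Lemma ind_abs (A : set (R * R)) x : `|\1_A x : R| <= 1.
by have /andP[h1 h2] := ind01 A x;rewrite ger0_norm. Qed.
Lemma indT (A : set (R * R)) x : A x -> \1_A x = 1 :> R.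
by move=> h;rewrite indicE mem_set. Qed.
Lemma indF (A : set (R * R)) x : ~ A x -> \1_A x = 0 :> R.
by move=> h;rewrite indicE memNset. Qed.

Lemma integral_box c r : 0 <= r ->
 (\int[leb2]_x (\1_(box c r) x)%:E = (4 * r ^+ 2)%:E)%E.
move=> r0;rewrite -(leb2_box c r0).
have := @integral_indic _ (measurableTypeR R * measurableTypeR R)%type R (@leb2 R) setT measurableT
 (box c r) (measurable_box c r).
by rewrite setIT.
Qed.

Lemma L1_box c r : L1 (\1_(box c r)).
have [r0|r0] := leP 0 r;last first.
 rewrite (_ : \1_ _ = fun=> 0);first exact: L10.
 apply/funext=> x;apply: indF=> -[+ _];rewrite leNgt.
 by rewrite (lt_le_trans r0).
apply/integrableP;split;first by apply/measurable_EFinP;exact: mf_ind.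
rewrite (_ : integral _ _ _ = \int[leb2]_x (\1_(box c r) x)%:E)%E.
 by rewrite integral_box// ltry.
apply: eq_integral=> x _;rewrite gee0_abs// lee_fin.
by case/andP : (ind01 (box c r) x).
Qed.

Lemma I_box c r : 0 <= r -> I (\1_(box c r)) = 4 * r ^+ 2.
by move=> r0;apply: EFin_inj;rewrite EFin_I ?integral_box//;exact: L1_box. Qed.

(** Continuity of translations at [0] in L^1. The class is linear and closed under L^1 limits, so
    all of L^1 is reached through rectangles, then measurable sets, then simple functions. *)
Definition Lc f : Prop := L1 f /\ forall e, 0 < e -> exists2 d, 0 < d &
 forall v, `|v.1| <= d -> `|v.2| <= d -> \I_x (`|f (x + v) - f x|) <= e.

Lemma L1_dist f g : L1 f -> L1 g -> L1 (fun x=> `|f x - g x|).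
by move=> hf hg;apply: L1_abs;exact: L1B. Qed.

Lemma Lc_lim f : L1 f ->
 (forall e, 0 < e -> exists2 g, Lc g & \I_x (`|f x - g x|) <= e) -> Lc f.
move=> hf h;split=> // e e0.
have e3 : 0 < e / 3 by rewrite divr_gt0.
have [g [hg cg] fg] := h _ e3;have [d d0 hd] := cg _ e3.
exists d=> // v v1 v2.
have hv := hd v v1 v2.
have L1fg := L1_dist hf hg.
have L1fgv := L1_sh v L1fg.
have L1gv : L1 (fun x=> `|g (x + v) - g x|) by apply: L1_dist=> //;exact: L1_sh.
apply: (letr (\I_x (`|f (x + v) - g (x + v)| + `|g (x + v) - g x| + `|f x - g x|))).
 apply: I_le.
 - by apply: L1_dist=> //;exact: L1_sh.
 - by apply: L1D=> //;apply: L1D.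
 - move=> x;rewrite (_ : f (x + v) - f x = (f (x + v) - g (x + v)) + (g (x + v) - g x) - (f x - g x));last by ring.
  by apply: le_normB;rewrite lerD2r;apply: ler_normD.
rewrite ID//;last exact: L1D.
rewrite ID// (I_sh v L1fg).
have -> : e = e / 3 + e / 3 + e / 3 by field.
by rewrite !lerD.
Qed.

Lemma Lc0 : Lc (fun=> 0).
split;first exact: L10.
move=> e e0;exists 1=> // v _ _;rewrite (eq_I (g := fun=> 0)) ?I0 ?ltW// => x.
by rewrite subrr normr0.
Qed.
Lemma LcD f g : Lc f -> Lc g -> Lc (fun x=> f x + g x).
move=> [hf cf] [hg cg];split;first exact: L1D.
move=> e e0;have e2 : 0 < e / 2 by rewrite divr_gt0.
have [d d0 hd] := cf _ e2;have [d' d'0 hd'] := cg _ e2.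
exists (Num.min d d');first by rewrite lt_min d0.
move=> v;rewrite !le_min=> /andP[a1 a2] /andP[b1 b2].
have hf' : L1 (fun x=> `|f (x + v) - f x|) by apply: L1_dist=> //;exact: L1_sh.
have hg' : L1 (fun x=> `|g (x + v) - g x|) by apply: L1_dist=> //;exact: L1_sh.
apply: (letr (\I_x (`|f (x + v) - f x| + `|g (x + v) - g x|))).
 apply: I_le;[|exact: L1D|].
  by apply: L1_dist;[apply: (@L1_sh R v (fun x=> f x + g x))|];exact: L1D.
 by move=> x;rewrite opprD addrACA;exact: ler_normD.
by rewrite ID// (splitr e) lerD ?hd ?hd'.
Qed.
Lemma LcZ k f : Lc f -> Lc (fun x=> k * f x).
move=> [hf cf];split;first exact: L1Z.
move=> e e0;have k1 : 0 < `|k| + 1 by rewrite ltr_wpDl.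
have [d d0 hd] := cf _ (divr_gt0 e0 k1).
exists d=> // v v1 v2.
have hf' : L1 (fun x=> `|f (x + v) - f x|) by apply: L1_dist=> //;exact: L1_sh.
rewrite (eq_I (g := fun x=> `|k| * `|f (x + v) - f x|));last first.
 by move=> x;rewrite -mulrBr normrM.
rewrite IZ//;have := hd v v1 v2;rewrite ler_pdivlMr// => h;apply: le_trans h.
by rewrite mulrC;apply: ler_wpM2l;[exact: I_ge0|rewrite lerDl].
Qed.
Lemma LcB f g : Lc f -> Lc g -> Lc (fun x=> f x - g x).
move=> hf /(LcZ (-1)) hg;rewrite (_ : (fun x=> _) = fun x=> f x + -1 * g x).
 exact: LcD.
by apply/funext=> x;ring.
Qed.
Lemma Lc_sum n (F : nat -> R * R -> R) : (forall i, Lc (F i)) ->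
 Lc (fun x=> \sum_(i < n) F i x).
move=> h;elim: n=> [|n IH].
 by under eq_fun do rewrite big_ord0;exact: Lc0.
by under eq_fun do rewrite big_ord_recr;apply: LcD.
Qed.

Lemma Lc_lip f (n K : R) : mf f -> 0 <= K -> 0 <= n ->
 (forall x, ~ box 0 n x -> f x = 0) ->
 (forall x v, `|f (x + v) - f x| <= K * (`|v.1| + `|v.2|)) -> Lc f.
move=> hf K0 n0 f0 lf.
have bnd x : `|f x| <= (K * (4 * n + 2)) * \1_(box 0 n) x.
 have [hx|hx] := pselect (box 0 n x);last by rewrite f0// indF// normr0 mulr0.
 rewrite indT// mulr1.
 (* A translate by [2 n + 1] leaves the support, so the Lipschitz condition alone bounds [f]. *)
 have /f0 fz : ~ box 0 n (x + (2 * n + 1, 0)).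
  rewrite box0E /= => -[+ _];move: hx;rewrite box0E=> -[+ _].
  rewrite !ler_norml;lra.
 have := lf x (2 * n + 1, 0);rewrite fz sub0r normrN normr0 addr0=> h;apply: le_trans h _.
 by rewrite /= ger0_norm;nra.
have L1f : L1 f.
 by apply: (L1_le hf _ bnd);apply: L1Z;exact: L1_box.
split=> // e e0.
have C0 : 0 < 2 * K * (4 * (n + 1) ^+ 2) + 1.
 by have := sqr_ge0 (n + 1);nra.
(* For shifts at most [1] the difference lives in the square of half-side [n + 1], of area
   [4 (n + 1)^2]; the added [1] keeps the denominator positive when [K = 0]. *)
exists (Num.min 1 (e / (2 * K * (4 * (n + 1) ^+ 2) + 1))).
 by rewrite lt_min ltr01 divr_gt0.
set d := Num.min _ _=> v v1 v2.
have d1 : d <= 1 by rewrite ge_min lexx.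
have d0 : 0 <= d by exact: le_trans v1.
have hb x : `|f (x + v) - f x| <= (2 * K * d) * \1_(box 0 (n + 1)) x.
 have [hx|hx] := pselect (box 0 (n + 1) x).
  rewrite indT// mulr1;apply: le_trans (lf _ _) _;nra.
 rewrite indF// mulr0 !f0 ?subr0 ?normr0//.
  by rewrite box0E=> -[h1 h2];apply: hx;rewrite box0E;split;lra.
 rewrite box0E /= => -[h1 h2];apply: hx;rewrite box0E;split.
  rewrite -(addrK v.1 x.1);apply: le_normB;lra.
 rewrite -(addrK v.2 x.2);apply: le_normB;lra.
apply: (letr (\I_x ((2 * K * d) * \1_(box 0 (n + 1)) x))).
 apply: I_le=> //;last by apply: L1Z;exact: L1_box.
 by apply: L1_dist=> //;exact: L1_sh.
rewrite IZ;last exact: L1_box.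
rewrite I_box;last by lra.
have : d <= e / (2 * K * (4 * (n + 1) ^+ 2) + 1) by rewrite ge_min lexx orbT.
rewrite ler_pdivlMr//;nra.
Qed.

Definition clip (t : R) := Num.max 0 (Num.min t 1).
Lemma clip01 t : 0 <= clip t <= 1.
by rewrite /clip le_max lexx/= ge_max ler01 ge_min lexx orbT. Qed.
Lemma clipE t : clip t = if t <= 0 then 0 else if t <= 1 then t else 1.
rewrite /clip;case: (leP t 1)=> h1;first by case: (leP t 0).
by case: (leP t 0)=> h2;[lra|apply: max_idPr].
Qed.
Lemma clip_lip s t : `|clip s - clip t| <= `|s - t|.
have := ler_norm (s - t);have := ler_norm (t - s);rewrite (distrC t s)=> h1 h2.
rewrite ler_norml;apply/andP;split;
 rewrite !clipE;case: (leP s 0)=> ?;case: (leP s 1)=> ?;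
 case: (leP t 0)=> ?;case: (leP t 1)=> ?;lra.
Qed.
Lemma mclip (h : R * R -> R) : mf h -> mf (fun x=> clip (h x)).
move=> hh;rewrite /clip.
by apply: measurable_maxr=> //;apply: measurable_minr.
Qed.

Lemma prod_lip (p q p' q' A B : R) : 0 <= q <= 1 -> 0 <= p' <= 1 ->
 `|p - p'| <= A -> `|q - q'| <= B -> `|p * q - p' * q'| <= A + B.
move=> /andP[q0 q1] /andP[p0 p1] hA hB.
have -> : p * q - p' * q' = (p - p') * q + p' * (q - q') by ring.
apply: le_normD.
rewrite !normrM [`|q|]ger0_norm// [`|p'|]ger0_norm//.
have := normr_ge0 (p - p');have := normr_ge0 (q - q');nra.
Qed.

(** A trapezoid that starts rising at [a] and starts falling at [b], so that its limit in [k] is the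
    indicator of []a, b]] at every point, endpoints included; half-open intervals are the pi-system
    used afterwards. *)
Definition ramp (a b : R) (k : nat) (s : R) : R :=
 clip (k.+1%:R * (s - a)) * clip (1 - k.+1%:R * (s - b)).
Lemma ramp01 a b k s : 0 <= ramp a b k s <= 1.
rewrite /ramp.
have /andP[h1 h2] := clip01 (k.+1%:R * (s - a)).
have /andP[h3 h4] := clip01 (1 - k.+1%:R * (s - b)).
by rewrite mulr_ge0// mulr_ile1.
Qed.
Lemma ramp_lip a b k s t : `|ramp a b k s - ramp a b k t| <= 2 * k.+1%:R * `|s - t|.
rewrite /ramp;set k1 := k.+1%:R;have k0 : 0 <= k1 :> R by [].
rewrite (_ : 2 * k1 * _ = k1 * `|s - t| + k1 * `|s - t|);last by ring.
apply: prod_lip;try exact: clip01;apply: le_trans (clip_lip _ _) _.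
 by rewrite (_ : _ - _ = k1 * (s - t));[rewrite normrM ger0_norm|ring].
by rewrite (_ : _ - _ = k1 * (t - s));[rewrite normrM ger0_norm// distrC|ring].
Qed.
Lemma ramp_supp a b k s : ~ (a <= s <= b + 1) -> ramp a b k s = 0.
move=> h;rewrite /ramp /clip.
have [ha|ha] := leP a s;last first.
 rewrite (_ : Num.max 0 (Num.min (k.+1%:R * _) 1) = 0) ?mul0r//.
 apply/max_idPl;rewrite ge_min;apply/orP;left;rewrite pmulr_rle0//;lra.
have hb : b + 1 < s by rewrite ltNge;apply/negP=> hb;apply: h;rewrite ha.
rewrite (_ : Num.max 0 (Num.min (1 - _) 1) = 0) ?mulr0//.
apply/max_idPl;rewrite ge_min;apply/orP;left.
have : (1 : R) <= k.+1%:R by rewrite ler1n.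
set k1 := k.+1%:R;nra.
Qed.
Lemma ramp_cvg a b s : ramp a b k s @[k --> \oo] --> ((a < s <= b)%R%:R : R).
have [ha|ha] := leP s a.
 rewrite (_ : (fun k=> _) = fun=> 0);first exact: cvg_cst.
 apply/funext=> k;rewrite /ramp /clip.
 rewrite (_ : Num.max 0 (Num.min (k.+1%:R * _) 1) = 0) ?mul0r//.
 apply/max_idPl;rewrite ge_min;apply/orP;left;rewrite pmulr_rle0//;lra.
have clip1 t : 1 <= t -> clip t = 1.
 by move=> t1;rewrite /clip (min_idPr _)//;apply/max_idPr.
have far (t : R) : 0 < t -> \forall k \near \oo, 1 <= k.+1%:R * t.
 move=> t0;near=> k;rewrite -ler_pdivrMr//.
 apply: (letr k%:R);last by rewrite ler_nat.
 by near: k;exact: nbhs_infty_ger.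
have [hb|hb] := leP s b=> /=.
 apply: cvg_near_cst;near=> k;rewrite /ramp.
 rewrite (clip1 (k.+1%:R * _));last by near: k;apply: far;lra.
 rewrite clip1 ?mulr1//.
 have : (0 : R) <= k.+1%:R by []. set k1 := k.+1%:R;nra.
apply: cvg_near_cst;near=> k;rewrite /ramp.
rewrite (_ : clip (1 - _) = 0) ?mulr0//;rewrite /clip.
apply/max_idPl;rewrite ge_min;apply/orP;left.
rewrite subr_le0;near: k;apply: far;lra.
Unshelve. all: by end_near.
Qed.

Lemma Lc_rect (a b c d : R) : Lc (\1_(`]a, b]%classic `*` `]c, d]%classic)).
set Q := _ `*` _;set n := `|a| + `|b| + `|c| + `|d| + 1.
have n0 : 0 <= n by rewrite !addr_ge0.
pose F k (x : R * R) := ramp a b k x.1 * ramp c d k x.2.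
have mpk p q k h : mf h -> mf (fun x=> ramp p q k (h x)).
 move=> hh;apply: mfM;apply: mclip;last apply: mfB;try exact: mfc;
 by apply: mfZ;apply: mfB=> //;exact: mfc.
have mF k : mf (F k) by apply: mfM;apply: mpk;[exact: mfst|exact: msnd].
have Fsupp k x : ~ box 0 n x -> F k x = 0.
 move=> h;rewrite /F.
 have [h1|h1] := pselect (a <= x.1 <= b + 1);last by rewrite ramp_supp ?mul0r.
 have [h2|h2] := pselect (c <= x.2 <= d + 1);last by rewrite [X in _ * X]ramp_supp ?mulr0.
 exfalso;apply: h;move: h1 h2=> /andP[h1 h2] /andP[h3 h4].
 have := ler_norm a;have := ler_norm b;have := ler_norm c;have := ler_norm d.
 have := ler_norm (- a);have := ler_norm (- b);have := ler_norm (- c);have := ler_norm (- d).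
 rewrite !normrN=> *;rewrite box0E /n;split;rewrite ler_norml;lra.
have F01 k x : 0 <= F k x <= 1.
 have /andP[? ?] := ramp01 a b k x.1;have /andP[? ?] := ramp01 c d k x.2.
 by rewrite /F mulr_ge0// mulr_ile1.
have mQ : measurable Q by apply: measurableX.
have Fcvg x : F k x @[k --> \oo] --> (\1_Q x : R).
 rewrite (_ : \1_Q x = (a < x.1 <= b)%R%:R * (c < x.2 <= d)%R%:R).
  by apply: cvgM;exact: ramp_cvg.
 rewrite indicE -natrM mulnb;congr (nat_of_bool _)%:R.
 apply/idP/idP=> [/set_mem[]|/andP[h1 h2]].
  by rewrite /= !in_itv/= => -> ->.
 by apply/mem_set;split;rewrite /= in_itv.
have Fb k x : `|F k x| <= \1_(box 0 n) x.
 have [h|h] := pselect (box 0 n x);last by rewrite Fsupp// normr0;case/andP: (ind01 (box 0 n) x).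
 by rewrite indT//;have /andP[? ?] := F01 k x;rewrite ger0_norm.
have dct := I_dct mF (mf_ind mQ) (L1_box _ _) Fb Fcvg.
have L1Q : L1 (\1_Q).
 apply: (L1_le (mf_ind mQ) (L1_box 0 n))=> x.
 have [hx|hx] := pselect (Q x);last first.
  by rewrite (indF hx) normr0;case/andP: (ind01 (box 0 n) x).
 rewrite (indT hx) normr1 indT//;case: hx=> /=;rewrite !in_itv/= => /andP[h1 h2] /andP[h3 h4].
 have := ler_norm a;have := ler_norm b;have := ler_norm c;have := ler_norm d.
 have := ler_norm (- a);have := ler_norm (- b);have := ler_norm (- c);have := ler_norm (- d).
 rewrite !normrN=> *;rewrite box0E /n;split;rewrite ler_norml;lra.
apply: Lc_lim=> // e e0.
have /cvgrPdist_lt/(_ e e0)[k _ /(_ k (leqnn k))] := dct.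
rewrite sub0r normrN ger0_norm ?I_ge0// => hk.
exists (F k).
 apply: (@Lc_lip _ n (2 * k.+1%:R))=> //.
 - exact: Fsupp.
 move=> x v;rewrite /F /= mulrDr;apply: prod_lip;try exact: ramp01.
  by apply: le_trans (ramp_lip _ _ _ _ _) _;rewrite addrAC subrr add0r.
 by apply: le_trans (ramp_lip _ _ _ _ _) _;rewrite addrAC subrr add0r.
rewrite (eq_I (g := fun x=> `|F k x - \1_Q x|)) ?ltW// => x.
exact: distrC.
Qed.

End TranslationContinuity.

Import HBSimple.

(** * Continuity of translations in L^1 and L^2: general functions *)

Section TranslationContinuity2.
Context {R : realType}.
Implicit Types (f g k : R * R -> R) (v : R * R).

Lemma nrm_le_sq f (c : R) : 0 <= c -> nsq f <= c ^+ 2 -> nrm f <= c.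
by move=> c0 h;rewrite -ler_sqr ?nnegrE ?nrm_ge0// nrm_sq. Qed.

Lemma Lc_ext f g : (forall x, f x = g x) -> Lc f -> Lc g.
by move=> /funext ->. Qed.

(** The sets [A] with the conclusion form a Dynkin class: complements by subtracting from [\1_K],
    countable disjoint unions by dominated convergence. Intersecting with the bounded set [K] keeps
    all indicators integrable. The map [p] is a coordinate or the identity. *)
Lemma Lc_dynkin d (T : measurableType d) (G : set (set T)) (p : R * R -> T)
  (K : set (R * R)) (n : R) :
 measurable_fun setT p -> measurable K -> K `<=` box 0 n ->
 @measurable _ T = <<s G >> -> setI_closed G -> Lc (\1_K) ->
 (forall A, G A -> Lc (\1_(p @^-1` A `&` K))) ->
 forall A, measurable A -> Lc (\1_(p @^-1` A `&` K)).
move=> mp mK Kn GE GI LK LG A;rewrite GE.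
have mpre B : measurable B -> measurable (p @^-1` B `&` K).
 by move=> mB;apply: measurableI=> //;rewrite -[X in measurable X]setTI;apply: mp.
apply: (@dynkin_induction _ T G (fun A=> Lc (\1_(p @^-1` A `&` K))))=> //.
- by rewrite preimage_setT setTI.
- move=> S mS LS;apply: Lc_ext (LcB LK LS)=> x.
 have [hK|hK] := pselect (K x);last first.
  by rewrite !indF ?subr0// => -[].
 rewrite (@indT _ K)//;have [hS|hS] := pselect (S (p x)).
  by rewrite (@indT _ (p @^-1` S `&` K))// indF ?subrr// => -[].
 by rewrite (@indF _ (p @^-1` S `&` K)) ?indT ?subr0// => -[].
- move=> F mF tF LF.
 pose S n := \bigcup_(i < n) F i.
 have mS n' : measurable (S n') by apply: bigcup_measurable=> i _.
 have mU : measurable (\bigcup_i F i) by apply: bigcup_measurable.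
 have LS n' : Lc (\1_(p @^-1` S n' `&` K)).
  apply: Lc_ext (@Lc_sum R n' (fun i=> \1_(p @^-1` F i `&` K)) LF)=> x.
  have [[/= [i /= hi Fx] Kx]|h] := pselect ((p @^-1` S n' `&` K) x).
   rewrite indT;last by split=> //;exists i.
   rewrite (bigD1 (Ordinal hi))//= indT// big1 ?addr0// => j ji.
   apply: indF=> -[Fj _];move: ji;rewrite -val_eqE/= => /eqP;apply.
   have /trivIsetP := tF;move=> /(_ j i Logic.I Logic.I) H.
   have [//|/eqP/H E] := pselect (nat_of_ord j = i).
   by have : (F j `&` F i) (p x) by [];rewrite E.
  rewrite indF// big1// => j _;apply: indF=> -[Fj Kx];apply: h;split=> //.
  by exists j=> //=.
 have L1U : L1 (\1_(p @^-1` (\bigcup_i F i) `&` K)).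
  apply: (L1_le (mf_ind (mpre _ mU)) (L1_box 0 n))=> x.
  have [h|h] := pselect ((p @^-1` (\bigcup_i F i) `&` K) x).
   by rewrite !indT ?normr1//;apply: Kn;case: h.
  by rewrite indF// normr0;case/andP : (ind01 (box 0 n) x).
 apply: Lc_lim=> // e e0.
 have /cvgrPdist_lt/(_ e e0)[N _ /(_ N (leqnn N))] : I (fun x =>
   `|\1_(p @^-1` S n' `&` K) x - \1_(p @^-1` (\bigcup_i F i) `&` K) x|) @[n' --> \oo] --> (0 : R).
  apply: (I_dct (fun n'=> mf_ind (mpre _ (mS n'))) (mf_ind (mpre _ mU)) (L1_box 0 n)).
 - move=> n' x;have [h|h] := pselect ((p @^-1` S n' `&` K) x).
   by rewrite !indT ?normr1//;apply: Kn;case: h.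
  by rewrite indF// normr0;case/andP : (ind01 (box 0 n) x).
 - move=> x;have [[/= [i _ Fx] Kx]|h] := pselect ((p @^-1` (\bigcup_i F i) `&` K) x).
   rewrite indT;last by split=> //;exists i.
   apply: cvg_near_cst;exists i.+1=> // m /= im;rewrite indT//;split=> //.
   by exists i.
  rewrite indF//;apply: cvg_near_cst;apply: nearW=> m;apply: indF=> -[[i _ Fx] Kx].
  by apply: h;split=> //;exists i.
 rewrite sub0r normrN ger0_norm ?I_ge0// => hN.
 exists (\1_(p @^-1` S N `&` K))=> //.
  rewrite (eq_I (g := fun x=> `|\1_(p @^-1` S N `&` K) x - \1_(p @^-1` (\bigcup_i F i) `&` K) x|)) ?ltW// => x.
  exact: distrC.
Qed.

Let W (n : R) : set (R * R) := `]-n, n]%classic `*` `]-n, n]%classic.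

Lemma W_box n : W n `<=` box 0 n.
move=> x [/=];rewrite !in_itv/= => /andP[h1 h2] /andP[h3 h4].
by rewrite box0E;split;rewrite ler_norml (ltW h1, ltW h3).
Qed.

Lemma ocitv_cap (a b c d : R) : `]a, b]%classic `&` `]c, d]%classic =
 `](Num.max a c), (Num.min b d)]%classic.
apply/seteqP;split=> x /=;rewrite !in_itv/= gt_max le_min.
 by move=> [/andP[-> ->] /andP[-> ->]].
by move=> /andP[/andP[-> ->] /andP[-> ->]].
Qed.

(** Three rounds of the Dynkin argument inside a bounded square: Borel set times interval, Borel set
    times Borel set, and finally every set of the generated sigma-algebra. *)
Lemma Lc_measurable (n : R) (E : set (R * R)) : measurable E -> Lc (\1_(E `&` W n)).
move=> mE.
have mWW (A B : set R) : measurable A -> measurable B -> measurable (A `*` B : set (R * R)).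
 by move=> mA mB;apply: measurableX.
have mo (a b : R) : measurable (`]a, b]%classic : set R) by [].
have RE : @measurable _ (measurableTypeR R) = <<s (@ocitv R) >> by [].
have st1 (A : set R) (c d : R) : measurable A ->
  Lc (\1_(fst @^-1` A `&` (`]-n, n]%classic `*` (`]c, d]%classic `&` `]-n, n]%classic)))).
 move=> mA.
 have mp : measurable_fun setT (fst : R * R -> measurableTypeR R) := measurable_fst.
 have mK : measurable (`]-n, n]%classic `*` (`]c, d]%classic `&` `]-n, n]%classic) : set (R * R)).
  by apply: mWW=> //;apply: measurableI.
 apply: (Lc_dynkin mp mK (n := n) _ RE (@ocitvI R))=> //.
 - by move=> x [/= h1 [h2 h3]];apply: W_box.
 - by rewrite ocitv_cap;exact: Lc_rect.
 - move=> _ [[a b] _ <-].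
  rewrite (_ : _ `&` _ = (`]a, b]%classic `&` `]-n, n]%classic) `*` (`]c, d]%classic `&` `]-n, n]%classic)).
   by rewrite !ocitv_cap;exact: Lc_rect.
  by apply/seteqP;split=> x /= => [[h1 [h2 h3]]//|[[h1 h2] h3]].
have st2 (A B : set R) : measurable A -> measurable B ->
  Lc (\1_(snd @^-1` B `&` ((A `&` `]-n, n]%classic) `*` `]-n, n]%classic))).
 move=> mA mB.
 have mp : measurable_fun setT (snd : R * R -> measurableTypeR R) := measurable_snd.
 have mK : measurable ((A `&` `]-n, n]%classic) `*` `]-n, n]%classic : set (R * R)).
  by apply: mWW=> //;apply: measurableI.
 apply: (Lc_dynkin mp mK (n := n) _ RE (@ocitvI R))=> //.
 - by move=> x [/= [h1 h2] h3];apply: W_box.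
 - have := st1 A (- n) n mA;rewrite setIid;apply: Lc_ext=> x;congr (\1_ _ x).
  by apply/seteqP;split=> y /= => [[h1 [h2 h3]]//|[[h1 h2] h3]].
 - move=> _ [[a b] _ <-].
  have := st1 A a b mA;apply: Lc_ext=> x;congr (\1_ _ x).
  by apply/seteqP;split=> y /= => [[h1 [h2 [h3 h4]]]//|[h1 [[h2 h3] h4]]].
apply: (@Lc_dynkin _ _ [set X | exists A, measurable A /\ exists B, measurable B /\ X = A `*` B]
 id _ n _ _ _ _ _ _ _ E)=> //.
- exact: mWW.
- exact: W_box.
- rewrite measurable_prod_measurableType //;congr (<<s _ >>).
 rewrite predeqE;split=> [[A mA [B mB <-]]|[A [mA [B [mB ->]]]]].
  by exists A;split=> //;exists B.
 by exists A=> //;exists B.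
- move=> _ _ [A1 [mA1 [A2 [mA2 ->]]]] [B1 [mB1 [B2 [mB2 ->]]]].
 exists (A1 `&` B1);split;first exact: measurableI.
 by exists (A2 `&` B2);split;[exact: measurableI|rewrite setXI].
- exact: Lc_rect.
- move=> _ [A [mA [B [mB ->]]]].
 have := st2 A B mA mB;apply: Lc_ext=> x;congr (\1_ _ x).
 by apply/seteqP;split=> y /= => [[h1 [[h2 h3] h4]]//|[[h1 h2] [h3 h4]]].
Qed.

Lemma L1_Lc f : L1 f -> Lc f.
move=> hf;apply: Lc_lim=> // e e0.
have [g [hg _ /fine_cvgP[_ /cvgrPdist_lt/(_ (e / 2))]]] :=
 @approximation_sfun_integrable _ (measurableTypeR R * measurableTypeR R)%type R (@leb2 R) setT
  measurableT (EFin \o f) hf.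
rewrite divr_gt0// => /(_ isT)[n _ /(_ n (leqnn n))].
rewrite sub0r normrN.
pose gn : R * R -> R := g n.
have hgn : L1 gn := hg n.
have -> : (fine \o (fun n=> \int[leb2]_z `|(EFin \o f) z - (g n z)%:E|)%E) n
  = \I_x (`|f x - gn x|) by [].
rewrite ger0_norm ?I_ge0// => h1.
(* The level sets of an integrable simple function may be unbounded, so it is first cut off to a
   large square. *)
pose F (m : nat) x := gn x * \1_(W m%:R) x.
have mW m : measurable (W m) by apply: measurableX.
have := @I_dct R F gn (fun x=> `|gn x|)
 (fun m=> mfM (L1_mf hgn) (mf_ind (mW m%:R))) (L1_mf hgn) (L1_abs hgn).
move=> H;have /cvgrPdist_lt/(_ (e / 2)) : \I_x (`|F m x - gn x|) @[m --> \oo] --> (0 : R).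
 apply: H=> [m x|x];first by rewrite /F normrM ler_piMr// ind_abs.
 apply: cvg_near_cst;near=> m;rewrite /F indT ?mulr1//.
 have : `|x.1| + `|x.2| + 1 <= m%:R by near: m;exact: nbhs_infty_ger.
 have := ler_norm x.1;have := ler_norm x.2;have := ler_norm (- x.1);have := ler_norm (- x.2).
 have := normr_ge0 x.1;have := normr_ge0 x.2.
 by rewrite !normrN=> *;split;rewrite /= in_itv/=;apply/andP;split;lra.
rewrite divr_gt0// => /(_ isT)[m _ /(_ m (leqnn m))].
rewrite sub0r normrN ger0_norm ?I_ge0// => h2.
have L1F : L1 (F m).
 apply: (L1_le _ (L1_abs hgn));first by apply: mfM;[exact: L1_mf|exact: mf_ind].
 by move=> x;rewrite /F normrM ler_piMr// ind_abs.
exists (F m).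
 have E : Lc (fun x : R * R=> \sum_(y <- finmap.enum_fset (fset_set (range (g n)))) y *
   \1_((g n @^-1` [set y] : set (R * R)) `&` W m%:R) x);last first.
  apply: Lc_ext E=> x;rewrite /F /gn;have := fimfunE (g n) x;rewrite /= => ->.
  rewrite fsbig_finite//= mulr_suml.
  apply: eq_bigr=> y _;rewrite -mulrA;congr (_ * _).
  by rewrite [in RHS]indicE [in RHS]indicE indicE in_setI;do 2 case: (_ \in _);rewrite ?mulr0 ?mul0r ?mulr1.
 elim: (finmap.enum_fset _)=> [|y s IH].
  by apply: Lc_ext (@Lc0 R)=> x;rewrite big_nil.
 have my : measurable (g n @^-1` [set y] : set (R * R)).
  by rewrite -[X in measurable X]setTI;apply: (L1_mf hgn).
 apply: Lc_ext (LcD (LcZ y (Lc_measurable m%:R my)) IH)=> x.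
 by rewrite big_cons.
apply: (letr (\I_x (`|f x - gn x| + `|F m x - gn x|))).
 apply: I_le;[exact: L1_dist|by apply: L1D;exact: L1_dist|]=> x.
 rewrite (_ : f x - F m x = (f x - gn x) - (F m x - gn x));last by ring.
 exact: ler_normB.
rewrite ID;[|exact: L1_dist|exact: L1_dist].
by rewrite (splitr e) lerD// ltW.
Unshelve. all: by end_near.
Qed.

(** Cutting [f] off to [|f| <= n] and to a square costs little in L^2, and for the resulting bounded
    function the squared increment is at most [2 n] times the increment, so continuity in L^1
    suffices. *)
Lemma L2_shift_cont f : L2 f -> forall e, 0 < e -> exists2 d, 0 < d &
 forall v, `|v.1| <= d -> `|v.2| <= d -> nrm (fun x=> f (x + v) - f x) <= e.
move=> hf e e0.
pose A (n : nat) := [set x | `|f x| <= n%:R] `&` box 0 n%:R.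
have mA n : measurable (A n).
 apply: measurableI;last exact: measurable_box.
 rewrite (_ : [set _ | _] = (fun x=> `|f x|) @^-1` `]-oo, n%:R]%classic);last first.
  by apply/seteqP;split=> x /=;rewrite in_itv.
 by rewrite -[X in measurable X]setTI;apply: (mf_abs hf.1).
pose F n x := f x * \1_(A n) x.
have F2 n : L2 (F n).
 apply: (L2_le _ hf)=> [|x];first by apply: mfM;[exact: hf.1|exact: mf_ind].
 by rewrite normrM ler_piMr// ind_abs.
have := @I_dct R (fun n x=> (f x - F n x) ^+ 2) (fun=> 0) (fun x=> f x ^+ 2)
 (fun n=> mfX 2 (mfB hf.1 (F2 n).1)) (mfc 0) hf.2.
move=> H;have /cvgrPdist_lt/(_ ((e / 3) ^+ 2)) :
  \I_x (`|(f x - F n x) ^+ 2 - 0|) @[n --> \oo] --> (0 : R).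
 apply: H=> [n x|x].
  rewrite /F;have [hx|hx] := pselect (A n x).
   by rewrite indT// mulr1 subrr expr0n normr0 sqr_ge0.
  by rewrite indF// mulr0 subr0 ger0_norm ?sqr_ge0.
 apply: cvg_near_cst;near=> n;rewrite /F indT ?mulr1 ?subrr ?expr0n//.
 have : `|f x| + (`|x.1| + `|x.2|) <= n%:R by near: n;exact: nbhs_infty_ger.
 have := normr_ge0 x.1;have := normr_ge0 x.2;have := normr_ge0 (f x)=> *.
 by split;[rewrite /=;lra|rewrite box0E;split;lra].
rewrite exprn_gt0 ?divr_gt0// => /(_ isT)[n _ /(_ n (leqnn n))].
rewrite sub0r normrN ger0_norm ?I_ge0// => h1.
have hn : nrm (fun x=> f x - F n x) <= e / 3.
 apply: nrm_le_sq;first by rewrite divr_ge0 ?ltW.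
 rewrite /nsq (eq_I (g := fun x=> `|(f x - F n x) ^+ 2 - 0|)) ?ltW// => x.
 by rewrite subr0 ger0_norm ?sqr_ge0.
have FL1 : L1 (F n).
 apply: (@L1_le _ _ (fun x=> n%:R * \1_(box 0 n%:R) x));first exact: (F2 n).1.
  by apply: L1Z;exact: L1_box.
 move=> x;rewrite /F;have [hx|hx] := pselect (A n x).
  by case: (hx)=> h3 h4;rewrite !indT// !mulr1.
 by rewrite (indF hx) mulr0 normr0 mulr_ge0//;case/andP : (ind01 (box 0 n%:R) x).
have Fb x : `|F n x| <= n%:R.
 rewrite /F;have [hx|hx] := pselect (A n x);last by rewrite indF// mulr0 normr0.
 by case: (hx)=> h3 _;rewrite indT// mulr1.
have [_ /(_ ((e / 3) ^+ 2 / (2 * n%:R + 1)))] := L1_Lc FL1.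
have n1 : (0 : R) < 2 * n%:R + 1 by rewrite ltr_wpDl.
rewrite divr_gt0 ?exprn_gt0 ?divr_gt0// => /(_ isT)[d d0 hd].
exists d=> // v v1 v2;have := hd v v1 v2;rewrite ler_pdivlMr// => h2.
have hF : nrm (fun x=> F n (x + v) - F n x) <= e / 3.
 apply: nrm_le_sq;first by rewrite divr_ge0 ?ltW.
 apply: le_trans h2;rewrite /nsq.
 have hL : L1 (fun x=> `|F n (x + v) - F n x|) by apply: L1_dist=> //;exact: L1_sh.
 apply: (letr (\I_x ((2 * n%:R) * `|F n (x + v) - F n x|))).
  apply: I_le;[|exact: L1Z|].
   by apply: (L2B _ _).2;[exact: L2_sh|].
  move=> x;rewrite -real_normK ?num_real// expr2 ler_wpM2r//.
  apply: le_normB;rewrite mulr2n mulrDl mul1r.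
  by apply: lerD.
 by rewrite IZ// mulrC ler_wpM2l ?I_ge0// lerDl.
have L2d : L2 (fun x=> f x - F n x) by exact: L2B.
have L2Fd : L2 (fun x=> F n (x + v) - F n x) by apply: L2B=> //;exact: L2_sh.
have -> : (fun x=> f (x + v) - f x) = (fun x=> ((f (x + v) - F n (x + v)) + (F n (x + v) - F n x)) - (f x - F n x)).
 by apply/funext=> x;ring.
have L2dv := L2_sh v L2d.
apply: le_trans (nrmB _ L2d) _;first exact: L2D.
apply: le_trans (lerD (nrmD L2dv L2Fd) (lexx _)) _.
rewrite (nrm_sh v L2d).
have -> : e = e / 3 + e / 3 + e / 3 by field.
by rewrite !lerD.
Unshelve. all: by end_near.
Qed.

End TranslationContinuity2.

#[global] Opaque I L1 mf.

(** * Convolution with bounded kernels of bounded support *)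

Section Convolution.
Context {R : realType}.
Implicit Types (f g k psi : R * R -> R) (v : R * R).

Definition ker (r : R) k : Prop :=
 [/\ mf k, exists M, forall x, `|k x| <= M & forall x, ~ box 0 r x -> k x = 0].

Definition cv f k (x : R * R) : R := \I_y (f (x - y) * k y).

Lemma ker_bound r k : ker r k -> exists2 M, 0 <= M & forall x, `|k x| <= M * \1_(box 0 r) x.
move=> [_ [M hM] h0];exists M;first exact: le_trans (hM 0).
move=> x;have [h|h] := pselect (box 0 r x);first by rewrite indT// mulr1.
by rewrite h0// normr0 indF// mulr0.
Qed.
Lemma ker_L1 r k : ker r k -> L1 k.
move=> kk;have [M M0 hM] := ker_bound kk;have [mk _ _] := kk.
by apply: (L1_le mk _ hM);apply: L1Z;exact: L1_box.
Qed.
Lemma bounded_L1_L2 f (M : R) : L1 f -> (forall x, `|f x| <= M) -> L2 f.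
move=> hf hM;split;first exact: L1_mf.
rewrite (_ : (fun x=> _) = fun x=> f x * f x).
 by apply: (L1_bM (M := M))=> //;exact: L1_mf.
by apply/funext=> x;ring.
Qed.
Lemma ker_L2 r k : ker r k -> L2 k.
move=> kk;have [_ [M hM] _] := kk.
exact: (bounded_L1_L2 (ker_L1 kk) hM).
Qed.
Lemma L1_sub v f : L1 f -> L1 (fun x=> f (x - v)).
exact: (@L1_sh R (- v)). Qed.
Lemma L2_sub v f : L2 f -> L2 (fun x=> f (x - v)).
exact: (@L2_sh R (- v)). Qed.

Lemma L1_cvint r f k x : L1 f -> ker r k -> L1 (fun y=> f (x - y) * k y).
move=> hf [mk [M hM] _];have h := L1_op x hf.
rewrite (_ : (fun y=> _) = fun y=> k y * f (x - y));last by apply/funext=> y;ring.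
exact: (L1_bM mk hM h).
Qed.

Lemma cvE r f k x : L1 f -> ker r k -> cv f k x = \I_y (f y * k (x - y)).
move=> hf kk;rewrite /cv -(I_op x (L1_cvint x hf kk)).
by apply: eq_I=> y;rewrite subKr.
Qed.

Lemma mf_sub2 f : mf f ->
 measurable_fun setT (fun z : (R * R) * (R * R)=> f (z.1 - z.2)).
move=> hf;apply: measurableT_comp hf _.
apply/measurable_fun_pairP;split=> /=;apply: measurable_funB.
- by apply: measurableT_comp;[exact: measurable_fst|exact: measurable_fst].
- by apply: measurableT_comp;[exact: measurable_fst|exact: measurable_snd].
- by apply: measurableT_comp;[exact: measurable_snd|exact: measurable_fst].
- by apply: measurableT_comp;[exact: measurable_snd|exact: measurable_snd].
Qed.

Lemma cv_swap r f k psi (N : R) : L1 f -> ker r k -> mf psi ->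
 (forall v, L1 (fun x=> psi x * f (x - v))) ->
 (forall v, \I_x (`|psi x * f (x - v)|) <= N) ->
 [/\ L1 (fun x=> psi x * cv f k x),
   L1 (fun y=> k y * \I_x (psi x * f (x - y))) &
   \I_x (psi x * cv f k x) = \I_y (k y * \I_x (psi x * f (x - y)))].
move=> hf kk mpsi hL hN.
have L1k := ker_L1 kk.
pose F (x y : R * R) := psi x * f (x - y) * k y.
have mF0 : measurable_fun setT (fun z : (R * R) * (R * R)=> psi z.1 * f (z.1 - z.2)).
 apply: measurable_funM;last exact: (mf_sub2 (L1_mf hf)).
 by apply: measurableT_comp mpsi _;exact: measurable_fst.
have mF : measurable_fun setT (fun z : (R * R) * (R * R)=> F z.1 z.2).
 apply: measurable_funM=> //.
 by apply: measurableT_comp (L1_mf L1k) _;exact: measurable_snd.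
have eF x y : F x y = k y * (psi x * f (x - y)) by rewrite /F;ring.
have hF y : L1 (fun x=> F x y).
 by under eq_fun do rewrite eF;apply: L1Z.
have hG : L1 (fun y=> N * `|k y|) by apply: L1Z;exact: L1_abs.
have FG y : \I_x (`|F x y|) <= N * `|k y|.
 rewrite (eq_I (g := fun x=> `|k y| * `|psi x * f (x - y)|)).
  by rewrite IZ;[rewrite mulrC ler_wpM2r|exact: L1_abs].
 by move=> x;rewrite eF normrM.
have [m1 m2 m3 m4] := I_swap mF hF hG FG.
have e1 : (fun x=> \I_y (F x y)) = (fun x=> psi x * cv f k x).
 apply/funext=> x;rewrite -IZ;last exact: (L1_cvint x hf kk).
 by apply: eq_I=> y;rewrite /F;ring.
have e2 : (fun y=> \I_x (F x y)) = (fun y=> k y * \I_x (psi x * f (x - y))).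
 by apply/funext=> y;rewrite -IZ//;apply: eq_I=> x;rewrite eF.
split.
- by rewrite -e1.
- rewrite -e2;apply: (L1_le m1 hG)=> y;apply: le_trans (FG y);exact: I_abs.
- by rewrite -e1 -e2.
Qed.

Lemma I_sub v f : L1 f -> \I_x (f (x - v)) = I f.
exact: (@I_sh R (- v)). Qed.
Lemma nrm_sub v f : L2 f -> nrm (fun x=> f (x - v)) = nrm f.
exact: (@nrm_sh R (- v)). Qed.

Lemma L1_cv r f k : L1 f -> ker r k -> L1 (cv f k).
move=> hf kk.
have [] := @cv_swap r f k (fun=> 1) (\I_x (`|f x|)) hf kk (mfc 1).
- by move=> v;under eq_fun do rewrite mul1r;exact: L1_sub.
- move=> v;rewrite (eq_I (g := fun x=> `|f (x - v)|))=> [|x];last by rewrite mul1r.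
 by rewrite (@I_sub v (fun x=> `|f x|)) ?lexx//;exact: L1_abs.
- by move=> + _ _;congr L1;apply/funext=> x;rewrite mul1r.
Qed.

Lemma ker_box r : ker r (\1_(box 0 r)).
split;[exact: mf_ind|by exists 1=> x;exact: ind_abs|exact: indF].
Qed.

(** Cauchy-Schwarz in the convolution variable bounds [(cv f k x)^2] by [nsq k] times the
    convolution of [f^2] with the indicator of the support of [k], which is integrable. *)
Lemma L2_cv r f k : L1 f -> L2 f -> ker r k -> L2 (cv f k).
move=> hf hf2 kk;have mc := L1_mf (L1_cv hf kk);split=> //.
have hq := L1_cv hf2.2 (ker_box r).
have L2k := ker_L2 kk.
apply: (@L1_le _ _ (fun x=> nsq k * cv (fun x=> f x ^+ 2) (\1_(box 0 r)) x)).
- exact: mfX.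
- exact: L1Z.
- move=> x;rewrite ger0_norm ?sqr_ge0//.
 have h2 : L2 (fun y=> f (x - y) * \1_(box 0 r) y).
  rewrite (_ : (fun y=> _) = fun y=> \1_(box 0 r) y * f (x - y)).
   apply: (@L2_bM _ _ _ 1);[exact: mf_ind|exact: ind_abs|exact: L2_op].
  by apply/funext=> y;rewrite mulrC.
 have := CS h2 L2k;rewrite mulrC.
 congr (_ <= _).
  congr (_ ^+ 2);apply: eq_I=> y;have [hy|hy] := pselect (box 0 r y).
   by rewrite indT// mulr1.
  by have [_ _ ->//] := kk;rewrite !mulr0.
 congr (_ * _);apply: eq_I=> y;rewrite indicE;case: (y \in _)=> /=.
  by rewrite !mulr1.
 by rewrite !mulr0 expr0n.
Qed.

(** A dual form of Minkowski's integral inequality: by Fubini the pairing is the [k]-weighted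
    integral of the pairings of [psi] with [f (x - v) - f x], and only [v] in the support of [k]
    counts. It is used for [psi] in L^2, for bounded [psi], and for integrable [psi] with bounded
    [f]. *)
Lemma cv_dual r f k psi (N D : R) : L1 f -> ker r k -> mf psi ->
 (forall v, L1 (fun x=> psi x * f (x - v))) ->
 (forall v, \I_x (`|psi x * f (x - v)|) <= N) ->
 (forall v, box 0 r v -> `|\I_x (psi x * (f (x - v) - f x))| <= D) ->
 `|\I_x (psi x * (cv f k x - I k * f x))| <= \I_y (`|k y|) * D.
move=> hf kk mpsi hL hN hD.
have [h1 h2 h3] := cv_swap hf kk mpsi hL hN.
have hp0 : L1 (fun x=> psi x * f x).
 by have := hL 0;congr L1;apply/funext=> x;rewrite subr0.
have L1k := ker_L1 kk.
have eI y : \I_x (psi x * (f (x - y) - f x)) =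
  \I_x (psi x * f (x - y)) - \I_x (psi x * f x).
 rewrite -IB;[|exact: hL|exact: hp0].
 by apply: eq_I=> x;ring.
clear hL hN.
rewrite (eq_I (g := fun x=> psi x * cv f k x - I k * (psi x * f x)));last by move=> x;ring.
rewrite (IB h1 (L1Z _ hp0)) h3 (IZ _ hp0) mulrC -(IZ _ L1k) -(IB h2 (L1Z _ L1k)).
have hB := L1B h2 (L1Z (\I_x (psi x * f x)) L1k).
apply: le_trans (I_abs hB) _.
rewrite mulrC -(IZ _ (L1_abs L1k)).
apply: I_le;[exact: L1_abs|exact: (L1Z _ (L1_abs L1k))|]=> y.
have -> : k y * \I_x (psi x * f (x - y)) - \I_x (psi x * f x) * k y =
  k y * \I_x (psi x * (f (x - y) - f x)) by rewrite eI;ring.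
rewrite normrM mulrC;have [hy|hy] := pselect (box 0 r y).
 by apply: ler_wpM2r;[exact: normr_ge0|exact: hD].
by have [_ _ k0] := kk;rewrite (k0 y hy) normr0 !mulr0.
Qed.

Lemma L2_L2_shift f psi v : L2 f -> L2 psi ->
 L1 (fun x=> psi x * f (x - v)) /\ \I_x (`|psi x * f (x - v)|) <= nrm psi * nrm f.
move=> hf hp;split;first by apply: L2M=> //;exact: L2_sub.
by rewrite -(nrm_sub v hf);apply: CSabs=> //;exact: L2_sub.
Qed.

Lemma cv_L2_approx f : L1 f -> L2 f -> forall e, 0 < e -> exists2 d, 0 < d &
 forall k r, ker r k -> r <= d ->
 nrm (fun x=> cv f k x - I k * f x) <= e * \I_y (`|k y|).
move=> hf hf2 e e0;have [d d0 hd] := L2_shift_cont hf2 e0.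
exists d=> // k r kk rd.
pose psi x := cv f k x - I k * f x.
have hp : L2 psi by apply: L2B;[exact: (L2_cv hf hf2 kk)|exact: L2Z].
have := @cv_dual r f k psi (nrm psi * nrm f) (nrm psi * e) hf kk hp.1
 (fun v=> (L2_L2_shift v hf2 hp).1) (fun v=> (L2_L2_shift v hf2 hp).2) _.
move=> /(_ _)/(le_trans (ler_norm _)) H.
have {}H : nsq psi <= \I_y (`|k y|) * (nrm psi * e).
 apply: le_trans (H _).
  by rewrite le_eqVlt;apply/orP;left;apply/eqP;apply: eq_I=> x;rewrite -expr2.
 move=> v;rewrite box0E=> -[v1 v2].
 have L2d : L2 (fun x=> f (x - v) - f x) by apply: L2B=> //;exact: L2_sub.
 apply: le_trans (CSn hp L2d) _;rewrite ler_wpM2l ?nrm_ge0//.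
 by apply: hd;rewrite /= normrN;[exact: le_trans v1 rd|exact: le_trans v2 rd].
rewrite -nrm_sq in H;rewrite -/psi.
have [p0|p0] := eqVneq (nrm psi) 0.
 by rewrite p0 mulr_ge0 ?I_ge0// ltW.
have pp : 0 < nrm psi by rewrite lt_neqAle eq_sym p0 nrm_ge0.
rewrite -(ler_pM2l pp) -expr2;apply: le_trans H _.
by rewrite le_eqVlt;apply/orP;left;apply/eqP;ring.
Qed.

Lemma cv_L1_dual f : L1 f -> forall e, 0 < e -> exists2 d, 0 < d &
 forall k r, ker r k -> r <= d -> forall psi M, mf psi -> (forall x, `|psi x| <= M) ->
 `|\I_x (psi x * (cv f k x - I k * f x))| <= M * e * \I_y (`|k y|).
move=> hf e e0;have [_ /(_ _ e0)[d d0 hd]] := L1_Lc hf.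
exists d=> // k r kk rd psi M mp hM.
have M0 : 0 <= M by exact: le_trans (hM 0).
rewrite mulrC;apply: (@cv_dual r f k psi (M * \I_x (`|f x|)))=> //.
- by move=> v;apply: (L1_bM mp hM);exact: L1_sub.
- move=> v;rewrite -(@I_sub v (fun x=> `|f x|));last exact: L1_abs.
 have hfv : L1 (fun x=> `|f (x - v)|) by apply: L1_abs;exact: L1_sub.
 rewrite -IZ//;apply: I_le.
 + by apply: L1_abs;apply: (L1_bM mp hM);exact: L1_sub.
 + exact: L1Z.
 + by move=> x;rewrite normrM ler_wpM2r.
- move=> v;rewrite box0E=> -[v1 v2].
 have hL : L1 (fun x=> `|f (x - v) - f x|) by apply: L1_dist=> //;exact: L1_sub.
 apply: (letr (\I_x (M * `|f (x - v) - f x|))).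
  apply: I_absle;[|exact: L1Z|].
   by apply: mfM=> //;apply: L1_mf;apply: L1B=> //;exact: L1_sub.
  by move=> x;rewrite normrM ler_wpM2r.
 rewrite IZ// ler_wpM2l//.
 by apply: hd;rewrite /= normrN;[exact: le_trans v1 rd|exact: le_trans v2 rd].
Qed.

Lemma cv_L1_approx f : L1 f -> forall e, 0 < e -> exists2 d, 0 < d &
 forall k r, ker r k -> r <= d ->
 \I_x (`|cv f k x - I k * f x|) <= e * \I_y (`|k y|).
move=> hf e e0;have [d d0 hd] := cv_L1_dual hf e0.
exists d=> // k r kk rd.
pose u x := cv f k x - I k * f x.
have mu : mf u by apply: mfB;[exact: (L1_mf (L1_cv hf kk))|apply: mfZ;exact: L1_mf].
(* Testing against the sign of the error recovers its L^1 norm. *)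
have := hd k r kk rd (fun x=> Num.sg (u x)) 1.
rewrite mul1r=> H;apply: le_trans (H _ _)=> [||x].
- rewrite -[leLHS]ger0_norm ?I_ge0// le_eqVlt;apply/orP;left;apply/eqP.
 by congr (`|_|);apply: eq_I=> x;rewrite -/(u x) -normrEsg.
- have -> : (fun x=> Num.sg (u x)) = (fun x=> (0 < u x)%R%:R - (u x < 0)%R%:R).
  apply/funext=> x;case: (ltrgt0P (u x))=> h.
  + by rewrite gtr0_sg// subr0.
  + by rewrite ltr0_sg// sub0r.
  + by rewrite h sgr0 subr0.
 have hs (A : set R) : measurable A -> mf (fun x=> \1_A (u x) : R).
  by move=> mA;apply: measurableT_comp mu;exact: measurable_indic.
 apply: mfB.
 + have := hs `]0, +oo[%classic (measurable_itv _);congr mf;apply/funext=> x.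
  by rewrite indicE;congr (nat_of_bool _)%:R;rewrite -[RHS]andbT;apply/idP/idP;rewrite inE/= in_itv.
 + have := hs `]-oo, 0[%classic (measurable_itv _);congr mf;apply/funext=> x.
  by rewrite indicE;congr (nat_of_bool _)%:R;apply/idP/idP;rewrite inE/= in_itv.
- by rewrite /= normr_sg;case: (_ != 0).
Qed.

End Convolution.

(** * Directional derivatives as derivatives along lines *)

Section LineDerivatives.
Context {R : realType}.
Implicit Types (f g : R * R -> R) (x v : R * R).

Lemma is_derive_lineP f x v (l : R) :
 is_derive x v f l <-> is_derive (0 : R) 1 (fun h : R=> f (h *: v + x)) l.
have e : (fun h : R=> h^-1 *: ((fun h : R=> f (h *: v + x)) (h *: 1 + 0) - f (0 *: v + x)))
  = (fun h=> h^-1 *: ((f \o shift x) (h *: v) - f x)).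
 by apply/funext=> h /=;rewrite addr0 scale0r add0r [h *: 1]mulr1.
split=> -[d1 d2];split.
- exact: (proj1 (derivable1P _ _ _) d1).
- by rewrite -d2 /derive -e.
- exact: (proj2 (derivable1P _ _ _) d1).
- by rewrite -d2 /derive -e.
Qed.

Lemma is_derive_comp1 f (h : R -> R) x v (l m : R) :
 is_derive x v f l -> is_derive (f x) 1 h m ->
 is_derive x v (fun y=> h (f y)) (m * l).
move=> /is_derive_lineP df dh;apply/is_derive_lineP.
have dh' : is_derive ((fun t : R=> f (t *: v + x)) 0) 1 h m by rewrite scale0r add0r.
exact: is_derive1_comp.
Qed.

Lemma is_derive_line f x v (l t : R) :
 is_derive (x + t *: v) v f l -> is_derive t 1 (fun h : R=> f (x + h *: v)) l.
move=> /is_derive_lineP df.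
pose g (h : R) := h - t.
have d1 : is_derive t 1 g 1 by rewrite /g;apply: is_derive_eq;rewrite subr0.
have df' : is_derive (g t) 1 (fun h : R=> f (h *: v + (x + t *: v))) l.
 by rewrite /g subrr.
have := @is_derive1_comp _ _ _ _ _ _ df' d1;rewrite mulr1.
rewrite (_ : _ \o g = (fun h : R=> f (x + h *: v)))//;apply/funext=> h /=.
by congr f;rewrite /g scalerBl [x + _]addrC addrA subrK addrC.
Qed.

End LineDerivatives.

(** * The algebra of smooth functions on the plane *)

Section Smooth.
Context {R : realType}.
Implicit Types (f g : R * R -> R) (x v : R * R) (i : 'I_2).

Definition dd i f : R * R -> R := 'D_(dir i) f.
Definition Sm f : Prop := forall k, Ck_on setT k f.

Lemma Ck_cont k f : Ck_on setT k f -> continuous f.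
by case: k=> [|k] [h _] x;apply: h;rewrite inE. Qed.
Lemma CkS_derive k f i x : Ck_on setT k.+1 f -> is_derive x (dir i) f (dd i f x).
by move=> [_ /(_ i)[h _]];apply/derivableP/h;rewrite inE. Qed.
Lemma CkS_dd k f i : Ck_on setT k.+1 f -> Ck_on setT k (dd i f).
by move=> [_ /(_ i)[_ h]]. Qed.
Lemma CkI k f (df : 'I_2 -> R * R -> R) : continuous f ->
 (forall i x, is_derive x (dir i) f (df i x)) -> (forall i, Ck_on setT k (df i)) ->
 Ck_on setT k.+1 f.
move=> cf hd hk;split;first by move=> x _;exact: cf.
move=> i;split;first by move=> x _;case: (hd i x).
by rewrite (_ : 'D_(dir i) f = df i)//;apply/funext=> x;case: (hd i x).
Qed.
Lemma Ck_W k f : Ck_on setT k.+1 f -> Ck_on setT k f.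
elim: k f=> [|k IH] f h;first by split=> // x _;exact: (Ck_cont h).
apply: (@CkI _ _ (fun i=> dd i f));first exact: Ck_cont h.
 by move=> i x;exact: CkS_derive h.
by move=> i;apply: IH;exact: CkS_dd h.
Qed.
Lemma Ck_0 f : continuous f -> Ck_on setT 0 f.
by move=> h;split=> // x _;exact: h. Qed.

Lemma CkD k f g : Ck_on setT k f -> Ck_on setT k g -> Ck_on setT k (fun x=> f x + g x).
elim: k f g=> [|k IH] f g hf hg.
 apply: Ck_0=> x;apply: continuousD;[exact: Ck_cont hf x|exact: Ck_cont hg x].
apply: (@CkI _ _ (fun i x=> dd i f x + dd i g x)).
- by move=> x;apply: continuousD;[exact: Ck_cont hf x|exact: Ck_cont hg x].
- move=> i x;have df := CkS_derive i x hf;have dg := CkS_derive i x hg.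
 exact: is_deriveD.
- by move=> i;apply: IH;exact: CkS_dd.
Qed.
Lemma CkM k f g : Ck_on setT k f -> Ck_on setT k g -> Ck_on setT k (fun x=> f x * g x).
elim: k f g=> [|k IH] f g hf hg.
 apply: Ck_0=> x;apply: continuousM;[exact: Ck_cont hf x|exact: Ck_cont hg x].
apply: (@CkI _ _ (fun i x=> f x * dd i g x + g x * dd i f x)).
- by move=> x;apply: continuousM;[exact: Ck_cont hf x|exact: Ck_cont hg x].
- move=> i x;have df := CkS_derive i x hf;have dg := CkS_derive i x hg.
 exact: is_deriveM.
- by move=> i;apply: CkD;apply: IH;try exact: Ck_W;exact: CkS_dd.
Qed.
Lemma Ck_cst k (c : R) : Ck_on setT k (fun=> c).
elim: k c=> [|k IH] c;first by apply: Ck_0=> x;exact: cst_continuous.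
by apply: (@CkI _ _ (fun _ _=> 0))=> //;move=> x;exact: cst_continuous.
Qed.

Lemma Sm_D f g : Sm f -> Sm g -> Sm (fun x=> f x + g x).
by move=> hf hg k;exact: CkD. Qed.
Lemma Sm_M f g : Sm f -> Sm g -> Sm (fun x=> f x * g x).
by move=> hf hg k;exact: CkM. Qed.
Lemma Sm_c (c : R) : Sm (fun=> c).
by move=> k;exact: Ck_cst. Qed.
Lemma Sm_Z (c : R) f : Sm f -> Sm (fun x=> c * f x).
by move=> hf;apply: Sm_M=> //;exact: Sm_c. Qed.
Lemma Sm_N f : Sm f -> Sm (fun x=> - f x).
move=> /(Sm_Z (-1));congr Sm;apply/funext=> x;exact: mulN1r.
Qed.
Lemma Sm_B f g : Sm f -> Sm g -> Sm (fun x=> f x - g x).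
by move=> hf hg;apply: Sm_D=> //;exact: Sm_N. Qed.
Lemma Sm_ext f g : (forall x, f x = g x) -> Sm f -> Sm g.
by move=> /funext ->. Qed.
Lemma Sm_cont f : Sm f -> continuous f.
by move=> /(_ 0%N)/Ck_cont. Qed.
Lemma Sm_der f i x : Sm f -> is_derive x (dir i) f (dd i f x).
by move=> /(_ 1%N)/CkS_derive. Qed.
Lemma Sm_dd f i : Sm f -> Sm (dd i f).
by move=> hf k;apply: CkS_dd;exact: hf. Qed.
Lemma SmI f (df : 'I_2 -> R * R -> R) : (forall i x, is_derive x (dir i) f (df i x)) ->
 continuous f -> (forall i, Sm (df i)) -> Sm f.
move=> hd cf hS [|k];first exact: Ck_0.
by apply: (CkI cf hd)=> i;exact: hS.
Qed.

Lemma is_derive_affine (t a b : R) : is_derive t 1 (fun h : R=> h * a + b) a.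
have h1 : is_derive t 1 (fun h : R=> h * a) a.
 have : is_derive t 1 (a \*: (id : R -> R)) (a *: (1 : R)) by exact: is_deriveZ.
 rewrite [a *: _]mulr1 (_ : a \*: id = (fun h=> h * a))//.
 by apply/funext=> h;exact: mulrC.
by have := is_deriveD h1 (is_derive_cst b t 1);rewrite addr0.
Qed.

Lemma Sm_fst : Sm fst.
apply: (@SmI _ (fun i _=> (dir i).1)).
- move=> i x;apply/is_derive_lineP;exact: is_derive_affine.
- by move=> x;exact: cvg_fst.
- by move=> i;exact: Sm_c.
Qed.
Lemma Sm_snd : Sm snd.
apply: (@SmI _ (fun i _=> (dir i).2)).
- move=> i x;apply/is_derive_lineP;exact: is_derive_affine.
- by move=> x;exact: cvg_snd.
- by move=> i;exact: Sm_c.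
Qed.

Lemma dd_eq i f x (l : R) : is_derive x (dir i) f l -> dd i f x = l.
by case. Qed.
Lemma dd_D i f g x : Sm f -> Sm g -> dd i (fun x=> f x + g x) x = dd i f x + dd i g x.
by move=> hf hg;apply: dd_eq;apply: is_deriveD;exact: Sm_der. Qed.
Lemma dd_M i f g x : Sm f -> Sm g ->
 dd i (fun x=> f x * g x) x = f x * dd i g x + g x * dd i f x.
move=> hf hg;apply: dd_eq.
have df := Sm_der i x hf;have dg := Sm_der i x hg;exact: is_deriveM.
Qed.
Lemma dd_c i (c : R) x : dd i (fun=> c) x = 0.
by apply: dd_eq;exact: is_derive_cst. Qed.
Lemma dd_Z i (c : R) f x : Sm f -> dd i (fun x=> c * f x) x = c * dd i f x.
by move=> hf;rewrite dd_M ?dd_c ?mulr0 ?addr0//;exact: Sm_c. Qed.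
Lemma dd_N i f x : Sm f -> dd i (fun x=> - f x) x = - dd i f x.
move=> hf;rewrite -[RHS]mulN1r -dd_Z//;congr (dd i _ x).
by apply/funext=> y;rewrite mulN1r.
Qed.
Lemma dd_B i f g x : Sm f -> Sm g -> dd i (fun x=> f x - g x) x = dd i f x - dd i g x.
by move=> hf hg;rewrite dd_D ?dd_N//;exact: Sm_N. Qed.
Lemma dd_fst i x : dd i fst x = (dir i).1.
by apply: dd_eq;apply/is_derive_lineP;exact: is_derive_affine. Qed.
Lemma dd_snd i x : dd i snd x = (dir i).2.
by apply: dd_eq;apply/is_derive_lineP;exact: is_derive_affine. Qed.

(** Infinite differentiability witnessed by the whole sequence of derivatives, so that the induction
    for compositions can run over all members of the sequence at once. *)
Definition smooth1 (h : R -> R) : Prop := exists2 G : nat -> R -> R, G 0%N = h &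
 forall (n : nat) (t : R), is_derive t (1 : R) (G n) (G n.+1 t).

Lemma is_derive_cont (h : R -> R) (t l : R) : is_derive t 1 h l -> {for t, continuous h}.
by move=> [d _];exact/differentiable_continuous/derivable1_diffP. Qed.

Lemma Sm_comp f (h : R -> R) : smooth1 h -> Sm f -> Sm (fun x=> h (f x)).
move=> [G <- hG] hf k.
have cG n : continuous (fun x=> G n (f x)).
 move=> x;apply: (@continuous_comp _ _ _ f (G n));first exact: Sm_cont hf x.
 exact: is_derive_cont (hG n (f x)).
elim: k 0%N=> [|k IH] n;first exact: Ck_0.
apply: (@CkI _ _ (fun i x=> G n.+1 (f x) * dd i f x))=> //.
- by move=> i x;apply: is_derive_comp1=> //;exact: Sm_der.
- by move=> i;apply: CkM;[exact: IH|exact: Sm_dd].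
Qed.

(** The regularity improves itself: the derivative of [f^-1] is [- f^-1 f^-1 Df], so [C^k] for
    [f^-1] yields [C^(k+1)]. *)
Lemma Sm_V f : Sm f -> (forall x, 0 < f x) -> Sm (fun x=> (f x)^-1).
move=> hf f0.
have cf : continuous (fun x=> (f x)^-1).
 move=> x;apply: (@continuous_comp _ _ _ f GRing.inv);first exact: Sm_cont hf x.
 by apply: inv_continuous;rewrite gt_eqF.
elim=> [|k IH];first exact: Ck_0.
apply: (@CkI _ _ (fun i x=> - ((f x)^-1 * (f x)^-1) * dd i f x))=> //.
- move=> i x;have [d1 d2] := Sm_der i x hf.
 split;first by apply: derivableV=> //;rewrite gt_eqF.
 by rewrite deriveV ?gt_eqF// d2 expr2 invfM.
- move=> i;apply: CkM;last exact: Sm_dd.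
 have := CkM IH IH=> /(CkM (Ck_cst k (-1)));congr Ck_on.
 by apply/funext=> x;rewrite mulN1r.
Qed.

Lemma Sm_ln f : Sm f -> (forall x, 0 < f x) -> Sm (fun x=> ln (f x)).
move=> hf f0.
apply: (@SmI _ (fun i x=> (f x)^-1 * dd i f x)).
- by move=> i x;apply: is_derive_comp1;[exact: Sm_der|exact: is_derive1_ln].
- move=> x.
 have cl := is_derive_cont (is_derive1_ln (f0 x)).
 have cf : {for x, continuous f} by exact: Sm_cont.
 exact: (@continuous_comp _ _ _ f (@ln R) x cf cl).
- by move=> i;apply: Sm_M;[exact: Sm_V|exact: Sm_dd].
Qed.

Lemma der_aff f (s : R) v i x : Sm f ->
 is_derive x (dir i) (fun y=> f (s *: y + v)) (s * dd i f (s *: x + v)).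
move=> hf;apply/is_derive_lineP.
have h1 := Sm_der i (s *: x + v) hf.
pose g (h : R) := h * s.
have d2 : is_derive (0 : R) 1 g s.
 have := is_derive_affine 0 s 0;rewrite (_ : (fun h=> _) = g)//.
 by apply/funext=> h;rewrite addr0.
have /is_derive_lineP h2 := h1.
have h2' : is_derive (g 0) 1 (fun h : R=> f (h *: dir i + (s *: x + v))) (dd i f (s *: x + v)).
 by rewrite /g mul0r.
have := is_derive1_comp h2' d2;rewrite mulrC.
rewrite (_ : _ \o _ = (fun h=> f (s *: (h *: dir i + x) + v)))//.
by apply/funext=> h /=;rewrite /g scalerDr scalerA addrA [s * h]mulrC.
Qed.
Lemma Sm_aff f (s : R) v : Sm f -> Sm (fun y=> f (s *: y + v)).
move=> hf k.
have caff g : Sm g -> continuous (fun y : R * R=> g (s *: y + v)).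
 move=> hg x;apply: (@continuous_comp _ _ _ (fun y : R * R=> s *: y + v) g).
  by apply: continuousD;[exact: scaler_continuous|exact: cst_continuous].
 exact: Sm_cont hg _.
elim: k f hf=> [|k IH] f hf;first by apply: Ck_0;exact: caff.
apply: (@CkI _ _ (fun i x=> s * dd i f (s *: x + v)));first exact: caff.
- by move=> i x;exact: der_aff.
- move=> i;apply: CkM;first exact: Ck_cst.
 by apply: IH;exact: Sm_dd.
Qed.
Lemma dd_aff f (s : R) v i x : Sm f ->
 dd i (fun y=> f (s *: y + v)) x = s * dd i f (s *: x + v).
by move=> hf;apply: dd_eq;exact: der_aff. Qed.

End Smooth.

(** * The flat function [exp(-1/t)] and the smooth step *)

Section Bump.
Context {R : realType}.

(* exp(-1/t) P(1/t) for t > 0, extended by 0 *)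
Definition bexp (P : {poly R}) (t : R) : R :=
 if 0 < t then expR (- t^-1) * P.[t^-1] else 0.
(** Differentiation preserves the shape: with [s = 1/t], the derivative of [exp(-s) P(s)] in [t] is
    [exp(-s) s^2 (P(s) - P'(s))]. *)
Definition bnext (P : {poly R}) : {poly R} := 'X^2 * (P - P^`()).

Lemma poly_growth (P : {poly R}) : exists2 C, 0 <= C & exists m : nat,
 forall s, 1 <= s -> `|P.[s]| <= C * s ^+ m.
elim/poly_ind: P=> [|P c [C C0 [m hm]]].
 by exists 0=> //;exists 0%N=> s _;rewrite horner0 normr0 mul0r.
exists (C + `|c|);first by rewrite addr_ge0.
exists m.+1=> s s1;rewrite !hornerE;apply: le_normD.
rewrite mulrDl;have s0 : 0 <= s by lra.
apply: lerD.
 by rewrite normrM (ger0_norm s0) exprSr mulrA ler_wpM2r// hm.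
by rewrite ler_peMr// exprn_ege1.
Qed.

Lemma expR_pow_le (s : R) (k : nat) : 0 <= s -> (s / k.+1%:R) ^+ k.+1 <= expR s.
move=> s0.
have h : 0 <= s / k.+1%:R by rewrite divr_ge0.
have -> : expR s = expR (s / k.+1%:R) ^+ k.+1.
 by rewrite -expRM_natl -mulr_natl mulrC divfK ?pnatr_eq0.
rewrite lerXn2r ?nnegrE ?expR_ge0//.
by apply: le_trans (expR_ge1Dx _);rewrite lerDr.
Qed.

(** If [P] grows like [s^m], the bound [(s / (m+2))^(m+2) <= exp s] at [s = 1/t] leaves a factor
    [t^2] to spare; this quadratic flatness makes the derivative at [0] vanish, for every [P] at
    once. *)
Lemma bexp_small (P : {poly R}) : exists2 C, 0 <= C & forall t, `|t| <= 1 -> `|bexp P t| <= C * t ^+ 2.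
have [C C0 [m hm]] := poly_growth P.
pose M : R := m.+2%:R ^+ m.+2;have M0 : 0 <= M by exact: exprn_ge0.
exists (C * M);first by rewrite mulr_ge0.
move=> t t1;rewrite /bexp;case: ifPn=> t0;last first.
 by rewrite normr0;apply: mulr_ge0;[exact: mulr_ge0|exact: sqr_ge0].
have t1' : t <= 1 by apply: le_trans (ler_norm _) t1.
have s1 : 1 <= t^-1 by rewrite invf_ge1.
have s0 : 0 < t^-1 by rewrite invr_gt0.
rewrite normrM (ger0_norm (expR_ge0 _)) expRN.
have h1 := @expR_pow_le t^-1 m.+1 (ltW s0).
have e0 := expR_gt0 t^-1.
rewrite mulrC ler_pdivrMr//.
apply: le_trans (hm _ s1) _.
have -> : C * M * t ^+ 2 * expR t^-1 = C * (M * (t ^+ 2 * expR t^-1)) by rewrite !mulrA.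
apply: ler_wpM2l=> //.
have -> : t^-1 ^+ m = M * (t ^+ 2 * (t^-1 / m.+2%:R) ^+ m.+2).
 have e1 : M * (t^-1 / m.+2%:R) ^+ m.+2 = t^-1 ^+ m.+2.
  by rewrite -exprMn mulrCA divff ?pnatr_eq0// mulr1.
 by rewrite mulrCA e1 -(addn2 m) exprD mulrCA -exprMn mulfV ?gt_eqF// expr1n mulr1.
apply: ler_wpM2l=> //;apply: ler_wpM2l=> //;exact: sqr_ge0.
Qed.

Lemma is_derive_quad0 (f : R -> R) (C : R) : f 0 = 0 ->
 (forall t, `|t| <= 1 -> `|f t| <= C * t ^+ 2) -> is_derive (0 : R) (1 : R) f 0.
move=> f0 hf.
have C0 : 0 <= C.
 by have := hf 1;rewrite normr1 expr1n mulr1=> /(_ (lexx _));apply: le_trans.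
have h : (fun h : R=> h^-1 *: ((f \o shift 0) (h *: (1 : R)) - f 0)) @ 0^' --> (0 : R).
 apply/cvgrPdist_le=> e e0.
 near=> t;rewrite /= f0 subr0 sub0r normrN addr0 [t *: _]mulr1 normrZ.
 have t0 : t != 0 by near: t;exact: nbhs_dnbhs_neq.
 have t1 : `|t| <= Num.min 1 (e / (C + 1)).
  near: t;apply: dnbhs0_le;rewrite lt_min ltr01 divr_gt0//;lra.
 move: t1;rewrite le_min=> /andP[t1 t2].
 have tp : 0 < `|t| by rewrite normr_gt0.
 rewrite normfV ler_pdivrMl//;apply: le_trans (hf _ t1) _.
 rewrite -real_normK ?num_real// expr2 mulrA mulrC ler_wpM2l//.
 move: t2;rewrite ler_pdivlMr;last by lra.
 by apply: le_trans;rewrite mulrC ler_wpM2l//;lra.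
split;first by apply/cvg_ex;exists 0.
exact: (cvg_lim (@norm_hausdorff _ _) h).
Unshelve. all: by end_near.
Qed.

Lemma is_derive_near (f g : R -> R) (t l : R) : (\forall s \near t, f s = g s) ->
 is_derive t (1 : R) g l -> is_derive t (1 : R) f l.
move=> fg [d1 d2].
have gf : \forall s \near t, g s = f s by apply: filterS fg.
split;first exact: near_eq_derivable gf d1.
by rewrite -d2;apply: near_eq_derive.
Qed.

Lemma bexp_derive P (t : R) : is_derive t (1 : R) (bexp P) (bexp (bnext P) t).
have [t0|t0|->] := ltgtP t 0.
- have -> : bexp (bnext P) t = 0 by rewrite /bexp ltNge (ltW t0).
 have d0 : is_derive t (1 : R) (fun _ : R=> 0 : R) (0 : R).
  by split;[exact: derivable_cst|exact: derive_cst].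
 apply: is_derive_near d0.
 have nt := open_nbhs_nbhs (conj (@open_lt _ (0 : R)) t0);apply: filterS nt=> s /= s0.
 by rewrite /bexp ltNge (ltW s0).
- apply: (@is_derive_near _ (fun s=> expR (- s^-1) * P.[s^-1])).
  have nt := open_nbhs_nbhs (conj (@open_gt _ (0 : R)) t0);apply: filterS nt=> s /= s0.
  by rewrite /bexp s0.
 have tn : t != 0 by rewrite gt_eqF.
 have dV : is_derive t (1 : R) (fun s=> s^-1) (- t ^- 2).
  split;first exact: derivableV.
  by rewrite (@deriveV _ _ id)// derive_id [_ *: _]mulr1.
 pose g (s : R) := - s^-1;pose w (s : R) := s^-1.
 have dNV : is_derive t (1 : R) g (t ^- 2).
  by have := is_deriveN dV;rewrite opprK.
 have dE := @is_derive1_comp R expR g t _ _ (is_derive_expR (g t)) dNV.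
 have dP : is_derive (w t) (1 : R) (horner P) P^`().[t^-1].
  by apply: DeriveDef;[exact: derivable_horner|rewrite -derive1E derivE].
 have dPP := @is_derive1_comp R (horner P) w t _ _ dP dV.
 have := is_deriveM dE dPP;rewrite /bexp t0 /bnext.
 move=> /is_derive_eq;apply.
 rewrite /= !hornerE /= -![_ *: _]/(_ * _) /g /w -exprVn;ring.
- have -> : bexp (bnext P) 0 = 0 by rewrite /bexp ltxx.
 have [C C0 hC] := bexp_small P.
 by apply: is_derive_quad0 hC;rewrite /bexp ltxx.
Qed.

Definition bB (t : R) : R := bexp 1 t.
Lemma smooth1_bB : smooth1 bB.
exists (fun n=> bexp (iter n bnext 1))=> // n t;exact: bexp_derive.
Qed.
Lemma bB_gt0 t : 0 < t -> 0 < bB t.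
by move=> t0;rewrite /bB /bexp t0 hornerC mulr1 expR_gt0. Qed.
Lemma bB_eq0 t : t <= 0 -> bB t = 0.
by move=> t0;rewrite /bB /bexp ltNge t0. Qed.
Lemma bB_ge0 t : 0 <= bB t.
by have [/bB_gt0/ltW|/bB_eq0 ->] := ltP 0 t. Qed.

Definition stp (t : R) : R := bB t / (bB t + bB (1 - t)).
Lemma stp_den t : 0 < bB t + bB (1 - t).
have [h|h] := ltP 0 t;first by rewrite ltr_pwDl ?bB_gt0 ?bB_ge0.
by rewrite ltr_wpDl ?bB_ge0// bB_gt0// subr_gt0;lra.
Qed.
Lemma stp01 t : 0 <= stp t <= 1.
have h := stp_den t;apply/andP;split.
 by apply: divr_ge0;[exact: bB_ge0|exact: ltW].
by rewrite /stp ler_pdivrMr// mul1r lerDl bB_ge0.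
Qed.
Lemma stp0 t : t <= 0 -> stp t = 0.
by move=> h;rewrite /stp bB_eq0// mul0r. Qed.
Lemma stp1 t : 1 <= t -> stp t = 1.
move=> h;have := stp_den t;rewrite /stp (@bB_eq0 (1 - t));last by lra.
by rewrite addr0=> h0;rewrite divff// gt_eqF.
Qed.
Lemma Sm_stp (f : R * R -> R) : Sm f -> Sm (fun x=> stp (f x)).
move=> hf;have h1 := Sm_comp smooth1_bB hf.
have h2 := Sm_comp smooth1_bB (Sm_B (Sm_c 1) hf).
by apply: Sm_M=> //;apply: Sm_V=> [|x];[exact: Sm_D|exact: stp_den].
Qed.

End Bump.

(** * Measurability of continuous functions, test functions of the plane, integration by parts *)

Section TestFunctions.
Context {R : realType}.
Implicit Types (f g phi : R * R -> R) (x v c : R * R) (i : 'I_2).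

Lemma near_box x (P : set (R * R)) : (\forall y \near x, P y) ->
 exists2 e, 0 < e & forall y, `|y.1 - x.1| < e -> `|y.2 - x.2| < e -> P y.
move=> /nbhs_ballP[e e0 h];exists e=> // y h1 h2;apply: h;split=> /=.
 by rewrite /ball/= distrC.
by rewrite /ball/= distrC.
Qed.
Lemma box_near x (e : R) (P : set (R * R)) : 0 < e ->
 (forall y, `|y.1 - x.1| < e -> `|y.2 - x.2| < e -> P y) -> \forall y \near x, P y.
move=> e0 h;apply/nbhs_ballP;exists e=> // y [h1 h2];apply: h.
 by move: h1;rewrite /ball/= distrC.
by move: h2;rewrite /ball/= distrC.
Qed.

(** An open set is the union of the countably many squares it contains with rational centre and
    half-side [1 / (n + 1)], and squares belong to the product sigma-algebra. *)
Lemma open_measurable2 (U : set (R * R)) : open U -> measurable U.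
move=> oU.
pose Q (q : rat * rat * nat) : set (R * R) := box (ratr q.1.1, ratr q.1.2) (q.2.+1%:R^-1).
rewrite (_ : U = \bigcup_(q in [set q | Q q `<=` U]) Q q).
 rewrite bigcup_mkcond;apply: countable_bigcupT_measurable;first exact: countableP.
 by move=> q;case: ifPn=> // _;exact: measurable_box.
apply/seteqP;split=> [x Ux|x [q /= qU]];last exact: qU.
have [e e0 he] := near_box (open_nbhs_nbhs (conj oU Ux)).
have [n hn] : exists n : nat, n.+1%:R^-1 < e / 2.
 have e2 : 0 < e / 2 by rewrite divr_gt0.
 exists (Num.truncn ((e / 2)^-1));rewrite invf_plt ?posrE//;exact: truncnS_gt.
have n0 : 0 < n.+1%:R^-1 :> R by rewrite invr_gt0.
set d : R := n.+1%:R^-1 in hn n0 *.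
have [q1 hq1] : exists q : rat, `|x.1 - ratr q| < d.
 have hd : x.1 - d < x.1 + d by lra.
 have [q] := rat_in_itvoo hd;rewrite in_itv/= => /andP[h1 h2].
 by exists q;rewrite ltr_distl;apply/andP;split;lra.
have [q2 hq2] : exists q : rat, `|x.2 - ratr q| < d.
 have hd : x.2 - d < x.2 + d by lra.
 have [q] := rat_in_itvoo hd;rewrite in_itv/= => /andP[h1 h2].
 by exists q;rewrite ltr_distl;apply/andP;split;lra.
exists (q1, q2, n)=> /=;last by split=> /=;exact: ltW.
move=> y [y1' y2'];have y1 : `|y.1 - ratr q1| <= d := y1'.
have y2 : `|y.2 - ratr q2| <= d := y2';apply: he.
 rewrite (_ : y.1 - x.1 = (y.1 - ratr q1) - (x.1 - ratr q1));last by ring.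
 by apply: le_lt_trans (ler_normB _ _) _;lra.
rewrite (_ : y.2 - x.2 = (y.2 - ratr q2) - (x.2 - ratr q2));last by ring.
by apply: le_lt_trans (ler_normB _ _) _;lra.
Qed.

Transparent mf.
Lemma cont_mf f : continuous f -> mf f.
move=> /continuousP cf;rewrite /mf.
apply: (measurability _ (RGenOpens.measurableE R)).
move=> _ [_ [a [b ->] <-]];rewrite setTI;apply: open_measurable2.
exact/cf/interval_open.
Qed.
Opaque mf.

Lemma Sm_mf f : Sm f -> mf f.
by move=> /Sm_cont/cont_mf. Qed.

Lemma dd_near f g i x : (\forall y \near x, f y = g y) -> dd i f x = dd i g x.
exact: near_eq_derive. Qed.

Lemma out_box_near c (r : R) x : ~ box c r x -> \forall y \near x, ~ box c r y.
move=> h;have [h1|h1] := ltP r `|x.1 - c.1|.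
 apply: (@box_near _ (`|x.1 - c.1| - r));first by rewrite subr_gt0.
 move=> y y1 _ [y2 _];move: y1;rewrite distrC.
 have := ler_normD (x.1 - y.1) (y.1 - c.1).
 by rewrite addrA subrK=> ? ?;lra.
have [h2|h2] := ltP r `|x.2 - c.2|;last by exfalso;apply: h.
apply: (@box_near _ (`|x.2 - c.2| - r));first by rewrite subr_gt0.
move=> y _ y1 [_ y2];move: y1;rewrite distrC.
have := ler_normD (x.2 - y.2) (y.2 - c.2).
by rewrite addrA subrK=> ? ?;lra.
Qed.

Lemma dd_supp f c (r : R) i : (forall x, ~ box c r x -> f x = 0) ->
 forall x, ~ box c r x -> dd i f x = 0.
move=> h x hx;rewrite -[RHS](dd_c i (0 : R) x);apply: dd_near.
by have := out_box_near hx;apply: filterS=> y;exact: h.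
Qed.

Definition tf phi : Prop := Sm phi /\ exists r, forall x, ~ box 0 r x -> phi x = 0.

Lemma tf_Sm phi : tf phi -> Sm phi. Proof. by case. Qed.
Lemma tf_dd phi i : tf phi -> tf (dd i phi).
by move=> [h [r hr]];split;[exact: Sm_dd|exists r;exact: dd_supp]. Qed.
Lemma tf_M f phi : Sm f -> tf phi -> tf (fun x=> f x * phi x).
by move=> hf [h [r hr]];split;[exact: Sm_M|exists r=> x /hr ->;rewrite mulr0].
Qed.
Lemma tf_D f phi : tf f -> tf phi -> tf (fun x=> f x + phi x).
move=> [hf [r1 hr1]] [h [r hr]];split;[exact: Sm_D|exists (Num.max r1 r)=> x hx].
rewrite hr1 ?hr ?addr0//.
 by move: hx;rewrite !box0E=> h1 [h2 h3];apply: h1;rewrite !le_max h2 h3 !orbT.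
by move: hx;rewrite !box0E=> h1 [h2 h3];apply: h1;rewrite !le_max h2 h3.
Qed.

Lemma compact_box c (r : R) : compact (box c r).
by rewrite boxE;apply: compact_setX;exact: segment_compact. Qed.

Lemma cont_bounded_box f c (r : R) : continuous f -> exists2 M, 0 <= M & forall x, box c r x -> `|f x| <= M.
move=> cf;have := @continuous_compact _ _ f (box c r) _ (@compact_box c r).
move=> /(_ (continuous_subspaceT cf))/compact_bounded[M [_ hM]].
exists (`|M| + 1);first by rewrite addr_ge0.
move=> x hx;apply: (hM (`|M| + 1));first by rewrite (le_lt_trans (ler_norm _))// ltrDl.
by exists x.
Qed.

Lemma tf_bound phi : tf phi -> exists2 M, 0 <= M & forall x, `|phi x| <= M.
move=> [/Sm_cont h [r hr]];have [M M0 hM] := @cont_bounded_box _ 0 r h.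
exists M=> // x;have [hx|hx] := pselect (box 0 r x);first exact: hM.
by rewrite hr// normr0.
Qed.
Lemma tf_ker phi : tf phi -> exists r, ker r phi.
move=> hp;have [M _ hM] := tf_bound hp;have [h [r hr]] := hp.
by exists r;split;[exact: Sm_mf|exists M|].
Qed.
Lemma tf_L2 phi : tf phi -> L2 phi.
by move=> /tf_ker[r] /ker_L2. Qed.
Lemma tf_L1 phi : tf phi -> L1 phi.
by move=> /tf_ker[r] /ker_L1. Qed.

Lemma line_MVT f i x (h : R) : Sm f -> exists2 t, `|t| <= `|h| &
 f (x + h *: dir i) - f x = h * dd i f (x + t *: dir i).
move=> hf.
pose F (t : R) := f (x + t *: dir i);pose F' (t : R) := dd i f (x + t *: dir i).
have dF (t : R) : is_derive t (1 : R) F (F' t) by apply: is_derive_line;exact: Sm_der.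
have cF (A : set R) : {within A, continuous F}.
 by apply: continuous_subspaceT=> t;exact: is_derive_cont (dF t).
have F0 : F 0 = f x by rewrite /F scale0r addr0.
have [h0|h0] := leP 0 h.
 have [t + e] := @MVT_segment R F F' 0 h h0 (fun t _=> dF t) (cF _).
 rewrite in_itv/= => /andP[t0 th];exists t;first by rewrite !ger0_norm.
 by rewrite -F0 -/(F h) e subr0 mulrC.
have [t + e] := @MVT_segment R F F' h 0 (ltW h0) (fun t _=> dF t) (cF _).
rewrite in_itv/= => /andP[t0 th];exists t;first by rewrite !ler0_norm ?lerN2// ltW.
by rewrite -F0 -/(F h) -opprB e sub0r mulrN opprK mulrC.
Qed.

Lemma Sm_lip f i (M : R) : Sm f -> (forall x, `|dd i f x| <= M) ->
 forall x (h : R), `|f (x + h *: dir i) - f x| <= M * `|h|.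
move=> hf hM x h;have [t _ ->] := line_MVT i x h hf.
by rewrite normrM mulrC ler_wpM2r.
Qed.
Lemma Sm_quad f i (M : R) : Sm f -> (forall x, `|dd i (dd i f) x| <= M) ->
 forall x (h : R), `|f (x + h *: dir i) - f x - h * dd i f x| <= M * h ^+ 2.
move=> hf hM x h;have [t ht ->] := line_MVT i x h hf.
rewrite -mulrBr normrM -(real_normK (num_real h)) expr2 mulrA [_ * `|h|]mulrC.
rewrite ler_wpM2l//;apply: le_trans (Sm_lip (Sm_dd i hf) hM x t) _.
by rewrite ler_wpM2l// (le_trans _ (hM x)).
Qed.

Lemma dirE v : v = v.1 *: dir ord0 + v.2 *: dir ord_max.
apply: injective_projections.
 by transitivity (v.1 * 1 + v.2 * 0);[ring|].
by transitivity (v.1 * 0 + v.2 * 1);[ring|].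
Qed.
Lemma Sm_lip2 f (M : R) : Sm f -> (forall i x, `|dd i f x| <= M) ->
 forall x v, `|f (x + v) - f x| <= M * (`|v.1| + `|v.2|).
move=> hf hM x v;rewrite [v in x + v]dirE addrA.
set a := x + _;rewrite (_ : _ - _ = (f (a + v.2 *: dir ord_max) - f a) + (f a - f x));last by ring.
apply: le_normD;rewrite mulrDr addrC.
by apply: lerD;apply: Sm_lip.
Qed.

Lemma tf_dd_bound phi : tf phi -> exists2 M, 0 <= M & forall i x, `|dd i phi x| <= M.
move=> hp;have [M M0 hM] := tf_bound (tf_dd ord0 hp).
have [M' M'0 hM'] := tf_bound (tf_dd ord_max hp).
exists (M + M');first exact: addr_ge0.
move=> i x;have [->|->] : i = ord0 \/ i = ord_max.
- by case: i=> -[|[|//]] hi;[left|right];exact: val_inj.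
- by apply: le_trans (hM x) _;rewrite lerDl.
- by apply: le_trans (hM' x) _;rewrite lerDr.
Qed.

(** By translation invariance [phi (x + h e_i) - phi x] has integral zero, so the second-order
    Taylor remainder gives [h |I (dd i phi)| <= C h^2] for all small [h]. *)
Lemma I_dd phi i : tf phi -> I (dd i phi) = 0.
move=> hp;have [M M0 hM] := tf_bound (tf_dd i (tf_dd i hp)).
have [hS [r hr]] := hp.
have r0 : exists2 r', 0 <= r' & forall x, ~ box 0 r' x -> phi x = 0.
 exists `|r| => // x hx;apply: hr;move: hx;rewrite !box0E=> h [h1 h2];apply: h.
 by split;apply: le_trans (ler_norm _).
have {r hr r0}[r r0 hr] := r0.
have L1p := tf_L1 hp;have L1d := tf_L1 (tf_dd i hp).
pose C := M * (4 * (r + 1) ^+ 2).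
have C0 : 0 <= C by apply: mulr_ge0=> //;apply: mulr_ge0=> //;exact: sqr_ge0.
have key (h : R) : 0 < h -> h <= 1 -> h * `|I (dd i phi)| <= C * h ^+ 2.
 move=> h0 h1.
 have e : h * I (dd i phi) = - \I_x (phi (x + h *: dir i) - phi x - h * dd i phi x).
  rewrite IB;[|by apply: L1B=> //;exact: L1_sh|exact: L1Z].
  by rewrite IB//;[rewrite I_sh// IZ//;ring|exact: L1_sh].
 rewrite -[h in leLHS]gtr0_norm// -normrM e normrN.
 apply: (letr (\I_x ((M * h ^+ 2) * \1_(box 0 (r + 1)) x)));last first.
  rewrite IZ ?I_box;[|lra|exact: L1_box].
  by rewrite /C le_eqVlt;apply/orP;left;apply/eqP;ring.
 apply: I_absle.
 - by apply: L1_mf;apply: L1B;[apply: L1B=> //;exact: L1_sh|exact: L1Z].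
 - by apply: L1Z;exact: L1_box.
 move=> x;have [hx|hx] := pselect (box 0 (r + 1) x).
  by rewrite indT// mulr1;apply: Sm_quad.
 rewrite indF// mulr0;have hx1 : ~ box 0 r x.
  by move: hx;rewrite !box0E=> h2 [h3 h4];apply: h2;split;lra.
 rewrite (hr _ hx1) (dd_supp i hr hx1) hr ?subr0 ?mulr0 ?subr0 ?normr0//.
 move: hx;rewrite !box0E=> h2 [h3 h4];apply: h2.
 have hd (a : bool) : `|h * a%:R| <= 1.
  by case: a;rewrite ?mulr1 ?mulr0 ?normr0 ?gtr0_norm.
 split.
  rewrite -(addrK (h *: dir i).1 x.1);apply: le_normB.
  by apply: lerD;[exact: h3|exact: hd].
 rewrite -(addrK (h *: dir i).2 x.2);apply: le_normB.
 by apply: lerD;[exact: h4|exact: hd].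
apply/eqP;rewrite -normr_le0;apply/ler_addgt0Pl=> e e0;rewrite addr0.
have C1 : 0 < C + 1 by lra.
pose h := Num.min 1 (e / (C + 1)).
have h0 : 0 < h by rewrite lt_min ltr01 divr_gt0.
have h1 : h <= 1 by rewrite ge_min lexx.
have h2 : h * (C + 1) <= e by rewrite -ler_pdivlMr// ge_min lexx orbT.
have := key h h0 h1;rewrite expr2 mulrCA ler_pM2l// => H.
by apply: le_trans H _;apply: le_trans h2;rewrite mulrC ler_wpM2l ?ltW//;lra.
Qed.

Lemma IBP f phi i : Sm f -> tf phi ->
 \I_x (f x * dd i phi x) = - \I_x (dd i f x * phi x).
move=> hf hp;apply/eqP;rewrite -addr_eq0;apply/eqP.
rewrite -ID;[|exact: tf_L1 (tf_M hf (tf_dd i hp))|exact: tf_L1 (tf_M (Sm_dd i hf) hp)].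
rewrite -[RHS](I_dd i (tf_M hf hp));apply: eq_I=> x.
by rewrite dd_M//;[ring|exact: tf_Sm].
Qed.

End TestFunctions.

(** * Mollifiers and cutoff functions on squares *)

Section Mollification.
Context {R : realType}.
Implicit Types (f g phi k : R * R -> R) (x v c : R * R) (i : 'I_2).

Lemma is_derive_of_quad f x v (l C : R) :
 (forall h : R, `|h| <= 1 -> `|f (x + h *: v) - f x - h * l| <= C * h ^+ 2) -> is_derive x v f l.
move=> hq;apply/is_derive_lineP.
pose F (h : R) := f (h *: v + x) - (h * l + f x).
have d0 : is_derive (0 : R) (1 : R) F 0.
 apply: (@is_derive_quad0 _ _ C);first by rewrite /F scale0r add0r mul0r add0r subrr.
 move=> t t1;rewrite /F [t *: v + x]addrC.
 by rewrite (_ : _ - _ = f (x + t *: v) - f x - t * l);[exact: hq|ring].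
have := is_deriveD d0 (is_derive_affine 0 l (f x));rewrite add0r.
by rewrite (_ : _ + _ = (fun h : R=> f (h *: v + x)))//;apply/funext=> h;rewrite /F /= subrK.
Qed.

Lemma cont_of_lip f (M : R) : (forall x v, `|f (x + v) - f x| <= M * (`|v.1| + `|v.2|)) -> continuous f.
move=> h x;apply/cvgrPdist_le=> e e0.
have M1 : 0 < 2 * (`|M| + 1) by rewrite mulr_gt0// ltr_wpDl.
apply: (@box_near _ _ (e / (2 * (`|M| + 1))));first by rewrite divr_gt0.
move=> y;rewrite !ltr_pdivlMr// => y1 y2.
have := h x (y - x);rewrite [x + _]addrC subrK=> H;rewrite distrC.
apply: le_trans H _=> /=.
have := ler_norm M;have := normr_ge0 (y.1 - x.1);have := normr_ge0 (y.2 - x.2).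
have := normr_ge0 M;nra.
Qed.

Lemma I_bM f g (M : R) : L1 f -> mf g -> (forall x, `|g x| <= M) ->
 `|\I_x (f x * g x)| <= M * \I_x (`|f x|).
move=> hf mg hM;rewrite -IZ;last exact: L1_abs.
apply: I_absle;first by apply: mfM=> //;exact: L1_mf.
 by apply: L1Z;exact: L1_abs.
by move=> x;rewrite normrM mulrC ler_wpM2r.
Qed.

Lemma L1_cv_tf f phi x : L1 f -> tf phi -> L1 (fun y=> f y * phi (x - y)).
move=> hf hp;have [M _ hM] := tf_bound hp.
rewrite (_ : (fun y=> _) = fun y=> phi (x - y) * f y);last by apply/funext=> y;rewrite mulrC.
by apply: (L1_bM (M := M))=> //;apply: mf_op;apply: Sm_mf;exact: tf_Sm.
Qed.

Lemma cv_tfE f phi x : L1 f -> tf phi -> cv f phi x = \I_y (f y * phi (x - y)).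
by move=> hf /tf_ker[r kk];exact: cvE hf kk. Qed.

Lemma cv_is_derive f phi i x : L1 f -> tf phi -> is_derive x (dir i) (cv f phi) (cv f (dd i phi) x).
move=> hf hp;have [M M0 hM] := tf_bound (tf_dd i (tf_dd i hp)).
have hd := tf_dd i hp.
apply: (@is_derive_of_quad _ _ _ _ (M * \I_x (`|f x|)))=> h _.
rewrite !cv_tfE//.
have l1 := L1_cv_tf (x + h *: dir i) hf hp;have l2 := L1_cv_tf x hf hp.
have l3 := L1_cv_tf x hf hd.
rewrite -IZ// -IB// -IB;[|exact: L1B|exact: L1Z].
rewrite (eq_I (g := fun y=> f y * (phi ((x - y) + h *: dir i) - phi (x - y) - h * dd i phi (x - y))));last first.
 by move=> y;rewrite [x + _ - y]addrAC;ring.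
rewrite mulrAC;apply: I_bM=> //;last first.
 by move=> y;apply: Sm_quad=> //;exact: tf_Sm.
have mo g : Sm g -> mf (fun y=> g (x - y)) by move=> hg;apply: mf_op;exact: Sm_mf.
have hS := tf_Sm hp.
apply: mfB;last by apply: mfZ;apply: mo;exact: Sm_dd.
apply: mfB;last exact: mo.
rewrite (_ : (fun y=> _) = fun y=> phi ((x + h *: dir i) - y));first exact: mf_op (Sm_mf hS).
by apply/funext=> y;rewrite addrAC.
Qed.

Lemma cv_cont f phi : L1 f -> tf phi -> continuous (cv f phi).
move=> hf hp;have [M M0 hM] := tf_dd_bound hp.
apply: (@cont_of_lip _ (M * \I_x (`|f x|)))=> x v.
rewrite !cv_tfE//.
have l1 := L1_cv_tf (x + v) hf hp;have l2 := L1_cv_tf x hf hp.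
rewrite -IB//.
rewrite (eq_I (g := fun y=> f y * (phi ((x - y) + v) - phi (x - y))));last first.
 by move=> y;rewrite [x + _ - y]addrAC;ring.
rewrite mulrAC;apply: I_bM=> //;last by move=> y;apply: Sm_lip2=> //;exact: tf_Sm.
have mo g w : Sm g -> mf (fun y=> g (w - y)) by move=> hg;apply: mf_op;exact: Sm_mf.
have hS := tf_Sm hp.
apply: mfB;last exact: mo.
rewrite (_ : (fun y=> _) = fun y=> phi ((x + v) - y));first exact: mo.
by apply/funext=> y;rewrite addrAC.
Qed.

Lemma Sm_cv f phi : L1 f -> tf phi -> Sm (cv f phi).
move=> hf hp k;elim: k phi hp=> [|k IH] phi hp;first by apply: Ck_0;exact: cv_cont.
apply: (@CkI _ _ _ (fun i=> cv f (dd i phi)));first exact: cv_cont.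
 by move=> i x;exact: cv_is_derive.
by move=> i;apply: IH;exact: tf_dd.
Qed.
Lemma dd_cv f phi i x : L1 f -> tf phi -> dd i (cv f phi) x = cv f (dd i phi) x.
by move=> hf hp;apply: dd_eq;exact: cv_is_derive. Qed.

Lemma cv_supp f k (r s : R) c x : (forall y, ~ box c s y -> f y = 0) ->
 (forall y, ~ box 0 r y -> k y = 0) -> ~ box c (s + r) x -> cv f k x = 0.
move=> hf hk hx;rewrite -[RHS](@I0 R);apply: eq_I=> y.
have [hy|hy] := pselect (box 0 r y);last by rewrite hk// mulr0.
rewrite hf ?mul0r// => -[h1 h2];apply: hx;move: hy;rewrite box0E=> -[h3 h4].
split.
 rewrite (_ : x.1 - c.1 = ((x - y).1 - c.1) + y.1);last by rewrite /=;ring.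
 by apply: le_normD;apply: lerD.
rewrite (_ : x.2 - c.2 = ((x - y).2 - c.2) + y.2);last by rewrite /=;ring.
by apply: le_normD;apply: lerD.
Qed.

Definition moll (e : R) k : Prop :=
 [/\ tf k, forall x, 0 <= k x, forall x, ~ box 0 e x -> k x = 0 & I k = 1].

Definition bump1 (t : R) : R := bB (1 - t) * bB (1 + t).
Definition bump2 x : R := bump1 x.1 * bump1 x.2.

Lemma Sm_bump1 f : Sm f -> Sm (fun x=> bump1 (f x)).
move=> hf;apply: Sm_M;apply: Sm_comp;try exact: smooth1_bB.
 by apply: Sm_B=> //;exact: Sm_c.
by apply: Sm_D=> //;exact: Sm_c.
Qed.
Lemma bump1_ge0 t : 0 <= bump1 t.
by rewrite mulr_ge0 ?bB_ge0. Qed.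
Lemma bump1_eq0 t : 1 < `|t| -> bump1 t = 0.
rewrite /bump1 ltr_normr=> /orP[h|h].
 by rewrite bB_eq0 ?mul0r//;lra.
by rewrite [X in _ * X]bB_eq0 ?mulr0//;lra.
Qed.
Lemma bump1_gt0 t : `|t| <= 1 / 2 -> 0 < bump1 t.
by rewrite ler_norml=> /andP[h1 h2];rewrite mulr_gt0 ?bB_gt0//;lra. Qed.

Lemma tf_bump2 (e : R) : 0 < e -> tf (fun x=> bump2 (e^-1 *: x + 0)) /\
 (forall x, ~ box 0 e x -> bump2 (e^-1 *: x + 0) = 0).
move=> e0.
have hs : forall x, ~ box 0 e x -> bump2 (e^-1 *: x + 0) = 0.
 move=> x;rewrite box0E addr0 /bump2 /= => h.
 have e1 (t : R) : e < `|t| -> bump1 (e^-1 * t) = 0.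
  move=> h1;apply: bump1_eq0;rewrite normrM gtr0_norm ?invr_gt0//.
  by rewrite mulrC ltr_pdivlMr// mul1r.
 have [h1|h1] := ltP e `|x.1|;first by rewrite -[_ *: x.1]/(_ * x.1) e1// mul0r.
 have [h2|h2] := ltP e `|x.2|;first by rewrite -[_ *: x.2]/(_ * x.2) [X in _ * X]e1// mulr0.
 by exfalso;apply: h.
split=> //;split;last by exists e.
by apply: (@Sm_aff _ bump2);apply: Sm_M;apply: Sm_bump1;[exact: Sm_fst|exact: Sm_snd].
Qed.

Lemma moll_exists (e : R) : 0 < e -> exists k, moll e k.
move=> e0;have [h1 h2] := tf_bump2 e0;set b := (fun x=> _) in h1.
have b0 x : 0 <= b x by rewrite mulr_ge0 ?bump1_ge0.
(* With integral zero the bump would vanish almost everywhere, yet it is positive on a whole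
   square. *)
have Ib : 0 < I b.
 rewrite lt_neqAle eq_sym I_ge0// andbT;apply/eqP=> Ib0.
 have /= ae := I_eq0 (tf_L1 h1) b0 Ib0.
 have : I (\1_(box 0 (e / 2))) = (0 : R).
  rewrite -[RHS](@I0 R);apply: I_ae;[exact: mf_ind|exact: mfc|].
  apply: filterS ae=> x bx;apply: indF;rewrite box0E=> -[x1 x2].
  have hh (t : R) : `|t| <= e / 2 -> 0 < bump1 (e^-1 * t).
   move=> ht;apply: bump1_gt0;rewrite normrM gtr0_norm ?invr_gt0//.
   by rewrite mulrC ler_pdivrMr//;lra.
  move: bx;rewrite /b addr0 /bump2 /= => /eqP;rewrite mulf_eq0=> /orP[]/eqP h.
   by have := hh _ x1;rewrite -[e^-1 * _]/(e^-1 *: _) h ltxx.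
  by have := hh _ x2;rewrite -[e^-1 * _]/(e^-1 *: _) h ltxx.
 rewrite I_box;last by rewrite divr_ge0 ?ltW.
 by move/eqP;rewrite mulf_eq0 expf_eq0/= mulf_eq0 invr_eq0 !pnatr_eq0/= orbF gt_eqF.
exists (fun x=> (I b)^-1 * b x);split.
- by apply: tf_M=> //;exact: Sm_c.
- by move=> x;rewrite mulr_ge0// invr_ge0 ltW.
- by move=> x hx;rewrite /b h2// mulr0.
- by rewrite IZ ?mulVf ?gt_eqF//;exact: tf_L1.
Qed.

Lemma moll_ker (e : R) k : moll e k -> ker e k.
move=> [h1 h2 h3 _];have [M _ hM] := tf_bound h1;split=> //;last by exists M.
exact: Sm_mf (tf_Sm h1).
Qed.
Lemma moll_abs (e : R) k : moll e k -> \I_x (`|k x|) = 1.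
by move=> [_ h _ <-];apply: eq_I=> x;rewrite ger0_norm. Qed.
Lemma moll_L2 f : L1 f -> L2 f -> forall e, 0 < e -> exists2 d, 0 < d &
 forall k r, moll r k -> r <= d -> nrm (fun x=> cv f k x - f x) <= e.
move=> h1 h2 e e0;have [d d0 hd] := cv_L2_approx h1 h2 e0.
exists d=> // k r hm rd;have := hd k r (moll_ker hm) rd.
have [_ _ _ ->] := hm;rewrite (moll_abs hm) mulr1.
by rewrite (_ : (fun x=> _) = (fun x=> cv f k x - f x))//;apply/funext=> x;rewrite mul1r.
Qed.
Definition eta c (r : R) x : R :=
 stp (2 - (x.1 - c.1) / r) * stp (2 + (x.1 - c.1) / r) *
 (stp (2 - (x.2 - c.2) / r) * stp (2 + (x.2 - c.2) / r)).

Lemma eta01 c r x : 0 <= eta c r x <= 1.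
rewrite /eta;have h a b : 0 <= stp (a : R) * stp b <= 1.
 have /andP[h1 h2] := stp01 a;have /andP[h3 h4] := stp01 b.
 by rewrite mulr_ge0// mulr_ile1.
have /andP[h1 h2] := h (2 - (x.1 - c.1) / r) (2 + (x.1 - c.1) / r).
have /andP[h3 h4] := h (2 - (x.2 - c.2) / r) (2 + (x.2 - c.2) / r).
by rewrite mulr_ge0// mulr_ile1.
Qed.
Lemma eta_abs c r x : `|eta c r x| <= 1.
by have /andP[h1 h2] := eta01 c r x;rewrite ger0_norm. Qed.
Lemma eta1 c r x : 0 < r -> box c r x -> eta c r x = 1.
move=> r0 [h1 h2].
have h (t : R) : `|t| <= r -> stp (2 - t / r) * stp (2 + t / r) = 1.
 move=> ht;have : `|t / r| <= 1.
  by rewrite normrM normfV (gtr0_norm r0) ler_pdivrMr// mul1r.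
 by rewrite ler_norml=> /andP[a b];rewrite !stp1 ?mulr1//;lra.
by rewrite /eta !h// mulr1.
Qed.
Lemma eta0 c r x : 0 < r -> ~ box c (2 * r) x -> eta c r x = 0.
move=> r0 hx.
have h (t : R) : 2 * r < `|t| -> stp (2 - t / r) * stp (2 + t / r) = 0.
 rewrite -ltr_pdivlMr// -[X in `|_| / X](gtr0_norm r0) -normf_div ltr_normr=> /orP[a|a].
  by rewrite stp0 ?mul0r//;lra.
 by rewrite [X in _ * X]stp0 ?mulr0//;lra.
have [h1|h1] := ltP (2 * r) `|x.1 - c.1|;first by rewrite /eta h// mul0r.
have [h2|h2] := ltP (2 * r) `|x.2 - c.2|;first by rewrite /eta [X in _ * X]h// mulr0.
by exfalso;apply: hx.
Qed.
Lemma Sm_eta c r : Sm (eta c r).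
have hd (f : R * R -> R) a : Sm f -> Sm (fun x=> (f x - a) / r).
 move=> hf;apply: Sm_M;[apply: Sm_B=> //|];exact: Sm_c.
have h f a : Sm f -> Sm (fun x=> stp (2 - (f x - a) / r) * stp (2 + (f x - a) / r)).
 move=> hf;apply: Sm_M;apply: Sm_stp;[apply: Sm_B|apply: Sm_D];try exact: hd;exact: Sm_c.
by apply: Sm_M;apply: h;[exact: Sm_fst|exact: Sm_snd].
Qed.
Lemma tf_eta c r : 0 < r -> tf (eta c r).
move=> r0;split;first exact: Sm_eta.
exists (2 * r + `|c.1| + `|c.2|)=> x hx;apply: eta0=> // -[h1 h2];apply: hx.
rewrite box0E;have := normr_ge0 c.1;have := normr_ge0 c.2=> *;split.
 by rewrite -(subrK c.1 x.1);apply: le_normD;lra.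
by rewrite -(subrK c.2 x.2);apply: le_normD;lra.
Qed.
Lemma eta_scale c (r : R) x : eta c r x = eta 0 1 (r^-1 *: x + (- (r^-1 *: c))).
rewrite /eta /=.
have e (a b : R) : (r^-1 * a - r^-1 * b - 0) / 1 = (a - b) / r.
 by rewrite subr0 divr1 -mulrBr mulrC.
by rewrite -!e.
Qed.
Lemma eta_dd : exists2 C : R, 0 <= C & forall c r i x, 0 < r -> `|dd i (eta c r) x| <= C / r.
have [C C0 hC] := tf_dd_bound (@tf_eta 0 1 ltr01).
exists C=> // c r i x r0.
rewrite (_ : eta c r = fun x=> eta 0 1 (r^-1 *: x + (- (r^-1 *: c))));last first.
 by apply/funext=> y;exact: eta_scale.
rewrite dd_aff;last exact: Sm_eta.
by rewrite normrM gtr0_norm ?invr_gt0// mulrC ler_wpM2r// invr_ge0 ltW.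
Qed.

End Mollification.

(** * Weak derivatives in the plane and difference quotients *)

Section WeakDerivative.
Context {R : realType}.
Implicit Types (f g phi psi k : R * R -> R) (x v c : R * R) (i : 'I_2).

Definition bs f : Prop := exists r : R, forall x, ~ box 0 r x -> f x = 0.
Definition K2 f : Prop := L2 f /\ bs f.

Lemma box_le (r s : R) x : r <= s -> box 0 r x -> box 0 s x.
by move=> rs;rewrite !box0E=> -[h1 h2];split;apply: le_trans rs. Qed.
Lemma bs2 f g : bs f -> bs g -> exists2 r : R, 0 <= r &
 forall x, ~ box 0 r x -> f x = 0 /\ g x = 0.
move=> [r hr] [s hs];exists (`|r| + `|s|);first by rewrite addr_ge0.
have h1 := ler_norm r;have h2 := ler_norm s;have h3 := normr_ge0 r;have h4 := normr_ge0 s.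
move=> x hx;split;[apply: hr|apply: hs]=> h;apply: hx;apply: box_le h;lra.
Qed.
Lemma K2_L2 f : K2 f -> L2 f. Proof. by case. Qed.
Lemma K2_mf f : K2 f -> mf f. Proof. by case=> -[]. Qed.
Lemma K2_L1 f : K2 f -> L1 f.
move=> [hf [r hr]].
have h1 : L2 (\1_(box 0 r)) := ker_L2 (ker_box r).
have := L2M h1 hf;congr L1;apply/funext=> x.
have [hx|hx] := pselect (box 0 r x);first by rewrite indT// mul1r.
by rewrite hr// mulr0.
Qed.
Lemma K2_D f g : K2 f -> K2 g -> K2 (fun x=> f x + g x).
move=> [hf bf] [hg bg];split;first exact: L2D.
by have [r _ hr] := bs2 bf bg;exists r=> x /hr[-> ->];rewrite addr0.
Qed.
Lemma K2_Z (a : R) f : K2 f -> K2 (fun x=> a * f x).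
by move=> [hf [r hr]];split;[exact: L2Z|exists r=> x /hr ->;rewrite mulr0]. Qed.
Lemma K2_N f : K2 f -> K2 (fun x=> - f x).
by move=> [hf [r hr]];split;[exact: L2N|exists r=> x /hr ->;rewrite oppr0]. Qed.
Lemma K2_B f g : K2 f -> K2 g -> K2 (fun x=> f x - g x).
by move=> hf hg;apply: K2_D=> //;exact: K2_N. Qed.
Lemma bs_sh v f : bs f -> bs (fun x=> f (x + v)).
move=> [r hr];exists (`|r| + `|v.1| + `|v.2|)=> x hx;apply: hr=> h;apply: hx.
move: h;rewrite !box0E=> -[h1 h2].
have := ler_norm r;have := normr_ge0 v.1;have := normr_ge0 v.2=> *.
split.
 by rewrite -(addrK v.1 x.1);apply: le_normB;move: h1;rewrite /=;lra.
by rewrite -(addrK v.2 x.2);apply: le_normB;move: h2;rewrite /=;lra.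
Qed.
Lemma K2_sh v f : K2 f -> K2 (fun x=> f (x + v)).
by move=> [hf bf];split;[exact: L2_sh|exact: bs_sh]. Qed.
Lemma tf_K2 phi : tf phi -> K2 phi.
by move=> h;split;[exact: tf_L2|case: h]. Qed.
Lemma K2_tfM phi g : Sm phi -> K2 g -> K2 (fun x=> phi x * g x).
move=> hp [hg [r hr]].
have [M M0 hM] := @cont_bounded_box R phi 0 r (Sm_cont hp).
have mp := Sm_mf hp;split;last by exists r=> x /hr ->;rewrite mulr0.
have : L2 (fun x=> (\1_(box 0 r) x * phi x) * g x).
 apply: (@L2_bM _ _ _ M)=> //;first by apply: mfM=> //;exact: mf_ind.
 move=> x;have [hx|hx] := pselect (box 0 r x);first by rewrite indT// mul1r hM.
 by rewrite indF// mul0r normr0.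
congr L2;apply/funext=> x;have [hx|hx] := pselect (box 0 r x).
 by rewrite indT// mul1r.
by rewrite hr// !mulr0.
Qed.
Lemma K2_cv f phi : K2 f -> tf phi -> tf (cv f phi).
move=> hf hp;split;first by apply: Sm_cv=> //;exact: K2_L1.
have [_ [r hr]] := hf;have [_ [s hs]] := hp.
by exists (r + s)=> x;apply: cv_supp.
Qed.

(** Weak differentiability in the whole plane, for functions of bounded support. Every test function
    of the plane is allowed, in particular reflected mollifiers, so mollification commutes with it
    ([wd_dd_cv]). *)
Definition wd i f g : Prop := [/\ K2 f, K2 g &
 forall phi, tf phi -> \I_x (f x * dd i phi x) = - \I_x (g x * phi x)].

Lemma K2M f g : K2 f -> K2 g -> L1 (fun x=> f x * g x).
by move=> /K2_L2 hf /K2_L2 hg;exact: L2M. Qed.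

Lemma I_shM v f g : K2 f -> K2 g ->
 \I_x (f (x + v) * g x) = \I_x (f x * g (x - v)).
move=> hf hg;have := I_sh v (K2M hf (K2_sh (- v) hg))=> <-.
by apply: eq_I=> x;rewrite addrK.
Qed.

Lemma tf_shN v phi : tf phi -> tf (fun x=> phi (x - v)).
move=> [h b];split;last exact: (@bs_sh (- v)).
by apply: Sm_ext (Sm_aff 1 (- v) h)=> x;rewrite scale1r.
Qed.
Lemma dd_shN v phi i x : Sm phi -> dd i (fun x=> phi (x - v)) x = dd i phi (x - v).
move=> h;rewrite -[x in RHS]scale1r -[RHS]mul1r -dd_aff//.
by congr (dd i _ x);apply/funext=> y;rewrite scale1r.
Qed.

Lemma is_derive_of_quad1 (F : R -> R) (t l C : R) :
 (forall h : R, `|h| <= 1 -> `|F (t + h) - F t - h * l| <= C * h ^+ 2) -> is_derive t (1 : R) F l.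
move=> hq.
pose G (h : R) := F (h + t) - (h * l + F t).
have d0 : is_derive (0 : R) (1 : R) G 0.
 apply: (@is_derive_quad0 _ _ C);first by rewrite /G add0r mul0r add0r subrr.
 move=> s s1;rewrite /G [s + t]addrC.
 by rewrite (_ : _ - _ = F (t + s) - F t - s * l);[exact: hq|ring].
have := is_deriveD d0 (is_derive_affine 0 l (F t));rewrite add0r.
rewrite (_ : _ + _ = (fun h : R=> F (h + t)));last first.
 by apply/funext=> h;rewrite /G /= subrK.
move=> d1;pose s (h : R) := h - t.
have ds : is_derive t (1 : R) s 1 by rewrite /s;apply: is_derive_eq;rewrite subr0.
have d1' : is_derive (s t) (1 : R) (fun h : R=> F (h + t)) l by rewrite /s subrr.
have := @is_derive1_comp _ _ _ _ _ _ d1' ds;rewrite mulr1.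
by rewrite (_ : _ \o _ = F)//;apply/funext=> h;rewrite /= /s subrK.
Qed.

Lemma MVT_R (F F' : R -> R) (h : R) : (forall t : R, is_derive t (1 : R) F (F' t)) ->
 exists2 t : R, `|t| <= `|h| & F h - F 0 = h * F' t.
move=> dF.
have cF (A : set R) : {within A, continuous F}.
 by apply: continuous_subspaceT=> t;exact: is_derive_cont (dF t).
have [h0|h0] := leP 0 h.
 have [t + e] := @MVT_segment R F F' 0 h h0 (fun t _=> dF t) (cF _).
 rewrite in_itv/= => /andP[t0 th];exists t;first by rewrite !ger0_norm.
 by rewrite e subr0 mulrC.
have [t + e] := @MVT_segment R F F' h 0 (ltW h0) (fun t _=> dF t) (cF _).
rewrite in_itv/= => /andP[t0 th];exists t;first by rewrite !ler0_norm ?lerN2// ltW.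
by rewrite -opprB e sub0r mulrN opprK mulrC.
Qed.

(** The pairing of [f] with [phi (x - t e_i)] is differentiable in [t], with derivative the pairing
    of [g] with the same translate. The real mean value theorem for this function replaces
    integration along the segment. *)
Lemma wd_mvt i f g phi (h : R) : wd i f g -> tf phi -> exists2 t : R, `|t| <= `|h| &
 \I_x ((f (x + h *: dir i) - f x) * phi x) =
 h * \I_x (g x * phi (x - t *: dir i)).
move=> [hf hg hw] hp.
pose F (t : R) := \I_x (f x * phi (x - t *: dir i)).
pose F' (t : R) := \I_x (g x * phi (x - t *: dir i)).
have [M M0 hM] := tf_bound (tf_dd i (tf_dd i hp)).
have hp' t := tf_shN (t *: dir i) hp.
have hS := tf_Sm hp.
have Kf t := K2M hf (tf_K2 (hp' t)).
have dF (t : R) : is_derive t (1 : R) F (F' t).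
 apply: (@is_derive_of_quad1 _ _ _ (M * \I_x (`|f x|)))=> s _.
 have hq := hp' t;set q := (fun x=> _) in hq.
 have mq : mf q by exact: Sm_mf (tf_Sm hq).
 have e : F' t = - \I_x (f x * dd i q x) by rewrite hw// opprK.
 have Kd := K2M hf (tf_K2 (tf_dd i hq)).
 rewrite e mulrN opprK -(IZ _ Kd) /F -(IB (Kf (t + s)) (Kf t)) -(ID (L1B (Kf (t + s)) (Kf t)) (L1Z s Kd)).
 rewrite (eq_I (g := fun x=> f x * (q (x + (- s) *: dir i) - q x - (- s) * dd i q x)));last first.
  move=> x;rewrite /q (_ : x + (- s) *: dir i - t *: dir i = x - (t + s) *: dir i);first by ring.
  by rewrite scalerDl scaleNr opprD -addrA [- _ - _]addrC.
 rewrite mulrAC;apply: I_bM;first exact: K2_L1.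
  apply: mfB;last by apply: mfZ;exact: Sm_mf (tf_Sm (tf_dd i hq)).
  by apply: mfB=> //;exact: mf_sh.
 move=> x;rewrite -[s ^+ 2]sqrrN;apply: Sm_quad;first exact: tf_Sm hq.
 move=> y;rewrite (_ : dd i q = fun y=> dd i phi (y - t *: dir i));last first.
  by apply/funext=> z;rewrite /q dd_shN.
 by rewrite dd_shN//;exact: Sm_dd.
have [t th E] := MVT_R h dF;exists t=> //;rewrite -/(F' t) -E /F.
have kp := tf_K2 hp.
rewrite (eq_I (g := fun x=> f (x + h *: dir i) * phi x - f x * phi x));last by move=> x;ring.
rewrite IB;[|exact: K2M (K2_sh _ hf) kp|exact: K2M].
rewrite I_shM//;congr (_ - _).
by apply: eq_I=> x;rewrite scale0r subr0.
Qed.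

(** Mollifying [psi] costs an arbitrarily small error. The point [t] depends on that error, which is
    harmless because only bounds uniform in [t] are drawn from it. *)
Lemma wd_mvt2 i f g psi (h e : R) : wd i f g -> K2 psi -> 0 < e -> exists2 t : R, `|t| <= `|h| &
 `|\I_x ((f (x + h *: dir i) - f x) * psi x) -
 h * \I_x (g x * psi (x - t *: dir i))| <= e.
move=> hfg hp e0;have [hf hg _] := hfg.
pose u x := f (x + h *: dir i) - f x.
have Ku : K2 u by apply: K2_B=> //;exact: K2_sh.
pose C := nrm u + `|h| * nrm g + 1.
have C0 : 0 < C by rewrite ltr_wpDl// addr_ge0 ?mulr_ge0 ?nrm_ge0.
have [d d0 hd] := moll_L2 (K2_L1 hp) (K2_L2 hp) (divr_gt0 e0 C0).
have [k hk] := moll_exists d0.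
pose phi := cv psi k;have hphi : tf phi by apply: K2_cv=> //;case: hk.
have hn : nrm (fun x=> phi x - psi x) <= e / C by exact: hd hk (lexx _).
have [t th E] := wd_mvt h hfg hphi;exists t=> //.
have kp := tf_K2 hphi.
have kd : K2 (fun x=> phi x - psi x) by exact: K2_B.
have -> : \I_x (u x * psi x) - h * \I_x (g x * psi (x - t *: dir i)) =
  h * \I_x (g x * (phi (x - t *: dir i) - psi (x - t *: dir i)))
  - \I_x (u x * (phi x - psi x)).
 have s1 := K2_sh (- (t *: dir i)) kp;have s2 := K2_sh (- (t *: dir i)) hp.
 rewrite (eq_I (f := fun x=> g x * (phi (x - t *: dir i) - psi (x - t *: dir i))) (g := fun x=> g x * phi (x - t *: dir i) - g x * psi (x - t *: dir i)))=> [|x];last by ring.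
 rewrite (eq_I (f := fun x=> u x * (phi x - psi x)) (g := fun x=> u x * phi x - u x * psi x))=> [|x];last by ring.
 rewrite IB;[|exact: K2M|exact: K2M].
 rewrite IB;[|exact: K2M|exact: K2M].
 by rewrite E;ring.
apply: le_normB;rewrite normrM.
have b1 := CSn (K2_L2 hg) (K2_L2 (K2_sh (- (t *: dir i)) kd)).
rewrite (nrm_sh _ (K2_L2 kd)) in b1.
have b2 := CSn (K2_L2 Ku) (K2_L2 kd).
apply: (letr (C * nrm (fun x=> phi x - psi x)));last first.
 by rewrite mulrC -ler_pdivlMr.
have := nrm_ge0 (fun x=> phi x - psi x);rewrite /C.
by move: b1 b2;have := normr_ge0 h;nra.
Qed.

Lemma le_eps (a b : R) : (forall e, 0 < e -> a <= b + e) -> a <= b.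
by move=> h;apply/ler_addgt0Pr. Qed.

Lemma wd_dual i f g psi (h D : R) : wd i f g -> K2 psi ->
 (forall t : R, `|t| <= `|h| -> `|\I_x (g x * psi (x - t *: dir i))| <= D) ->
 `|\I_x ((f (x + h *: dir i) - f x) * psi x)| <= `|h| * D.
move=> hfg hp hD;apply: le_eps=> e e0.
have [t th E] := wd_mvt2 h hfg hp e0.
set a := I _ in E *;set b := I _ in E.
rewrite -[a](subrK (h * b)) addrC;apply: le_normD;apply: lerD=> //.
by rewrite normrM ler_wpM2l//;exact: hD.
Qed.

Lemma wd_shift_le i f g (h : R) : wd i f g ->
 nrm (fun x=> f (x + h *: dir i) - f x) <= `|h| * nrm g.
move=> hfg;have [hf hg _] := hfg.
pose u x := f (x + h *: dir i) - f x.
have Ku : K2 u by apply: K2_B=> //;exact: K2_sh.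
have := @wd_dual i f g u h (nrm g * nrm u) hfg Ku.
move=> /(_ _)/(le_trans (ler_norm _)) H.
have {}H : nsq u <= `|h| * (nrm g * nrm u).
 apply: le_trans (H _).
  by rewrite le_eqVlt;apply/orP;left;apply/eqP;apply: eq_I=> x;rewrite -expr2.
 move=> t _;rewrite -(nrm_sh (- (t *: dir i)) (K2_L2 Ku)).
 by apply: CSn;[exact: K2_L2|exact: K2_L2 (K2_sh _ Ku)].
rewrite -/u;have [u0|u0] := eqVneq (nrm u) 0;first by rewrite u0 mulr_ge0 ?nrm_ge0.
have up : 0 < nrm u by rewrite lt_neqAle eq_sym u0 nrm_ge0.
by rewrite -(ler_pM2r up) -expr2 nrm_sq -mulrA.
Qed.

(** The remainder [u] is tested against itself: the mean value form turns the pairing into [h] times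
    that of [u] with [g (x + t e_i) - g x], up to an arbitrarily small error. Together with
    continuity of translations this gives convergence of difference quotients in L^2. *)
Lemma wd_strong i f g (h D : R) : wd i f g ->
 (forall t : R, `|t| <= `|h| -> nrm (fun x=> g (x + t *: dir i) - g x) <= D) ->
 nrm (fun x=> f (x + h *: dir i) - f x - h * g x) <= `|h| * D.
move=> hfg hD;have [hf hg _] := hfg.
pose u x := f (x + h *: dir i) - f x - h * g x.
have Ku : K2 u by apply: K2_B;[apply: K2_B=> //;exact: K2_sh|exact: K2_Z].
have D0 : 0 <= D.
 by apply: le_trans (hD 0 _);[exact: nrm_ge0|rewrite normr0].
have H : nsq u <= `|h| * (D * nrm u).
 apply: le_eps=> e e0;have [t th E] := wd_mvt2 h hfg Ku e0.
 have kb := K2M (K2_B (K2_sh (h *: dir i) hf) hf) Ku.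
 have e1 : nsq u = (\I_x ((f (x + h *: dir i) - f x) * u x) -
   h * \I_x (g x * u (x - t *: dir i))) +
   h * \I_x ((g (x + t *: dir i) - g x) * u x).
  have kg := K2M hg Ku;have kgt := K2M (K2_sh (t *: dir i) hg) Ku.
  rewrite (eq_I (f := fun x=> (g (x + t *: dir i) - g x) * u x) (g := fun x=> g (x + t *: dir i) * u x - g x * u x))=> [|x];last by ring.
  rewrite IB// I_shM//.
  rewrite /nsq (eq_I (g := fun x=> (f (x + h *: dir i) - f x) * u x - h * (g x * u x)))=> [|x];last by rewrite /u;ring.
  rewrite IB//;last exact: L1Z.
  by rewrite IZ//;ring.
 rewrite e1 addrC;apply: lerD;last exact: le_trans (ler_norm _) E.
 apply: le_trans (ler_norm _) _;rewrite normrM ler_wpM2l//.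
 have kgg := K2_B (K2_sh (t *: dir i) hg) hg.
 apply: le_trans (CSn (K2_L2 kgg) (K2_L2 Ku)) _.
 by rewrite ler_wpM2r ?nrm_ge0// hD.
rewrite -/u;have [u0|u0] := eqVneq (nrm u) 0;first by rewrite u0 mulr_ge0.
have up : 0 < nrm u by rewrite lt_neqAle eq_sym u0 nrm_ge0.
by rewrite -(ler_pM2r up) -expr2 nrm_sq -mulrA.
Qed.

Lemma dir_small i (h : R) : `|(h *: dir i).1| <= `|h| /\ `|(h *: dir i).2| <= `|h|.
have hd (a : bool) : `|h * a%:R| <= `|h|.
 by case: a;rewrite ?mulr1 ?mulr0 ?normr0.
by split;exact: hd.
Qed.

Lemma wd_diff i f g (e : R) : wd i f g -> 0 < e -> exists2 d, 0 < d &
 forall h : R, `|h| <= d -> nrm (fun x=> f (x + h *: dir i) - f x - h * g x) <= `|h| * e.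
move=> hfg e0;have [hf hg _] := hfg.
have [d d0 hd] := L2_shift_cont (K2_L2 hg) e0;exists d=> // h hh.
apply: wd_strong hfg _=> t th;have [h1 h2] := dir_small i t.
by apply: hd;[exact: le_trans h1 (le_trans th hh)|exact: le_trans h2 (le_trans th hh)].
Qed.

(** The converse direction: convergence of the difference quotients after pairing with the test
    function is enough. The product rule and the chain rule are both derived from this criterion. *)
Lemma wd_of_diff i f g phi : L1 f -> L1 g -> tf phi ->
 (forall e, 0 < e -> exists2 d, 0 < d & forall h : R, 0 < h -> h <= d ->
  `|\I_x ((f (x + h *: dir i) - f x - h * g x) * phi x)| <= h * e) ->
 \I_x (f x * dd i phi x) = - \I_x (g x * phi x).
move=> hf hg hp H.
have [M M0 hM] := tf_bound (tf_dd i (tf_dd i hp)).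
have [B B0 hB] := tf_bound hp;have [B' B'0 hB'] := tf_bound (tf_dd i hp).
have hS := tf_Sm hp;have mp := Sm_mf hS;have md := Sm_mf (tf_Sm (tf_dd i hp)).
have Lb (u q : R * R -> R) (b : R) : L1 u -> mf q -> (forall x, `|q x| <= b) -> L1 (fun x=> u x * q x).
 move=> hu hq hb;have := L1_bM hq hb hu;congr L1;apply/funext=> x;exact: mulrC.
have fp := Lb _ _ _ hf mp hB;have gp := Lb _ _ _ hg mp hB;have fd := Lb _ _ _ hf md hB'.
set a := I _;set b := \I_x (g x * phi x).
suff : `|a + b| <= 0 by rewrite normr_le0 addr_eq0=> /eqP.
apply: le_eps=> e e0;rewrite add0r.
have [d d0 hd] := H _ (divr_gt0 e0 (ltr0n _ 2)).
pose C := M * \I_x (`|f x|) + 1.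
have C0 : 0 < C by rewrite ltr_wpDl// mulr_ge0// I_ge0.
pose h := Num.min d (e / (2 * C)).
have h0 : 0 < h by rewrite lt_min d0 divr_gt0// mulr_gt0.
have h1 : h <= d by rewrite ge_min lexx.
have h2 : h * (2 * C) <= e by rewrite -ler_pdivlMr ?mulr_gt0// ge_min lexx orbT.
have {hd}hd := hd h h0 h1.
have fph := Lb (fun x=> f (x + h *: dir i)) _ _ (L1_sh _ hf) mp hB.
have e1 : \I_x ((f (x + h *: dir i) - f x - h * g x) * phi x) =
 \I_x (f x * (phi (x + (- h) *: dir i) - phi x - (- h) * dd i phi x)) - h * (a + b).
 have fphN := Lb f (fun x=> phi (x + (- h) *: dir i)) B hf (mf_sh _ mp) (fun x=> hB _).
 rewrite (eq_I (g := fun x=> f (x + h *: dir i) * phi x - f x * phi x - h * (g x * phi x)));last by move=> x;ring.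
 rewrite IB;[|exact: L1B|exact: L1Z].
 rewrite IB// IZ// -/b.
 rewrite (eq_I (f := fun x=> f x * (phi (x + (- h) *: dir i) - phi x - (- h) * dd i phi x)) (g := fun x=> f x * phi (x + (- h) *: dir i) - f x * phi x + h * (f x * dd i phi x)));last by move=> x;ring.
 rewrite ID;[|exact: L1B|exact: L1Z].
 rewrite IB// IZ// -/a -(I_sh (h *: dir i) fphN).
 rewrite (eq_I (f := fun x=> f (x + h *: dir i) * phi (x + h *: dir i + _)) (g := fun x=> f (x + h *: dir i) * phi x));last first.
  by move=> x;rewrite scaleNr addrK.
 by ring.
have b1 : `|\I_x (f x * (phi (x + (- h) *: dir i) - phi x - (- h) * dd i phi x))| <= M * h ^+ 2 * \I_x (`|f x|).
 apply: I_bM=> //.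
  by apply: mfB;[apply: mfB=> //;exact: mf_sh|exact: mfZ].
 by move=> x;rewrite -[h ^+ 2]sqrrN;exact: Sm_quad.
rewrite -(ler_pM2l h0) -[h in leLHS]gtr0_norm// -normrM.
rewrite (_ : h * (a + b) = \I_x (f x * (phi (x + (- h) *: dir i) - phi x - (- h) * dd i phi x))
 - \I_x ((f (x + h *: dir i) - f x - h * g x) * phi x));last by rewrite e1;ring.
apply: le_normB.
have I0f : 0 <= \I_x (`|f x|) by exact: I_ge0.
rewrite (splitr e) mulrDr;apply: lerD=> //.
apply: le_trans b1 _;rewrite expr2.
have : h * (M * \I_x (`|f x|)) <= e / 2 by move: h2;rewrite /C;nra.
by move=> /(ler_wpM2l (ltW h0));apply: le_trans;rewrite le_eqVlt;apply/orP;left;apply/eqP;ring.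
Qed.

End WeakDerivative.

(** * Weak derivatives in the disk: cutoffs, product rule, chain rule *)

Section Disk.
Context {R : realType}.
Implicit Types (f g phi psi k chi : R * R -> R) (x v c : R * R) (i : 'I_2).

Definition E2 x : R := x.1 ^+ 2 + x.2 ^+ 2.
Lemma diskE x : disk x <-> E2 x < 1.
rewrite /disk /= /enorm2 -/(E2 x) -[X in _ < X]sqrtr1 ltr_sqrt//.
Qed.
Lemma Sm_E2 : Sm E2.
have h f : Sm f -> Sm (fun x=> f x ^+ 2).
 by move=> hf;apply: Sm_ext (Sm_M hf hf)=> x;rewrite expr2.
by apply: Sm_D;apply: h;[exact: Sm_fst|exact: Sm_snd].
Qed.
Lemma E2_box x (r : R) : E2 x <= r ^+ 2 -> 0 <= r -> box 0 r x.
move=> h r0;rewrite box0E;move: h;rewrite /E2=> h.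
have := sqr_ge0 x.1;have := sqr_ge0 x.2=> h1 h2.
split;rewrite -ler_sqr ?nnegrE// real_normK ?num_real//;lra.
Qed.
Lemma disk_open : open (disk : set (R * R)).
rewrite (_ : disk = E2 @^-1` [set t | t < 1]).
 by apply: open_comp=> [x _|];[exact: Sm_cont Sm_E2 x|exact: open_lt].
by apply/seteqP;split=> x /diskE.
Qed.
Lemma mdisk : measurable (disk : set (R * R)).
exact: open_measurable2 disk_open. Qed.

(** The compact support of [Ccinfty_disk] is replaced by a concentric closed disk, which is
    equivalent by [cdP]; the explicit radius leaves room for further cutoffs and for
    mollification. *)
Definition cd phi : Prop := Sm phi /\ exists2 r : R, r < 1 & forall x, r < E2 x -> phi x = 0.

Lemma cd_bs phi (r : R) : r < 1 -> (forall x, r < E2 x -> phi x = 0) ->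
 forall x, ~ box 0 1 x -> phi x = 0.
move=> r1 h x hx;apply: h;rewrite ltNge;apply/negP=> h;apply: hx.
by apply: E2_box=> //;rewrite expr1n;lra.
Qed.
Lemma cd_tf phi : cd phi -> tf phi.
by move=> [h [r r1 hr]];split=> //;exists 1;exact: cd_bs hr. Qed.
Lemma cd_Sm phi : cd phi -> Sm phi. Proof. by case. Qed.
Lemma cd_M f phi : Sm f -> cd phi -> cd (fun x=> f x * phi x).
by move=> hf [h [r r1 hr]];split;[exact: Sm_M|exists r=> // x /hr ->;rewrite mulr0].
Qed.
Lemma cd_Z (a : R) phi : cd phi -> cd (fun x=> a * phi x).
by apply: cd_M;exact: Sm_c. Qed.
Lemma cd_D f phi : cd f -> cd phi -> cd (fun x=> f x + phi x).
move=> [hf [r1 r11 hr1]] [h [r r1' hr]];split;[exact: Sm_D|exists (Num.max r1 r)].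
 by rewrite gt_max r11.
by move=> x;rewrite gt_max=> /andP[h1 h2];rewrite hr1// hr// addr0.
Qed.

Lemma E2_near (r : R) x : r < E2 x -> \forall y \near x, r < E2 y.
move=> h;have := @Sm_cont R E2 Sm_E2 x [set t | r < t].
by apply;apply: open_nbhs_nbhs;split=> //;exact: open_gt.
Qed.
Lemma E2_near_lt (r : R) x : E2 x < r -> \forall y \near x, E2 y < r.
move=> h;have := @Sm_cont R E2 Sm_E2 x [set t | t < r].
by apply;apply: open_nbhs_nbhs;split=> //;exact: open_lt.
Qed.
Lemma dd_supp_E2 phi (r : R) i : (forall x, r < E2 x -> phi x = 0) ->
 forall x, r < E2 x -> dd i phi x = 0.
move=> h x hx;rewrite -[RHS](dd_c i (0 : R) x);apply: dd_near.
by apply: filterS (E2_near hx)=> y;exact: h.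
Qed.
Lemma cd_dd phi i : cd phi -> cd (dd i phi).
by move=> [h [r r1 hr]];split;[exact: Sm_dd|exists r=> //;exact: dd_supp_E2]. Qed.

Lemma compact_E2 (r : R) : compact [set x | E2 x <= r].
apply: (@subclosed_compact _ _ (box 0 (`|r| + 1))).
- rewrite (_ : [set _ | _] = E2 @^-1` [set t | t <= r])//.
 by apply: closed_comp=> [x _|];[exact: Sm_cont Sm_E2 x|exact: closed_le].
- exact: compact_box.
- move=> x /= hx;apply: E2_box;last by rewrite addr_ge0.
 apply: le_trans hx _;have := ler_norm r;have := normr_ge0 r;nra.
Qed.

Lemma compact_disk_E2 (K : set (R * R)) : compact K -> K `<=` disk ->
 exists2 r : R, r < 1 & forall x, K x -> E2 x <= r.
move=> cK Kd;have [K0|K0] := pselect (K !=set0);last first.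
 by exists 0=> // x Kx;exfalso;apply: K0;exists x.
have cE : {within K, continuous E2} by apply: continuous_subspaceT;exact: Sm_cont Sm_E2.
have [c /set_mem cK' h] := compact_EVT_max K0 cK cE.
exists (E2 c);first by apply/diskE;exact: Kd.
by move=> x /mem_set;exact: h.
Qed.

Lemma cdP phi : Ccinfty_disk phi <-> cd phi.
split=> [[h [K [cK Kd hK]]]|[h [r r1 hr]]].
 split=> //;have [r r1 hr] := compact_disk_E2 cK Kd.
 by exists r=> // x rx;apply: hK=> /hr;rewrite leNgt rx.
split=> //;exists [set x | E2 x <= r];split;first exact: compact_E2.
 by move=> x /= hx;apply/diskE;exact: le_lt_trans hx r1.
by move=> x /= /negP;rewrite -ltNge;exact: hr.
Qed.

Definition chi (r s : R) x : R := stp ((s - E2 x) / (s - r)).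
Lemma chi_cd (r s : R) : r < s -> s < 1 -> cd (chi r s).
move=> rs s1;split.
 apply: Sm_stp;apply: Sm_M;last exact: Sm_c.
 by apply: Sm_B;[exact: Sm_c|exact: Sm_E2].
exists s=> // x hx;apply: stp0.
by rewrite pmulr_lle0 ?invr_gt0 ?subr_gt0//;lra.
Qed.
Lemma chi01 (r s : R) x : 0 <= chi r s x <= 1.
exact: stp01. Qed.
Lemma chi1 (r s : R) x : r < s -> E2 x <= r -> chi r s x = 1.
by move=> rs h;apply: stp1;rewrite ler_pdivlMr ?subr_gt0// mul1r;lra.
Qed.

Lemma dd_chi1 (r s : R) i x : r < s -> E2 x < r -> dd i (chi r s) x = 0.
move=> rs h;rewrite -[RHS](dd_c i (1 : R) x);apply: dd_near.
by apply: filterS (E2_near_lt h)=> y /ltW;exact: chi1.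
Qed.
Lemma mid2 (r : R) : r < 1 -> exists s t : R, [/\ r < s, s < 1, s < t & t < 1].
by move=> r1;exists ((r + 1) / 2), (((r + 1) / 2 + 1) / 2);split;lra. Qed.
Lemma box_add x v (d : R) : box 0 d v -> box x d (x + v).
by rewrite box0E /box /= [x.1 + _]addrC [x.2 + _]addrC !addrK. Qed.
Lemma box0_dir i (d h : R) : `|h| <= d -> box 0 d (h *: dir i).
move=> hd;have d0 : 0 <= d := le_trans (normr_ge0 _) hd.
by rewrite box0E /=;split;rewrite normrM;case: (_ == _);rewrite /= ?normr1 ?normr0 ?mulr1 ?mulr0.
Qed.
Lemma geo2 (r s : R) : r < s -> s < 1 -> exists2 d, 0 < d & forall x y, E2 x <= r -> box x d y -> E2 y <= s.
move=> rs s1;pose d := Num.min 1 ((s - r) / 6).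
have d0 : 0 < d by rewrite lt_min ltr01 divr_gt0 ?subr_gt0.
have [da db] : d <= 1 /\ d <= (s - r) / 6 by rewrite /d !ge_min !lexx ?orbT.
exists d=> // x y hx [y1 y2].
have [x1 x2] : `|x.1| <= 1 /\ `|x.2| <= 1.
 by rewrite -box0E;apply: E2_box=> //;rewrite expr1n;lra.
have hb (a b : R) : `|a| <= 1 -> `|b - a| <= d -> b ^+ 2 <= a ^+ 2 + 3 * d.
 by rewrite !ler_norml=> /andP[p1 p2] /andP[p3 p4];nra.
have := hb _ _ x1 y1;have := hb _ _ x2 y2;move: hx;rewrite /E2;lra.
Qed.
(** The cutoff equals [1] on a neighbourhood of the support of [phi]. The last clause covers small
    translates, so difference quotients of cut-off functions can be compared with those of the
    original ones when paired with [phi]. *)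
Lemma cd_cut phi : cd phi -> exists chi, [/\ cd chi, forall x, 0 <= chi x <= 1,
 forall x, chi x * phi x = phi x, forall i x, chi x * dd i phi x = dd i phi x &
 (forall j x, dd j chi x * phi x = 0) /\
 exists2 d, 0 < d & forall i x (h : R), `|h| <= d -> chi (x + h *: dir i) * phi x = phi x].
move=> [hS [r r1 hr]].
have [s [t [rs s1 st t1]]] := mid2 r1.
have key x (u : R) : (r < E2 x -> u = 0) -> chi s t x * u = u.
 move=> hu;have [h|h] := leP (E2 x) r;last by rewrite hu// mulr0.
 by rewrite chi1// ?mul1r//;lra.
exists (chi s t);split.
- exact: chi_cd.
- by move=> x;exact: chi01.
- by move=> x;apply: key;exact: hr.
- by move=> i x;apply: key;exact: dd_supp_E2.
split.
 move=> j x;have [h|h] := leP (E2 x) r;last by rewrite hr// mulr0.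
 by rewrite (dd_chi1 j st (le_lt_trans h rs)) mul0r.
have [d d0 hd] := geo2 rs s1;exists d=> // i x h hh.
have [hx|hx] := leP (E2 x) r;last by rewrite hr// mulr0.
by rewrite chi1// ?mul1r//;apply: hd hx _;apply: box_add;exact: box0_dir.
Qed.

Definition msk f x : R := \1_disk x * f x.
Lemma mskT f x : disk x -> msk f x = f x.
by move=> h;rewrite /msk indT// mul1r. Qed.
Lemma mskF f x : ~ disk x -> msk f x = 0.
by move=> h;rewrite /msk indF// mul0r. Qed.
Lemma msk_restrict f : f \_ disk = msk f.
by apply/funext=> x;rewrite /msk /patch indicE;case: ifP=> _;rewrite ?mul1r ?mul0r.
Qed.
Lemma mf_msk f : mf f -> mf (msk f).
by move=> h;apply: mfM=> //;apply: mf_ind;exact: mdisk. Qed.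
Lemma cd_off phi x : cd phi -> ~ disk x -> phi x = 0.
move=> [_ [r r1 hr]] hx;apply: hr;rewrite ltNge;apply/negP=> h;apply: hx.
by apply/diskE;exact: le_lt_trans h r1.
Qed.
Lemma msk_cd f phi x : cd phi -> msk f x * phi x = f x * phi x.
move=> hp;have [h|h] := pselect (disk x);first by rewrite mskT.
by rewrite (cd_off hp h) !mulr0.
Qed.

Definition W i f g : Prop := forall phi, cd phi ->
 \I_x (f x * dd i phi x) = - \I_x (g x * phi x).
Definition D2 f : Prop := mf f /\ L2 (msk f).
Definition W2 i f g : Prop := [/\ D2 f, D2 g & W i f g].

Lemma msk_bs f : bs (msk f).
exists 1=> x hx;apply: mskF=> /diskE h;apply: hx.
by apply: E2_box=> //;rewrite expr1n ltW.
Qed.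
Lemma D2_K2 f : D2 f -> K2 (msk f).
by move=> [_ h];split=> //;exact: msk_bs. Qed.
Lemma D2_cd f phi : cd phi -> D2 f -> K2 (fun x=> phi x * f x).
move=> hp hf;have := K2_tfM (cd_Sm hp) (D2_K2 hf);congr K2.
by apply/funext=> x;rewrite mulrC msk_cd// mulrC.
Qed.
Lemma D2_D f g : D2 f -> D2 g -> D2 (fun x=> f x + g x).
move=> [mf1 hf] [mg hg];split;first exact: mfD.
by have := L2D hf hg;congr L2;apply/funext=> x;rewrite /msk;ring.
Qed.
Lemma D2_Z (a : R) f : D2 f -> D2 (fun x=> a * f x).
move=> [mf1 hf];split;first exact: mfZ.
by have := L2Z a hf;congr L2;apply/funext=> x;rewrite /msk;ring.
Qed.
Lemma D2_bM f g (M : R) : mf f -> (forall x, `|f x| <= M) -> D2 g -> D2 (fun x=> f x * g x).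
move=> mf1 hM [mg hg];split;first exact: mfM.
by have := L2_bM mf1 hM hg;congr L2;apply/funext=> x;rewrite /msk;ring.
Qed.
Lemma D2_N f : D2 f -> D2 (fun x=> - f x).
by move=> /(D2_Z (-1));congr D2;apply/funext=> x;ring. Qed.
Lemma D2_B f g : D2 f -> D2 g -> D2 (fun x=> f x - g x).
by move=> hf hg;apply: D2_D=> //;exact: D2_N. Qed.
Lemma D2_le f g : mf f -> D2 g -> (forall x, `|f x| <= `|g x|) -> D2 f.
move=> mf1 [mg hg] h;split=> //;apply: (L2_le _ hg);first exact: mf_msk.
by move=> x;rewrite /msk !normrM ler_wpM2l.
Qed.
Lemma D2_b f (M : R) : mf f -> (forall x, `|f x| <= M) -> D2 f.
move=> mf1 hM;split=> //.
have h : L2 (\1_(box 0 1) : R * R -> R) := ker_L2 (ker_box 1).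
have := L2_bM mf1 hM h=> /(L2_le _);apply;first exact: mf_msk.
move=> x;have [hx|hx] := pselect (disk x);last by rewrite mskF// normr0.
rewrite mskT// indT ?mulr1//;apply: E2_box=> //;rewrite expr1n ltW//;exact/diskE.
Qed.
Lemma D2_sum n (F : 'I_n -> R * R -> R) : (forall j, D2 (F j)) -> D2 (fun x=> \sum_(j < n) F j x).
move=> h;elim: n F h=> [|n IH] F h.
 by under eq_fun do rewrite big_ord0;apply: (@D2_b _ 0)=> [|x];[exact: mfc|rewrite normr0].
by under eq_fun do rewrite big_ord_recl;apply: D2_D=> //;apply: IH.
Qed.
Lemma D2_L1 f phi : cd phi -> D2 f -> L1 (fun x=> f x * phi x).
by move=> hp /(D2_cd hp)/K2_L1;congr L1;apply/funext=> x;rewrite mulrC. Qed.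
Lemma D2M_L1 f g phi : cd phi -> D2 f -> D2 g -> L1 (fun x=> f x * g x * phi x).
move=> hp hf hg;have := K2M (D2_cd hp hf) (D2_K2 hg);congr L1;apply/funext=> x.
rewrite (_ : _ * msk g x = f x * (msk g x * phi x));last by ring.
by rewrite msk_cd// mulrA.
Qed.

(** A cutoff turns a weak derivative in the disk into one in the plane, where arguments by
    translation are available. *)
Lemma W2_loc i f g chi : cd chi -> W2 i f g ->
 wd i (fun x=> chi x * f x) (fun x=> chi x * g x + dd i chi x * f x).
move=> hc [hf hg hw];split;first exact: D2_cd.
 by apply: K2_D;apply: D2_cd=> //;exact: cd_dd.
move=> phi hp;have hcp : cd (fun x=> phi x * chi x) by apply: cd_M=> //;exact: tf_Sm hp.
have := hw _ hcp.
have l1 : L1 (fun x=> f x * (dd i chi x * phi x)).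
 apply: D2_L1=> //;have := cd_M (tf_Sm hp) (cd_dd i hc);congr cd.
 by apply/funext=> x;rewrite mulrC.
have l2 : L1 (fun x=> f x * (chi x * dd i phi x)).
 apply: D2_L1=> //;have := cd_M (tf_Sm (tf_dd i hp)) hc;congr cd.
 by apply/funext=> x;rewrite mulrC.
have l3 : L1 (fun x=> g x * (phi x * chi x)) by exact: D2_L1.
rewrite (eq_I (g := fun x=> f x * (dd i chi x * phi x) + f x * (chi x * dd i phi x)))=> [|x];last first.
 by rewrite dd_M;[ring|exact: tf_Sm hp|exact: cd_Sm hc].
rewrite ID// => e.
rewrite (eq_I (f := fun x=> (chi x * g x + dd i chi x * f x) * phi x) (g := fun x=> g x * (phi x * chi x) + f x * (dd i chi x * phi x)))=> [|x];last by ring.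
rewrite ID// opprD -e (eq_I (g := fun x=> f x * (chi x * dd i phi x)))=> [|x];last by ring.
by ring.
Qed.

Lemma W_ext i f f' g g' : (forall x, disk x -> f x = f' x) -> (forall x, disk x -> g x = g' x) ->
 W i f g -> W i f' g'.
move=> ef eg h phi hp.
have e (a b : R * R -> R) psi : cd psi -> (forall x, disk x -> a x = b x) ->
  \I_x (b x * psi x) = \I_x (a x * psi x).
 move=> hpsi ab;apply: eq_I=> x;rewrite -(msk_cd a x hpsi) -(msk_cd b x hpsi).
 by have [hx|hx] := pselect (disk x);[rewrite !mskT// ab|rewrite !mskF].
by rewrite (e f f')//;[rewrite (e g g')//;exact: h|exact: cd_dd].
Qed.

(** No factor is assumed bounded, so the product is only integrable and the rule is a distributional
    identity. The first-order error of [F G] splits into [dF dG + rF G + F rG]; in L^2 the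
    increments are [O(h)] and the remainders [o(h)], so each term is [o(h)] in L^1. *)
Lemma W_mul i f f' g g' : W2 i f f' -> W2 i g g' ->
 W i (fun x=> f x * g x) (fun x=> f' x * g x + f x * g' x).
move=> hf hg phi hp.
have [ch [hc c01 c1 c2 [c3 [d d0 c4]]]] := cd_cut hp.
have wf := W2_loc hc hf;have wg := W2_loc hc hg.
set F := (fun x=> _) in wf;set F' := (fun x=> _) in wf.
set G := (fun x=> _) in wg;set G' := (fun x=> _) in wg.
have [kF kF' _] := wf;have [kG kG' _] := wg.
have LFG := K2M kF kG.
have LFG' : L1 (fun x=> F' x * G x + F x * G' x) by apply: L1D;exact: K2M.
have [B B0 hB] := tf_bound (cd_tf hp).
have mp := Sm_mf (cd_Sm hp).
have main := @wd_of_diff R i (fun x=> F x * G x) (fun x=> F' x * G x + F x * G' x) phi LFG LFG' (cd_tf hp).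
have : \I_x (F x * G x * dd i phi x) = - \I_x ((F' x * G x + F x * G' x) * phi x).
 apply: main=> e e0.
 pose C := B * (nrm F' * nrm G' + nrm G + nrm F) + 1.
 have C1 : 0 < C by rewrite ltr_wpDl// mulr_ge0// !addr_ge0 ?mulr_ge0 ?nrm_ge0.
 have eC : 0 < e / C by rewrite divr_gt0.
 have [d1 d10 h1] := wd_diff wf eC;have [d2 d20 h2] := wd_diff wg eC.
 exists (Num.min (e / C) (Num.min d1 d2));first by rewrite !lt_min eC d10 d20.
 move=> h h0;rewrite !le_min=> /and3P[b0 b1 b2].
 have := h1 h;rewrite gtr0_norm// => /(_ b1) {}h1.
 have := h2 h;rewrite gtr0_norm// => /(_ b2) {}h2.
 have s1 := wd_shift_le h wf;have s2 := wd_shift_le h wg.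
 rewrite gtr0_norm// in s1;rewrite gtr0_norm// in s2.
 set dF := (fun x=> _) in s1;set dG := (fun x=> _) in s2.
 set rF := (fun x=> _) in h1;set rG := (fun x=> _) in h2.
 have kdF : K2 dF by apply: K2_B=> //;exact: K2_sh.
 have kdG : K2 dG by apply: K2_B=> //;exact: K2_sh.
 have krF : K2 rF by apply: K2_B=> //;exact: K2_Z.
 have krG : K2 rG by apply: K2_B=> //;exact: K2_Z.
 pose q x := dF x * dG x + rF x * G x + F x * rG x.
 have Lq : L1 q by apply: L1D;[apply: L1D|];exact: K2M.
 rewrite (eq_I (g := fun x=> q x * phi x))=> [|x];last by rewrite /q /dF /dG /rF /rG;ring.
 apply: le_trans (I_bM Lq mp hB) _.
 have l1 := L1_abs (K2M kdF kdG);have l2 := L1_abs (K2M krF kG);have l3 := L1_abs (K2M kF krG).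
 have q1 : \I_x (`|q x|) <= nrm dF * nrm dG + nrm rF * nrm G + nrm F * nrm rG.
  apply: (letr (\I_x (`|dF x * dG x| + `|rF x * G x| + `|F x * rG x|))).
   apply: I_le;[exact: L1_abs|by apply: L1D=> //;exact: L1D|move=> x].
   by apply: le_normD;rewrite lerD2r;exact: ler_normD.
  rewrite ID//;last exact: L1D.
  by rewrite ID//;apply: lerD;[apply: lerD|];apply: CSabs;exact: K2_L2.
 have nF := nrm_ge0 F;have nG := nrm_ge0 G;have nF' := nrm_ge0 F';have nG' := nrm_ge0 G'.
 have ndF := nrm_ge0 dF;have ndG := nrm_ge0 dG.
 have q2 : \I_x (`|q x|) <= h * (e / C) * (nrm F' * nrm G' + nrm G + nrm F).
  apply: le_trans q1 _.
  have a1 : nrm dF * nrm dG <= (h * nrm F') * (h * nrm G').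
   by apply: ler_pM.
  have a2 : (h * nrm F') * (h * nrm G') <= h * (e / C) * (nrm F' * nrm G').
   rewrite (_ : _ * (h * nrm G') = h * h * (nrm F' * nrm G'));last by ring.
   by rewrite ler_wpM2r ?mulr_ge0// ler_wpM2l// ltW.
  have a3 : nrm rF * nrm G <= h * (e / C) * nrm G by rewrite ler_wpM2r.
  have a4 : nrm F * nrm rG <= h * (e / C) * nrm F by rewrite mulrC ler_wpM2r.
  rewrite !mulrDr;apply: lerD a4;apply: lerD a3;exact: le_trans a1 a2.
 apply: le_trans (ler_wpM2l B0 q2) _.
 rewrite (_ : B * _ = h * (e / C) * (C - 1));last by rewrite /C;ring.
 have ee : h * (e / C) * C = h * e by rewrite -mulrA divfK// gt_eqF.
 rewrite mulrBr ee mulr1 lerBlDr lerDl;apply: mulr_ge0;exact: ltW.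
rewrite (eq_I (g := fun x=> f x * g x * dd i phi x))=> [|x].
 move=> ->;congr (- _);apply: eq_I=> x;rewrite /F /G /F' /G'.
 rewrite (_ : _ * phi x = (f' x * g x + f x * g' x) * (ch x * (ch x * phi x)) + 2 * f x * g x * ch x * (dd i ch x * phi x));last by ring.
 by rewrite !c1 c3 mulr0 addr0.
by rewrite /F /G -[in RHS](c2 i x) -[in RHS](c2 i x);ring.
Qed.

Lemma wd_diff_fin n i (U U' : 'I_n -> R * R -> R) (e : R) : (forall j, wd i (U j) (U' j)) ->
 0 < e -> exists2 d : R, 0 < d & forall j (h : R), `|h| <= d ->
  nrm (fun x=> U j (x + h *: dir i) - U j x - h * U' j x) <= `|h| * e.
move=> wU e0;elim: n U U' wU=> [|n IH] U U' wU;first by exists 1=> // -[].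
have [d1 d10 h1] := IH (fun j=> U (lift ord0 j)) (fun j=> U' (lift ord0 j)) (fun j=> wU (lift ord0 j)).
have [d2 d20 h2] := wd_diff (wU ord0) e0.
exists (Num.min d1 d2);first by rewrite lt_min d10.
move=> j h;rewrite le_min=> /andP[b1 b2].
by case: (unliftP ord0 j)=> [k ->|->];[exact: h1|exact: h2].
Qed.

(** The outer function enters only through its values [p] and the coefficients [a j] of a
    first-order expansion with a global quadratic remainder. It is applied to [1 / f] with [f]
    bounded below, and to the Euclidean norm away from the origin. *)
Lemma W_chain n i (u g a : 'I_n -> R * R -> R) p (A C : R) :
 (forall j, W2 i (u j) (g j)) -> D2 p ->
 (forall j, mf (a j)) -> (forall j x, `|a j x| <= A) -> 0 <= C ->
 (forall x y, `|p y - p x - \sum_(j < n) a j x * (u j y - u j x)| <=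
  C * \sum_(j < n) (u j y - u j x) ^+ 2) ->
 W i p (fun x=> \sum_(j < n) a j x * g j x).
move=> hu hp ma ha C0 hC phi hphi.
have [ch [hc c01 c1 c2 [c3 [d d0 c4]]]] := cd_cut hphi.
pose U j x := ch x * u j x;pose U' j x := ch x * g j x + dd i ch x * u j x.
have wU j : wd i (U j) (U' j) := W2_loc hc (hu j).
have kU j : K2 (U j) by case: (wU j).
have kU' j : K2 (U' j) by case: (wU j).
pose P x := ch x * p x;pose Gp x := ch x * \sum_(j < n) a j x * g j x.
have LP : L1 P by exact: K2_L1 (D2_cd hc hp).
have D2ag j : D2 (fun x=> a j x * g j x) by apply: (@D2_bM _ _ A)=> //;case: (hu j).
have LGp : L1 Gp by apply: K2_L1;apply: D2_cd=> //;exact: D2_sum.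
have tp := cd_tf hphi;have [B B0 hB] := tf_bound tp.
have A0 (j : 'I_n) : 0 <= A by exact: le_trans (normr_ge0 _) (ha j 0).
have mp := Sm_mf (cd_Sm hphi).
have : \I_x (P x * dd i phi x) = - \I_x (Gp x * phi x).
 apply: wd_of_diff=> // e e0.
 pose N := \sum_(j < n) nsq (U' j).
 have N0 : 0 <= N by apply: sumr_ge0=> j _;exact: nsq_ge0.
 pose Q := B * C * N + \sum_(j < n) A * nrm phi + 1.
 have S0 : 0 <= \sum_(j < n) A * nrm phi by apply: sumr_ge0=> j _;rewrite mulr_ge0 ?nrm_ge0// (A0 j).
 have Q1 : 0 < Q by rewrite ltr_wpDl// addr_ge0// !mulr_ge0.
 have eQ : 0 < e / Q by rewrite divr_gt0.
 have hd := wd_diff_fin wU eQ.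
 have [dd0 dd00 hdd] := hd.
 exists (Num.min (e / Q) (Num.min d dd0));first by rewrite !lt_min eQ d0 dd00.
 move=> h h0;rewrite !le_min=> /and3P[b0 b1 b2].
 have hn : `|h| = h by rewrite gtr0_norm.
 pose dU j x := U j (x + h *: dir i) - U j x.
 pose rU j x := dU j x - h * U' j x.
 have kdU j : K2 (dU j) by apply: K2_B=> //;exact: K2_sh.
 have krU j : K2 (rU j) by apply: K2_B=> //;exact: K2_Z.
 (* Where [phi] is nonzero the cutoff equals [1] both at [x] and at the shifted point, so the
    expansion of [p] can be read on the cut-off functions. *)
 have ptw x : `|(P (x + h *: dir i) - P x - h * Gp x) * phi x| <=
   (B * C) * \sum_(j < n) dU j x ^+ 2 + \sum_(j < n) A * `|rU j x * phi x|.
  have eu (k : R * R -> R) : (ch (x + h *: dir i) * k (x + h *: dir i)) * phi x = k (x + h *: dir i) * phi x.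
   by rewrite mulrAC c4 ?hn// mulrC.
  have eu0 (k : R * R -> R) : (ch x * k x) * phi x = k x * phi x by rewrite mulrAC c1 mulrC.
  have [px|px] := eqVneq (phi x) 0.
   rewrite px mulr0 normr0 addr_ge0//.
    by rewrite !mulr_ge0//;apply: sumr_ge0=> j _;exact: sqr_ge0.
   by apply: sumr_ge0=> j _;rewrite mulr_ge0// (A0 j).
  have cx : ch x = 1 by apply: (mulIf px);rewrite c1 mul1r.
  have cxh : ch (x + h *: dir i) = 1 by apply: (mulIf px);rewrite c4 ?hn// mul1r.
  have cd0 : dd i ch x = 0 by apply: (mulIf px);rewrite c3 mul0r.
  have edU j : dU j x = u j (x + h *: dir i) - u j x by rewrite /dU /U cx cxh !mul1r.
  have erU j : rU j x = dU j x - h * g j x by rewrite /rU /U' cx cd0 mul1r mul0r addr0.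
  have -> : P (x + h *: dir i) - P x - h * Gp x =
   (p (x + h *: dir i) - p x - \sum_(j < n) a j x * dU j x) + \sum_(j < n) a j x * rU j x.
   rewrite /P /Gp cx cxh !mul1r mulr_sumr.
   under [X in _ = _ + X]eq_bigr=> j _ do rewrite erU mulrBr.
   rewrite sumrB;under [X in _ = _ + (_ - X)]eq_bigr=> j _ do rewrite mulrCA.
   by ring.
  rewrite mulrDl;apply: le_normD;apply: lerD.
   rewrite normrM mulrC -mulrA;apply: ler_pM=> //.
   have := hC x (x + h *: dir i).
   rewrite (eq_bigr (fun j=> a j x * dU j x))=> [|j _];last by rewrite edU.
   rewrite [X in _ <= C * X -> _](eq_bigr (fun j=> dU j x ^+ 2))=> [|j _];last by rewrite edU.
   by [].
  rewrite mulr_suml;apply: le_trans (ler_norm_sum _ _ _) _;apply: ler_sum=> j _.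
  by rewrite -mulrA normrM ler_wpM2r.
 have LdU j : L1 (fun x=> dU j x ^+ 2) by case: (K2_L2 (kdU j)).
 have LrU j : L1 (fun x=> `|rU j x * phi x|) by apply: L1_abs;apply: K2M=> //;exact: tf_K2.
 have LS1 : L1 (fun x=> \sum_(j < n) dU j x ^+ 2) by exact: L1_sum.
 have LS2 : L1 (fun x=> \sum_(j < n) A * `|rU j x * phi x|) by apply: L1_sum=> j;exact: L1Z.
 apply: (letr (\I_x ((B * C) * \sum_(j < n) dU j x ^+ 2 + \sum_(j < n) A * `|rU j x * phi x|))).
  apply: I_absle=> //.
   apply: mfM=> //;apply: mfB;last by apply: mfZ;exact: L1_mf.
   by apply: mfB;[apply: mf_sh|];exact: L1_mf.
  by apply: L1D=> //;exact: L1Z.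
 rewrite ID//;last exact: L1Z.
 rewrite IZ// I_sum// I_sum;last by move=> j;exact: L1Z.
 have t1 : \sum_(j < n) \I_x (dU j x ^+ 2) <= h * (e / Q) * N.
  rewrite mulr_sumr;apply: ler_sum=> j _.
  have := wd_shift_le h (wU j);rewrite hn -/(dU j)=> s1.
  rewrite -/(nsq (dU j)) -!nrm_sq.
  have : nrm (dU j) ^+ 2 <= (h * nrm (U' j)) ^+ 2 
   by rewrite lerXn2r ?nnegrE ?nrm_ge0//;apply: mulr_ge0;[exact: ltW|exact: nrm_ge0].
  move=> /le_trans;apply;rewrite exprMn expr2 ler_wpM2r ?sqr_ge0//.
  by rewrite ler_wpM2l// ltW.
 have t2 : \sum_(j < n) \I_x (A * `|rU j x * phi x|) <= h * (e / Q) * \sum_(j < n) A * nrm phi.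
  rewrite mulr_sumr;apply: ler_sum=> j _;rewrite IZ// mulrCA ler_wpM2l ?(A0 j)//.
  apply: le_trans (CSabs (K2_L2 (krU j)) (tf_L2 tp)) _;rewrite ler_wpM2r ?nrm_ge0//.
  by have := hdd j h;rewrite hn;apply.
 have BC0 : 0 <= B * C by exact: mulr_ge0.
 apply: le_trans (lerD (ler_wpM2l BC0 t1) t2) _.
 rewrite (_ : _ + _ = h * (e / Q) * (Q - 1));last by rewrite /Q;ring.
 have ee : h * (e / Q) * Q = h * e by rewrite -mulrA divfK// gt_eqF.
 rewrite mulrBr ee mulr1 lerBlDr lerDl;apply: mulr_ge0;exact: ltW.
rewrite (eq_I (g := fun x=> p x * dd i phi x))=> [|x];last by rewrite /P mulrAC c2 mulrC.
by move=> ->;congr (- _);apply: eq_I=> x;rewrite /Gp mulrAC c1 mulrC.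
Qed.

End Disk.

(** * From the definitions of the statement to the working ones: [weak_partial], [Dirichlet],
    [H10] *)

Section Bridge.
Context {R : realType}.
Implicit Types (f g phi psi k : R * R -> R) (x v c : R * R) (i : 'I_2).

Lemma tf_refl k x : tf k -> tf (fun y=> k (x - y)).
move=> hk;split.
 rewrite (_ : (fun y=> _) = (fun y=> k (-1 *: y + x)));first by apply: Sm_aff;exact: tf_Sm hk.
 by apply/funext=> y;rewrite scaleN1r addrC.
have [_ [r hr]] := hk;exists (`|r| + `|x.1| + `|x.2|)=> y hy;apply: hr=> h;apply: hy.
move: h;rewrite !box0E=> -[h1 h2].
have := ler_norm r;have := normr_ge0 x.1;have := normr_ge0 x.2=> *.
split.
 rewrite (_ : y.1 = x.1 - (x - y).1);last by rewrite /=;ring.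
 by apply: le_normB;move: h1;rewrite /=;lra.
rewrite (_ : y.2 = x.2 - (x - y).2);last by rewrite /=;ring.
by apply: le_normB;move: h2;rewrite /=;lra.
Qed.
Lemma dd_refl k i x y : tf k -> dd i (fun y=> k (x - y)) y = - dd i k (x - y).
move=> hk;rewrite (_ : (fun y=> _) = (fun y=> k (-1 *: y + x))).
 by rewrite dd_aff ?scaleN1r 1?addrC ?mulN1r//;exact: tf_Sm hk.
by apply/funext=> z;rewrite scaleN1r addrC.
Qed.
Lemma wd_dd_cv i f g k x : wd i f g -> tf k -> dd i (cv f k) x = cv g k x.
move=> [hf hg hw] hk;rewrite (dd_cv _ _ (K2_L1 hf) hk).
rewrite (cv_tfE _ (K2_L1 hf) (tf_dd i hk)) (cv_tfE _ (K2_L1 hg) hk).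
have := hw _ (tf_refl x hk);rewrite (eq_I (g := fun y=> - (f y * dd i k (x - y))))=> [|y];last first.
 by rewrite dd_refl// mulrN.
rewrite (IN (L1_cv_tf _ (K2_L1 hf) (tf_dd i hk)));first by move/oppr_inj.
Qed.

Lemma K2_dual0 f : K2 f -> (forall phi, tf phi -> \I_x (f x * phi x) = 0) -> nrm f = 0.
move=> hf h0;apply/eqP;rewrite -sqrf_eq0 nrm_sq eq_le nsq_ge0 andbT.
apply: le_eps=> e e0;rewrite add0r.
have C0 : 0 < nrm f + 1 by rewrite ltr_wpDl ?nrm_ge0.
have [d d0 hd] := moll_L2 (K2_L1 hf) (K2_L2 hf) (divr_gt0 e0 C0).
have [k hk] := moll_exists d0;have hn := hd k d hk (lexx _).
have hc : tf (cv f k) by apply: K2_cv=> //;case: hk.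
have kc := tf_K2 hc.
have -> : nsq f = - \I_x (f x * (cv f k x - f x)).
 rewrite (eq_I (g := fun x=> f x * cv f k x - f x ^+ 2))=> [|x];last by ring.
 by rewrite (IB (K2M hf kc) (K2_L2 hf).2) h0// sub0r opprK.
apply: le_trans (ler_norm _) _;rewrite normrN.
apply: le_trans (CSn (K2_L2 hf) (K2_L2 (K2_B kc hf))) _.
have := ler_wpM2l (nrm_ge0 f) hn=> /le_trans;apply.
rewrite mulrA ler_pdivrMr// mulrC;apply: ler_wpM2l;first exact: ltW.
by rewrite lerDl.
Qed.

Lemma disk_chi x : disk x -> exists n : nat, E2 x <= 1 - n.+2%:R^-1 :> R.
move=> /diskE h;have h' : 0 < 1 - E2 x by rewrite subr_gt0.
exists (Num.truncn ((1 - E2 x)^-1)).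
rewrite lerBrDr -lerBrDl invf_ple ?posrE//.
by apply: ltW;apply: lt_trans (truncnS_gt _) _;rewrite ltr_nat.
Qed.

(** Multiplied by a cutoff, the difference is orthogonal to every test function of the plane, hence
    null; countably many cutoffs exhaust the disk. *)
Lemma W_uniq i f g g' : D2 g -> D2 g' -> W i f g -> W i f g' ->
 {ae leb2, forall x, disk x -> g x = g' x}.
move=> hg hg' h h'.
pose r (n : nat) : R := 1 - n.+2%:R^-1;pose s (n : nat) : R := 1 - n.+3%:R^-1.
have rs n : r n < s n by rewrite /r /s ltrD2l ltrN2 ltf_pV2 ?posrE// ltr_nat.
have s1 n : s n < 1 by rewrite /s gtrBl invr_gt0.
have hd : D2 (fun x=> g x - g' x) by exact: D2_B.
have key n : {ae leb2, forall x, chi (r n) (s n) x * (g x - g' x) = 0}.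
 have hc := chi_cd (rs n) (s1 n).
 have hk := D2_cd hc hd.
 apply: (nrm_eq0 (K2_L2 hk));apply: K2_dual0=> // phi hp.
 have hpc : cd (fun x=> phi x * chi (r n) (s n) x) by apply: cd_M=> //;exact: tf_Sm hp.
 rewrite (eq_I (g := fun x=> g x * (phi x * chi (r n) (s n) x) - g' x * (phi x * chi (r n) (s n) x)))=> [|x];last by ring.
 rewrite IB;[|exact: D2_L1|exact: D2_L1].
 by rewrite -[X in X - _]opprK -h// -[X in _ - X]opprK -h'// subrr.
have : {ae leb2, forall x n, chi (r n) (s n) x * (g x - g' x) = 0}.
 by apply: ae_foralln=> n;exact: key.
apply: filterS=> x hx dx;have [n hn] := disk_chi dx.
by have := hx n;rewrite chi1// mul1r=> /eqP;rewrite subr_eq0=> /eqP.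
Qed.

Transparent I L1 mf.
Lemma L2_diskP f : L2_disk f <-> L2 (msk f).
have e2 : (fun x=> msk f x ^+ 2) = (fun x=> f x ^+ 2) \_ disk.
 apply/funext=> x;rewrite /msk /patch indicE;case: ifP=> _;first by rewrite mul1r.
 by rewrite mul0r expr0n.
have iE : leb2.-integrable disk (fun x=> (f x ^+ 2)%:E) <-> L1 (fun x=> msk f x ^+ 2).
 have H := @integrable_mkcond _ (measurableTypeR R * measurableTypeR R)%type R (@leb2 R) disk
  (fun x=> (f x ^+ 2)%:E) mdisk.
 by rewrite /L1 e2 (_ : EFin \o _ = (fun x=> (f x ^+ 2)%:E) \_ disk)// -restrict_EFin.
have mE : measurable_fun disk f <-> mf (msk f).
 rewrite -msk_restrict /mf;exact: (measurable_restrictT _ mdisk).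
by rewrite /L2_disk /L2 iE mE.
Qed.

Lemma int_disk f : \int[leb2]_(x in disk) f x = I (msk f).
by rewrite Rintegral_mkcond msk_restrict. Qed.
Opaque I L1 mf.

Lemma weakP i f g : is_weak_partial i f g <-> W i (msk f) (msk g).
have e (a b : R * R -> R) : \int[leb2]_(x in disk) (a x * b x) = \I_x (msk a x * b x).
 by rewrite int_disk;apply: eq_I=> x;rewrite /msk mulrA.
by split=> h phi /cdP hp;have := h phi hp;rewrite !e.
Qed.

Lemma msk_msk f x : msk (msk f) x = msk f x.
by have [h|h] := pselect (disk x);[rewrite mskT|rewrite !mskF]. Qed.
Lemma L2_msk_D2 f : L2 (msk f) -> D2 (msk f).
by move=> h;split;[case: h|rewrite (_ : msk (msk f) = msk f)//;apply/funext=> x;exact: msk_msk]. Qed.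

(** [weak_partial] is a choice by [xget]: one admissible [g] guarantees that the chosen function is
    a weak derivative too, and uniqueness identifies the two almost everywhere. *)
Lemma weak_partial_ae i f g : L2_disk g -> is_weak_partial i f g ->
 [/\ L2_disk (weak_partial i f), is_weak_partial i f (weak_partial i f) &
  {ae leb2, forall x, disk x -> weak_partial i f x = g x}].
move=> hg hw;have [h1 h2] : L2_disk (weak_partial i f) /\ is_weak_partial i f (weak_partial i f).
 by rewrite /weak_partial;case: xgetP=> [g' -> //|/(_ g)[]].
split=> //;have := @W_uniq i (msk f) (msk (weak_partial i f)) (msk g).
move=> /(_ (L2_msk_D2 ((L2_diskP _).1 h1)) (L2_msk_D2 ((L2_diskP _).1 hg)) ((weakP _ _ _).1 h2) ((weakP _ _ _).1 hw)).
by apply: filterS=> x h dx;have := h dx;rewrite !mskT.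
Qed.

Lemma W_ae i f f' g : mf f -> mf f' -> {ae leb2, forall x, disk x -> f x = f' x} ->
 W i f g -> W i f' g.
move=> m1 m2 ff h phi hp;rewrite -h//.
have md := Sm_mf (cd_Sm (cd_dd i hp)).
apply: I_ae;[exact: mfM|exact: mfM|].
apply: filterS ff=> x hx;have [dx|dx] := pselect (disk x);first by rewrite hx.
by rewrite (cd_off (cd_dd i hp) dx) !mulr0.
Qed.

Lemma L2_msk_D2' f : K2 f -> D2 f.
move=> [[m h] _];split=> //;apply: L2_bM (@ind_abs R disk) _=> //.
exact: mf_ind mdisk.
Qed.

(* Criterion for the weak partials of the original, possibly not globally measurable, functions. *)
Lemma weak_partial_W2 i f F G : mf (msk f) -> {ae leb2, forall x, disk x -> f x = F x} ->
 W2 i F G -> [/\ L2_disk f, L2_disk G, is_weak_partial i f G &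
  {ae leb2, forall x, disk x -> weak_partial i f x = G x}].
move=> mfm fF [hF hG hW].
have aeF : {ae leb2, forall x, msk f x = msk F x}.
 apply: filterS fF=> x hx;have [dx|dx] := pselect (disk x);first by rewrite !mskT// hx.
 by rewrite !mskF.
have hf : L2_disk f by apply/L2_diskP;apply: L2_ae aeF=> //;case: hF.
have hG' : L2_disk G by apply/L2_diskP;case: hG.
have hw : is_weak_partial i f G.
 apply/weakP;apply: (@W_ae i F).
 - by case: hF.
 - exact: mfm.
 - by apply: filterS fF=> x hx dx;rewrite mskT// hx.
 - by apply: W_ext hW=> x dx;rewrite ?mskT.
by have [_ _ h] := weak_partial_ae hG' hw;split.
Qed.

Lemma ae_all_fin (T : finType) (P : T -> R * R -> Prop) : (forall t, {ae leb2, forall x, P t x}) ->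
 {ae leb2, forall x, forall t, P t x}.
move=> hP.
have : {ae leb2, forall x (n : nat), if unpickle n is Some t then P t x else True}.
 apply: ae_foralln=> n;case: (unpickle n)=> [t|];first exact: hP.
 by apply: aeW.
by apply: filterS=> x h t;have := h (pickle t);rewrite pickleK.
Qed.

(** Lets the energy of a competitor be computed from explicit representatives of its components and
    of their weak derivatives. *)
Lemma Dirichlet_E N (w : R * R -> 'rV[R]_N) (F : 'I_N -> R * R -> R) (G : 'I_N -> 'I_2 -> R * R -> R) :
 (forall j, mf (msk (component w j))) ->
 {ae leb2, forall x, disk x -> forall j, component w j x = F j x} ->
 (forall j i, W2 i (F j) (G j i)) ->
 H1v w /\ Dirichlet w = I (msk (fun x=> \sum_(j < N) \sum_(i < 2) G j i x ^+ 2)).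
move=> mw wF hW.
have wF' j : {ae leb2, forall x, disk x -> component w j x = F j x}.
 by apply: filterS wF=> x h dx;exact: h.
have h j i := weak_partial_W2 (mw j) (wF' j) (hW j i).
split.
 move=> j;split;first by have [] := h j ord0.
 by move=> i;exists (G j i);have [] := h j i.
rewrite /Dirichlet int_disk.
have mG j i : mf (G j i) by case: (hW j i)=> _ [].
have mwp j i : mf (msk (weak_partial i (component w j))).
 have [a1 a2 a3 _] := h j i;have [b1 _ _] := weak_partial_ae a2 a3.
 by have /L2_diskP[] := b1.
apply: I_ae.
- rewrite (_ : msk _ = fun x=> \sum_(j < N) \sum_(i < 2) msk (weak_partial i (component w j)) x ^+ 2).
  by apply: mf_sum=> j;apply: mf_sum=> i;exact: mfX.
 apply/funext=> x;have [dx|dx] := pselect (disk x).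
  by rewrite mskT//;apply: eq_bigr=> j _;apply: eq_bigr=> i _;rewrite mskT.
 rewrite mskF// big1// => j _;apply: big1=> i _;by rewrite mskF// expr0n.
- by apply: mf_msk;apply: mf_sum=> j;apply: mf_sum=> i;exact: mfX.
have : {ae leb2, forall x (j : 'I_N) (i : 'I_2), disk x -> weak_partial i (component w j) x = G j i x}.
 by apply: ae_all_fin=> j;apply: ae_all_fin=> i;have [] := h j i.
apply: filterS=> x hx;have [dx|dx] := pselect (disk x);last by rewrite !mskF.
rewrite !mskT//;apply: eq_bigr=> j _;apply: eq_bigr=> i _;by rewrite hx.
Qed.

Lemma cd_moll f (r : R) : K2 f -> r < 1 -> (forall x, r < E2 x -> f x = 0) -> exists2 d, 0 < d &
 forall k e, moll e k -> e <= d -> cd (cv f k).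
move=> Kf r1 hr;have [s [_ [rs s1 _ _]]] := mid2 r1;have [d d0 hd] := geo2 rs s1.
exists d=> // k e hk ed;have [tk _ ks _] := hk;split;first exact: tf_Sm (K2_cv Kf tk).
exists s=> // x hx;rewrite /cv -[RHS](@I0 R);apply: eq_I=> y.
have [hy|hy] := pselect (box 0 e y);last by rewrite ks// mulr0.
rewrite hr ?mul0r// ltNge;apply/negP=> hxy;move: hx;rewrite ltNge=> /negP;apply.
by apply: hd hxy _;have := box_add (x - y) (box_le ed hy);rewrite subrK.
Qed.

(** A function supported away from the circle is weakly differentiable in the whole plane, and its
    mollifications are test functions of the disk that converge together with their gradients. This
    makes the radial variations admissible. *)
Lemma H10_of_W2 f (Df : 'I_2 -> R * R -> R) (r : R) : r < 1 -> (forall x, r < E2 x -> f x = 0) ->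
 (forall i, W2 i f (Df i)) -> H10 f.
move=> r1 hr hW;have D2f : D2 f by case: (hW ord0).
have D2D i : D2 (Df i) by case: (hW i).
split.
 have fF : {ae leb2, forall x, disk x -> f x = f x} by apply: aeW.
 have mm : mf (msk f) by apply: mf_msk;case: D2f.
 split;first by have [] := weak_partial_W2 mm fF (hW ord0).
 by move=> i;exists (Df i);have [] := weak_partial_W2 mm fF (hW i).
have [s [t [rs s1 st t1]]] := mid2 r1.
have hc := chi_cd st t1;set ch := chi s t in hc.
have wf i : wd i f (fun x=> ch x * Df i x).
 have := W2_loc hc (hW i).
 have e1 : (fun x=> ch x * f x) = f.
  apply/funext=> x;have [h|h] := leP (E2 x) r;last by rewrite hr// mulr0.
  by rewrite /ch chi1// ?mul1r//;lra.
 have e2 : (fun x=> ch x * Df i x + dd i ch x * f x) = (fun x=> ch x * Df i x).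
  apply/funext=> x;have [h|h] := leP (E2 x) r;last by rewrite hr// mulr0 addr0.
  by rewrite (dd_chi1 i st (le_lt_trans h rs)) mul0r addr0.
 by rewrite e1 e2.
have Kf : K2 f by case: (wf ord0).
have KD i : K2 (fun x=> ch x * Df i x) by case: (wf i).
have D2cD i : D2 (fun x=> ch x * Df i x) by exact: (L2_msk_D2' (KD i)).
have cDE i : {ae leb2, forall x, disk x -> ch x * Df i x = Df i x}.
 apply: (@W_uniq i f)=> //;last by case: (hW i).
 by move=> phi hp;case: (wf i)=> _ _;apply;exact: cd_tf.
have [d4 d40 hcd] := cd_moll Kf r1 hr.
have step (e : R) : 0 < e -> exists2 phi, cd phi & H1_norm_sq (phi \- f) <= e.
 move=> e0;pose e' := Num.sqrt (e / 3).
 have e3 : 0 < e / 3 by rewrite divr_gt0.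
 have e'0 : 0 < e' by rewrite sqrtr_gt0.
 have e'2 : e' ^+ 2 = e / 3 by rewrite sqr_sqrtr// ltW.
 have [d1 d10 h1] := moll_L2 (K2_L1 Kf) (K2_L2 Kf) e'0.
 have [d2 d20 h2] := moll_L2 (K2_L1 (KD ord0)) (K2_L2 (KD ord0)) e'0.
 have [d3 d30 h3] := moll_L2 (K2_L1 (KD ord_max)) (K2_L2 (KD ord_max)) e'0.
 pose d := Num.min (Num.min d1 d2) (Num.min d3 d4).
 have d0 : 0 < d by rewrite !lt_min d10 d20 d30 d40.
 have [k hk] := moll_exists d0.
 have [b1 b2] : d <= d1 /\ d <= d2 by split;rewrite /d !ge_min lexx ?orbT.
 have [b3 b4] : d <= d3 /\ d <= d4 by split;rewrite /d !ge_min lexx ?orbT.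
 have [tk _ ks _] := hk.
 have hp : cd (cv f k) := hcd _ _ hk b4.
 exists (cv f k)=> //.
 pose G i x := dd i (cv f k) x - ch x * Df i x.
 have W2p i : W2 i (fun x=> cv f k x - f x) (G i).
  have D2cd phi : cd phi -> D2 phi by move=> hphi;exact: (L2_msk_D2' (tf_K2 (cd_tf hphi))).
  split;[by apply: D2_B=> //;exact: D2cd|by apply: D2_B=> //;exact: D2cd (cd_dd i hp)|].
  move=> phi hphi;have tp := cd_tf hphi.
  rewrite (eq_I (g := fun x=> cv f k x * dd i phi x - f x * dd i phi x))=> [|x];last by ring.
  have l1 := tf_L1 (tf_M (cd_Sm hp) (tf_dd i tp));have l2 := K2M Kf (tf_K2 (tf_dd i tp)).
  rewrite IB// IBP//;last exact: cd_Sm.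
  have [_ _ ->//] := wf i.
  rewrite (eq_I (f := fun x=> G i x * phi x) (g := fun x=> dd i (cv f k) x * phi x - ch x * Df i x * phi x))=> [|x];last by rewrite /G;ring.
  rewrite IB;[by ring|exact: tf_L1 (tf_M (Sm_dd i (cd_Sm hp)) tp)|exact: K2M (KD i) (tf_K2 tp)].
 have D2G i : D2 (G i) by case: (W2p i).
 have mm : mf (msk (cv f k \- f)).
  by apply: mf_msk;case: (W2p ord0)=> -[].
 have fF : {ae leb2, forall x, disk x -> (cv f k \- f) x = cv f k x - f x} by apply: aeW.
 have hw i := weak_partial_W2 mm fF (W2p i).
 rewrite /H1_norm_sq int_disk.
 have -> : I (msk (fun x=> (cv f k \- f) x ^+ 2 + grad_sq (cv f k \- f) x)) =
   \I_x (msk (fun x=> cv f k x - f x) x ^+ 2 + (msk (G ord0) x ^+ 2 + msk (G ord_max) x ^+ 2)).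
  have mwp i : mf (msk (weak_partial i (cv f k \- f))).
   have [a1 a2 a3 _] := hw i;have [b1' _ _] := weak_partial_ae a2 a3.
   by have /L2_diskP[] := b1'.
  have mcf : mf (msk (fun x=> cv f k x - f x)) by apply: mf_msk;case: (W2p ord0)=> -[].
  apply: I_ae.
  - rewrite (_ : msk _ = fun x=> msk (cv f k \- f) x ^+ 2 + \sum_(i < 2) msk (weak_partial i (cv f k \- f)) x ^+ 2).
    by apply: mfD;[exact: mfX|apply: mf_sum=> i;exact: mfX].
   apply/funext=> x;have [dx|dx] := pselect (disk x).
    by rewrite !mskT//;congr (_ + _);apply: eq_bigr=> i _;rewrite mskT.
   rewrite !mskF// expr0n add0r big1// => i _;by rewrite mskF// expr0n.
  - apply: mfD;first exact: mfX.
   by apply: mfD;apply: mfX;apply: mf_msk;[case: (D2G ord0)|case: (D2G ord_max)].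
  have : {ae leb2, forall x (i : 'I_2), disk x -> weak_partial i (cv f k \- f) x = G i x}.
   by apply: ae_all_fin=> i;have [] := hw i.
  apply: filterS=> x hx;have [dx|dx] := pselect (disk x).
   have -> : msk (fun x=> (cv f k \- f) x ^+ 2 + grad_sq (cv f k \- f) x) x = (cv f k x - f x) ^+ 2 + grad_sq (cv f k \- f) x.
    exact: mskT.
   have -> : grad_sq (cv f k \- f) x = \sum_(i < 2) G i x ^+ 2.
    by apply: eq_bigr=> i _;rewrite hx.
   have -> : \sum_(i < 2) G i x ^+ 2 = G ord0 x ^+ 2 + G ord_max x ^+ 2.
    rewrite big_ord_recl big_ord_recl big_ord0 addr0.
    by rewrite (_ : lift _ _ = ord_max)//;exact: val_inj.
   by rewrite (mskT _ dx) (mskT _ dx) (mskT _ dx).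
  rewrite (mskF _ dx) (mskF _ dx) (mskF _ dx) (mskF _ dx).
  by rewrite expr0n !addr0.
 have nb (u : R * R -> R) : L2 u -> nrm u <= e' -> \I_x (msk u x ^+ 2) <= e / 3.
  move=> hu hn;rewrite -e'2;apply: (letr (nrm u ^+ 2));last by rewrite ler_sqr ?nnegrE ?nrm_ge0 ?(ltW e'0).
  rewrite nrm_sq;apply: I_le.
  - by case: (L2_bM (mf_ind mdisk) (@ind_abs R disk) hu).
  - by case: hu.
  - move=> x;have [dx|dx] := pselect (disk x);first by rewrite mskT.
   by rewrite mskF// expr0n sqr_ge0.
 have Lm (u : R * R -> R) : D2 u -> L1 (fun x=> msk u x ^+ 2) by move=> [_ []].
 have D2d : D2 (fun x=> cv f k x - f x) by case: (W2p ord0).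
 rewrite ID;[|exact: Lm|by apply: L1D;exact: Lm].
 rewrite ID;[|exact: Lm|exact: Lm].
 have -> : e = e / 3 + (e / 3 + e / 3) by field.
 apply: lerD;last apply: lerD;apply: nb.
 - exact: K2_L2 (K2_B (tf_K2 (cd_tf hp)) Kf).
 - exact: h1 hk b1.
 - exact: K2_L2 (K2_B (tf_K2 (tf_dd _ (cd_tf hp))) (KD _)).
 - have -> : G ord0 = fun x=> cv (fun x=> ch x * Df ord0 x) k x - ch x * Df ord0 x.
   by apply/funext=> x;rewrite /G (wd_dd_cv _ (wf ord0)).
  exact: h2 hk b2.
 - exact: K2_L2 (K2_B (tf_K2 (tf_dd _ (cd_tf hp))) (KD _)).
 - have -> : G ord_max = fun x=> cv (fun x=> ch x * Df ord_max x) k x - ch x * Df ord_max x.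
   by apply/funext=> x;rewrite /G (wd_dd_cv _ (wf ord_max)).
  exact: h3 hk b3.
have /choice[ph hph] : forall n : nat, exists phi, cd phi /\ H1_norm_sq (phi \- f) <= n.+1%:R^-1.
 move=> n;have [phi h1 h2] := step n.+1%:R^-1 ltac:(by rewrite invr_gt0).
 by exists phi.
exists ph;first by move=> n;apply/cdP;case: (hph n).
apply: (@squeeze_cvgr _ _ _ _ (fun=> 0) (fun n=> n.+1%:R^-1));last first.
- exact: cvg_harmonic.
- exact: cvg_cst.
apply: nearW=> n;case: (hph n)=> _ ->;rewrite andbT.
apply: Rintegral_ge0=> x _;rewrite addr_ge0 ?sqr_ge0//.
by apply: sumr_ge0=> i _;exact: sqr_ge0.
Qed.

End Bridge.

(** * Dyadic averages: one step of the telescoping and almost orthogonality *)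

Section Trilinear.
Context {R : realType}.
Implicit Types (f g h phi psi k b F : R * R -> R) (x v w c : R * R) (i : 'I_2) (s : R).

Lemma sum_CS J (p q : 'I_J -> R) (P Q : R) : 0 <= P -> 0 <= Q ->
 \sum_j p j ^+ 2 <= P ^+ 2 -> \sum_j q j ^+ 2 <= Q ^+ 2 -> \sum_j p j * q j <= P * Q.
move=> P0 Q0 hp hq.
have key : (\sum_j p j * q j) ^+ 2 <= (\sum_j p j ^+ 2) * (\sum_j q j ^+ 2).
 elim: J p q {hp hq} => [|J IH] p q;first by rewrite !big_ord0 mulr0 expr0n.
 rewrite !big_ord_recl;have {IH} := IH (fun j=> p (lift ord0 j)) (fun j=> q (lift ord0 j)).
 move: (p ord0) (q ord0)=> a b.
 set S := \sum_j _;set X := \sum_j _;set Y := \sum_j _=> h.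
 have X0 : 0 <= X by apply: sumr_ge0=> j _;exact: sqr_ge0.
 have Y0 : 0 <= Y by apply: sumr_ge0=> j _;exact: sqr_ge0.
 suff : 2 * (a * b * S) <= a ^+ 2 * Y + b ^+ 2 * X by nra.
 have h1 : 0 <= a ^+ 2 * Y by rewrite mulr_ge0 ?sqr_ge0.
 have h2 : 0 <= b ^+ 2 * X by rewrite mulr_ge0 ?sqr_ge0.
 have h3 : (2 * (a * b * S)) ^+ 2 <= (a ^+ 2 * Y + b ^+ 2 * X) ^+ 2.
  have -> : (2 * (a * b * S)) ^+ 2 = 4 * ((a * b) ^+ 2 * S ^+ 2) by ring.
  have := ler_wpM2l (sqr_ge0 (a * b)) h;have := sqr_ge0 (a ^+ 2 * Y - b ^+ 2 * X).
  nra.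
 by apply: le_trans (ler_norm _) _;rewrite -ler_sqr ?nnegrE ?addr_ge0// real_normK ?num_real.
apply: le_trans (ler_norm _) _;rewrite -ler_sqr ?nnegrE ?mulr_ge0// real_normK ?num_real//.
apply: le_trans key _;rewrite exprMn;apply: ler_pM=> //;apply: sumr_ge0=> j _;exact: sqr_ge0.
Qed.

Lemma I_tri f g h (q : R) : L2 f -> L2 g -> mf h -> (forall x, `|h x| <= q) ->
 `|\I_x (f x * g x * h x)| <= q * (nrm f * nrm g).
move=> hf hg mh hq;have q0 : 0 <= q := le_trans (normr_ge0 _) (hq 0).
apply: le_trans (I_absle (g := fun x=> q * `|f x * g x|) _ _ _) _.
- by apply: mfM=> //;apply: mfM;[case: hf|case: hg].
- by apply: L1Z;apply: L1_abs;exact: L2M.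
- by move=> x;rewrite normrM mulrC ler_wpM2r.
by rewrite IZ;[rewrite ler_wpM2l// CSabs|apply: L1_abs;exact: L2M].
Qed.

Lemma L1_tri f g h (q : R) : L2 f -> L2 g -> mf h -> (forall x, `|h x| <= q) ->
 L1 (fun x=> f x * g x * h x).
move=> hf hg mh hq.
have : L1 (fun x=> h x * (f x * g x)) by apply: (L1_bM mh hq);exact: L2M.
by congr L1;apply/funext=> x;rewrite mulrC.
Qed.

(** The mean and the difference of [f] and its translate, that is, the two Haar components in the
    direction [v]. *)
Definition Mv v f x := (f x + f (x - v)) / 2.
Definition dv v f x := f x - f (x - v).

(** The parallelogram law. Telescoped over the scales it bounds the sum of all squared differences
    by the squared norm of [f], see [yy_sum]. *)
Lemma nsq_Mv v f : L2 f -> nsq f = nsq (Mv v f) + nsq (dv v f) / 4.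
move=> hf;have hs := L2_sub v hf.
have e1 : nsq (fun x=> f (x - v)) = nsq f by rewrite -!nrm_sq nrm_sub.
have hM : L2 (Mv v f).
 by have := L2Z 2^-1 (L2D hf hs);congr L2;apply/funext=> x;rewrite /Mv mulrC.
have hd : L2 (dv v f) by exact: L2B.
have [_ l1] := hM;have [_ l2] := hd;have [_ l3] := hf;have [_ l4] := hs.
have -> : nsq (dv v f) / 4 = \I_x (4^-1 * dv v f x ^+ 2) by rewrite (IZ _ l2) mulrC.
rewrite [nsq (Mv v f)]/nsq -(ID l1 (L1Z _ l2)).
rewrite (eq_I (g := fun x=> 2^-1 * (f x ^+ 2 + f (x - v) ^+ 2)))=> [|x];last first.
 by rewrite /Mv /dv;field.
rewrite (IZ _ (L1D l3 l4)) (ID l3 l4).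
by rewrite -/(nsq f) -/(nsq (fun x=> f (x - v))) e1;lra.
Qed.

Lemma tf_B f g : tf f -> tf g -> tf (fun x=> f x - g x).
move=> hf hg;rewrite (_ : (fun _=> _) = fun x=> f x + (-1) * g x).
 by apply: tf_D=> //;apply: tf_M=> //;exact: Sm_c.
by apply/funext=> x;rewrite mulN1r.
Qed.
Lemma tf_Z (a : R) f : tf f -> tf (fun x=> a * f x).
by apply: tf_M;exact: Sm_c. Qed.
Lemma tf_Mv v f : tf f -> tf (Mv v f).
move=> hf;rewrite (_ : Mv v f = fun x=> 2^-1 * (f x + f (x - v))).
 by apply: tf_Z;apply: tf_D=> //;exact: tf_shN.
by apply/funext=> x;rewrite /Mv mulrC.
Qed.
Lemma tf_dv v f : tf f -> tf (dv v f).
by move=> hf;apply: tf_B=> //;exact: tf_shN. Qed.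
Lemma dd_Mv v f i : tf f -> dd i (Mv v f) = Mv v (dd i f).
move=> hf;apply/funext=> x.
have S1 := tf_Sm hf;have S2 := tf_Sm (tf_shN v hf).
rewrite (_ : Mv v f = fun x=> 2^-1 * (f x + f (x - v))).
 by rewrite dd_Z;[rewrite dd_D// dd_shN// /Mv mulrC|exact: Sm_D].
by apply/funext=> y;rewrite /Mv mulrC.
Qed.
Lemma dd_dv v f i : tf f -> dd i (dv v f) = dv v (dd i f).
move=> hf;apply/funext=> x.
by rewrite dd_B ?dd_shN//;[exact: tf_Sm|exact: tf_Sm|exact: tf_Sm (tf_shN v hf)].
Qed.
Lemma nrm_Mv v f : L2 f -> nrm (Mv v f) <= nrm f.
by move=> hf;rewrite /nrm ler_wsqrtr// (nsq_Mv v hf) lerDl divr_ge0// nsq_ge0. Qed.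
Lemma Mv_bound v f (M : R) : (forall x, `|f x| <= M) -> forall x, `|Mv v f x| <= M.
move=> h x;rewrite /Mv normrM [ `|2^-1| ]ger0_norm// ler_pdivrMr//.
by apply: le_normD;have := h x;have := h (x - v);lra.
Qed.
Lemma dv_Mv w v f : dv w (Mv v f) = Mv v (dv w f).
apply/funext=> x;rewrite /dv /Mv (_ : x - w - v = x - v - w);first by field.
by rewrite addrAC.
Qed.

Definition T3 phi (A : 'I_2 -> R * R -> R) b := \sum_i \I_x (phi x * A i x * dd i b x).
Definition dvg (A : 'I_2 -> R * R -> R) x := \sum_i dd i (A i) x.

Lemma tf3 f g h : tf f -> tf g -> tf h -> tf (fun x=> f x * g x * h x).
by move=> hf hg;apply: tf_M;apply: Sm_M;exact: tf_Sm. Qed.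

(** With [f = M + d / 2] and its translate [M - d / 2], and likewise for [g] and [h], terms with an
    odd number of differences cancel in the mean of the two products; beyond the product of the
    means only those with exactly two differences remain. *)
Lemma I_Mv3 v f g h : tf f -> tf g -> tf h ->
 \I_x (f x * g x * h x) - \I_x (Mv v f x * Mv v g x * Mv v h x) =
 4^-1 * (\I_x (Mv v f x * dv v g x * dv v h x) + (\I_x (dv v f x * Mv v g x * dv v h x) +
 \I_x (dv v f x * dv v g x * Mv v h x))).
move=> hf hg hh.
have t1 := tf_L1 (tf3 hf hg hh).
have s1 : L1 (fun x=> f (x - v) * g (x - v) * h (x - v)) := L1_sub v t1.
have e1 : \I_x (f x * g x * h x) = \I_x (2^-1 * (f x * g x * h x + f (x - v) * g (x - v) * h (x - v))).
 rewrite (IZ _ (L1D t1 s1)) (ID t1 s1) (I_sub v t1);lra.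
have t2 := tf_L1 (tf3 (tf_Mv v hf) (tf_Mv v hg) (tf_Mv v hh)).
have t3 := tf_L1 (tf3 (tf_Mv v hf) (tf_dv v hg) (tf_dv v hh)).
have t4 := tf_L1 (tf3 (tf_dv v hf) (tf_Mv v hg) (tf_dv v hh)).
have t5 := tf_L1 (tf3 (tf_dv v hf) (tf_dv v hg) (tf_Mv v hh)).
rewrite e1 -(IB (L1Z _ (L1D t1 s1)) t2) -(ID t4 t5) -(ID t3 (L1D t4 t5)) -(IZ _ (L1D t3 (L1D t4 t5))).
by apply: eq_I=> x;rewrite /Mv /dv;field.
Qed.

Lemma tf_dvg (A : 'I_2 -> R * R -> R) : (forall i, tf (A i)) -> tf (dvg A).
move=> hA;rewrite (_ : dvg A = fun x=> dd ord0 (A ord0) x + dd ord_max (A ord_max) x).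
 by apply: tf_D;exact: tf_dd.
apply/funext=> x;rewrite /dvg big_ord_recl big_ord_recl big_ord0 addr0.
by rewrite (_ : lift _ _ = ord_max)//;exact: val_inj.
Qed.
Lemma Mv_sum v n (F : 'I_n -> R * R -> R) x :
 Mv v (fun x=> \sum_j F j x) x = \sum_j Mv v (F j) x.
by rewrite /Mv -big_split /= mulr_suml. Qed.
Lemma dv_sum v n (F : 'I_n -> R * R -> R) x :
 dv v (fun x=> \sum_j F j x) x = \sum_j dv v (F j) x.
by rewrite /dv -sumrB. Qed.
Lemma dvg_Mv v A : (forall i, tf (A i)) -> dvg (fun i=> Mv v (A i)) = Mv v (dvg A).
by move=> hA;apply/funext=> x;rewrite Mv_sum;apply: eq_bigr=> i _;rewrite dd_Mv.
Qed.

Lemma four_bound (s1 s2 s3 s4 B1 B2 B3 B4 q p : R) :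
 `|s1| <= q * B1 -> `|s2| <= q * B2 -> `|s3| <= p * B3 -> `|s4| <= p * B4 ->
 `|4^-1 * (- (s1 + s2) + (s3 + s4))| <= q * (B1 + B2) + p * (B3 + B4).
move=> h1 h2 h3 h4;rewrite normrM ger0_norm//.
have : `|- (s1 + s2) + (s3 + s4)| <= (q * B1 + q * B2) + (p * B3 + p * B4).
 apply: le_normD;rewrite normrN.
 apply: lerD;apply: le_normD;exact: lerD.
rewrite 2!mulrDr;apply: le_trans;rewrite -[leRHS]mul1r.
by apply: ler_wpM2r=> //;rewrite invf_le1// ler1n.
Qed.

(** Of the three terms with two differences, two contain [dv v phi], which takes the sup bound [p].
    In the third [phi] is only averaged; there the derivative is moved off [dv v b], falling on
    [phi] and on [A], where it forms the divergence, so that the undifferentiated [dv v b] takes the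
    sup bound [q]. *)
Lemma T3_step v phi A b (p q : R) : tf phi -> (forall i, tf (A i)) -> tf b ->
 (forall x, `|dv v phi x| <= p) -> (forall x, `|dv v b x| <= q) ->
 `|T3 phi A b - T3 (Mv v phi) (fun i=> Mv v (A i)) (Mv v b)| <=
 q * (\sum_i nrm (dd i phi) * nrm (dv v (A i)) + nrm phi * nrm (dv v (dvg A))) +
 p * (\sum_i nrm (A i) * nrm (dv v (dd i b)) + \sum_i nrm (dd i b) * nrm (dv v (A i))).
move=> hp hA hb bp bq.
have p0 : 0 <= p := le_trans (normr_ge0 _) (bp 0).
have q0 : 0 <= q := le_trans (normr_ge0 _) (bq 0).
have hMp := tf_Mv v hp;have hdp := tf_dv v hp;have hdb := tf_dv v hb;have hMb := tf_Mv v hb.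
have hMA i := tf_Mv v (hA i);have hdA i := tf_dv v (hA i).
have hbi i := tf_dd i hb.
have e0 : T3 phi A b - T3 (Mv v phi) (fun i=> Mv v (A i)) (Mv v b) =
 4^-1 * (\sum_i \I_x (Mv v phi x * dv v (A i) x * dd i (dv v b) x) +
 (\sum_i \I_x (dv v phi x * Mv v (A i) x * dv v (dd i b) x) +
  \sum_i \I_x (dv v phi x * dv v (A i) x * Mv v (dd i b) x))).
 transitivity (\sum_i 4^-1 * (\I_x (Mv v phi x * dv v (A i) x * dd i (dv v b) x) +
   (\I_x (dv v phi x * Mv v (A i) x * dv v (dd i b) x) +
    \I_x (dv v phi x * dv v (A i) x * Mv v (dd i b) x)))).
  rewrite /T3 -sumrB;apply: eq_bigr=> i _;cbv beta.
  rewrite (dd_Mv v i hb) (dd_dv v i hb);exact: (I_Mv3 v hp (hA i) (hbi i)).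
 by rewrite -mulr_sumr big_split /= big_split.
have e1 : \sum_i \I_x (Mv v phi x * dv v (A i) x * dd i (dv v b) x) =
 - (\sum_i \I_x (dd i (Mv v phi) x * dv v (A i) x * dv v b x) +
   \I_x (Mv v phi x * dv v (dvg A) x * dv v b x)).
 have -> : \I_x (Mv v phi x * dv v (dvg A) x * dv v b x) =
   \sum_i \I_x (Mv v phi x * dv v (dd i (A i)) x * dv v b x).
  rewrite -I_sum;last first.
   by move=> i;apply: tf_L1;apply: tf3=> //;apply: tf_dv;exact: tf_dd.
  by apply: eq_I=> x;rewrite dv_sum mulr_sumr mulr_suml.
 rewrite -big_split /= -sumrN;apply: eq_bigr=> i _.
 have S : Sm (fun x=> Mv v phi x * dv v (A i) x) by apply: Sm_M;exact: tf_Sm.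
 rewrite (IBP i S hdb);congr (- _).
 rewrite -ID;last 2 first.
 - by apply: tf_L1;apply: tf3=> //;exact: tf_dd.
 - by apply: tf_L1;apply: tf3=> //;apply: tf_dv;exact: tf_dd.
 apply: eq_I=> x;rewrite dd_M;[|exact: tf_Sm|exact: tf_Sm].
 by rewrite (dd_dv v i (hA i));ring.
rewrite e0 e1 {e0 e1}.
have b1 : `|\sum_i \I_x (dd i (Mv v phi) x * dv v (A i) x * dv v b x)| <=
 q * \sum_i nrm (dd i phi) * nrm (dv v (A i)).
 apply: le_trans (ler_norm_sum _ _ _) _;rewrite mulr_sumr;apply: ler_sum=> i _.
 apply: le_trans (I_tri (tf_L2 (tf_dd i hMp)) (tf_L2 (hdA i)) (Sm_mf (tf_Sm hdb)) bq) _.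
 rewrite (dd_Mv v i hp);apply: (ler_wpM2l q0);apply: (ler_wpM2r (nrm_ge0 _));exact: (nrm_Mv v (tf_L2 (tf_dd i hp))).
have b2 : `|\I_x (Mv v phi x * dv v (dvg A) x * dv v b x)| <= q * (nrm phi * nrm (dv v (dvg A))).
 apply: le_trans (I_tri (tf_L2 hMp) (tf_L2 (tf_dv v (tf_dvg hA))) (Sm_mf (tf_Sm hdb)) bq) _.
 apply: (ler_wpM2l q0);apply: (ler_wpM2r (nrm_ge0 _));exact: (nrm_Mv v (tf_L2 hp)).
have b3 : `|\sum_i \I_x (dv v phi x * Mv v (A i) x * dv v (dd i b) x)| <=
 p * \sum_i nrm (A i) * nrm (dv v (dd i b)).
 apply: le_trans (ler_norm_sum _ _ _) _;rewrite mulr_sumr;apply: ler_sum=> i _.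
 rewrite (eq_I (g := fun x=> Mv v (A i) x * dv v (dd i b) x * dv v phi x))=> [|x];last by ring.
 apply: le_trans (I_tri (tf_L2 (hMA i)) (tf_L2 (tf_dv v (hbi i))) (Sm_mf (tf_Sm hdp)) bp) _.
 apply: (ler_wpM2l p0);apply: (ler_wpM2r (nrm_ge0 _));exact: (nrm_Mv v (tf_L2 (hA i))).
have b4 : `|\sum_i \I_x (dv v phi x * dv v (A i) x * Mv v (dd i b) x)| <=
 p * \sum_i nrm (dd i b) * nrm (dv v (A i)).
 apply: le_trans (ler_norm_sum _ _ _) _;rewrite mulr_sumr;apply: ler_sum=> i _.
 rewrite (eq_I (g := fun x=> Mv v (dd i b) x * dv v (A i) x * dv v phi x))=> [|x];last by ring.
 apply: le_trans (I_tri (tf_L2 (tf_Mv v (hbi i))) (tf_L2 (hdA i)) (Sm_mf (tf_Sm hdp)) bp) _.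
 apply: (ler_wpM2l p0);apply: (ler_wpM2r (nrm_ge0 _));exact: (nrm_Mv v (tf_L2 (hbi i))).
exact: four_bound b1 b2 b3 b4.
Qed.

(** Half-open intervals make the doubling [ho1E] exact at every point, hence averaging at scale
    [2 s] is exactly two mean steps after averaging at scale [s]. *)
Definition ho1 s (t : R) : R := ((0 <= t < s)%R)%:R.
Definition ha s x : R := (s ^+ 2)^-1 * (ho1 s x.1 * ho1 s x.2).
Definition av s f := cv f (ha s).

Lemma ho1_01 s t : 0 <= ho1 s t <= 1.
by rewrite /ho1 ler0n lern1 leq_b1. Qed.
Lemma ho1E s t : 0 < s -> ho1 (2 * s) t = ho1 s t + ho1 s (t - s).
move=> s0;rewrite /ho1;have [h1|h1] := ltP t 0.
 have -> : (0 <= t - s) = false by apply/negbTE;rewrite -ltNge;lra.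
 by rewrite /= addr0.
have [h2|h2] := ltP t s.
 have -> : (0 <= t - s) = false by apply/negbTE;rewrite -ltNge;lra.
 have -> : t < 2 * s by lra.
 by rewrite /= addr0.
have -> : (0 <= t - s) by lra.
have -> : (t - s < s) = (t < 2 * s) by apply/idP/idP;lra.
by rewrite /= add0r.
Qed.
Lemma haE s x : 0 < s -> ha (2 * s) x =
 4^-1 * (ha s x + ha s (x - s *: dir ord0) + ha s (x - s *: dir ord_max) + ha s (x - s *: dir ord0 - s *: dir ord_max)).
move=> s0;have sn0 : s != 0 by rewrite gt_eqF.
have [a1 a2] : (x - s *: dir ord0).1 = x.1 - s /\ (x - s *: dir ord0).2 = x.2.
 by rewrite /dir /= /GRing.scale /= mulr1 mulr0 subr0.
have [b1 b2] : (x - s *: dir ord_max).1 = x.1 /\ (x - s *: dir ord_max).2 = x.2 - s.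
 by rewrite /dir /= /GRing.scale /= mulr1 mulr0 subr0.
have [c1 c2] : (x - s *: dir ord0 - s *: dir ord_max).1 = x.1 - s /\ (x - s *: dir ord0 - s *: dir ord_max).2 = x.2 - s.
 by rewrite /dir /= /GRing.scale /= !mulr1 !mulr0 !subr0.
rewrite /ha a1 a2 b1 b2 c1 c2 !ho1E//.
by field.
Qed.
Lemma ha_ge0 s x : 0 <= ha s x.
by rewrite mulr_ge0 ?invr_ge0 ?sqr_ge0// mulr_ge0.
Qed.
Lemma ha_le s x : ha s x <= (s ^+ 2)^-1.
rewrite /ha ler_piMr ?invr_ge0 ?sqr_ge0//;case/andP: (ho1_01 s x.1)=> ? ?;case/andP: (ho1_01 s x.2)=> ? ?.
by rewrite mulr_ile1.
Qed.
Lemma haI s : ha s = fun x=> (s ^+ 2)^-1 * \1_(`[0, s[%classic `*` `[0, s[%classic) x.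
apply/funext=> x;rewrite /ha /ho1 indicE -natrM mulnb;congr (_ * (nat_of_bool _)%:R).
apply/idP/idP=> [/andP[h1 h2]|];first by apply/mem_set;split;rewrite /= in_itv.
by move=> /set_mem[];rewrite /= !in_itv /= => -> ->.
Qed.
Lemma I_ha s : 0 < s -> I (ha s) = 1.
move=> s0;rewrite haI.
have mQ : measurable (`[0, s[%classic `*` `[0, s[%classic : set (R * R)) by exact: measurableX.
have L1Q : L1 (\1_(`[0, s[%classic `*` `[0, s[%classic) : R * R -> R).
 apply: (L1_le (mf_ind mQ) (L1_box 0 s))=> x.
 have [hx|hx] := pselect ((`[0, s[%classic `*` `[0, s[%classic) x);last first.
  by rewrite (indF hx) normr0;case/andP: (ind01 (box 0 s) x).
 rewrite (indT hx) normr1 indT//;case: hx=> /=;rewrite !in_itv /= => /andP[a1 a2] /andP[a3 a4].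
 by rewrite box0E !ger0_norm// ltW// ltW.
rewrite IZ//;apply: EFin_inj;rewrite EFinM EFin_I//.
have h : lebesgue_measure (`[0, s[%classic : set R) = s%:E.
 by rewrite lebesgue_measure_itv/= lte_fin s0 sube0.
have h2 : leb2 (`[0, s[%classic `*` `[0, s[%classic : set (R * R)) = (s%:E * s%:E)%E.
 by rewrite /leb2 product_measure1E//;congr (_ * _)%E;exact: h.
rewrite integral_indic// setIT.
transitivity ((s ^+ 2)^-1%:E * (s%:E * s%:E))%E;first by congr (_ * _)%E;exact: h2.
by rewrite -!EFinM;congr EFin;field;rewrite gt_eqF.
Qed.
Lemma ha_ker s : 0 < s -> ker s (ha s).
move=> s0;split.
- rewrite haI;apply: mfZ;apply: mf_ind;exact: measurableX.
- by exists (s ^+ 2)^-1=> x;rewrite ger0_norm ?ha_ge0// ha_le.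
move=> x hx;rewrite haI indF ?mulr0// => -[/=];rewrite !in_itv /= => /andP[a1 a2] /andP[a3 a4].
by apply: hx;rewrite box0E !ger0_norm// !ltW.
Qed.
Lemma ha_K2 s : 0 < s -> K2 (ha s).
by move=> s0;split;[exact: ker_L2 (ha_ker s0)|exists s;case: (ha_ker s0)]. Qed.
Lemma av_comm s f : 0 < s -> tf f -> av s f = cv (ha s) f.
move=> s0 hf;apply/funext=> x;rewrite /av (cvE _ (tf_L1 hf) (ha_ker s0)) /cv.
by apply: eq_I=> y;rewrite mulrC.
Qed.
Lemma tf_av s f : 0 < s -> tf f -> tf (av s f).
by move=> s0 hf;rewrite av_comm//;apply: K2_cv=> //;exact: ha_K2. Qed.
Lemma dd_av s f i : 0 < s -> tf f -> dd i (av s f) = av s (dd i f).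
move=> s0 hf;apply/funext=> x;rewrite !av_comm//;last exact: tf_dd.
by apply: dd_cv=> //;exact: K2_L1 (ha_K2 s0).
Qed.
Lemma L1_cvi s f x : 0 < s -> tf f -> L1 (fun y=> f (x - y) * ha s y).
by move=> s0 hf;apply: L1_cvint (tf_L1 hf) (ha_ker s0). Qed.
Lemma av_double s f : 0 < s -> tf f ->
 av (2 * s) f = Mv (s *: dir ord_max) (Mv (s *: dir ord0) (av s f)).
move=> s0 hf;apply/funext=> x.
have sh v : L1 (fun y=> f (x - y) * ha s (y - v)) /\ \I_y (f (x - y) * ha s (y - v)) = av s f (x - v).
 have h : L1 (fun y=> f (x - v - y) * ha s y) by exact: L1_cvi.
 have e : (fun y=> f (x - y) * ha s (y - v)) = (fun y=> f (x - v - (y - v)) * ha s (y - v)).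
  by apply/funext=> y;congr (f _ * _);rewrite opprB addrA subrK.
 rewrite e;split;first exact: (L1_sub v h).
 exact: (I_sub v h).
have [l1 e1] := sh (s *: dir ord0);have [l2 e2] := sh (s *: dir ord_max).
have [l3 e3] := sh (s *: dir ord0 + s *: dir ord_max).
have l0 : L1 (fun y=> f (x - y) * ha s y) by exact: L1_cvi.
have -> : av (2 * s) f x = 4^-1 * (av s f x + av s f (x - s *: dir ord0) + av s f (x - s *: dir ord_max) +
  av s f (x - (s *: dir ord0 + s *: dir ord_max))).
 rewrite /av /cv (eq_I (g := fun y=> 4^-1 * (f (x - y) * ha s y + f (x - y) * ha s (y - s *: dir ord0) +
 f (x - y) * ha s (y - s *: dir ord_max) + f (x - y) * ha s (y - (s *: dir ord0 + s *: dir ord_max)))));last first.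
  by move=> y;rewrite haE// opprD addrA;ring.
 have l01 := L1D l0 l1;have l012 := L1D l01 l2.
 by rewrite (IZ _ (L1D l012 l3)) (ID l012 l3) (ID l01 l2) (ID l0 l1) e1 e2 e3.
rewrite /Mv (_ : x - s *: dir ord_max - s *: dir ord0 = x - (s *: dir ord0 + s *: dir ord_max)).
 by field.
by rewrite opprD addrA addrAC.
Qed.
Lemma av_sup s f (N : R) : 0 < s -> tf f -> \I_y (`|f y|) <= N -> forall x, `|av s f x| <= N / s ^+ 2.
move=> s0 hf hN x;rewrite /av /cv.
have lf := L1_abs (tf_L1 hf).
apply: le_trans (I_absle (g := fun y=> (s ^+ 2)^-1 * `|f (x - y)|) _ _ _) _.
- exact: L1_mf (L1_cvi x s0 hf).
- by apply: L1Z;exact: (L1_op x lf).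
- move=> y;rewrite normrM mulrC ler_wpM2r// ger0_norm ?ha_ge0// ha_le//.
rewrite (IZ _ (L1_op x lf)) (I_op x lf) mulrC ler_wpM2r// invr_ge0 sqr_ge0 //.
Qed.
(* The functions [ej] are the indicators of squares divided by their side; their
 Gram matrix decays geometrically away from the diagonal. *)
Definition ej s x y := s * ha s (x - y).
Lemma ej_L2 s x : 0 < s -> L2 (ej s x).
by move=> s0;apply: L2Z;apply: (L2_op x);exact: K2_L2 (ha_K2 s0). Qed.
Lemma ej_dot s t x y : 0 < s -> s <= t -> 0 <= \I_z (ej s x z * ej t y z) <= s / t.
move=> s0 st;have t0 : 0 < t by exact: lt_le_trans st.
have g r w z : 0 < r -> 0 <= ej r w z by move=> r0;rewrite mulr_ge0 ?ha_ge0// ltW.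
apply/andP;split;first by apply: I_ge0=> z;rewrite mulr_ge0 ?g.
have L1h := ker_L1 (ha_ker s0).
apply: le_trans (@I_le R _ (fun z=> (s / t) * ha s (x - z)) _ _ _) _.
- apply: L2M;exact: ej_L2.
- by apply: L1Z;exact: (L1_op x L1h).
- move=> z;rewrite /ej [leRHS](_ : _ = s * ha s (x - z) * (t * (t ^+ 2)^-1));last by field;rewrite gt_eqF.
 rewrite [leLHS](_ : _ = s * ha s (x - z) * (t * ha t (y - z)));last by ring.
 apply: ler_wpM2l;first by rewrite mulr_ge0 ?ha_ge0 ?ltW.
 by apply: ler_wpM2l;[exact: ltW|exact: ha_le].
by rewrite (IZ _ (L1_op x L1h)) (I_op x L1h) I_ha// mulr1.
Qed.

(** A Bessel inequality for almost orthogonal functions, with one arbitrary square per scale. By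
    [ej_dot] the overlap of scales [j <= n] is at most [s j / s n], so [B n] bounds the pairing of
    the partial sum [G n] with [e n] and is halved at each step before the new term enters.
    Cauchy-Schwarz against [G J] concludes. *)
Lemma bessel s0 J F (X : nat -> R * R) : 0 < s0 -> tf F ->
 \sum_(j < J) (2 ^+ j * s0 * av (2 ^+ j * s0) F (X j)) ^+ 2 <= 3 * nsq F.
move=> s00 hF;pose s (j : nat) := 2 ^+ j * s0.
have sp j : 0 < s j by rewrite mulr_gt0 ?exprn_gt0.
have sl j j' : (j <= j')%N -> s j <= s j' by move=> h;rewrite ler_pM2r//;apply: ler_weXn2l=> //;rewrite ler1n.
pose e j := ej (s j) (X j).
have Le j : L2 (e j) by exact: ej_L2.
pose a j := \I_y (F y * e j y).
have ae j : a j = s j * av (s j) F (X j).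
 rewrite /av (cvE _ (tf_L1 hF) (ha_ker (sp j))) -IZ.
  by apply: eq_I=> y;rewrite /e /ej;ring.
 by apply: L2M;[exact: tf_L2|apply: (L2_op (X j));exact: K2_L2 (ha_K2 (sp j))].
have -> : \sum_(j < J) (2 ^+ j * s0 * av (2 ^+ j * s0) F (X j)) ^+ 2 = \sum_(j < J) a j ^+ 2.
 by apply: eq_bigr=> j _;rewrite ae.
pose G n y := \sum_(j < n) a j * e j y.
have LG n : L2 (G n) by apply: L2_sum=> j;exact: L2Z.
pose B n := \sum_(j < n) `|a j| * (s j / s n).
have BS n : B n.+1 = (B n + `|a n|) / 2.
 have s2 : s n.+1 = 2 * s n by rewrite /s exprS mulrA.
 have sn0 : s n != 0 by rewrite gt_eqF.
 rewrite /B big_ord_recr /= mulrDl mulr_suml s2;congr (_ + _);last by field.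
 by apply: eq_bigr=> j _;field.
have B0 n : 0 <= B n by apply: sumr_ge0=> j _;rewrite mulr_ge0 ?divr_ge0 ?(ltW (sp _)).
have GS n : nsq (G n.+1) = nsq (G n) + 2 * a n * \I_y (G n y * e n y) + a n ^+ 2 * nsq (e n).
 rewrite /nsq (eq_I (g := fun y=> G n y ^+ 2 + 2 * a n * (G n y * e n y) + a n ^+ 2 * e n y ^+ 2));last first.
  by move=> y;rewrite /G big_ord_recr /=;ring.
 have l1 := (LG n).2;have l2 := L1Z (2 * a n) (L2M (LG n) (Le n));have l3 := L1Z (a n ^+ 2) (Le n).2.
 by rewrite (ID (L1D l1 l2) l3) (ID l1 l2) (IZ _ (L2M (LG n) (Le n))) (IZ _ (Le n).2).
have GB n : `|\I_y (G n y * e n y)| <= B n.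
 rewrite (eq_I (g := fun y=> \sum_(j < n) a j * (e j y * e n y)));last first.
  by move=> y;rewrite /G mulr_suml;apply: eq_bigr=> j _;rewrite mulrA.
 rewrite I_sum;last by move=> j;apply: L1Z;exact: L2M.
 apply: le_trans (ler_norm_sum _ _ _) _;apply: ler_sum=> j _.
 rewrite IZ;last exact: L2M.
 have /andP[h1 h2] := ej_dot (X j) (X n) (sp j) (sl _ _ (ltnW (ltn_ord j))).
 by rewrite normrM ler_wpM2l// ger0_norm.
have en n : nsq (e n) <= 1.
 have /andP[_ h] := ej_dot (X n) (X n) (sp n) (lexx _).
 have -> : nsq (e n) = \I_z (ej (s n) (X n) z * ej (s n) (X n) z).
  by apply: eq_I=> y;rewrite expr2.
 by apply: le_trans h _;rewrite divff// gt_eqF.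
(* The correction [2 B^2] is what closes the induction: the step then reduces to the nonnegativity
   of [(B n - |a n|)^2]. *)
have inv n : nsq (G n) + 2 * B n ^+ 2 <= 3 * \sum_(j < n) a j ^+ 2.
 elim: n=> [|n IH].
  rewrite /B !big_ord0 mulr0 expr0n mulr0 addr0 /nsq (eq_I (g := fun=> 0)) ?I0// => y.
  by rewrite /G big_ord0 expr0n.
 rewrite BS GS big_ord_recr /=;move: IH (GB n) (en n) (B0 n).
 set S := \sum_(j < n) _;move: (nsq (G n)) (nsq (e n)) (B n) (I _)=> x y b c IH h1 h2 b0.
 have h3 : 2 * a n * c <= 2 * (`|a n| * b).
  rewrite -mulrA ler_wpM2l//;apply: le_trans (ler_norm _) _;rewrite normrM ler_wpM2l//.
 have h4 : a n ^+ 2 * y <= a n ^+ 2 by rewrite ler_piMr ?sqr_ge0.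
 have h5 : a n ^+ 2 = `|a n| ^+ 2 by rewrite real_normK ?num_real.
 rewrite h5 in h4 *;move: (sqr_ge0 (b - `|a n|))=> h6.
 nra.
have S0 : 0 <= \sum_(j < J) a j ^+ 2 by apply: sumr_ge0=> j _;exact: sqr_ge0.
have eS : \I_y (F y * G J y) = \sum_(j < J) a j ^+ 2.
 rewrite (eq_I (g := fun y=> \sum_(j < J) a j * (F y * e j y)));last first.
  by move=> y;rewrite /G mulr_sumr;apply: eq_bigr=> j _;ring.
 rewrite I_sum;last by move=> j;apply: L1Z;apply: L2M=> //;exact: tf_L2.
 by apply: eq_bigr=> j _;rewrite IZ ?expr2//;apply: L2M=> //;exact: tf_L2.
have := CS (tf_L2 hF) (LG J);rewrite eS.
have hG : nsq (G J) <= 3 * \sum_(j < J) a j ^+ 2.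
 by apply: le_trans (inv J);rewrite lerDl mulr_ge0// sqr_ge0.
move: hG S0 (nsq_ge0 F);set S := \sum_(j < J) _;move: (nsq (G J)) (nsq F)=> x y hG S0 y0 h.
have [S00|S00] := eqVneq S 0;first by rewrite S00 mulr_ge0.
have Sp : 0 < S by rewrite lt_neqAle eq_sym S00.
rewrite -(ler_pM2r Sp) -expr2;apply: le_trans h _.
by rewrite [3 * y]mulrC -mulrA ler_wpM2l.
Qed.
End Trilinear.

(** * The trilinear div-curl estimate *)

Section Trilinear2.
Context {R : realType}.
Implicit Types (f g h phi psi k b F : R * R -> R) (x v w c : R * R) (i : 'I_2) (s : R).

Definition pk (r : R) k := [/\ ker r k, forall x, 0 <= k x & I k = 1].
Lemma pk_abs r k : pk r k -> \I_x (`|k x|) = 1.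
by move=> [_ k0 <-];apply: eq_I=> x;rewrite ger0_norm. Qed.
Lemma pk_moll r k : moll r k -> pk r k.
by move=> h;split;[exact: moll_ker|case: h|case: h]. Qed.
Lemma pk_ha s : 0 < s -> pk s (ha s).
by move=> s0;split;[exact: ha_ker|exact: ha_ge0|exact: I_ha]. Qed.

Lemma cv_bound r k f (M : R) : pk r k -> L1 f -> (forall x, `|f x| <= M) -> forall x, `|cv f k x| <= M.
move=> [kk k0 k1] hf hM x;have L1k := ker_L1 kk.
rewrite /cv;apply: le_trans (I_absle (g := fun y=> M * k y) _ (L1Z _ L1k) _) _.
- exact: L1_mf (L1_cvint x hf kk).
- by move=> y;rewrite normrM [ `|k y| ]ger0_norm// ler_wpM2r.
by rewrite (IZ _ L1k) k1 mulr1.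
Qed.

Lemma nrm_cv r k f : pk r k -> K2 f -> nrm (cv f k) <= nrm f.
move=> [kk k0 k1] hf;have l1 := K2_L1 hf;have l2 := K2_L2 hf.
have hp : L2 (cv f k) := L2_cv l1 l2 kk.
have [h1 h2 h3] := cv_swap l1 kk hp.1 (fun v=> (L2_L2_shift v l2 hp).1) (fun v=> (L2_L2_shift v l2 hp).2).
have : nsq (cv f k) <= nrm (cv f k) * nrm f.
 rewrite /nsq (eq_I (g := fun x=> cv f k x * cv f k x))=> [|x];last by rewrite expr2.
 rewrite h3;apply: le_trans (@I_le R _ (fun y=> (nrm (cv f k) * nrm f) * k y) h2 (L1Z _ (ker_L1 kk)) _) _.
  move=> y;rewrite (mulrC (nrm _ * _));apply: (ler_wpM2l (k0 y));apply: le_trans (ler_norm _) _.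
  have := CSn hp (L2_sub y l2);by rewrite (nrm_sub y l2).
 by rewrite (IZ _ (ker_L1 kk)) k1 mulr1.
rewrite -nrm_sq;have := nrm_ge0 (cv f k);move: (nrm (cv f k)) (nrm f) (nrm_ge0 f)=> a b b0 a0.
have [->|a1] := eqVneq a 0;first by [].
have ap : 0 < a by rewrite lt_neqAle eq_sym a1.
by rewrite expr2 (ler_pM2l ap).
Qed.

Lemma cv_approx f : K2 f -> forall e, 0 < e -> exists2 d, 0 < d &
 forall k r, pk r k -> r <= d -> nrm (fun x=> cv f k x - f x) <= e.
move=> hf e e0;have [d d0 hd] := cv_L2_approx (K2_L1 hf) (K2_L2 hf) e0.
exists d=> // k r kk rd;have [k1 _ k2] := kk;have := hd k r k1 rd.
rewrite (pk_abs kk) k2 mulr1;congr (nrm _ <= _);apply/funext=> x;by rewrite mul1r.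
Qed.

(** Mollifying one factor at a time, [A] and [B] are handled in L^2. For [phi], which is paired with
    the merely integrable [A B], duality moves the error onto translates of [A B], continuous in
    L^1, while [phi] is bounded. *)
Lemma tri_approx phi (A B : R * R -> R) (M : R) : K2 phi -> (forall x, `|phi x| <= M) -> K2 A -> K2 B ->
 forall e, 0 < e -> exists2 d, 0 < d & forall k r, pk r k -> r <= d ->
 `|\I_x (cv phi k x * cv A k x * cv B k x) - \I_x (phi x * A x * B x)| <= e.
move=> hp hM hA hB e e0;have M0 : 0 <= M := le_trans (normr_ge0 _) (hM 0).
pose C := M * (nrm A + nrm B + 1) + 1.
have C0 : 0 < C by rewrite ltr_wpDl// mulr_ge0// !addr_ge0// nrm_ge0.
have eC : 0 < e / C by rewrite divr_gt0.
have [d1 d10 h1] := cv_approx hA eC;have [d2 d20 h2] := cv_approx hB eC.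
have LAB := K2M hA hB.
have [_ /(_ _ eC)[d3 d30 h3]] := L1_Lc LAB.
pose d := Num.min d1 (Num.min d2 d3).
exists d;first by rewrite !lt_min d10 d20 d30.
move=> k r kk;rewrite !le_min=> /andP[r1 /andP[r2 r3]].
have kr := kk;have [kk1 k0 k1] := kk.
have LA : L2 (cv A k) := L2_cv (K2_L1 hA) (K2_L2 hA) kk1.
have LB : L2 (cv B k) := L2_cv (K2_L1 hB) (K2_L2 hB) kk1.
have Lp : L2 (cv phi k) := L2_cv (K2_L1 hp) (K2_L2 hp) kk1.
have bp := cv_bound kk (K2_L1 hp) hM.
have LdA : L2 (fun x=> cv A k x - A x) by apply: L2B=> //;exact: K2_L2.
have LdB : L2 (fun x=> cv B k x - B x) by apply: L2B=> //;exact: K2_L2.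
have mdp : mf (fun x=> cv phi k x - phi x) by apply: mfB;[exact: Lp.1|exact: K2_mf].
have bdp x : `|cv phi k x - phi x| <= M + M.
 by apply: le_normB;apply: lerD.
have t1 := L1_tri LdA LB Lp.1 bp.
have t2 := L1_tri (K2_L2 hA) LdB Lp.1 bp.
have t3 := L1_tri (K2_L2 hA) (K2_L2 hB) mdp bdp.
have t0 : L1 (fun x=> cv phi k x * cv A k x * cv B k x).
 have := L1_tri LA LB Lp.1 bp;congr L1;apply/funext=> x;ring.
have t00 : L1 (fun x=> phi x * A x * B x).
 have := L1_tri (K2_L2 hA) (K2_L2 hB) (K2_mf hp) hM;congr L1;apply/funext=> x;ring.
rewrite -(IB t0 t00) (eq_I (g := fun x=> ((cv A k x - A x) * cv B k x * cv phi k x +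
 A x * (cv B k x - B x) * cv phi k x) + A x * B x * (cv phi k x - phi x)))=> [|x];last by ring.
rewrite (ID (L1D t1 t2) t3) (ID t1 t2).
have b1 := I_tri LdA LB Lp.1 bp;have b2 := I_tri (K2_L2 hA) LdB Lp.1 bp.
have b3 : `|\I_x (A x * B x * (cv phi k x - phi x))| <= M * (e / C).
 have := @cv_dual R r phi k (fun x=> A x * B x) (M * \I_x (`|A x * B x|)) (M * (e / C)) (K2_L1 hp) kk1.
 rewrite (pk_abs kr) k1 mul1r (eq_I (f := fun x=> A x * B x * (cv phi k x - 1 * phi x))
  (g := fun x=> A x * B x * (cv phi k x - phi x)))=> [|x];last by rewrite mul1r.
 have ls v : L1 (fun x=> A x * B x * phi (x - v)).
  have : L1 (fun x=> phi (x - v) * (A x * B x)).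
   by apply: (@L1_bM _ _ _ M)=> //;exact: L1_mf (L1_sub v (K2_L1 hp)).
  by congr L1;apply/funext=> x;rewrite mulrC.
 apply.
 - exact: L1_mf LAB.
 - exact: ls.
 - move=> v;rewrite -(IZ _ (L1_abs LAB));apply: I_le.
  + exact: L1_abs (ls v).
  + exact: L1Z (L1_abs LAB).
  + by move=> x;rewrite normrM mulrC;apply: ler_wpM2r.
 move=> v;rewrite box0E=> -[v1 v2].
 have l0 : L1 (fun x=> A x * B x * phi x).
  by have := ls 0;congr L1;apply/funext=> x;rewrite subr0.
 have LABv := L1_sh v LAB.
 have lv : L1 (fun x=> A (x + v) * B (x + v) * phi x).
  by have := L1_sh v (ls v);congr L1;apply/funext=> x;rewrite addrK.
 have lsh : \I_x (A x * B x * phi (x - v)) = \I_x (A (x + v) * B (x + v) * phi x).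
  by rewrite -(I_sh v (ls v));apply: eq_I=> x;rewrite addrK.
 rewrite (eq_I (g := fun x=> A x * B x * phi (x - v) - A x * B x * phi x))=> [|x];last by ring.
 rewrite (IB (ls v) l0) lsh -(IB lv l0).
 have lD := L1B LABv LAB.
 apply: le_trans (I_absle (g := fun x=> M * `|A (x + v) * B (x + v) - A x * B x|) _ (L1Z _ (L1_abs lD)) _) _.
 - exact: L1_mf (L1B lv l0).
 - by move=> x;rewrite -mulrBl normrM mulrC;apply: ler_wpM2r.
 rewrite (IZ _ (L1_abs lD));apply: ler_wpM2l=> //.
 by apply: h3;[exact: le_trans v1 r3|exact: le_trans v2 r3].
have c1 : M * (nrm (fun x=> cv A k x - A x) * nrm (cv B k)) <= M * (e / C * nrm B).
 apply: ler_wpM2l=> //;apply: ler_pM;rewrite ?nrm_ge0//;[exact: h1 kk r1|exact: nrm_cv kk hB].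
have c2 : M * (nrm A * nrm (fun x=> cv B k x - B x)) <= M * (nrm A * (e / C)).
 apply: ler_wpM2l=> //;apply: ler_wpM2l;[exact: nrm_ge0|exact: h2 kk r2].
apply: le_normD.
apply: le_trans (lerD (le_trans (ler_normD _ _) (lerD (le_trans b1 c1) (le_trans b2 c2))) b3) _.
have -> : M * (e / C * nrm B) + M * (nrm A * (e / C)) + M * (e / C) = e * ((M * (nrm A + nrm B + 1)) / C).
 by ring.
by rewrite ler_piMr ?(ltW e0)// ler_pdivrMr// mul1r /C lerDl.
Qed.

(** Supplies a point where [|f|] is at least half its supremum, so that sup norms can be fed to
    [bessel], which handles point values. *)
Lemma near_sup f (M : R) : (forall x, `|f x| <= M) -> exists x0, forall x, `|f x| <= 2 * `|f x0|.
move=> hM;pose S := [set `|f x| | x in [set: R * R]].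
have hS : has_sup S.
 by split;[exists `|f 0|;exists 0|exists M=> _ [x _ <-]].
have [h|h] := pselect (exists y, f y != 0);last first.
 exists 0=> x;have -> : f x = 0 by apply/eqP;apply: contra_notT h=> h;exists x.
 by rewrite normr0 mulr_ge0.
have [y hy] := h.
have s0 : 0 < sup S.
 apply: (@lt_le_trans _ _ `|f y|);first by rewrite normr_gt0.
 by apply: ub_le_sup;[case: hS|exists y].
have [_ [x0 _ <-] hx0] := sup_adherent (divr_gt0 s0 (ltr0Sn R 1)) hS.
exists x0=> x;apply: (letr (sup S));first by apply: ub_le_sup;[case: hS|exists x].
by lra.
Qed.

Lemma norm_pM (a b : R) : 0 < a -> `|a * b| = a * `|b|.
by move=> a0;rewrite normrM gtr0_norm. Qed.
Lemma ord2P i : i = ord0 \/ i = ord_max.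
by case: i=> -[|[|//]] h;[left|right];exact: val_inj. Qed.
Lemma sum2E (F : 'I_2 -> R) : \sum_i F i = F ord0 + F ord_max.
by rewrite big_ord_recl big_ord_recl big_ord0 addr0;congr (_ + F _);exact: val_inj. Qed.
Lemma sum_tri J (p q u : nat -> R) (X a z : 'I_2 -> R) (y1 y2 : nat -> 'I_2 -> R) :
 \sum_(j < J) (q j * (\sum_i X i * y1 j i + u j) + p j * (\sum_i a i * y2 j i + \sum_i z i * y1 j i)) =
 \sum_i \sum_(j < J) q j * (X i * y1 j i) + \sum_(j < J) q j * u j +
 (\sum_i \sum_(j < J) p j * (a i * y2 j i) + \sum_i \sum_(j < J) p j * (z i * y1 j i)).
rewrite ![in RHS]sum2E -!big_split /=;apply: eq_bigr=> j _.
by rewrite !sum2E;ring.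
Qed.
Lemma sum_leM (X t : 'I_2 -> R) (K : R) : (forall i, t i <= X i * K) -> \sum_i t i <= (\sum_i X i) * K.
by move=> h;rewrite mulr_suml;apply: ler_sum=> i _;exact: h. Qed.
Lemma fin_arith (X a z P G : R) : 0 <= z -> 0 <= P -> 0 <= G ->
 X * (15 * (z * a)) + P * (15 * (z * G)) + (a * (15 * (X * z)) + z * (15 * (X * a))) <= 45 * (X * a + P * G) * z.
by move=> z0 P0 G0;have := mulr_ge0 z0 (mulr_ge0 P0 G0);lra. Qed.
Lemma le_self_sqr (t : R) : 1 <= t -> t <= t * t.
by move=> h;nra. Qed.
Lemma pp_arith (a b c d : R) : 0 <= a -> 0 <= b -> c <= 3 * a ^+ 2 -> d <= 3 * b ^+ 2 ->
 8 * (c + d) <= (5 * (a + b)) ^+ 2.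
by move=> *;nra. Qed.
Lemma tail_arith (P S s q e : R) : 0 < e -> 0 < s -> 0 < q -> P * S / s / e < q -> P / (q * s) * S <= e.
move=> e0 s0 q0;rewrite ltr_pdivrMr// ltr_pdivrMr// => h.
by rewrite mulrAC ler_pdivrMr ?mulr_gt0//;apply: le_trans (ltW h) _;rewrite mulrCA mulrA.
Qed.
Lemma two_dist (a b c d e : R) : `|a - c| <= e / 2 -> `|b - d| <= e / 2 -> `|a + b - (c + d)| <= e.
move=> h1 h2;rewrite opprD addrACA;apply: le_normD.
by rewrite [leRHS](splitr e);exact: lerD.
Qed.
Lemma dist_le (a c B e : R) : `|a| <= B -> `|a - c| <= e -> `|c| <= B + e.
move=> h1 h2;rewrite -(subrK a c) addrC;apply: le_normD.
by apply: lerD=> //;rewrite distrC.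
Qed.
Lemma T3E phi A b : T3 phi A b =
 \I_x (phi x * A ord0 x * dd ord0 b x) + \I_x (phi x * A ord_max x * dd ord_max b x).
exact: sum2E. Qed.
Lemma tele8 J (a : nat -> R) : \sum_(j < J) 8 * (a j - a j.+1) = 8 * (a 0%N - a J).
by elim: J=> [|J IH];[rewrite big_ord0;ring|rewrite big_ord_recr /= IH;ring]. Qed.

Section Fixed.
Variables (s0 : R).
Hypothesis s00 : 0 < s0.
Local Notation s j := (2 ^+ j * s0).
Local Notation AV j f := (av (2 ^+ j * s0) f).
Let sp j : 0 < s j. Proof. by rewrite mulr_gt0 ?exprn_gt0. Qed.
Let vv j i : R * R := s j *: dir i.

Lemma AV_S j f : tf f -> AV j.+1 f = Mv (vv j ord_max) (Mv (vv j ord0) (AV j f)).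
by move=> hf;rewrite exprS -mulrA av_double. Qed.
Lemma nrm_AV j f : tf f -> nrm (AV j f) <= nrm f.
by move=> hf;apply: nrm_cv (pk_ha (sp j)) (tf_K2 hf). Qed.

Definition yy j f := nrm (dv (vv j ord0) (AV j f)) + nrm (dv (vv j ord_max) (Mv (vv j ord0) (AV j f))).
(** Between consecutive scales the squared norm drops by a quarter of the sum of the two squared
    differences, and [(a + b)^2 <= 2 (a^2 + b^2)]: hence the factor [8], and the sum telescopes. *)
Lemma yy_sum J f : tf f -> \sum_(j < J) yy j f ^+ 2 <= (3 * nrm f) ^+ 2.
move=> hf.
have h j : yy j f ^+ 2 <= 8 * (nsq (AV j f) - nsq (AV j.+1 f)).
 have t0 := tf_av (sp j) hf;have t1 := tf_Mv (vv j ord0) t0.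
 rewrite AV_S// (nsq_Mv (vv j ord0) (tf_L2 t0)) (nsq_Mv (vv j ord_max) (tf_L2 t1)) /yy -!nrm_sq.
 move: (nrm (dv _ (AV j f))) (nrm (dv _ (Mv _ _)))=> a b.
 by have := sqr_ge0 (a - b);nra.
apply: (letr (\sum_(j < J) 8 * (nsq (AV j f) - nsq (AV j.+1 f)))).
 by apply: ler_sum=> j _;exact: h.
rewrite (tele8 J (fun j=> nsq (AV j f)));have := nrm_AV 0 hf;have := nsq_ge0 (AV J f);rewrite -(nrm_sq (AV 0 f)).
by have := nrm_ge0 (AV 0 f);move: (nrm (AV 0 f)) (nrm f)=> a b *;nra.
Qed.

(** By the mean value theorem, the increment over [s j] of the average at scale [s j] is [s j] times
    the average of a partial derivative at some point. [near_sup] fixes one point per scale and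
    direction, and [bessel] sums the squares. This is the substitute for an embedding of H^1 into
    the bounded functions. *)
Lemma pp_exists f : tf f -> exists p : nat -> R,
 (forall j x i, `|dv (vv j i) (AV j f) x| <= p j) /\
 forall J, \sum_(j < J) p j ^+ 2 <= (5 * \sum_i nrm (dd i f)) ^+ 2.
move=> hf.
have hX (ji : nat * 'I_2) : exists x0, forall x, `|AV ji.1 (dd ji.2 f) x| <= 2 * `|AV ji.1 (dd ji.2 f) x0|.
 have [M _ hM] := tf_bound (tf_av (sp ji.1) (tf_dd ji.2 hf));exact: near_sup hM.
have [X hX'] := choice hX.
have [t [tB tS]] : exists t : nat -> 'I_2 -> R, (forall j x i, `|dv (vv j i) (AV j f) x| <= 2 * `|t j i|) /\
  forall J i, \sum_(j < J) t j i ^+ 2 <= 3 * nrm (dd i f) ^+ 2.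
 exists (fun j i=> s j * AV j (dd i f) (X (j, i)));split=> [j x i|J i];last first.
  rewrite nrm_sq;have B := bessel J (fun j=> X (j, i)) s00 (tf_dd i hf). exact B.
 have [u _ hu] := line_MVT i (x - vv j i) (s j) (tf_Sm (tf_av (sp j) hf)).
 have -> : dv (vv j i) (AV j f) x = s j * AV j (dd i f) (x - vv j i + u *: dir i).
  by rewrite -(dd_av i (sp j) hf) -hu subrK.
 have B : `|AV j (dd i f) (x - vv j i + u *: dir i)| <= 2 * `|AV j (dd i f) (X (j, i))| := hX' (j, i) _.
 have gen (a b : R) : `|a| <= 2 * `|b| -> `|s j * a| <= 2 * `|s j * b|.
  by move=> h;rewrite !(norm_pM _ (sp j)) mulrCA (ler_pM2l (sp j)).
 exact: gen _ _ B.
clear hX hX' X.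
exists (fun j=> 2 * (`|t j ord0| + `|t j ord_max|));split=> [j x i|J].
 apply: le_trans (tB j x i) _;rewrite (ler_pM2l (ltr0Sn R 1)).
 by case: (ord2P i)=> ->;rewrite ?lerDl ?lerDr.
apply: (letr (\sum_(j < J) 8 * (t j ord0 ^+ 2 + t j ord_max ^+ 2))).
 apply: ler_sum=> j _;rewrite -(real_normK (num_real (t j ord0))) -(real_normK (num_real (t j ord_max))).
 by move: `|t j ord0| `|t j ord_max| => a b;have := sqr_ge0 (a - b);nra.
have -> : \sum_(j < J) 8 * (t j ord0 ^+ 2 + t j ord_max ^+ 2) =
  8 * (\sum_(j < J) t j ord0 ^+ 2 + \sum_(j < J) t j ord_max ^+ 2).
 by rewrite -mulr_sumr big_split.
rewrite (sum2E (fun i=> nrm (dd i f))).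
exact: pp_arith (nrm_ge0 _) (nrm_ge0 _) (tS J ord0) (tS J ord_max).
Qed.

(** In each term of the telescoping sum one factor, [p j] or [q j], comes from [pp_exists] and one
    from [yy_sum]; both are square summable, so [sum_CS] applies with constant [5 * 3 = 15], and the
    four groups of terms are covered by [45]. *)
Lemma T3_av_bound phi A b : tf phi -> (forall i, tf (A i)) -> tf b ->
 `|T3 (AV 0 phi) (fun i=> AV 0 (A i)) (AV 0 b)| <=
 45 * ((\sum_i nrm (dd i phi)) * (\sum_i nrm (A i)) + nrm phi * nrm (dvg A)) * \sum_i nrm (dd i b).
move=> hp hA hb;have hg := tf_dvg hA.
have [p [bp Sp]] := pp_exists hp;have [q [bq Sq]] := pp_exists hb.
have p0 j : 0 <= p j := le_trans (normr_ge0 _) (bp j 0 ord0).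
have q0 j : 0 <= q j := le_trans (normr_ge0 _) (bq j 0 ord0).
pose TT j := T3 (AV j phi) (fun i=> AV j (A i)) (AV j b).
pose X i := nrm (dd i phi);pose a i := nrm (A i);pose z i := nrm (dd i b).
have tA j i : tf (AV j (A i)) by exact: tf_av.
have tp j := tf_av (sp j) hp;have tb j := tf_av (sp j) hb.
have gE j : dvg (fun i=> AV j (A i)) = AV j (dvg A).
 have e f x : tf f -> AV j f x = \I_y (f y * ha (s j) (x - y)).
  by move=> hf;rewrite /av (cvE _ (tf_L1 hf) (ha_ker (sp j))).
 have l f x : tf f -> L1 (fun y=> f y * ha (s j) (x - y)).
  move=> hf;apply: L2M;first exact: tf_L2.
  exact: L2_op (K2_L2 (ha_K2 (sp j))).
 apply/funext=> x;rewrite /dvg (e _ _ hg) (eq_I (g := fun y=> \sum_i dd i (A i) y * ha (s j) (x - y))).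
  rewrite I_sum;last by move=> i;apply: l;exact: tf_dd.
  by apply: eq_bigr=> i _;rewrite (dd_av i (sp j) (hA i)) e//;exact: tf_dd.
 by move=> y;rewrite mulr_suml.
have step j : `|TT j - TT j.+1| <= q j * (\sum_i X i * yy j (A i) + nrm phi * yy j (dvg A)) +
  p j * (\sum_i a i * yy j (dd i b) + \sum_i z i * yy j (A i)).
 pose v0 := vv j ord0;pose v1 := vv j ord_max.
 have S1 := T3_step (v := v0) (tp j) (tA j) (tb j) (fun x=> bp j x ord0) (fun x=> bq j x ord0).
 have bp1 x : `|dv v1 (Mv v0 (AV j phi)) x| <= p j.
  by rewrite dv_Mv;apply: Mv_bound=> y;exact: bp.
 have bq1 x : `|dv v1 (Mv v0 (AV j b)) x| <= q j.
  by rewrite dv_Mv;apply: Mv_bound=> y;exact: bq.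
 have S2 := T3_step (v := v1) (tf_Mv v0 (tp j)) (fun i=> tf_Mv v0 (tA j i)) (tf_Mv v0 (tb j)) bp1 bq1.
 have eT : TT j.+1 = T3 (Mv v1 (Mv v0 (AV j phi))) (fun i=> Mv v1 (Mv v0 (AV j (A i)))) (Mv v1 (Mv v0 (AV j b))).
  rewrite /TT (AV_S j hp) (AV_S j hb);congr (T3 _ _ _).
  by apply/funext=> i;rewrite (AV_S j (hA i)).
 rewrite eT -/(TT j) in S1 S2 *.
 have -> : TT j - T3 (Mv v1 (Mv v0 (AV j phi))) (fun i=> Mv v1 (Mv v0 (AV j (A i)))) (Mv v1 (Mv v0 (AV j b))) =
  (TT j - T3 (Mv v0 (AV j phi)) (fun i=> Mv v0 (AV j (A i))) (Mv v0 (AV j b))) +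
  (T3 (Mv v0 (AV j phi)) (fun i=> Mv v0 (AV j (A i))) (Mv v0 (AV j b)) -
  T3 (Mv v1 (Mv v0 (AV j phi))) (fun i=> Mv v1 (Mv v0 (AV j (A i)))) (Mv v1 (Mv v0 (AV j b)))).
  by rewrite addrA subrK.
 apply: le_normD;apply: le_trans (lerD S1 S2) _.
 rewrite addrACA -!mulrDr (dvg_Mv v0 (tA j)) gE.
 have n1 f : tf f -> nrm (AV j f) <= nrm f by exact: nrm_AV.
 have n2 f : tf f -> nrm (Mv v0 (AV j f)) <= nrm f.
  by move=> hf;apply: le_trans (nrm_Mv v0 (tf_L2 (tf_av (sp j) hf))) (n1 _ hf).
 have d1 f i : tf f -> nrm (dd i (AV j f)) <= nrm (dd i f).
  by move=> hf;rewrite (dd_av i (sp j) hf);apply: n1;exact: tf_dd.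
 have d2 f i : tf f -> nrm (dd i (Mv v0 (AV j f))) <= nrm (dd i f).
  by move=> hf;rewrite (dd_Mv v0 i (tf_av (sp j) hf)) (dd_av i (sp j) hf);apply: n2;exact: tf_dd.
 have e1 f i : tf f -> dd i (AV j f) = AV j (dd i f) by move=> hf;rewrite (dd_av i (sp j) hf).
 have e2 f i : tf f -> dd i (Mv v0 (AV j f)) = Mv v0 (AV j (dd i f)).
  by move=> hf;rewrite (dd_Mv v0 i (tf_av (sp j) hf)) (dd_av i (sp j) hf).
 have comb (c1 c2 c y1 y2 : R) : c1 <= c -> c2 <= c -> 0 <= y1 -> 0 <= y2 -> c1 * y1 + c2 * y2 <= c * (y1 + y2).
  by move=> ? ? ? ?;rewrite mulrDr;apply: lerD;apply: ler_wpM2r.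
 apply: lerD;[apply: (ler_wpM2l (q0 j))|apply: (ler_wpM2l (p0 j))].
  rewrite addrACA;apply: lerD;last exact: comb (n1 _ hp) (n2 _ hp) (nrm_ge0 _) (nrm_ge0 _).
  rewrite -big_split /=;apply: ler_sum=> i _.
  exact: comb (d1 _ _ hp) (d2 _ _ hp) (nrm_ge0 _) (nrm_ge0 _).
 rewrite addrACA;apply: lerD;rewrite -big_split /=;apply: ler_sum=> i _.
  rewrite (e1 _ _ hb) (e2 _ _ hb);exact: comb (n1 _ (hA i)) (n2 _ (hA i)) (nrm_ge0 _) (nrm_ge0 _).
 exact: comb (d1 _ _ hb) (d2 _ _ hb) (nrm_ge0 _) (nrm_ge0 _).
pose Xs := \sum_i X i;pose As := \sum_i a i;pose Zs := \sum_i z i.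
have X0 i : 0 <= X i by exact: nrm_ge0.
have a0 i : 0 <= a i by exact: nrm_ge0.
have z0 i : 0 <= z i by exact: nrm_ge0.
have Xs0 : 0 <= Xs by apply: sumr_ge0=> i _;exact: X0.
have Zs0 : 0 <= Zs by apply: sumr_ge0=> i _;exact: z0.
have le_sum (c : 'I_2 -> R) i : (forall i, 0 <= c i) -> c i <= \sum_i c i.
 by move=> c0;rewrite (bigD1 i)//= lerDl sumr_ge0.
have cs J (c : R) (r : nat -> R) f : 0 <= c -> (forall J, \sum_(j < J) r j ^+ 2 <= (5 * c) ^+ 2) -> tf f ->
  \sum_(j < J) r j * yy j f <= 15 * (c * nrm f).
 move=> c0 hr hf;have := sum_CS (p := fun j : 'I_J=> r j) (q := fun j : 'I_J=> yy j f) _ _ (hr J) (yy_sum J hf).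
 by rewrite (_ : 15 * _ = 5 * c * (3 * nrm f));[apply;rewrite mulr_ge0// nrm_ge0|ring].
have total J : `|TT 0 - TT J| <= 45 * (Xs * As + nrm phi * nrm (dvg A)) * Zs.
 have -> : TT 0 - TT J = \sum_(j < J) (TT j - TT j.+1).
  by elim: J=> [|J IH];[rewrite big_ord0 subrr|rewrite big_ord_recr /= -IH addrA subrK].
 apply: le_trans (ler_norm_sum _ _ _) _.
 apply: (letr (\sum_(j < J) (q j * (\sum_i X i * yy j (A i) + nrm phi * yy j (dvg A)) +
  p j * (\sum_i a i * yy j (dd i b) + \sum_i z i * yy j (A i))))).
  by apply: ler_sum=> j _;exact: step.
 rewrite (sum_tri J p q (fun j=> nrm phi * yy j (dvg A)) X a z (fun j i=> yy j (A i)) (fun j i=> yy j (dd i b))).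
 have csq f : tf f -> \sum_(j < J) q j * yy j f <= 15 * (Zs * nrm f) := cs J Zs q f Zs0 Sq.
 have csp f : tf f -> \sum_(j < J) p j * yy j f <= 15 * (Xs * nrm f) := cs J Xs p f Xs0 Sp.
 have pull (c : R) (r : nat -> R) f (K : R) : 0 <= c -> \sum_(j < J) r j * yy j f <= K ->
   \sum_(j < J) r j * (c * yy j f) <= c * K.
  by move=> c0 h;under eq_bigr do rewrite mulrCA;rewrite -mulr_sumr;exact: ler_wpM2l.
 have up (K c d : R) : 0 <= K -> c <= d -> 15 * (K * c) <= 15 * (K * d).
  by move=> K0 cd;apply: ler_wpM2l=> //;apply: ler_wpM2l.
 have r1 := sum_leM (fun i=> pull _ _ _ _ (X0 i) (le_trans (csq _ (hA i)) (up _ _ _ Zs0 (le_sum a i a0)))).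
 have r2 := pull _ _ _ _ (nrm_ge0 phi) (csq _ hg).
 have r3 := sum_leM (fun i=> pull _ _ _ _ (a0 i) (le_trans (csp _ (tf_dd i hb)) (up _ _ _ Xs0 (le_sum z i z0)))).
 have r4 := sum_leM (fun i=> pull _ _ _ _ (z0 i) (le_trans (csp _ (hA i)) (up _ _ _ Xs0 (le_sum a i a0)))).
 apply: le_trans (lerD (lerD r1 r2) (lerD r3 r4)) _.
 exact: (fin_arith _ _ Zs0 (nrm_ge0 phi) (nrm_ge0 (dvg A))).
(* At scale [2^J s0] the average of [phi] has sup norm at most its L^1 norm over the area, so the
   form vanishes in the limit of large scales and the telescoping sum is complete. *)
have tail : forall e, 0 < e -> exists J, `|TT J| <= e.
 move=> e e0;pose N := \I_y (`|phi y|) * (\sum_i a i * z i) / s0 ^+ 2.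
 exists (Num.truncn (N / e));set J := Num.truncn _.
 have s2 : 0 < s J ^+ 2 by rewrite exprn_gt0.
 have hJ : N / e < (2 ^+ J) ^+ 2.
  have j1 : J.+1%:R <= 2 ^+ J :> R by rewrite -natrX ler_nat ltn_expl.
  have j2 : 1 <= 2 ^+ J :> R by apply: exprn_ege1;rewrite ler1n.
  apply: lt_le_trans (truncnS_gt _) _;apply: le_trans j1 _;rewrite expr2.
  exact: le_self_sqr j2.
 have bs : `|TT J| <= \I_y (`|phi y|) / s J ^+ 2 * \sum_i a i * z i.
  rewrite mulr_sumr;apply: le_trans (ler_norm_sum _ _ _) _;apply: ler_sum=> i _.
  have bphi := av_sup (sp J) hp (lexx _).
  rewrite (eq_I (g := fun x=> AV J (A i) x * dd i (AV J b) x * AV J phi x))=> [|x];last by ring.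
  apply: le_trans (I_tri (tf_L2 (tA J i)) (tf_L2 (tf_dd i (tb J))) (Sm_mf (tf_Sm (tp J))) bphi) _.
  apply: ler_wpM2l;first by rewrite divr_ge0 ?(ltW s2)// I_ge0.
  have n1 : nrm (AV J (A i)) <= a i := nrm_AV J (hA i).
  have n2 := nrm_AV J (tf_dd i hb);rewrite -(dd_av i (sp J) hb) in n2.
  exact: ler_pM (nrm_ge0 _) (nrm_ge0 _) n1 n2.
 apply: le_trans bs _;rewrite exprMn.
 by apply: (tail_arith e0 _ _ hJ);rewrite exprn_gt0// exprn_gt0.
apply: le_eps=> e e0;have [J hJ] := tail e e0.
have := total J;rewrite -/(TT 0)=> h.
rewrite -(subrK (TT J) (TT 0));apply: le_normD;exact: lerD.
Qed.
End Fixed.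

Lemma trilinear_tf phi A b : tf phi -> (forall i, tf (A i)) -> tf b ->
 `|T3 phi A b| <=
 45 * ((\sum_i nrm (dd i phi)) * (\sum_i nrm (A i)) + nrm phi * nrm (dvg A)) * \sum_i nrm (dd i b).
move=> hp hA hb;apply: le_eps=> e e0;have e2 : 0 < e / 2 by rewrite divr_gt0.
have [M M0 hM] := tf_bound hp.
have [d0 d00 h0] := tri_approx (tf_K2 hp) hM (tf_K2 (hA ord0)) (tf_K2 (tf_dd ord0 hb)) e2.
have [d1 d10 h1] := tri_approx (tf_K2 hp) hM (tf_K2 (hA ord_max)) (tf_K2 (tf_dd ord_max hb)) e2.
pose s0 := Num.min d0 d1;have s00 : 0 < s0 by rewrite lt_min d00 d10.
have {}h0 := h0 _ _ (pk_ha s00) (ltac:(by rewrite /s0 ge_min lexx)).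
have {}h1 := h1 _ _ (pk_ha s00) (ltac:(by rewrite /s0 ge_min lexx orbT)).
have := T3_av_bound s00 hp hA hb;rewrite expr0 mul1r.
set B := 45 * _ * _=> hB.
have hd : `|T3 (av s0 phi) (fun i=> av s0 (A i)) (av s0 b) - T3 phi A b| <= e.
 have g0 : dd ord0 (av s0 b) = cv (dd ord0 b) (ha s0) := dd_av ord0 s00 hb.
 have g1 : dd ord_max (av s0 b) = cv (dd ord_max b) (ha s0) := dd_av ord_max s00 hb.
 rewrite -g0 in h0;rewrite -g1 in h1.
 rewrite (T3E phi) (T3E (av s0 phi));exact: two_dist h0 h1.
exact: dist_le hB hd.
Qed.

(* A div-curl estimate: [A . Db] pairs with the merely H^1 function [phi], although it is only in L^1. *)
Theorem trilinear phi b (Dp A Db : 'I_2 -> R * R -> R) g (M : R) :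
 (forall i, wd i phi (Dp i)) -> (forall x, `|phi x| <= M) -> (forall i, wd i b (Db i)) ->
 (forall i, K2 (A i)) -> K2 g ->
 (forall psi, tf psi -> \sum_i \I_x (A i x * dd i psi x) = - \I_x (g x * psi x)) ->
 `|\sum_i \I_x (phi x * A i x * Db i x)| <=
 45 * ((\sum_i nrm (Dp i)) * (\sum_i nrm (A i)) + nrm phi * nrm g) * \sum_i nrm (Db i).
move=> hp hM hb hA hg hdiv.
have Kp : K2 phi by case: (hp ord0).
have KDp i : K2 (Dp i) by case: (hp i).
have Kb : K2 b by case: (hb ord0).
have KDb i : K2 (Db i) by case: (hb i).
apply: le_eps=> e e0;have e2 : 0 < e / 2 by rewrite divr_gt0.
have [d0 d00 h0] := tri_approx Kp hM (hA ord0) (KDb ord0) e2.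
have [d1 d10 h1] := tri_approx Kp hM (hA ord_max) (KDb ord_max) e2.
pose d := Num.min d0 d1;have dp : 0 < d by rewrite lt_min d00 d10.
have [k hk] := moll_exists dp;have pkk := pk_moll hk;have tk : tf k by case: hk.
have {}h0 := h0 _ _ pkk (ltac:(by rewrite /d ge_min lexx)).
have {}h1 := h1 _ _ pkk (ltac:(by rewrite /d ge_min lexx orbT)).
have tp := K2_cv Kp tk;have tb := K2_cv Kb tk;have tA i := K2_cv (hA i) tk.
have ep i : dd i (cv phi k) = cv (Dp i) k by apply/funext=> x;exact: wd_dd_cv (hp i) tk.
have eb i : dd i (cv b k) = cv (Db i) k by apply/funext=> x;exact: wd_dd_cv (hb i) tk.
have eg : dvg (fun i=> cv (A i) k) = cv g k.
 apply/funext=> x;rewrite (cv_tfE _ (K2_L1 hg) tk).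
 have := hdiv _ (tf_refl x tk)=> /(congr1 -%R);rewrite opprK=> <-.
 rewrite -sumrN;apply: eq_bigr=> i _.
 rewrite (dd_cv _ _ (K2_L1 (hA i)) tk) (cv_tfE _ (K2_L1 (hA i)) (tf_dd i tk)).
 rewrite -IN;first by apply: eq_I=> y;rewrite (dd_refl _ _ _ tk) mulrN opprK.
 have := L1N (L1_cv_tf x (K2_L1 (hA i)) (tf_dd i tk));congr L1;apply/funext=> y.
 by rewrite (dd_refl _ _ _ tk) mulrN.
have := trilinear_tf tp tA tb;rewrite eg=> hB.
have {}hB : `|T3 (cv phi k) (fun i=> cv (A i) k) (cv b k)| <=
 45 * ((\sum_i nrm (Dp i)) * (\sum_i nrm (A i)) + nrm phi * nrm g) * \sum_i nrm (Db i).
 apply: le_trans hB _;apply: ler_pM.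
 - by rewrite mulr_ge0// addr_ge0// mulr_ge0// ?nrm_ge0//;apply: sumr_ge0=> i _;exact: nrm_ge0.
 - by apply: sumr_ge0=> i _;exact: nrm_ge0.
 - apply: ler_wpM2l=> //;apply: lerD.
   apply: ler_pM;try by apply: sumr_ge0=> i _;exact: nrm_ge0.
    by apply: ler_sum=> i _;rewrite ep;exact: nrm_cv pkk (KDp i).
   by apply: ler_sum=> i _;exact: nrm_cv pkk (hA i).
  by apply: ler_pM;rewrite ?nrm_ge0//;[exact: nrm_cv pkk Kp|exact: nrm_cv pkk hg].
 - by apply: ler_sum=> i _;rewrite eb;exact: nrm_cv pkk (KDb i).
have hd : `|T3 (cv phi k) (fun i=> cv (A i) k) (cv b k) - \sum_i \I_x (phi x * A i x * Db i x)| <= e.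
 rewrite -(eb ord0) in h0;rewrite -(eb ord_max) in h1.
 rewrite T3E (sum2E (fun i=> \I_x (phi x * A i x * Db i x)));exact: two_dist h0 h1.
exact: dist_le hB hd.
Qed.
End Trilinear2.

(** * Polar decomposition [u = lambda v] of a map staying away from the origin *)

Section Polar.
Context {R : realType}.
Implicit Types (f g phi psi k : R * R -> R) (x v : R * R) (i : 'I_2).

Lemma mf_inv f : mf f -> (forall x, 0 <= f x) -> mf (fun x=> (f x)^-1).
move=> hf f0;rewrite (_ : (fun _=> _) = (fun x=> f x `^ (-1)));last first.
 by apply/funext=> x;rewrite powR_inv1.
exact: (measurableT_comp (measurable_powR (-1)) hf).
Qed.
Lemma mf_sqrt f : mf f -> (forall x, 0 <= f x) -> mf (fun x=> Num.sqrt (f x)).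
move=> hf f0;rewrite (_ : (fun _=> _) = (fun x=> f x `^ 2^-1));last first.
 by apply/funext=> x;rewrite powR12_sqrt.
exact: (measurableT_comp (measurable_powR 2^-1) hf).
Qed.

Lemma D2_mf f : D2 f -> mf f. Proof. by case. Qed.
Lemma D2_abs f : D2 f -> D2 (fun x=> `|f x|).
by move=> hf;apply: (D2_le _ hf)=> [|x];[apply: mf_abs;case: hf|rewrite normr_id]. Qed.

Lemma inv_quad (c a b : R) : 0 < c -> c <= a -> c <= b ->
 `|b^-1 - a^-1 - - (a ^+ 2)^-1 * (b - a)| <= (c ^+ 3)^-1 * (b - a) ^+ 2.
move=> c0 ca cb;have a0 : 0 < a by exact: lt_le_trans ca.
have b0 : 0 < b by exact: lt_le_trans cb.
have -> : b^-1 - a^-1 - - (a ^+ 2)^-1 * (b - a) = (a ^+ 2 * b)^-1 * (b - a) ^+ 2.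
 by field;rewrite !gt_eqF.
rewrite ger0_norm;last by rewrite mulr_ge0 ?sqr_ge0// invr_ge0 mulr_ge0 ?sqr_ge0 ?ltW.
apply: ler_wpM2r;first exact: sqr_ge0.
rewrite lef_pV2 ?posrE ?mulr_gt0 ?exprn_gt0// exprSr.
by apply: ler_pM;rewrite ?sqr_ge0 ?(ltW c0)// ler_sqr ?nnegrE ?(ltW c0) ?(ltW a0).
Qed.

Lemma W2_inv i f g (c : R) : 0 < c -> (forall x, c <= f x) -> W2 i f g ->
 W2 i (fun x=> (f x)^-1) (fun x=> - (f x ^+ 2)^-1 * g x).
move=> c0 hc [hf hg hw];have f0 x : 0 < f x by exact: lt_le_trans (hc x).
have mfi : mf (fun x=> (f x)^-1) by apply: mf_inv=> [|x];[case: hf|exact: ltW].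
have mfi2 : mf (fun x=> - (f x ^+ 2)^-1).
 by apply: mfN;apply: mf_inv=> [|x];[apply: mfX;case: hf|exact: sqr_ge0].
have bi x : `|(f x)^-1| <= c^-1.
 by rewrite ger0_norm ?invr_ge0 ?(ltW (f0 x))// lef_pV2 ?posrE.
have bi2 x : `|- (f x ^+ 2)^-1| <= (c ^+ 2)^-1.
 rewrite normrN ger0_norm ?invr_ge0 ?sqr_ge0// lef_pV2 ?posrE ?exprn_gt0//.
 by rewrite ler_sqr ?nnegrE ?(ltW c0) ?(ltW (f0 x)).
have hD : D2 (fun x=> (f x)^-1) := D2_b mfi bi.
split=> //;first exact: D2_bM mfi2 bi2 hg.
have := @W_chain R 1 i (fun=> f) (fun=> g) (fun=> fun x=> - (f x ^+ 2)^-1) (fun x=> (f x)^-1) (c ^+ 2)^-1 (c ^+ 3)^-1.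
have -> : (fun x=> \sum_(j < 1) - (f x ^+ 2)^-1 * g x) = (fun x=> - (f x ^+ 2)^-1 * g x).
 by apply/funext=> x;rewrite big_ord1.
apply=> //.
- by rewrite invr_ge0 exprn_ge0 ?ltW.
- by move=> x y;rewrite !big_ord1;exact: inv_quad.
Qed.

Definition en n (z : 'I_n -> R * R -> R) x := Num.sqrt (\sum_j z j x ^+ 2).
Lemma ss_ge0 n (z : 'I_n -> R) : 0 <= \sum_j z j ^+ 2.
by apply: sumr_ge0=> j _;exact: sqr_ge0. Qed.
Lemma en_sq n (z : 'I_n -> R * R -> R) x : en z x ^+ 2 = \sum_j z j x ^+ 2.
by rewrite sqr_sqrtr// ss_ge0. Qed.
Lemma en_ge0 n (z : 'I_n -> R * R -> R) x : 0 <= en z x. Proof. exact: sqrtr_ge0. Qed.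
Lemma en_mf n (z : 'I_n -> R * R -> R) : (forall j, mf (z j)) -> mf (en z).
by move=> h;apply: mf_sqrt=> [|x];[apply: mf_sum=> j;exact: mfX|exact: ss_ge0]. Qed.
Lemma en_ge n (z : 'I_n -> R * R -> R) j x : `|z j x| <= en z x.
rewrite -ler_sqr ?nnegrE ?en_ge0// en_sq real_normK ?num_real// (bigD1 j)//= lerDl.
by apply: sumr_ge0=> k _;exact: sqr_ge0.
Qed.
Lemma en_le n (z : 'I_n -> R * R -> R) x : en z x <= \sum_j `|z j x|.
rewrite -ler_sqr ?nnegrE ?en_ge0 ?sumr_ge0// en_sq.
elim: n z=> [|n IH] z;first by rewrite !big_ord0 expr0n.
rewrite !big_ord_recl;have := IH (fun j=> z (lift ord0 j)).
set s := \sum_j _;set t := \sum_j _=> h.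
have t0 : 0 <= t by apply: sumr_ge0.
rewrite sqrrD real_normK ?num_real// -addrA lerD2l;apply: le_trans h _.
by rewrite lerDr mulrn_wge0// mulr_ge0.
Qed.
Lemma D2_en n (z : 'I_n -> R * R -> R) : (forall j, D2 (z j)) -> D2 (en z).
move=> h;apply: (D2_le _ (D2_sum (fun j=> D2_abs (h j))))=> [|x];first by apply: en_mf=> j;case: (h j).
by rewrite !ger0_norm ?en_ge0 ?sumr_ge0//;exact: en_le.
Qed.

(** With [p] the inner product of [y] and [z], the left side is [(a b - p) / a], nonnegative by
    Cauchy-Schwarz, and [|z - y|^2 = a^2 + b^2 - 2 p] is at least [2 (a b - p)]. *)
Lemma norm_quad n (y z : 'I_n -> R) (a b c : R) : 0 < c -> c <= a -> 0 <= b ->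
 a ^+ 2 = \sum_j y j ^+ 2 -> b ^+ 2 = \sum_j z j ^+ 2 ->
 `|b - a - \sum_j y j / a * (z j - y j)| <= c^-1 * \sum_j (z j - y j) ^+ 2.
move=> c0 ca b0 ha hb;have a0 : 0 < a by exact: lt_le_trans ca.
have an0 : a != 0 by rewrite gt_eqF.
pose p := \sum_j y j * z j.
have hp : p <= a * b by apply: sum_CS;rewrite ?(ltW a0)// -?ha -?hb.
have -> : b - a - \sum_j y j / a * (z j - y j) = (a * b - p) / a.
 have -> : \sum_j y j / a * (z j - y j) = (p - a ^+ 2) / a.
  by rewrite ha /p -sumrB mulr_suml;apply: eq_bigr=> j _;field.
 by field.
have -> : \sum_j (z j - y j) ^+ 2 = a ^+ 2 + b ^+ 2 - 2 * p.
 by rewrite ha hb /p mulr_sumr -big_split -sumrB /=;apply: eq_bigr=> j _;ring.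
rewrite ger0_norm;last by rewrite divr_ge0 ?(ltW a0)// subr_ge0.
rewrite mulrC;apply: ler_pM;rewrite ?invr_ge0 ?(ltW a0) ?subr_ge0//.
 by rewrite lef_pV2 ?posrE.
by have := sqr_ge0 (a - b);lra.
Qed.

Section PolarOf.
Variables (n : nat) (z : 'I_n -> R * R -> R) (Dz : 'I_n -> 'I_2 -> R * R -> R) (c : R).
Hypotheses (c0 : 0 < c) (hc : forall x, c <= en z x) (hz : forall j i, W2 i (z j) (Dz j i)).
(** The direction of [z]; the next two definitions are the derivatives of its modulus and of its
    direction. [pDzE] and [pDn_orth] say that the gradient splits orthogonally into these two
    parts. *)
Definition pn j x := z j x / en z x.
Definition pDm i x := \sum_j pn j x * Dz j i x.
Definition pDn j i x := (Dz j i x - pn j x * pDm i x) / en z x.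

Let m0 x : 0 < en z x. Proof. exact: lt_le_trans (hc x). Qed.
Let D2z j : D2 (z j). Proof. by case: (hz j ord0). Qed.
Let D2Dz j i : D2 (Dz j i). Proof. by case: (hz j i). Qed.
Let menz : mf (en z). Proof. by apply: en_mf=> j;case: (D2z j). Qed.
Let minv : mf (fun x=> (en z x)^-1). Proof. by apply: mf_inv=> [//|x];exact: ltW. Qed.
Let binv x : `|(en z x)^-1| <= c^-1.
by rewrite ger0_norm ?invr_ge0 ?(ltW (m0 x))// lef_pV2 ?posrE. Qed.

Lemma pn_mf j : mf (pn j).
by apply: mfM=> //;case: (D2z j). Qed.
Lemma pn_abs j x : `|pn j x| <= 1.
rewrite /pn normrM [ `|_^-1| ]gtr0_norm ?invr_gt0// ler_pdivrMr// mul1r;exact: en_ge.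
Qed.
Lemma pn_sq x : \sum_j pn j x ^+ 2 = 1.
under eq_bigr do rewrite /pn expr_div_n;rewrite -mulr_suml -en_sq divff// expf_neq0// gt_eqF//.
Qed.
Lemma pDzE j i x : Dz j i x = pDm i x * pn j x + en z x * pDn j i x.
by rewrite /pDn;field;rewrite gt_eqF. Qed.
Lemma pDn_orth i x : \sum_j pn j x * pDn j i x = 0.
have -> : \sum_j pn j x * pDn j i x = \sum_j (pn j x * Dz j i x / en z x - pn j x ^+ 2 * (pDm i x / en z x)).
 by apply: eq_bigr=> j _;rewrite /pDn;ring.
by rewrite sumrB -!mulr_suml pn_sq mul1r subrr.
Qed.
Lemma D2_pDm i : D2 (pDm i).
by apply: D2_sum=> j;exact: D2_bM (pn_mf j) (pn_abs j) (D2Dz j i). Qed.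
Lemma W2_en i : W2 i (en z) (pDm i).
split;[exact: D2_en|exact: D2_pDm|].
apply: (@W_chain R n i z (fun j=> Dz j i) pn (en z) 1 c^-1)=> //.
- exact: D2_en.
- exact: pn_mf.
- exact: pn_abs.
- by rewrite invr_ge0 ltW.
- by move=> x y;apply: norm_quad=> //;rewrite ?en_ge0 ?en_sq.
Qed.
(** The product is [Dz] minus its radial part, so the weighted derivative [lambda Dv] is square
    integrable before any upper bound on the modulus is known. *)
Lemma D2_mDn j i : D2 (fun x=> en z x * pDn j i x).
rewrite (_ : (fun _=> _) = fun x=> Dz j i x - pn j x * pDm i x).
 by apply: D2_B=> //;exact: D2_bM (pn_mf j) (pn_abs j) (D2_pDm i).
by apply/funext=> x;rewrite /pDn mulrCA divff ?mulr1// gt_eqF.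
Qed.
Lemma D2_pDn j i : D2 (pDn j i).
rewrite (_ : pDn j i = fun x=> (en z x)^-1 * (Dz j i x - pn j x * pDm i x)).
 apply: (D2_bM minv binv);apply: D2_B=> //;exact: D2_bM (pn_mf j) (pn_abs j) (D2_pDm i).
by apply/funext=> x;rewrite /pDn mulrC.
Qed.
Lemma W2_pn j i : W2 i (pn j) (pDn j i).
split;[exact: D2_b (pn_mf j) (pn_abs j)|exact: D2_pDn|].
have := W_mul (hz j i) (W2_inv c0 hc (W2_en i));apply: W_ext=> x _ //.
by rewrite /pDn /pn;field;rewrite gt_eqF.
Qed.
End PolarOf.

Lemma polar_sq n (v dv : 'I_n -> R) (l dl : R) : \sum_j v j ^+ 2 = 1 -> \sum_j v j * dv j = 0 ->
 \sum_j (dl * v j + l * dv j) ^+ 2 = dl ^+ 2 + l ^+ 2 * \sum_j dv j ^+ 2.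
move=> h1 h2.
have -> : \sum_j (dl * v j + l * dv j) ^+ 2 =
 \sum_j (dl ^+ 2 * v j ^+ 2 + (2 * dl * l * (v j * dv j) + l ^+ 2 * dv j ^+ 2)).
 by apply: eq_bigr=> j _;ring.
by rewrite !big_split /= -!mulr_sumr h1 h2 mulr1 mulr0 add0r.
Qed.
Lemma polar_dot n (v dv : 'I_n -> R) (l dl p dp : R) : \sum_j v j ^+ 2 = 1 -> \sum_j v j * dv j = 0 ->
 \sum_j (dl * v j + l * dv j) * (dp * v j + p * dv j) = dl * dp + l * p * \sum_j dv j ^+ 2.
move=> h1 h2.
have -> : \sum_j (dl * v j + l * dv j) * (dp * v j + p * dv j) =
 \sum_j (dl * dp * v j ^+ 2 + ((dl * p + l * dp) * (v j * dv j) + l * p * dv j ^+ 2)).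
 by apply: eq_bigr=> j _;ring.
by rewrite !big_split /= -!mulr_sumr h1 h2 mulr1 mulr0 add0r.
Qed.

(* The weak derivatives see the values of [u] only up to null sets and off the disk, so [u] may be
 replaced by globally defined components that avoid the unit ball everywhere. *)
Lemma good_repr N (u : R * R -> 'rV[R]_N) : (0 < N)%N -> X_space (solid_ball N) u ->
 exists (U : 'I_N -> R * R -> R) (G : 'I_N -> 'I_2 -> R * R -> R),
 [/\ forall j i, W2 i (U j) (G j i), forall x, 1 <= en U x,
  {ae leb2, forall x, disk x -> forall j, component u j x = U j x} &
  forall j, mf (msk (component u j))].
move=> N0 [h1 hae].
pose j0 : 'I_N := Ordinal N0.
have hm j : L2 (msk (component u j)) by apply/L2_diskP;case: (h1 j).
have /choice[g hg] : forall ji : 'I_N * 'I_2, exists g, L2_disk g /\ is_weak_partial ji.2 (component u ji.1) g.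
 by move=> [j i];have [_ /(_ i)[g]] := h1 j;exists g.
pose M j := msk (component u j).
pose S := [set x | 1 <= en M x].
have mM : mf (en M) by apply: en_mf=> j;case: (hm j).
have mS : measurable S.
 rewrite (_ : S = en M @^-1` `[1, +oo[%classic);last by apply/seteqP;split=> x;rewrite /S /= in_itv /= andbT.
 by rewrite -[X in measurable X]setTI;apply: mM=> //;exact: measurable_itv.
(* Off [S], that is on a null part of the disk and outside the disk, the value is replaced by a
   fixed unit vector, so that [en U >= 1] holds everywhere. *)
pose U j x := \1_S x * M j x + (1 - \1_S x) * (j == j0)%:R.
pose G j i := msk (g (j, i)).
have UE x : S x -> forall j, U j x = M j x by move=> h j;rewrite /U indT// subrr mul0r addr0 mul1r.
have UN x : ~ S x -> forall j, U j x = (j == j0)%:R by move=> h j;rewrite /U indF// mul0r add0r subr0 mul1r.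
have mU j : mf (U j).
 have mi := mf_ind mS;apply: mfD;first by apply: mfM=> //;case: (hm j).
 by apply: mfM;[apply: mfB=> //;exact: mfc|exact: mfc].
have aeU : {ae leb2, forall x, disk x -> forall j, component u j x = U j x}.
 apply: filterS hae=> x hx dx j;rewrite UE;first by rewrite /M mskT.
 have -> : S x = (1 <= enorm (u x)) by rewrite /S /= /en /enorm;under eq_bigr do rewrite /M mskT//.
 by rewrite leNgt;apply/negP;exact: hx.
exists U, G;split=> //;last by move=> j;case: (hm j).
- move=> j i;have [hg1 hg2] := hg (j, i).
 have D2G : D2 (G j i) by apply: L2_msk_D2;apply/L2_diskP.
 split=> //.
  split=> //;apply: (L2_ae _ (hm j));first exact: mf_msk.
  apply: filterS aeU=> x hx;have [dx|dx] := pselect (disk x);last by rewrite !mskF.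
  by rewrite !mskT// hx.
 apply: (@W_ae R i (M j));[by case: (hm j)|exact: mU| |exact/weakP].
 by apply: filterS aeU=> x hx dx;rewrite /M mskT// hx.
move=> x;have [h|h] := pselect (S x).
 rewrite (_ : en U x = en M x)//;rewrite /en;congr Num.sqrt;apply: eq_bigr=> j _;by rewrite UE.
rewrite /en (bigD1 j0)//= big1 ?addr0;last by move=> j /negPf hj;rewrite UN// hj expr0n.
by rewrite UN// eqxx expr1n sqrtr1.
Qed.
End Polar.

(** * Linear operations on weak derivatives and vector-valued test functions *)

Section Weak.
Context {R : realType}.
Implicit Types (f g phi psi k : R * R -> R) (x v : R * R) (i : 'I_2).

Lemma W2_D i f f' g g' : W2 i f f' -> W2 i g g' -> W2 i (fun x=> f x + g x) (fun x=> f' x + g' x).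
move=> [hf hf' wf] [hg hg' wg];split;[exact: D2_D|exact: D2_D|]=> phi hp.
have hd := cd_dd i hp.
rewrite (eq_I (g := fun x=> f x * dd i phi x + g x * dd i phi x))=> [|x];last by rewrite mulrDl.
rewrite (ID (D2_L1 hd hf) (D2_L1 hd hg)) (wf _ hp) (wg _ hp) -opprD -(ID (D2_L1 hp hf') (D2_L1 hp hg')).
by congr (- _);apply: eq_I=> x;rewrite mulrDl.
Qed.
Lemma W2_Z i (c : R) f f' : W2 i f f' -> W2 i (fun x=> c * f x) (fun x=> c * f' x).
move=> [hf hf' wf];split;[exact: D2_Z|exact: D2_Z|]=> phi hp.
have hd := cd_dd i hp.
rewrite (eq_I (g := fun x=> c * (f x * dd i phi x)))=> [|x];last by rewrite mulrA.
rewrite (IZ _ (D2_L1 hd hf)) (wf _ hp) mulrN -(IZ _ (D2_L1 hp hf')).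
by congr (- _);apply: eq_I=> x;rewrite mulrA.
Qed.
Lemma D2_cdf phi : cd phi -> D2 phi.
by move=> h;exact: L2_msk_D2' (tf_K2 (cd_tf h)). Qed.
Lemma W2_cd i phi : cd phi -> W2 i phi (dd i phi).
move=> h;split;[exact: D2_cdf|exact: D2_cdf (cd_dd i h)|].
by move=> psi hp;apply: IBP;[exact: cd_Sm|exact: cd_tf].
Qed.
Lemma mskM f g x : msk (fun y=> f y * g y) x = msk f x * msk g x.
have [h|h] := pselect (disk x);first by rewrite !mskT.
by rewrite !mskF// mul0r.
Qed.
Lemma D2M f g : D2 f -> D2 g -> L1 (msk (fun x=> f x * g x)).
by move=> [_ hf] [_ hg];have := L2M hf hg;congr L1;apply/funext=> x;rewrite mskM. Qed.
Lemma msk_sum n (F : 'I_n -> R * R -> R) x : msk (fun x=> \sum_j F j x) x = \sum_j msk (F j) x.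
by rewrite /msk mulr_sumr. Qed.
Lemma L1_msk_sum n (F : 'I_n -> R * R -> R) : (forall j, L1 (msk (F j))) -> L1 (msk (fun x=> \sum_j F j x)).
by move=> h;have := L1_sum h;congr L1;apply/funext=> x;rewrite msk_sum. Qed.

Lemma T1_arith (a y z : R) : 0 <= y -> 0 <= z -> z ^+ 2 <= a -> y <= z / 4 + 5 / 16 -> y ^+ 2 <= (a + 1) / 2.
move=> y0 z0 h1 h2.
have : y ^+ 2 <= (z / 4 + 5 / 16) ^+ 2 by rewrite ler_sqr ?nnegrE//;lra.
by have := sqr_ge0 (z - 5 / 4);nra.
Qed.

Lemma is_derive_scalew n x v f (l : R) (w : 'rV[R]_n) : is_derive x v f l ->
 is_derive x v (fun y=> f y *: w) (l *: w).
move=> [df <-];have h : (fun t : R=> t^-1 *: ((fun y=> f y *: w) (t *: v + x) - f x *: w)) @ 0^' --> 'D_v f x *: w.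
 rewrite (_ : (fun t : R=> _) = (fun t : R=> (t^-1 *: (f (t *: v + x) - f x)) *: w)).
  by apply: cvgZr_tmp;exact: df.
 by apply/funext=> t;rewrite -scalerBl scalerA.
by split;[apply/cvg_ex;exists ('D_v f x *: w)|apply/cvg_lim].
Qed.
Lemma Ck_scalew n (k : nat) f (w : 'rV[R]_n) : Sm f -> Ck_on setT k (fun y=> f y *: w).
elim: k f=> [|k IH] f hf.
 by split=> // x _;apply: cvgZr_tmp;exact: Sm_cont hf x.
split;first by move=> x _;apply: cvgZr_tmp;exact: Sm_cont hf x.
move=> i;have hd x := is_derive_scalew w (Sm_der i x hf).
split;first by move=> x _;case: (hd x).
rewrite (_ : 'D_(dir i) _ = fun y=> dd i f y *: w);first by apply: IH;exact: Sm_dd.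
by apply/funext=> x;case: (hd x).
Qed.
Lemma cd_scalew n f (w : 'rV[R]_n) : cd f -> Ccinfty_disk (fun y=> f y *: w).
move=> hf;have /cdP[_ [K [cK Kd hK]]] := hf;split;first by move=> k;apply: Ck_scalew;exact: cd_Sm.
by exists K;split=> // x hx;rewrite hK// scale0r.
Qed.
End Weak.

(** * First variations of the Dirichlet energy *)

Section Critical.
Context {R : realType}.
Variables (N : nat) (u : R * R -> 'rV[R]_N) (U : 'I_N -> R * R -> R) (G : 'I_N -> 'I_2 -> R * R -> R).
Hypotheses (hU : forall j i, W2 i (U j) (G j i)) (U1 : forall x, 1 <= en U x)
 (uU : {ae leb2, forall x, disk x -> forall j, component u j x = U j x})
 (mu : forall j, mf (msk (component u j))) (crit : critical u).
Implicit Types (f g phi psi : R * R -> R) (x v : R * R) (i : 'I_2).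
Local Notation lam := (en U).
Local Notation V := (pn U).
Local Notation DL := (pDm U G).
Local Notation DV := (pDn U G).

Let M j := msk (component u j).
Let mM : mf (en M). Proof. by apply: en_mf. Qed.
Let mMi : mf (fun x=> (en M x)^-1). Proof. by apply: mf_inv=> [//|x];exact: en_ge0. Qed.
Let enM x : disk x -> en M x = enorm (u x).
by move=> dx;rewrite /en /enorm;congr Num.sqrt;apply: eq_bigr=> j _;rewrite /M mskT. Qed.
Let enU x : (forall j, component u j x = U j x) -> enorm (u x) = lam x.
by move=> h;rewrite /en /enorm;congr Num.sqrt;apply: eq_bigr=> j _;rewrite -h. Qed.
Let lam0 x : 0 < lam x. Proof. exact: lt_le_trans (U1 x). Qed.
Let D2U j : D2 (U j). Proof. by case: (hU j ord0). Qed.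
Let W2V j i := W2_pn ltr01 U1 hU j i.
Let W2L i := W2_en ltr01 U1 hU i.
Let V1 x : \sum_j V j x ^+ 2 = 1 := pn_sq ltr01 U1 x.
Let VDV i x : \sum_j V j x * DV j i x = 0 := pDn_orth G ltr01 U1 i x.
Let GE j i x : G j i x = DL i x * V j x + lam x * DV j i x := pDzE G ltr01 U1 j i x.
Let mV j : mf (V j) := pn_mf ltr01 U1 hU j.
Let bV j x : `|V j x| <= 1 := pn_abs ltr01 U1 j x.

(** Along [(lambda + e phi) v] the energy is exactly a quadratic polynomial [a + 2 e b + e^2 c], so
    the one-sided derivative of the definition is [2 b]; [polar_dot] rewrites [b] as the stated
    integral. Boundedness of [phi] keeps [phi v] in H^1. *)
Lemma radial_variation phi (P : 'I_2 -> R * R -> R) (r B e0 : R) : r < 1 -> (forall x, r < E2 x -> phi x = 0) ->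
 (forall x, `|phi x| <= B) -> (forall i, W2 i phi (P i)) -> 0 < e0 ->
 (forall e x, 0 < e -> e <= e0 -> 1 <= lam x + e * phi x) ->
 0 <= I (msk (fun x=> \sum_i (DL i x * P i x + lam x * phi x * \sum_j DV j i x ^+ 2))).
move=> r1 hr hB hP e00 he0;have [crit1 _] := crit.
have D2p : D2 phi by case: (hP ord0).
have D2P i : D2 (P i) by case: (hP i).
pose K j i x := P i x * V j x + phi x * DV j i x.
have WK j i : W2 i (fun x=> phi x * V j x) (K j i).
 have D2V : D2 (V j) by case: (W2V j i).
 have D2DV : D2 (DV j i) by case: (W2V j i).
 split.
 - by have := D2_bM (mV j) (bV j) D2p;congr D2;apply/funext=> x;rewrite mulrC.
 - apply: D2_D;last exact: D2_bM (D2_mf D2p) hB D2DV.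
  by have := D2_bM (mV j) (bV j) (D2P i);congr D2;apply/funext=> x;rewrite mulrC.
 - exact: W_mul (hP i) (W2V j i).
pose w (e : R) x := (enorm (u x) + e * phi x) *: normalize (u x).
pose F (e : R) j x := U j x + e * (phi x * V j x).
pose DF (e : R) j i x := G j i x + e * K j i x.
have WF e j i : W2 i (F e j) (DF e j i) by exact: W2_D (hU j i) (W2_Z e (WK j i)).
have wF e : {ae leb2, forall x, disk x -> forall j, component (w e) j x = F e j x}.
 apply: filterS uU=> x hx dx j;have ex := enU (hx dx).
 rewrite /component /w /normalize !mxE ex;have := hx dx j;rewrite /component=> ->.
 by rewrite /F /pn;field;rewrite gt_eqF.
have mw e j : mf (msk (component (w e) j)).
 rewrite (_ : msk _ = fun x=> (en M x + e * phi x) * ((en M x)^-1 * M j x)).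
  apply: mfM;first by apply: mfD=> //;apply: mfZ;exact: D2_mf.
  by apply: mfM=> //;exact: mu.
 apply/funext=> x;have [dx|dx] := pselect (disk x);last by rewrite mskF// /M mskF// !mulr0.
 by rewrite mskT// /component /w /normalize !mxE (enM dx) /M mskT.
have hD e := Dirichlet_E (mw e) (wF e) (WF e).
pose a := I (msk (fun x=> \sum_j \sum_i G j i x * G j i x)).
pose b := I (msk (fun x=> \sum_j \sum_i G j i x * K j i x)).
pose c := I (msk (fun x=> \sum_j \sum_i K j i x * K j i x)).
have D2G j i : D2 (G j i) by case: (hU j i).
have D2K j i : D2 (K j i) by case: (WK j i).
have La : L1 (msk (fun x=> \sum_j \sum_i G j i x * G j i x)).
 by apply: L1_msk_sum=> j;apply: L1_msk_sum=> i;exact: D2M.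
have Lb : L1 (msk (fun x=> \sum_j \sum_i G j i x * K j i x)).
 by apply: L1_msk_sum=> j;apply: L1_msk_sum=> i;exact: D2M.
have Lc : L1 (msk (fun x=> \sum_j \sum_i K j i x * K j i x)).
 by apply: L1_msk_sum=> j;apply: L1_msk_sum=> i;exact: D2M.
have hE e : Dirichlet (w e) = a + (2 * e) * b + e ^+ 2 * c.
 have [_ ->] := hD e;rewrite -(IZ _ Lb) -(IZ _ Lc) -(ID La (L1Z _ Lb)) -(ID (L1D La (L1Z _ Lb)) (L1Z _ Lc)).
 apply: eq_I=> x;rewrite /msk [2 * e * _]mulrCA [e ^+ 2 * _]mulrCA -!mulrDr;congr (_ * _).
 rewrite !mulr_sumr -!big_split /=;apply: eq_bigr=> j _.
 rewrite !mulr_sumr -!big_split /=;apply: eq_bigr=> i _.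
 by rewrite /DF;ring.
have adm : admissible u phi.
 split;first exact: H10_of_W2 r1 hr hP.
 near=> e;split;last by case: (hD e).
 have e_gt0 : 0 < e by near: e;exact: nbhs_right_gt.
 have e_le : e <= e0 by near: e;exact: nbhs_right_le.
 by apply: filterS uU=> x hx dx;rewrite (enU (hx dx));exact: he0.
have [l hl l0] := crit1 _ adm.
have h2 : (fun e : R=> 2 * b + e * c) @ 0^'+ --> 2 * b + 0 * c.
 apply: cvgD;first exact: cvg_cst.
 by apply: cvgM;[apply: cvg_at_right_filter;exact: cvg_id|exact: cvg_cst].
have h3 : (fun e : R=> (Dirichlet (w e) - Dirichlet (w 0)) / e) @ 0^'+ --> 2 * b + 0 * c.
 apply: cvg_trans h2;apply: near_eq_cvg;near=> e.
 have e_gt0 : 0 < e by near: e;exact: nbhs_right_gt.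
 by rewrite !hE;field;rewrite gt_eqF.
have lb : l = 2 * b + 0 * c by exact: (cvg_unique _ hl h3).
have b0 : 0 <= b by move: l0;rewrite lb mul0r addr0 pmulr_rge0.
apply: le_trans b0 _;rewrite le_eqVlt;apply/orP;left;apply/eqP;apply: eq_I=> x;rewrite /msk;congr (_ * _).
rewrite exchange_big /=;apply: eq_bigr=> i _.
rewrite -(polar_dot (lam x) (DL i x) (phi x) (P i x) (V1 x) (VDV i x)).
by apply: eq_bigr=> j _;rewrite GE.
Unshelve. all: by end_near.
Qed.

(** One partial derivative at one point, with [a = |Dv|^2], [nu = v_j], [de = Dv_j], [p = psi] and
    [d = D psi]. Here [m] is the squared norm of [v + e psi e_j] and [T] half its derivative, so the
    quotient expression is the squared derivative of the normalized map. The bounds by [1/4] keep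
    [m >= 1/2], and the error is quadratic in [e] with a weight linear in [a]. *)
Lemma tangent_quad (a nu p d de e : R) : 0 <= a -> `|nu| <= 1 -> `|p| <= 4^-1 -> `|d| <= 4^-1 ->
 de ^+ 2 <= a -> `|e| <= 1 ->
 let m := 1 + 2 * e * (nu * p) + e ^+ 2 * p ^+ 2 in
 let T := e * (p * de + nu * d) + e ^+ 2 * (p * d) in
 2^-1 <= m /\
 `|(a + 2 * e * (d * de) + e ^+ 2 * d ^+ 2) / m - T ^+ 2 / m ^+ 2 - a - e * (2 * (d * de - a * (nu * p)))| <=
 4 * e ^+ 2 * (a + 1).
move=> a0 hnu hp hd hde he m T.
pose s := nu * p;pose b := d * de;pose q := p ^+ 2.
have hs : `|s| <= 4^-1 by rewrite /s normrM -[leRHS]mul1r;apply: ler_pM.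
have hes : `|e * s| <= 4^-1 by rewrite normrM -[leRHS]mul1r;apply: ler_pM.
have q0 : 0 <= q by exact: sqr_ge0.
have hq : q <= 16^-1 by rewrite /q -real_normK ?num_real//;have := normr_ge0 p;nra.
have hm : 2^-1 <= m.
 have := mulr_ge0 (sqr_ge0 e) q0;move: hes;rewrite ler_norml=> /andP[h1 _].
 by rewrite /m -/s -/q (_ : 2 * e * s = 2 * (e * s));[lra|ring].
have m0 : 0 < m by apply: lt_le_trans hm.
split=> //.
have hdea : `|de| <= (a + 1) / 2.
 have := sqr_ge0 (`|de| - 1);have : `|de| ^+ 2 <= a by rewrite real_normK ?num_real.
 by move: `|de| => y *;nra.
have hb : `|b| <= (a + 1) / 8.
 rewrite /b normrM;apply: le_trans (ler_pM _ _ hd hdea) _=> //;lra.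
have has : `|a * s| <= a / 4 by rewrite normrM (ger0_norm a0) ler_wpM2l.
have hbs : `|b - a * s| <= (a + 1) * (3 / 8).
 apply: le_normB;apply: le_trans (lerD hb has) _;lra.
pose N1 := d ^+ 2 - a * q - 4 * s * (b - a * s) - 2 * e * q * (b - a * s).
have hN : `|N1| <= a + 1.
 have d2 : `|d ^+ 2| <= 16^-1 by rewrite normrX;have := normr_ge0 d;move: hd;move: `|d| => y *;nra.
 have aq : `|a * q| <= a / 16 by rewrite normrM (ger0_norm a0) (ger0_norm q0) ler_wpM2l.
 have t1 : `|4 * s * (b - a * s)| <= (a + 1) * (3 / 8).
  rewrite normrM -[leRHS]mul1r;apply: ler_pM=> //.
  by rewrite normrM ger0_norm// mulrC -ler_pdivlMr// mul1r.
 have t2 : `|2 * e * q * (b - a * s)| <= (a + 1) * (3 / 8).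
  rewrite normrM -[leRHS]mul1r;apply: ler_pM=> //.
  rewrite normrM (ger0_norm q0) normrM ger0_norm//.
  by have := normr_ge0 e;move: he;move: `|e| => y *;nra.
 apply: le_normB;apply: le_trans (lerD (ler_normB _ _) (lexx _)) _.
 apply: le_trans (lerD (lerD (ler_normB _ _) (lexx _)) (lexx _)) _.
 apply: le_trans (lerD (lerD (lerD d2 aq) t1) t2) _;lra.
pose T1 := p * de + nu * d + e * (p * d).
have hT : T1 ^+ 2 <= (a + 1) / 2.
 have t1 : `|p * de| <= `|de| / 4 by rewrite normrM mulrC ler_wpM2l.
 have t2 : `|nu * d| <= 4^-1 by rewrite normrM -[leRHS]mul1r;apply: ler_pM.
 have t3 : `|e * (p * d)| <= 16^-1.
  rewrite normrM -[leRHS]mul1r;apply: ler_pM=> //;rewrite normrM.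
  rewrite (_ : 16^-1 = 4^-1 * 4^-1 :> R);[exact: ler_pM|lra].
 have : `|T1| <= `|de| / 4 + 5 / 16.
  apply: le_normD;apply: le_trans (lerD (ler_normD _ _) (lexx _)) _;lra.
 have h2 : `|de| ^+ 2 <= a by rewrite real_normK ?num_real.
 rewrite -(real_normK (num_real T1));exact: T1_arith (normr_ge0 _) (normr_ge0 _) h2.
have -> : (a + 2 * e * (d * de) + e ^+ 2 * d ^+ 2) / m - T ^+ 2 / m ^+ 2 - a - e * (2 * (d * de - a * (nu * p))) =
 e ^+ 2 * (N1 / m - T1 ^+ 2 / m ^+ 2).
 have E1 : a + 2 * e * (d * de) + e ^+ 2 * d ^+ 2 = (a + 2 * e * (b - a * s)) * m + e ^+ 2 * N1.
  by rewrite /m /N1 /b /s /q;ring.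
 have E2 : T = e * T1 by rewrite /T /T1;ring.
 have gen (X m' n t : R) : m' != 0 -> (X * m' + e ^+ 2 * n) / m' - (e * t) ^+ 2 / m' ^+ 2 = X + e ^+ 2 * (n / m' - t ^+ 2 / m' ^+ 2).
  by move=> ?;field.
 by rewrite E1 E2 gen ?gt_eqF// /b /s;ring.
rewrite normrM ger0_norm ?sqr_ge0// (_ : 4 * e ^+ 2 * (a + 1) = e ^+ 2 * (4 * (a + 1)));last by ring.
apply: ler_wpM2l;first exact: sqr_ge0.
apply: le_normB.
have b1 : `|N1 / m| <= 2 * (a + 1).
 rewrite normrM [ `|m^-1| ]ger0_norm ?invr_ge0 ?(ltW m0)// ler_pdivrMr//.
 by apply: le_trans hN _;nra.
have b2 : `|T1 ^+ 2 / m ^+ 2| <= 2 * (a + 1).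
 rewrite ger0_norm;last by rewrite divr_ge0 ?sqr_ge0.
 rewrite ler_pdivrMr ?exprn_gt0//;apply: le_trans hT _.
 have : 4^-1 <= m ^+ 2 by nra.
 by move: (m ^+ 2)=> y *;nra.
by apply: le_trans (lerD b1 b2) _;lra.
Qed.

Let D2lDV k i : D2 (fun x=> lam x * DV k i x) := D2_mDn ltr01 U1 hU k i.
Lemma L1_lam2 i : L1 (msk (fun x=> lam x ^+ 2 * \sum_k DV k i x ^+ 2)).
rewrite (_ : (fun x=> _) = fun x=> \sum_k (lam x * DV k i x) * (lam x * DV k i x)).
 by apply: L1_msk_sum=> k;exact: D2M.
by apply/funext=> x;rewrite mulr_sumr;apply: eq_bigr=> k _;ring.
Qed.
Lemma L1_tangential j psi : cd psi ->
 L1 (msk (fun x=> \sum_i lam x ^+ 2 * (DV j i x * dd i psi x - (\sum_k DV k i x ^+ 2) * (V j x * psi x)))).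
move=> hpsi;have [B1 B10 hB1] := tf_bound (cd_tf hpsi);have [B2 B20 hB2] := tf_dd_bound (cd_tf hpsi).
have D2L : D2 lam by case: (W2L ord0).
apply: L1_msk_sum=> i.
have D2ldpsi : D2 (fun x=> lam x * dd i psi x).
 have := D2_bM (Sm_mf (Sm_dd i (cd_Sm hpsi))) (hB2 i) D2L;congr D2;apply/funext=> x;by rewrite mulrC.
rewrite (_ : msk _ = fun x=> msk (fun y=> (lam y * DV j i y) * (lam y * dd i psi y)) x -
  (V j x * psi x) * msk (fun y=> lam y ^+ 2 * \sum_k DV k i y ^+ 2) x).
 apply: L1B;first exact: D2M.
 apply: (@L1_bM _ _ _ B1)=> //;[by apply: mfM=> //;exact: Sm_mf (cd_Sm hpsi)| |exact: L1_lam2].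
 by move=> x;rewrite normrM -[leRHS]mul1r;apply: ler_pM.
by apply/funext=> x;rewrite /msk;ring.
Qed.

(** The variation is [psi] times the [j]-th basis vector. For [|e| <= 1] the perturbed direction has
    norm at least [1/2], so its polar decomposition is available and the energy is compared with its
    linearization in [e]. *)
Lemma tangential_small j psi : cd psi -> (forall x, `|psi x| <= 4^-1) -> (forall i x, `|dd i psi x| <= 4^-1) ->
 I (msk (fun x=> \sum_i lam x ^+ 2 * (DV j i x * dd i psi x - (\sum_k DV k i x ^+ 2) * (V j x * psi x)))) = 0.
move=> hpsi hp hd;have [_ crit2] := crit.
pose wj (k : 'I_N) : R := (k == j)%:R.
have wsum (F : 'I_N -> R) : \sum_k wj k * F k = F j.
 by rewrite (bigD1 j)//= big1 /wj ?eqxx ?mul1r ?addr0// => k /negPf ->;rewrite mul0r.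
have wjj : wj j = 1 by rewrite /wj eqxx.
pose z (e : R) k x := V k x + e * (wj k * psi x).
pose Dz (e : R) k i x := DV k i x + e * (wj k * dd i psi x).
have Wz e k i : W2 i (z e k) (Dz e k i) by exact: W2_D (W2V k i) (W2_Z e (W2_Z (wj k) (W2_cd i hpsi))).
pose mm (e : R) x := 1 + 2 * e * (V j x * psi x) + e ^+ 2 * psi x ^+ 2.
pose TT (e : R) i x := e * (psi x * DV j i x + V j x * dd i psi x) + e ^+ 2 * (psi x * dd i psi x).
pose aa i x := \sum_k DV k i x ^+ 2.
have enz e x : en (z e) x ^+ 2 = mm e x.
 rewrite en_sq (eq_bigr (fun k=> V k x ^+ 2 + (2 * e * psi x * (wj k * V k x) + e ^+ 2 * psi x ^+ 2 * (wj k * wj k)))).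
  by rewrite !big_split /= -!mulr_sumr !wsum V1 /mm wjj;ring.
 by move=> k _;rewrite /z;ring.
have Dzz e i x : \sum_k Dz e k i x ^+ 2 = aa i x + 2 * e * (dd i psi x * DV j i x) + e ^+ 2 * dd i psi x ^+ 2.
 rewrite (eq_bigr (fun k=> DV k i x ^+ 2 + (2 * e * dd i psi x * (wj k * DV k i x) + e ^+ 2 * dd i psi x ^+ 2 * (wj k * wj k)))).
  by rewrite !big_split /= -!mulr_sumr !wsum /aa wjj;ring.
 by move=> k _;rewrite /Dz;ring.
have zDz e i x : \sum_k z e k x * Dz e k i x = TT e i x.
 rewrite (eq_bigr (fun k=> V k x * DV k i x + (e * psi x * (wj k * DV k i x) + (e * dd i psi x * (wj k * V k x) +
  e ^+ 2 * (psi x * dd i psi x) * (wj k * wj k))))).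
  by rewrite !big_split /= -!mulr_sumr !wsum VDV /TT wjj;ring.
 by move=> k _;rewrite /z /Dz;ring.
have aa0 i x : 0 <= aa i x by exact: ss_ge0.
have DVa i x : DV j i x ^+ 2 <= aa i x.
 by rewrite /aa (bigD1 j)//= lerDl;apply: sumr_ge0=> k _;exact: sqr_ge0.
have quad e i x : `|e| <= 1 -> _ := fun he=> tangent_quad (aa0 i x) (bV j x) (hp x) (hd i x) (DVa i x) he.
have c0 : (0 : R) < 2^-1 by [].
have hc e x : `|e| <= 1 -> 2^-1 <= en (z e) x.
 move=> he;rewrite -ler_sqr ?nnegrE ?en_ge0 ?invr_ge0// enz.
 have [h _] := quad e ord0 x he;apply: le_trans h;lra.
pose n e := pn (z e);pose Dn e := pDn (z e) (Dz e).
pose S e i x := \sum_k Dn e k i x ^+ 2.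
have SE e i x : `|e| <= 1 -> S e i x = (aa i x + 2 * e * (dd i psi x * DV j i x) + e ^+ 2 * dd i psi x ^+ 2) / mm e x -
  TT e i x ^+ 2 / mm e x ^+ 2.
 move=> he;have ez : en (z e) x != 0 by rewrite gt_eqF//;apply: lt_le_trans (hc e x he).
 rewrite -Dzz -zDz -enz.
 have Dm : pDm (z e) (Dz e) i x = (\sum_k z e k x * Dz e k i x) / en (z e) x.
  by rewrite /pDm mulr_suml;apply: eq_bigr=> k _;rewrite /pn;ring.
 have n1 : \sum_k n e k x ^+ 2 = 1 := pn_sq c0 (fun y=> hc e y he) x.
 have : \sum_k Dz e k i x ^+ 2 = pDm (z e) (Dz e) i x ^+ 2 + en (z e) x ^+ 2 * S e i x.
  rewrite -(polar_sq (en (z e) x) (pDm (z e) (Dz e) i x) n1 (pDn_orth _ c0 (fun y=> hc e y he) i x)).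
  by apply: eq_bigr=> k _;rewrite (pDzE _ c0 (fun y=> hc e y he)).
 move=> ->;rewrite Dm;field;exact: ez.
pose w (e : R) x := enorm (u x) *: normalize (normalize (u x) + e *: (psi x *: (\row_k wj k))).
pose F e k x := lam x * n e k x.
pose DF e k i x := DL i x * n e k x + lam x * Dn e k i x.
have D2DL i : D2 (DL i) by case: (W2L i).
have D2L : D2 lam by case: (W2L ord0).
have mpsi := Sm_mf (cd_Sm hpsi).
have mdpsi i := Sm_mf (Sm_dd i (cd_Sm hpsi)).
have D2ldpsi i : D2 (fun x=> lam x * dd i psi x).
 by have := D2_bM (mdpsi i) (hd i) D2L;congr D2;apply/funext=> x;rewrite mulrC.
have mn e k : `|e| <= 1 -> mf (n e k) by move=> he;apply: (pn_mf c0 (fun y=> hc e y he)).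
have bn e k x : `|e| <= 1 -> `|n e k x| <= 1 by move=> he;exact: (pn_abs c0 (fun y=> hc e y he)).
have D2nM e k f : `|e| <= 1 -> D2 f -> D2 (fun x=> n e k x * f x).
 by move=> he hf;exact: D2_bM (mn e k he) (fun x=> bn e k x he) hf.
have D2lDn e k i : `|e| <= 1 -> D2 (fun x=> lam x * Dn e k i x).
 move=> he;have D2lDz k' : D2 (fun x=> lam x * Dz e k' i x).
  have := D2_D (D2lDV k' i) (D2_Z (e * wj k') (D2ldpsi i));congr D2;apply/funext=> x;rewrite /Dz;ring.
 have D2lDm : D2 (fun x=> lam x * pDm (z e) (Dz e) i x).
  have := D2_sum (fun k'=> D2nM e k' _ he (D2lDz k'));congr D2;apply/funext=> x.
  by rewrite /pDm mulr_sumr;apply: eq_bigr=> k' _;rewrite mulrCA.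
 have mi : mf (fun x=> (en (z e) x)^-1).
  by apply: mf_inv=> [|x];[apply: en_mf=> k';case: (Wz e k' i)=> -[]|exact: en_ge0].
 have bi x : `|(en (z e) x)^-1| <= 2.
  have h := hc e x he;have h0 : 0 < en (z e) x by exact: lt_le_trans h.
  by rewrite gtr0_norm ?invr_gt0// -[leRHS]invrK lef_pV2 ?posrE ?invr_gt0.
 have := D2_bM mi bi (D2_B (D2lDz k) (D2nM e k _ he D2lDm));congr D2;apply/funext=> x.
 by rewrite /Dn /pDn /n;ring.
have WF e k i : `|e| <= 1 -> W2 i (F e k) (DF e k i).
 move=> he;have Wn := W2_pn c0 (fun y=> hc e y he) (Wz e) k i;split.
 - by have := D2nM e k _ he D2L;congr D2;apply/funext=> x;rewrite mulrC.
 - apply: D2_D;last exact: D2lDn.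
  by have := D2nM e k _ he (D2DL i);congr D2;apply/funext=> x;rewrite mulrC.
 - exact: W_mul (W2L i) Wn.
have wF e : {ae leb2, forall x, disk x -> forall k, component (w e) k x = F e k x}.
 apply: filterS uU=> x hx dx k;have ex := enU (hx dx).
 have nE k' : (normalize (u x) + e *: (psi x *: (\row_k wj k))) ord0 k' = z e k' x.
  rewrite /normalize !mxE ex;have := hx dx k';rewrite /component=> ->.
  by rewrite /z /pn mulrC [psi x * _]mulrC.
 rewrite /component /w {2}/normalize 2!mxE nE ex.
 rewrite /F /n /pn [z e k x / _]mulrC;congr (_ * (_^-1 * _)).
 by rewrite /enorm /en;congr Num.sqrt;apply: eq_bigr=> k' _;rewrite -nE /normalize ex.
have mw e k : mf (msk (component (w e) k)).
 pose y k' x := (en M x)^-1 * M k' x + e * (psi x * wj k').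
 have my k' : mf (y k').
  by apply: mfD;[apply: mfM=> //;exact: mu|apply: mfZ;apply: mfM=> //;exact: mfc].
 rewrite (_ : msk _ = fun x=> en M x * ((en y x)^-1 * y k x)).
  by apply: mfM=> //;apply: mfM=> //;apply: mf_inv=> [|x];[exact: en_mf|exact: en_ge0].
 apply/funext=> x;have [dx|dx] := pselect (disk x);last first.
  rewrite mskF// (_ : en M x = 0) ?mul0r// /en big1 ?sqrtr0// => k' _;by rewrite /M mskF// expr0n.
 have nE k' : (normalize (u x) + e *: (psi x *: (\row_k wj k))) ord0 k' = y k' x.
  by rewrite /normalize !mxE /y (enM dx) /M mskT.
 rewrite mskT// /component /w {2}/normalize 2!mxE nE (enM dx);congr (_ * (_^-1 * _)).
 by rewrite /enorm /en;congr Num.sqrt;apply: eq_bigr=> k' _;rewrite nE.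
pose Q e x := \sum_k \sum_i DF e k i x ^+ 2.
have QE e x : `|e| <= 1 -> Q e x = \sum_i (DL i x ^+ 2 + lam x ^+ 2 * S e i x).
 move=> he;rewrite /Q exchange_big /=;apply: eq_bigr=> i _.
 exact: polar_sq (pn_sq c0 (fun y=> hc e y he) x) (pDn_orth _ c0 (fun y=> hc e y he) i x).
have LQ e : `|e| <= 1 -> L1 (msk (Q e)).
 move=> he;apply: L1_msk_sum=> k;apply: L1_msk_sum=> i.
 have [_ h _] := WF e k i he;have := D2M h h;congr L1;congr msk;apply/funext=> x;by rewrite expr2.
have hE e : `|e| <= 1 -> Dirichlet (w e) = I (msk (Q e)).
 by move=> he;have [_ ->] := Dirichlet_E (mw e) (wF e) (fun k i=> WF e k i he).
pose L x := \sum_i lam x ^+ 2 * (DV j i x * dd i psi x - aa i x * (V j x * psi x)).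
have Laa i : L1 (msk (fun x=> lam x ^+ 2 * aa i x)) := L1_lam2 i.
have LL : L1 (msk L) := L1_tangential j hpsi.
pose B x := \sum_i lam x ^+ 2 * (aa i x + 1).
have LB : L1 (msk B).
 apply: L1_msk_sum=> i.
 rewrite (_ : msk _ = fun x=> msk (fun y=> lam y ^+ 2 * aa i y) x + msk (fun y=> lam y * lam y) x).
  by apply: L1D=> //;exact: D2M.
 by apply/funext=> x;rewrite /msk;ring.
have z1 : `|0 : R| <= 1 by rewrite normr0.
(* The linear coefficient comes from [tangent_quad] integrated against [lam^2]; the error weight is
   integrable because [lam] and [lam |Dv|] are square integrable. *)
have key e : `|e| <= 1 -> `|Dirichlet (w e) - Dirichlet (w 0) - e * (2 * I (msk L))| <= (4 * I (msk B)) * e ^+ 2.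
 move=> he;rewrite (hE _ he) (hE _ z1) mulrA -(IZ _ LL) -(IB (LQ _ he) (LQ _ z1)) -(IB (L1B (LQ _ he) (LQ _ z1)) (L1Z _ LL)).
 rewrite [leRHS]mulrAC -(IZ _ LB);apply: I_absle.
 - exact: L1_mf (L1B (L1B (LQ _ he) (LQ _ z1)) (L1Z _ LL)).
 - exact: L1Z.
 move=> x;have [dx|dx] := pselect (disk x);last by rewrite !(mskF _ dx) !mulr0 subrr subr0 normr0.
 rewrite !(mskT _ dx) (QE _ _ he) (QE _ _ z1) /L /B !mulr_sumr -sumrB -sumrB.
 apply: le_trans (ler_norm_sum _ _ _) _;apply: ler_sum=> i _.
 have [_ h1] := quad e i x he;rewrite -(SE e i x he) in h1.
 have S0 : S 0 i x = aa i x.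
  by rewrite (SE _ _ _ z1) /mm /TT;field.
 rewrite S0 (_ : DL i x ^+ 2 + lam x ^+ 2 * S e i x - (DL i x ^+ 2 + lam x ^+ 2 * aa i x) -
  e * 2 * (lam x ^+ 2 * (DV j i x * dd i psi x - aa i x * (V j x * psi x))) =
  lam x ^+ 2 * (S e i x - aa i x - e * (2 * (dd i psi x * DV j i x - aa i x * (V j x * psi x)))));last by ring.
 rewrite normrM ger0_norm ?sqr_ge0// [leRHS]mulrCA;apply: ler_wpM2l;first exact: sqr_ge0.
 exact: h1.
have d1 : is_derive (0 : R) (1 : R) (fun e=> Dirichlet (w e)) (2 * I (msk L)).
 by apply: (@is_derive_of_quad1 _ _ _ _ (4 * I (msk B)))=> e he;rewrite add0r;exact: key.
have d2 : is_derive (0 : R) (1 : R) (fun e=> Dirichlet (w e)) 0 := crit2 _ (cd_scalew _ hpsi).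
have : 2 * I (msk L) = 0 by case: d1=> _ <-;case: d2.
by move/eqP;rewrite mulf_eq0 pnatr_eq0 /= => /eqP.
Qed.

(** The identity is linear in [psi], so a multiple small enough for [tangential_small] suffices. *)
Lemma tangential j psi : cd psi ->
 I (msk (fun x=> \sum_i lam x ^+ 2 * (DV j i x * dd i psi x - (\sum_k DV k i x ^+ 2) * (V j x * psi x)))) = 0.
move=> hpsi;have [B1 B10 hB1] := tf_bound (cd_tf hpsi);have [B2 B20 hB2] := tf_dd_bound (cd_tf hpsi).
pose c := (4 * (B1 + B2 + 1))^-1.
have c0 : 0 < c by rewrite invr_gt0 mulr_gt0// ltr_wpDl// addr_ge0.
have cB (t : R) : 0 <= t -> t <= B1 + B2 + 1 -> c * t <= 4^-1.
 by move=> t0 ht;rewrite /c invfM -mulrA ler_piMr// mulrC ler_pdivrMr ?mul1r// ltr_wpDl// addr_ge0.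
have := @tangential_small j (fun x=> c * psi x) (cd_Z c hpsi) _ _.
set X := msk _=> H;have {H}h : I X = 0.
 apply: H=> [x|i x];rewrite ?(dd_Z _ _ _ (cd_Sm hpsi)) normrM (gtr0_norm c0);apply: cB=> //.
  by apply: le_trans (hB1 x) _;lra.
 by apply: le_trans (hB2 i x) _;lra.
set Y := msk _.
have XY x : Y x = c^-1 * X x.
 rewrite /X /Y /msk mulrCA;congr (_ * _);rewrite mulr_sumr;apply: eq_bigr=> i _.
 by rewrite (dd_Z _ _ _ (cd_Sm hpsi));field;rewrite gt_eqF.
by rewrite (eq_I XY) (IZ _ (L1_tangential j (cd_Z c hpsi))) h mulr0.
Qed.
End Critical.

(** * Stationary maps and the subharmonicity of the modulus *)

Section Subharmonic.
Context {R : realType}.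
Implicit Types (f g phi psi k : R * R -> R) (x v : R * R) (i : 'I_2).

(** Mollifications of [phi] converge with their gradients in L^2. The pairing with an [f] that is
    only integrable converges because [phi] is bounded and translations are continuous in L^1;
    positive kernels preserve the sign. *)
Lemma test_approx phi (P A : 'I_2 -> R * R -> R) f (B r : R) : r < 1 -> (forall x, r < E2 x -> phi x = 0) ->
 (forall x, `|phi x| <= B) -> (forall i, wd i phi (P i)) -> (forall i, L2 (A i)) -> L1 f ->
 forall e, 0 < e -> exists phi', [/\ cd phi', (forall x, 0 <= phi x) -> forall x, 0 <= phi' x,
  `|\sum_i \I_x (A i x * dd i phi' x) - \sum_i \I_x (A i x * P i x)| <= e &
  `|\I_x (f x * phi' x) - \I_x (f x * phi x)| <= e].
move=> r1 hr hB hP hA hf e e0;have B0 : 0 <= B := le_trans (normr_ge0 _) (hB 0).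
have Kp : K2 phi by case: (hP ord0).
have KP i : K2 (P i) by case: (hP i).
pose C := nrm (A ord0) + nrm (A ord_max) + B + 1.
have C0 : 0 < C by rewrite /C ltr_wpDl// !addr_ge0// nrm_ge0.
have eC : 0 < e / C by rewrite divr_gt0.
have [d0 d00 h0] := cv_approx (KP ord0) eC.
have [d1 d10 h1] := cv_approx (KP ord_max) eC.
have [d2 d20 h2] := cd_moll Kp r1 hr.
have [_ /(_ _ eC)[d3 d30 h3]] := L1_Lc hf.
pose d := Num.min (Num.min d0 d1) (Num.min d2 d3).
have dp : 0 < d by rewrite !lt_min d00 d10 d20 d30.
have [k hk] := moll_exists dp;have pkk := pk_moll hk;have [tk k0 ks k1] := hk.
have [r0 [r1' [r2 r3]]] : d <= d0 /\ d <= d1 /\ d <= d2 /\ d <= d3.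
 by rewrite /d !ge_min !lexx !orbT.
have ep i : dd i (cv phi k) = cv (P i) k by apply/funext=> x;exact: wd_dd_cv (hP i) tk.
have eCC : e / C * C = e by rewrite divfK// gt_eqF.
have LcP i : L2 (cv (P i) k) := L2_cv (K2_L1 (KP i)) (K2_L2 (KP i)) (moll_ker hk).
have bd i : nrm (fun x=> cv (P i) k x - P i x) <= e / C ->
  `|\I_x (A i x * dd i (cv phi k) x) - \I_x (A i x * P i x)| <= nrm (A i) * (e / C).
 move=> hn;rewrite ep -(IB (L2M (hA i) (LcP i)) (L2M (hA i) (K2_L2 (KP i)))).
 rewrite (eq_I (g := fun x=> A i x * (cv (P i) k x - P i x)))=> [|x];last by rewrite mulrBr.
 apply: le_trans (CSn (hA i) (L2B (LcP i) (K2_L2 (KP i)))) _.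
 by apply: ler_wpM2l=> //;exact: nrm_ge0.
have bf : `|\I_x (f x * cv phi k x) - \I_x (f x * phi x)| <= B * (e / C).
 have := @cv_dual R d phi k f (B * \I_x (`|f x|)) (B * (e / C)) (K2_L1 Kp) (moll_ker hk) (L1_mf hf).
 rewrite (moll_abs hk) k1 mul1r.
 have ls v : L1 (fun x=> f x * phi (x - v)).
  have : L1 (fun x=> phi (x - v) * f x).
   by apply: (@L1_bM _ _ _ B)=> //;exact: L1_mf (L1_sub v (K2_L1 Kp)).
  by congr L1;apply/funext=> x;rewrite mulrC.
 have l0 : L1 (fun x=> f x * phi x).
  by have := ls 0;congr L1;apply/funext=> x;rewrite subr0.
 have lc : L1 (fun x=> f x * cv phi k x).
  have : L1 (fun x=> cv phi k x * f x).
   by apply: (@L1_bM _ _ _ B)=> //;[exact: L1_mf (L1_cv (K2_L1 Kp) (moll_ker hk))|exact: cv_bound pkk (K2_L1 Kp) hB].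
  by congr L1;apply/funext=> x;rewrite mulrC.
 rewrite (eq_I (f := fun x=> f x * (cv phi k x - 1 * phi x))
  (g := fun x=> f x * cv phi k x - f x * phi x))=> [|x];last by rewrite mul1r mulrBr.
 rewrite (IB lc l0);apply.
 - exact: ls.
 - move=> v;rewrite -(IZ _ (L1_abs hf));apply: I_le.
  + exact: L1_abs (ls v).
  + exact: L1Z (L1_abs hf).
  + by move=> x;rewrite normrM mulrC;apply: ler_wpM2r.
 move=> v;rewrite box0E=> -[v1 v2].
 have hfv := L1_sh v hf.
 have lv : L1 (fun x=> f (x + v) * phi x).
  by have := L1_sh v (ls v);congr L1;apply/funext=> x;rewrite addrK.
 have lsh : \I_x (f x * phi (x - v)) = \I_x (f (x + v) * phi x).
  by rewrite -(I_sh v (ls v));apply: eq_I=> x;rewrite addrK.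
 rewrite (eq_I (g := fun x=> f x * phi (x - v) - f x * phi x))=> [|x];last by rewrite mulrBr.
 rewrite (IB (ls v) l0) lsh -(IB lv l0).
 have lD := L1B hfv hf.
 apply: le_trans (I_absle (g := fun x=> B * `|f (x + v) - f x|) _ (L1Z _ (L1_abs lD)) _) _.
 - exact: L1_mf (L1B lv l0).
 - by move=> x;rewrite -mulrBl normrM mulrC;apply: ler_wpM2r.
 rewrite (IZ _ (L1_abs lD));apply: ler_wpM2l=> //.
 by apply: h3;[exact: le_trans v1 r3|exact: le_trans v2 r3].
exists (cv phi k);split.
- exact: h2 hk r2.
- move=> p0 x;apply: I_ge0=> y;exact: mulr_ge0.
- rewrite !sum2E opprD addrACA;apply: le_normD.
 apply: le_trans (lerD (bd ord0 (h0 _ _ pkk r0)) (bd ord_max (h1 _ _ pkk r1'))) _.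
 rewrite -mulrDl mulrC -[leRHS]eCC;apply: ler_wpM2l;first exact: ltW.
 by rewrite /C -addrA lerDl addr_ge0.
- apply: le_trans bf _;rewrite mulrC -[leRHS]eCC;apply: ler_wpM2l;first exact: ltW.
 by rewrite /C addrAC lerDr !addr_ge0// nrm_ge0.
Qed.

(* The last two conditions are the Euler-Lagrange inequality in the radial direction and the
 Euler-Lagrange equation in the tangential directions. *)
Record stationary n (U : 'I_n -> R * R -> R) (G : 'I_n -> 'I_2 -> R * R -> R) : Prop := Stationary {
 st_W2 : forall j i, W2 i (U j) (G j i);
 st_ge1 : forall x, 1 <= en U x;
 st_rad : forall phi (P : 'I_2 -> R * R -> R) (r B e0 : R), r < 1 -> (forall x, r < E2 x -> phi x = 0) ->
  (forall x, `|phi x| <= B) -> (forall i, W2 i phi (P i)) -> 0 < e0 ->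
  (forall e x, 0 < e -> e <= e0 -> 1 <= en U x + e * phi x) ->
  0 <= I (msk (fun x=> \sum_i (pDm U G i x * P i x + en U x * phi x * \sum_j pDn U G j i x ^+ 2)));
 st_tan : forall j psi, cd psi ->
  I (msk (fun x=> \sum_i en U x ^+ 2 * (pDn U G j i x * dd i psi x -
   (\sum_k pDn U G k i x ^+ 2) * (pn U j x * psi x)))) = 0 }.

Lemma abs_sub1 (y : R) : 0 <= y -> y <= 1 -> `|y - 1| <= 1.
by move=> y0 y1;rewrite ler_norml;lra. Qed.
Lemma W2_cst i (c : R) : W2 i (fun=> c) (fun=> 0).
split.
- by apply: (@D2_b _ _ `|c|)=> //;exact: mfc.
- by apply: (@D2_b _ _ 0)=> [|x];[exact: mfc|rewrite normr0].
move=> phi hp;rewrite (IZ _ (tf_L1 (tf_dd i (cd_tf hp)))) (I_dd i (cd_tf hp)) mulr0.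
by rewrite (eq_I (g := fun=> 0)) ?I0 ?oppr0// => x;rewrite mul0r.
Qed.

Section Sub.
Variables (n : nat) (U : 'I_n -> R * R -> R) (G : 'I_n -> 'I_2 -> R * R -> R).
Hypothesis st : stationary U G.
Local Notation lam := (en U).
Local Notation V := (pn U).
Local Notation DL := (pDm U G).
Local Notation DV := (pDn U G).
Local Notation aa i x := (\sum_j DV j i x ^+ 2).
Let hU := st_W2 st.
Let U1 := st_ge1 st.
Let lam0 x : 0 < lam x. Proof. exact: lt_le_trans (U1 x). Qed.
Let W2V j i := W2_pn ltr01 U1 hU j i.
Let W2L i := W2_en ltr01 U1 hU i.
Let D2L : D2 lam. Proof. by case: (W2L ord0). Qed.
Let D2DL i : D2 (DL i). Proof. by case: (W2L i). Qed.
Let D2lDV (k : 'I_n) i : D2 (fun x=> lam x * DV k i x) := D2_mDn ltr01 U1 hU k i.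

Lemma L1_aa i : L1 (msk (fun x=> lam x ^+ 2 * aa i x)).
rewrite (_ : (fun x=> _) = fun x=> \sum_k (lam x * DV k i x) * (lam x * DV k i x)).
 by apply: L1_msk_sum=> k;exact: D2M.
by apply/funext=> x;rewrite mulr_sumr;apply: eq_bigr=> k _;ring.
Qed.
Lemma mf_aa i : mf (fun x=> aa i x).
by apply: mf_sum=> k;apply: mfX;case: (W2V k i)=> _ []. Qed.
Lemma L1_lamaa i f (B : R) : mf f -> (forall x, `|f x| <= B) -> L1 (msk (fun x=> lam x * f x * aa i x)).
move=> hf hB;have B0 : 0 <= B := le_trans (normr_ge0 _) (hB 0).
apply: (L1_le _ (L1Z B (L1_aa i)))=> [|x].
 by apply: mf_msk;apply: mfM (mf_aa i);apply: mfM hf;case: D2L.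
have [dx|dx] := pselect (disk x);last by rewrite !mskF// normr0 mulr0.
rewrite !mskT// normrM (ger0_norm (ss_ge0 _)) mulrA;apply: ler_wpM2r;first exact: ss_ge0.
rewrite normrM (gtr0_norm (lam0 x)) mulrC expr2;apply: ler_pM=> //;first exact: ltW.
by rewrite ler_peMl ?(ltW (lam0 x)).
Qed.

(** The weight is [g = 1 - d^2 / (lambda - 1 + d)^2], which is nonnegative, increasing in [lambda],
    and zero at [lambda = 1]. In the radial inequality for [- eta g] both the term
    [g' |D lambda|^2 eta] and the term with [|Dv|^2] have the favourable sign, leaving the claim for
    a primitive [H] of [g] instead of [lambda]. Then [d] tends to zero. *)
Lemma subharmonic eta : cd eta -> (forall x, 0 <= eta x) ->
 \sum_i \I_x (DL i x * dd i eta x) <= 0.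
move=> he e0;have [B B0 hB] := tf_bound (cd_tf he).
pose C := \sum_i \I_x (`|dd i (dd i eta) x|).
have C0 : 0 <= C by apply: sumr_ge0=> i _;exact: I_ge0.
apply: le_eps=> d' d'0;rewrite add0r.
pose d := d' / (C + 1).
have d0 : 0 < d by rewrite divr_gt0// ltr_wpDl.
have dC : d * C <= d' by rewrite /d mulrAC ler_pdivrMr ?ltr_wpDl//;apply: ler_wpM2l;[exact: ltW|rewrite lerDl].
pose t x := lam x + (d - 1).
have td x : d <= t x by rewrite /t;have := U1 x;lra.
have t0 x : 0 < t x by exact: lt_le_trans (td x).
have Wt i : W2 i t (DL i).
 have := W2_D (W2L i) (W2_cst i (d - 1));congr W2;apply/funext=> x;by rewrite addr0.
pose v x := (t x)^-1;pose Dv i x := - (t x ^+ 2)^-1 * DL i x.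
have Wv i : W2 i v (Dv i) := W2_inv d0 td (Wt i).
have v0 x : 0 < v x by rewrite invr_gt0.
have vd x : d * v x <= 1 by rewrite /v ler_pdivrMr// mul1r.
have dv0 x : 0 <= d * v x by rewrite mulr_ge0 ?ltW.
pose g x := 1 - d ^+ 2 * v x ^+ 2.
pose Dg i x := 2 * d ^+ 2 * v x ^+ 3 * DL i x.
have mv : mf v by case: (Wv ord0)=> -[].
have D2Dg i : D2 (Dg i).
 apply: (@D2_bM _ _ _ (2 / d)) (D2DL i);first by apply: mfM;[exact: mfc|exact: mfX].
 move=> x;rewrite ger0_norm;last by rewrite mulr_ge0 ?exprn_ge0 ?(ltW (v0 x))// mulr_ge0 ?sqr_ge0.
 rewrite (_ : _ * v x ^+ 3 = 2 / d * (d * v x) ^+ 3);last by field;rewrite gt_eqF.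
 by apply: ler_piMr;[rewrite divr_ge0 ?(ltW d0)|exact: exprn_ile1].
have Wg i : W2 i g (Dg i).
 split=> //.
  apply: (@D2_b _ _ 1);first by apply: mfB;[exact: mfc|apply: mfM;[exact: mfc|exact: mfX]].
  move=> x;have := dv0 x;have := vd x;rewrite /g -exprMn;move: (d * v x)=> y y1 y0.
  have y2 : y ^+ 2 <= 1 by exact: exprn_ile1.
  by rewrite ger0_norm ?subr_ge0// gerBl sqr_ge0.
 have Wvv := W_mul (Wv i) (Wv i).
 have D2vv : D2 (fun x=> v x * v x) /\ D2 (fun x=> Dv i x * v x + v x * Dv i x).
  have bv x : `|v x| <= d^-1 by rewrite gtr0_norm// /v lef_pV2 ?posrE.
  have D2Dv : D2 (Dv i) by case: (Wv i).
  have D2v : D2 v by case: (Wv i).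
  have h := D2_bM mv bv D2Dv;split;first exact: D2_bM mv bv D2v.
  apply: D2_D=> //;by have := h;congr D2;apply/funext=> x;rewrite mulrC.
 have [_ _] := W2_D (W2_cst i 1) (W2_Z (- d ^+ 2) (And3 D2vv.1 D2vv.2 Wvv)).
 apply: W_ext=> x _;first by rewrite /g;ring.
 by rewrite /Dg /Dv -exprVn -/(v x);ring.
have g01 x : 0 <= g x <= 1.
 have := dv0 x;have := vd x;rewrite /g -exprMn;move: (d * v x)=> y y1 y0.
 have y2 : y ^+ 2 <= 1 by exact: exprn_ile1.
 by rewrite subr_ge0 gerBl sqr_ge0 y2.
(* [g] vanishes at least linearly where [lambda = 1], with slope of order [1 / d]; this is why steps
   up to [d / (2 (B + 1))] preserve [lambda >= 1]. *)
have gs x : g x * d <= 2 * (lam x - 1).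
 have e1 : d * v x + (lam x - 1) * v x = 1.
  by rewrite -mulrDl (_ : d + (lam x - 1) = t x) ?divff ?gt_eqF// /t;ring.
 have := v0 x;have s0 : 0 <= lam x - 1 by rewrite subr_ge0.
 have := vd x;have := dv0 x;rewrite /g -exprMn.
 rewrite (_ : 1 - (d * v x) ^+ 2 = (lam x - 1) * v x * (1 + d * v x));last first.
  by rewrite (_ : (lam x - 1) * v x = 1 - d * v x);[ring|move: e1;lra].
 move: (lam x - 1) s0=> s s0 a b c.
 rewrite (_ : _ * d = s * ((1 + d * v x) * (d * v x)));last by ring.
 by rewrite [2 * s]mulrC;apply: ler_wpM2l=> //;nra.
pose phi x := - (eta x * g x).
pose P i x := - (dd i eta x * g x + eta x * Dg i x).
have mg : mf g by case: (Wg ord0)=> -[].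
have bg x : `|g x| <= 1 by case/andP: (g01 x)=> h1 h2;rewrite ger0_norm.
have WP i : W2 i phi (P i).
 have := W_mul (W2_cd i he) (Wg i)=> h.
 have D1 : D2 (fun x=> eta x * g x).
  by have := D2_bM mg bg (D2_cdf he);congr D2;apply/funext=> x;rewrite mulrC.
 have D3 : D2 (fun x=> dd i eta x * g x + eta x * Dg i x).
  apply: D2_D;last exact: D2_bM (Sm_mf (cd_Sm he)) hB (D2Dg i).
  by have := D2_bM mg bg (D2_cdf (cd_dd i he));congr D2;apply/funext=> x;rewrite mulrC.
 have := W2_Z (-1) (And3 D1 D3 h);congr W2;apply/funext=> x;by rewrite mulN1r.
have [r r1 hr] := he.2.
have hrad : 0 <= I (msk (fun x=> \sum_i (DL i x * P i x + lam x * phi x * aa i x))).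
 apply: (@st_rad _ _ _ st phi P r B (d / (2 * (B + 1))))=> //.
 - by move=> x hx;rewrite /phi hr// mul0r oppr0.
 - move=> x;rewrite normrN normrM -[leRHS]mulr1;apply: ler_pM=> //.
 - by rewrite divr_gt0// mulr_gt0// ltr_wpDl.
 move=> e x e_gt0 he';rewrite /phi mulrN lerBrDr addrC -lerBrDr.
 have /andP[g0 g1] := g01 x.
 apply: (letr (e * (2 * (B + 1)) * (g x / 2))).
  rewrite -mulrA;apply: ler_wpM2l;first exact: ltW.
  rewrite (_ : 2 * (B + 1) * (g x / 2) = (B + 1) * g x);last by field.
  apply: ler_wpM2r=> //;apply: le_trans (ler_norm _) _;apply: le_trans (hB x) _;by rewrite lerDl.
 apply: (letr (d * (g x / 2))).
  apply: ler_wpM2r;first by rewrite divr_ge0.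
  by move: he';rewrite ler_pdivlMr// mulr_gt0// ltr_wpDl.
 by have := gs x;rewrite [g x * d]mulrC;lra.
(* The primitive of [g] as a function of [lambda], normalized to vanish at [lambda = 1]; it differs
   from [lambda - 1] by at most [d]. *)
pose H x := lam x + (- (1 + d) + d ^+ 2 * v x).
pose DH i x := g x * DL i x.
have WH i : W2 i H (DH i).
 have := W2_D (W2L i) (W2_D (W2_cst i (- (1 + d))) (W2_Z (d ^+ 2) (Wv i))).
 congr W2;apply/funext=> x;rewrite /DH /g /Dv -exprVn -/(v x);ring.
have L1t i : L1 (fun x=> DH i x * dd i eta x) by apply: D2_L1;[exact: cd_dd|case: (WH i)].
have neg : \sum_i \I_x (DH i x * dd i eta x) <= 0.
 have L1a i : L1 (fun x=> Dg i x * DL i x * eta x) := D2M_L1 he (D2Dg i) (D2DL i).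
 have L1b i : L1 (msk (fun x=> lam x * phi x * aa i x)).
  apply: (@L1_lamaa i phi B);first by case: (WP ord0)=> -[].
  by move=> x;rewrite normrN normrM -[leRHS]mulr1;apply: ler_pM.
 have e1 : I (msk (fun x=> \sum_i (DL i x * P i x + lam x * phi x * aa i x))) =
  \sum_i (- \I_x (DH i x * dd i eta x) - \I_x (Dg i x * DL i x * eta x) + I (msk (fun x=> lam x * phi x * aa i x))).
  rewrite (eq_I (g := fun x=> \sum_i (- (DH i x * dd i eta x) - Dg i x * DL i x * eta x + msk (fun x=> lam x * phi x * aa i x) x))).
   rewrite I_sum=> [|i];last by apply: L1D=> //;apply: L1B=> //;exact: L1N.
   apply: eq_bigr=> i _;have l1 := L1N (L1t i).
   by rewrite (ID (L1B l1 (L1a i)) (L1b i)) (IB l1 (L1a i)) (IN (L1t i)).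
  move=> x;rewrite msk_sum;apply: eq_bigr=> i _.
  have [dx|dx] := pselect (disk x);last first.
   by rewrite !mskF// (cd_off he dx) (cd_off (cd_dd i he) dx) !mulr0 !oppr0 !addr0.
  by rewrite !mskT// /DH /P;ring.
 move: hrad;rewrite e1=> hrad.
 rewrite -oppr_ge0 -sumrN;apply: le_trans hrad _;apply: ler_sum=> i _.
 have p1 : 0 <= \I_x (Dg i x * DL i x * eta x).
  apply: I_ge0=> x;apply: mulr_ge0=> //;rewrite /Dg -mulrA mulr_ge0 -?expr2 ?sqr_ge0//.
  by rewrite mulr_ge0 ?exprn_ge0 ?(ltW (v0 x))// mulr_ge0 ?sqr_ge0.
 have p2 : I (msk (fun x=> lam x * phi x * aa i x)) <= 0.
  rewrite -oppr_ge0 -IN//;apply: I_ge0=> x;rewrite -/(- msk _ x).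
  have [dx|dx] := pselect (disk x);last by rewrite mskF// oppr0.
  rewrite mskT// /phi mulrN mulNr opprK;have /andP[g0 _] := g01 x.
  by rewrite !mulr_ge0 ?ss_ge0 ?(ltW (lam0 x)).
 by move: p1 p2;lra.
(* Moving both derivatives onto [eta] turns the uniform closeness of [H] and [lambda - 1] into
   closeness of the integrals; the constant [1] is invisible since second derivatives of [eta]
   integrate to zero. *)
have cmp i : `|\I_x (DL i x * dd i eta x) - \I_x (DH i x * dd i eta x)| <= d * \I_x (`|dd i (dd i eta) x|).
 have hdd := cd_dd i he;have hdd2 := cd_dd i hdd.
 have [D2H _ wH] := WH i;have [_ _ wL] := W2L i;have [D21 _ w1] := W2_cst i 1.
 have eL : \I_x (DL i x * dd i eta x) = - \I_x (lam x * dd i (dd i eta) x).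
  by rewrite (wL _ hdd) opprK.
 have eH : \I_x (DH i x * dd i eta x) = - \I_x (H x * dd i (dd i eta) x).
  by rewrite (wH _ hdd) opprK.
 have e1 : \I_x (1 * dd i (dd i eta) x) = 0.
  by rewrite (w1 _ hdd) (eq_I (g := fun=> 0))=> [|x];rewrite ?I0 ?oppr0 ?mul0r.
 have lL := D2_L1 hdd2 D2L;have lH := D2_L1 hdd2 D2H;have l1 := D2_L1 hdd2 D21.
 have l2 := L1_abs (tf_L1 (cd_tf hdd2)).
 have e2 : \I_x (H x * dd i (dd i eta) x) - \I_x (lam x * dd i (dd i eta) x) =
   \I_x ((d ^+ 2 * v x - d) * dd i (dd i eta) x).
  rewrite -[LHS]addr0 -[X in _ + X]e1 -(IB lH lL) -(ID (L1B lH lL) l1).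
  by apply: eq_I=> x;rewrite /H;ring.
 rewrite eL eH opprK addrC e2 -(IZ _ l2);apply: I_absle (L1Z _ l2) _.
  by apply: mfM;[apply: mfB;[apply: mfM=> //;exact: mfc|exact: mfc]|exact: Sm_mf (cd_Sm hdd2)].
 move=> x;rewrite normrM;apply: ler_wpM2r=> //.
 rewrite expr2 -mulrA -[X in _ - X]mulr1 -mulrBr normrM (gtr0_norm d0) ler_piMr ?(ltW d0)//.
 exact: abs_sub1 (dv0 x) (vd x).
apply: le_trans dC;rewrite /C mulr_sumr.
apply: (letr (\sum_i (d * \I_x (`|dd i (dd i eta) x|) + \I_x (DH i x * dd i eta x)))).
 apply: ler_sum=> i _;rewrite -lerBlDr;apply: le_trans (cmp i);exact: ler_norm.
by rewrite big_split /= gerDl.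
Qed.
End Sub.
End Subharmonic.

(** * Truncated logarithms and the averaging kernels they generate *)

Section Kernel.
Context {R : realType}.
Implicit Types (f g phi psi k : R * R -> R) (x y v : R * R) (i : 'I_2).

(** The [i]-th coordinate, in a form uniform in [i]. *)
Definition crd i x : R := x.1 * (dir i : R * R).1 + x.2 * (dir i : R * R).2.
Lemma Sm_crd i : Sm (crd i).
by apply: Sm_D;apply: Sm_M;[exact: Sm_fst|exact: Sm_c|exact: Sm_snd|exact: Sm_c]. Qed.
Lemma dirsq i : (dir i : R * R).1 ^+ 2 + (dir i : R * R).2 ^+ 2 = 1.
by case: (ord2P i)=> ->;rewrite /dir /= ?expr1n ?expr0n /= ?addr0 ?add0r. Qed.
Lemma dd_crd i x : dd i (crd i) x = 1.
have S1 := @Sm_fst R;have S2 := @Sm_snd R.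
have c1 := @Sm_c R (dir i : R * R).1;have c2 := @Sm_c R (dir i : R * R).2.
rewrite dd_D;[|exact: Sm_M|exact: Sm_M].
by rewrite !dd_M// !dd_c dd_fst dd_snd !mulr0 !add0r -!expr2 dirsq.
Qed.
Lemma dd_E2 i x : dd i E2 x = 2 * crd i x.
have S1 := @Sm_fst R;have S2 := @Sm_snd R.
rewrite (_ : E2 = fun x : R * R=> x.1 * x.1 + x.2 * x.2);last by apply/funext=> y;rewrite /E2 !expr2.
rewrite dd_D;[|exact: Sm_M|exact: Sm_M].
by rewrite !dd_M// dd_fst dd_snd /crd;ring.
Qed.
Lemma crd_E2 x : \sum_i crd i x ^+ 2 = E2 x.
by rewrite sum2E /crd /E2 /dir /=;ring. Qed.

Definition bB' (t : R) := bexp (bnext 1) t.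
Lemma bB'_ge0 t : 0 <= bB' t.
rewrite /bB' /bexp;case: ifP=> // _;rewrite mulr_ge0 ?expR_ge0// /bnext.
by rewrite derivC subr0 mulr1 hornerXn sqr_ge0.
Qed.
Lemma Sm_bB f : Sm f -> Sm (fun x=> bB (f x)).
exact: Sm_comp smooth1_bB. Qed.
Lemma dd_bB f i x : Sm f -> dd i (fun y=> bB (f y)) x = bB' (f x) * dd i f x.
by move=> hf;apply: dd_eq;apply: is_derive_comp1;[exact: Sm_der|exact: bexp_derive].
Qed.

Definition tht x := stp (2 - E2 x).
Lemma Sm_2E2 : Sm (fun x=> 2 - E2 x).
by apply: Sm_B;[exact: Sm_c|exact: Sm_E2]. Qed.
Lemma Sm_tht : Sm tht. Proof. exact: Sm_stp Sm_2E2. Qed.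
Lemma tht1 x : E2 x <= 1 -> tht x = 1.
by move=> h;apply: stp1;lra. Qed.
Lemma tht0 x : 2 <= E2 x -> tht x = 0.
by move=> h;apply: stp0;lra. Qed.
Lemma tf_tht : tf tht.
split;first exact: Sm_tht.
exists 2=> x hx;apply: tht0;rewrite leNgt;apply/negP=> h;apply: hx;apply: E2_box=> //;lra.
Qed.
(** The cutoff decreases radially. The sign is found by differentiating the product relation
    [tht (b1 + b2) = b1] behind the smooth step, both [b1] and [b2] being monotone functions of
    [E2]. *)
Lemma dd_tht_sign x : \sum_i crd i x * dd i tht x <= 0.
pose b1 y := bB (2 - E2 y);pose b2 y := bB (1 - (2 - E2 y)).
have S2 := Sm_2E2;have S3 : Sm (fun y=> 1 - (2 - E2 y)) by apply: Sm_B=> //;exact: Sm_c.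
have Sb1 : Sm b1 by exact: Sm_bB. have Sb2 : Sm b2 by exact: Sm_bB.
have d0 : 0 < b1 x + b2 x by exact: stp_den.
have e i : dd i tht x * (b1 x + b2 x) = - 2 * crd i x * ((1 - tht x) * bB' (2 - E2 x) + tht x * bB' (1 - (2 - E2 x))).
 have h1 : dd i b1 x = bB' (2 - E2 x) * (- (2 * crd i x)).
  by rewrite dd_bB// dd_B ?dd_c ?dd_E2 ?sub0r//;[exact: Sm_c|exact: Sm_E2].
 have h2 : dd i b2 x = bB' (1 - (2 - E2 x)) * (2 * crd i x).
  by rewrite dd_bB// dd_B ?dd_c//;[rewrite dd_B ?dd_c ?dd_E2 ?sub0r ?opprK//;[exact: Sm_c|exact: Sm_E2]|exact: Sm_c].
 have : dd i (fun y=> tht y * (b1 y + b2 y)) x = dd i b1 x.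
  congr (dd i _ x);apply/funext=> y;rewrite /tht /stp -/(b1 y) -/(b2 y) divfK// gt_eqF//;exact: stp_den.
 have St := Sm_tht;have Sb := Sm_D Sb1 Sb2.
 rewrite (dd_M i x St Sb) (dd_D i x Sb1 Sb2) h1 h2=> h.
 apply: (@addrI _ (tht x * (bB' (2 - E2 x) * - (2 * crd i x) + bB' (1 - (2 - E2 x)) * (2 * crd i x)))).
 by rewrite [dd i tht x * _]mulrC h;ring.
rewrite -(pmulr_lle0 _ d0) mulr_suml.
have /andP[t0 t1] := stp01 (2 - E2 x).
have p0 : 0 <= (1 - tht x) * bB' (2 - E2 x) + tht x * bB' (1 - (2 - E2 x)).
 by apply: addr_ge0;apply: mulr_ge0;rewrite ?bB'_ge0// subr_ge0.
rewrite -oppr_ge0 -sumrN;apply: sumr_ge0=> i _.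
rewrite -mulrA e;move: p0;set W := (X in 0 <= X)=> p0.
rewrite (_ : - (crd i x * (- 2 * crd i x * W)) = 2 * (crd i x ^+ 2 * W));last by ring.
by rewrite mulr_ge0// mulr_ge0// sqr_ge0.
Qed.

(* A smooth function equal to ln|x| away from the origin. *)
Definition Qq x : R := 1 + stp (4 * E2 x - 1) * (E2 x - 1).
Lemma Sm_Qq : Sm Qq.
have h : Sm (fun x=> 4 * E2 x - 1) by apply: Sm_B;[apply: Sm_Z;exact: Sm_E2|exact: Sm_c].
apply: Sm_D;first exact: Sm_c.
by apply: Sm_M;[exact: Sm_stp h|apply: Sm_B;[exact: Sm_E2|exact: Sm_c]].
Qed.
Lemma Qq_out x : 2^-1 <= E2 x -> Qq x = E2 x.
by move=> h;rewrite /Qq stp1;[ring|lra]. Qed.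
Lemma Qq_in x : E2 x <= 4^-1 -> Qq x = 1.
by move=> h;rewrite /Qq stp0;[ring|lra]. Qed.
Lemma Qq_ge x : E2 x <= 1 -> E2 x <= Qq x.
by move=> h;rewrite /Qq;have /andP[] := stp01 (4 * E2 x - 1);move: (stp _)=> s *;nra. Qed.
Lemma Qq_le x : E2 x <= 1 -> Qq x <= 1.
by move=> h;rewrite /Qq;have /andP[] := stp01 (4 * E2 x - 1);move: (stp _)=> s *;nra. Qed.
Lemma Qq_gt0 x : 0 < Qq x.
have [h|h] := leP (E2 x) 4^-1;first by rewrite Qq_in.
have [h1|h1] := leP (E2 x) 1;first by apply: lt_le_trans (Qq_ge h1);apply: lt_trans h.
by rewrite Qq_out;lra.
Qed.
Definition Lk x : R := 2^-1 * ln (Qq x).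
Lemma Sm_lnQ : Sm (fun x=> ln (Qq x)). Proof. exact: Sm_ln Sm_Qq Qq_gt0. Qed.
Lemma Sm_Lk : Sm Lk. Proof. exact: Sm_Z Sm_lnQ. Qed.
Lemma dd_Lk i x : dd i Lk x = 2^-1 * ((Qq x)^-1 * dd i Qq x).
rewrite (dd_Z _ _ _ Sm_lnQ);congr (_ * _);apply: dd_eq;apply: is_derive_comp1.
 exact: Sm_der Sm_Qq.
exact: is_derive1_ln (Qq_gt0 x).
Qed.
Lemma dd_Lk_out i x : 2^-1 < E2 x -> dd i Lk x = crd i x * (Qq x)^-1.
move=> h;rewrite dd_Lk (_ : dd i Qq x = 2 * crd i x);first by field;rewrite gt_eqF// Qq_gt0.
rewrite -dd_E2;apply: dd_near;apply: filterS (E2_near h)=> y hy;apply: Qq_out;exact: ltW.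
Qed.
(** The Laplacian of the regularized logarithm: a smooth charge in place of the point mass at the
    origin. It lives in a small disk because the logarithm is harmonic elsewhere. *)
Definition rho x : R := \sum_i dd i (dd i Lk) x.
Lemma rho0 x : 2^-1 < E2 x -> rho x = 0.
move=> h;have SV := Sm_V Sm_Qq Qq_gt0;have Qn0 := gt_eqF (Qq_gt0 x).
have e i : dd i (dd i Lk) x = - crd i x * (2 * crd i x) / Qq x ^+ 2 + (Qq x)^-1.
 rewrite (@dd_near _ _ (fun y=> crd i y * (Qq y)^-1));last first.
  by apply: filterS (E2_near h)=> y hy;exact: dd_Lk_out.
 rewrite (dd_M i x (Sm_crd i) SV) dd_crd mulr1;congr (_ + _).
 have hQ : dd i Qq x = 2 * crd i x.
  rewrite -dd_E2;apply: dd_near;apply: filterS (E2_near h)=> y hy;apply: Qq_out;exact: ltW.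
 have : dd i (fun y=> Qq y * (Qq y)^-1) x = 0.
  rewrite -[RHS](dd_c i (1 : R) x);congr (dd i _ x);apply/funext=> y.
  by rewrite divff// gt_eqF// Qq_gt0.
 rewrite (dd_M i x Sm_Qq SV) hQ=> /eqP;rewrite addr_eq0=> /eqP E.
 have -> : dd i (fun y=> (Qq y)^-1) x = (Qq x)^-1 * (Qq x * dd i (fun y=> (Qq y)^-1) x).
  by rewrite mulKf// Qn0.
 by rewrite E;field;rewrite Qn0.
rewrite /rho (eq_bigr _ (fun i _=> e i)) big_split /= sumr_const card_ord.
have -> : \sum_i - crd i x * (2 * crd i x) / Qq x ^+ 2 = - 2 * E2 x / Qq x ^+ 2.
 by rewrite -crd_E2 !mulr_sumr mulr_suml;apply: eq_bigr=> i _;ring.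
by rewrite (Qq_out (ltW h)) -(Qq_out (ltW h));field;rewrite Qn0.
Qed.
Lemma Sm_sum2 (F : 'I_2 -> R * R -> R) : (forall i, Sm (F i)) -> Sm (fun x=> \sum_i F i x).
by move=> h;apply: (Sm_ext (f := fun x=> F ord0 x + F ord_max x))=> [x|];[rewrite sum2E|exact: Sm_D].
Qed.
Lemma E2_out (r : R) x : 0 <= r -> ~ box 0 r x -> r ^+ 2 < E2 x.
by move=> r0 hx;rewrite ltNge;apply/negP=> h;apply: hx;exact: E2_box. Qed.
Lemma tf_rho : tf rho.
split;first by apply: Sm_sum2=> i;apply: Sm_dd;apply: Sm_dd;exact: Sm_Lk.
by exists 1=> x /(E2_out ler01) h;apply: rho0;rewrite expr1n in h;lra.
Qed.

(** [tht] equals [1] on the support of [rho], so integration by parts moves the integral to the ring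
    [1 <= |x|^2 <= 2]. There [D Lk = x / |x|^2], and since [x . D tht <= 0] it may be replaced by
    [x / 2]; a second integration by parts bounds [I rho] below by [I tht]. *)
Lemma I_rho_gt0 : 0 < I rho.
have St := Sm_tht;have tt := tf_tht.
have L1d i : L1 (fun x=> dd i (dd i Lk) x * tht x).
 by apply: tf_L1;apply: tf_M tt;apply: Sm_dd;apply: Sm_dd;exact: Sm_Lk.
have L1e i : L1 (fun x=> dd i Lk x * dd i tht x).
 by apply: tf_L1;apply: tf_M (tf_dd i tt);apply: Sm_dd;exact: Sm_Lk.
have L1f i : L1 (fun x=> crd i x * dd i tht x).
 by apply: tf_L1;apply: tf_M (tf_dd i tt);exact: Sm_crd.
have e1 : I rho = - \I_x (\sum_i dd i Lk x * dd i tht x).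
 rewrite (eq_I (f := rho) (g := fun x=> \sum_i dd i (dd i Lk) x * tht x));last first.
  move=> x;rewrite -mulr_suml -/(rho x);have [h|h] := leP (E2 x) 1;first by rewrite tht1// mulr1.
  by rewrite rho0 ?mul0r//;lra.
 rewrite (I_sum L1d) (I_sum L1e) -sumrN;apply: eq_bigr=> i _.
 by rewrite (IBP i (Sm_dd i Sm_Lk) tt) opprK.
have e2 : \I_x (\sum_i crd i x * dd i tht x) = - (2 * I tht).
 rewrite (I_sum L1f) (eq_bigr (fun=> - I tht))=> [|i _];first by rewrite sumr_const card_ord;ring.
 rewrite (IBP i (Sm_crd i) tt);congr (- _);apply: eq_I=> x;by rewrite dd_crd mul1r.
have le x : \sum_i dd i Lk x * dd i tht x <= 2^-1 * \sum_i crd i x * dd i tht x.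
 have [h1|h1] := ltP (E2 x) 1.
  have z i : dd i tht x = 0.
   rewrite -[RHS](dd_c i (1 : R) x);apply: dd_near.
   by apply: filterS (E2_near_lt h1)=> y /ltW;exact: tht1.
  by rewrite !big1 ?mulr0// => i _;rewrite z mulr0.
 have [h2|h2] := ltP 2 (E2 x).
  have z i : dd i tht x = 0.
   rewrite -[RHS](dd_c i (0 : R) x);apply: dd_near.
   by apply: filterS (E2_near h2)=> y /ltW;exact: tht0.
  by rewrite !big1 ?mulr0// => i _;rewrite z mulr0.
 have h3 : 2^-1 < E2 x by lra.
 have -> : \sum_i dd i Lk x * dd i tht x = (E2 x)^-1 * \sum_i crd i x * dd i tht x.
  rewrite mulr_sumr;apply: eq_bigr=> i _;rewrite (dd_Lk_out _ h3) (Qq_out (ltW h3));ring.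
 apply: (ler_wnM2r (dd_tht_sign x));rewrite lef_pV2 ?posrE//;lra.
have L1s (F : 'I_2 -> R * R -> R) : (forall i, L1 (F i)) -> L1 (fun x=> \sum_i F i x) by exact: L1_sum.
have h4 := I_le (L1s _ L1e) (L1Z 2^-1 (L1s _ L1f)) le.
have e3 : I tht <= I rho.
 move: h4;rewrite (IZ _ (L1s _ L1f)) e2 e1;lra.
apply: lt_le_trans e3;apply: (@lt_le_trans _ _ (I (\1_(box 0 (2^-1 : R))))).
 by rewrite I_box ?invr_ge0// mulr_gt0// exprn_gt0.
apply: I_le;[exact: L1_box|exact: tf_L1|]=> x.
have [hx|hx] := pselect (box 0 (2^-1 : R) x);last by rewrite indF//;case/andP: (stp01 (2 - E2 x)).
rewrite indT// tht1//;move: hx;rewrite box0E /E2=> -[a b].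
rewrite -(real_normK (num_real x.1)) -(real_normK (num_real x.2)).
by have := normr_ge0 x.1;have := normr_ge0 x.2;nra.
Qed.

(** The truncated logarithm: the difference of the potential at two consecutive dyadic scales, where
    [ln 2] cancels the two logarithms outside a small disk. *)
Definition k0 x : R := Lk x - Lk (2 *: x + 0) + ln 2.
Lemma Sm_k0 : Sm k0.
have h : Sm (fun x=> Lk (2 *: x + 0)) := Sm_aff 2 0 Sm_Lk.
by apply: Sm_D;[apply: Sm_B=> //;exact: Sm_Lk|exact: Sm_c].
Qed.
Lemma E2Z (a : R) x : E2 (a *: x + 0) = a ^+ 2 * E2 x.
by rewrite addr0 /E2 /= /GRing.scale /=;ring. Qed.
Lemma k0_supp x : 2^-1 <= E2 x -> k0 x = 0.
move=> h;have E0 : 0 < E2 x by lra.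
have h2 : 2^-1 <= E2 (2 *: x + 0) by rewrite E2Z;lra.
rewrite /k0 /Lk !Qq_out// E2Z lnM ?posrE ?exprn_gt0// lnXn//;lra.
Qed.
(** It amounts to [Qq (2 x) <= 4 Qq x]: an equality where [Qq] is [E2] at both points, a consequence
    of [Qq >= E2] in the middle range, and of [Qq <= 1] near the origin. *)
Lemma k0_ge0 x : 0 <= k0 x.
suff : ln (Qq (2 *: x + 0)) <= ln (2 ^+ 2 * Qq x).
 by rewrite lnM ?posrE ?exprn_gt0 ?Qq_gt0// lnXn// mulr2n /k0 /Lk;lra.
rewrite ler_ln ?posrE ?mulr_gt0 ?exprn_gt0 ?Qq_gt0//.
have [h|h] := leP 2^-1 (E2 x).
 by rewrite (Qq_out h) Qq_out E2Z//;lra.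
have h1 : E2 x <= 1 by lra.
have [h2|h2] := leP (E2 x) 4^-1.
 rewrite (Qq_in h2) mulr1;apply: le_trans (Qq_le _) _;first by rewrite E2Z;lra.
 by rewrite -natrX ler1n.
rewrite (@Qq_out (2 *: x + 0));last by rewrite E2Z;lra.
by rewrite E2Z;apply: ler_wpM2l;[rewrite exprn_ge0|exact: Qq_ge].
Qed.
Lemma tf_k0 : tf k0.
split;first exact: Sm_k0.
by exists 1=> x /(E2_out ler01) h;apply: k0_supp;rewrite expr1n in h;lra.
Qed.
Lemma lap_k0 x : \sum_i dd i (dd i k0) x = rho x - 4 * rho (2 *: x + 0).
have SL := Sm_Lk.
have e i : dd i k0 = fun y=> dd i Lk y - 2 * dd i Lk (2 *: y + 0).
 have S1 : Sm (fun x=> Lk (2 *: x + 0)) := Sm_aff 2 0 SL.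
 apply/funext=> y;rewrite dd_D;[|exact: Sm_B|exact: Sm_c].
 by rewrite dd_B// dd_c addr0 dd_aff.
have e2 i : dd i (dd i k0) x = dd i (dd i Lk) x - 4 * dd i (dd i Lk) (2 *: x + 0).
 have S1 := Sm_dd i SL;have S2 : Sm (fun x=> dd i Lk (2 *: x + 0)) := Sm_aff 2 0 S1.
 by rewrite e (dd_B i x S1 (Sm_Z 2 S2)) (dd_Z _ _ _ S2) (dd_aff 2 0 i x S1) mulrA -natrM.
by rewrite (eq_bigr _ (fun i _=> e2 i)) sumrB -mulr_sumr.
Qed.

Definition sc (j : nat) : R := 2 ^- j.
Lemma sc_gt0 j : 0 < sc j. Proof. by rewrite invr_gt0 exprn_gt0. Qed.
Lemma scS j : sc j.+1 = sc j / 2.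
by rewrite /sc exprS invfM mulrC. Qed.
Definition rh j y : R := (2 ^+ j) ^+ 2 * rho (2 ^+ j *: y + 0).
(** As a function of [y], the truncated logarithm at scale [2^-j] around [x]. By [lap_kk] its
    Laplacian is the difference of two consecutive averaging kernels, which is the link between
    averages of a function and its Laplacian. *)
Definition kk j x y : R := k0 (- 2 ^+ j *: y + 2 ^+ j *: x).
Lemma tf_aff f (a : R) v : a != 0 -> tf f -> tf (fun y=> f (a *: y + v)).
move=> a0 [hf [r hr]];split;first exact: Sm_aff.
pose s := (`|r| + `|v.1| + `|v.2|) / `|a|;have na : 0 < `|a| by rewrite normr_gt0.
exists s=> y hy;apply: hr=> h;apply: hy;move: h;rewrite !box0E /= /GRing.scale /= => -[h1 h2].
have key (b w : R) : `|a * b + w| <= r -> `|w| <= `|v.1| + `|v.2| -> `|b| <= s.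
 move=> q1 q2;rewrite /s ler_pdivlMr// mulrC -normrM -[a * b](addrK w).
 apply: le_normB;rewrite -addrA;apply: lerD=> //.
 by apply: le_trans q1 _;exact: ler_norm.
by split;[apply: key h1 _;rewrite lerDl|apply: key h2 _;rewrite lerDr].
Qed.
Lemma twoj0 j : 0 < 2 ^+ j :> R. Proof. by rewrite exprn_gt0. Qed.
Lemma tf_rh j : tf (rh j).
by apply: tf_Z;apply: tf_aff tf_rho;rewrite gt_eqF// twoj0. Qed.
Lemma tf_kk j x : tf (kk j x).
by apply: tf_aff tf_k0;rewrite oppr_eq0 gt_eqF// twoj0. Qed.
Lemma rh_supp j y : ~ box 0 (sc j) y -> rh j y = 0.
move=> hy;rewrite /rh rho0 ?mulr0// E2Z.
have := E2_out (ltW (sc_gt0 j)) hy;rewrite /sc exprVn=> h.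
have : 1 < (2 ^+ j) ^+ 2 * E2 y.
 by rewrite mulrC -ltr_pdivrMr ?exprn_gt0// ?twoj0// div1r.
lra.
Qed.
Lemma kk_supp j x y : ~ box x (sc j) y -> kk j x y = 0.
move=> hy;rewrite /kk (_ : - 2 ^+ j *: y + 2 ^+ j *: x = 2 ^+ j *: (x - y) + 0);last first.
 by rewrite addr0 scalerBr scaleNr addrC.
apply: k0_supp;rewrite E2Z.
have hxy : ~ box 0 (sc j) (x - y).
 move=> h;apply: hy;move: h;rewrite box0E=> -[h1 h2];split;rewrite distrC.
  exact: h1.
 exact: h2.
have := E2_out (ltW (sc_gt0 j)) hxy;rewrite /sc exprVn=> h.
have : 1 < (2 ^+ j) ^+ 2 * E2 (x - y).
 by rewrite mulrC -ltr_pdivrMr ?exprn_gt0// ?twoj0// div1r.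
lra.
Qed.
Lemma kk_ge0 j x y : 0 <= kk j x y. Proof. exact: k0_ge0. Qed.
Lemma dd_kk j x i y : dd i (kk j x) y = - 2 ^+ j * dd i k0 (- 2 ^+ j *: y + 2 ^+ j *: x).
exact: dd_aff Sm_k0. Qed.
Lemma dd2_kk j x i i' y : dd i' (dd i (kk j x)) y = (2 ^+ j) ^+ 2 * dd i' (dd i k0) (- 2 ^+ j *: y + 2 ^+ j *: x).
have S1 := Sm_dd i Sm_k0.
have S2 : Sm (fun y=> dd i k0 (- 2 ^+ j *: y + 2 ^+ j *: x)) := Sm_aff _ _ S1.
rewrite (_ : dd i (kk j x) = fun y=> - 2 ^+ j * dd i k0 (- 2 ^+ j *: y + 2 ^+ j *: x)).
 by rewrite (dd_Z _ _ _ S2) (dd_aff _ _ _ _ S1);ring.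
by apply/funext=> z;exact: dd_kk.
Qed.
Lemma lap_kk j x y : \sum_i dd i (dd i (kk j x)) y = rh j (x - y) - rh j.+1 (x - y).
rewrite (eq_bigr _ (fun i _=> dd2_kk j x i i y)) -mulr_sumr lap_k0 /rh.
have -> : - 2 ^+ j *: y + 2 ^+ j *: x = 2 ^+ j *: (x - y) + 0 by rewrite addr0 scalerBr scaleNr addrC.
have -> : 2 *: (2 ^+ j *: (x - y) + 0) + 0 = 2 ^+ j.+1 *: (x - y) + 0 by rewrite !addr0 scalerA exprS.
have -> : (2 ^+ j.+1) ^+ 2 = 4 * (2 ^+ j) ^+ 2 :> R by rewrite [2 ^+ j.+1]exprS;ring.
by rewrite mulrBr;congr (_ - _);rewrite mulrA [_ * 4]mulrC.
Qed.

(* [avg j f x] is a signed average of [f] over the square of half-side [2^-j] centered at [x]. *)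
Definition avg j f := cv f (rh j).
Lemma avgE j f x : L1 f -> avg j f x = \I_y (f y * rh j (x - y)).
by move=> hf;rewrite /avg (cv_tfE _ hf (tf_rh j)). Qed.
Lemma avg_diff j f x : L1 f -> avg j f x - avg j.+1 f x = \sum_i \I_y (f y * dd i (dd i (kk j x)) y).
move=> hf;have l j' := L1_cv_tf x hf (tf_rh j').
rewrite !avgE// -(IB (l j) (l j.+1)) -I_sum.
 by apply: eq_I=> y;rewrite -mulr_sumr lap_kk mulrBr.
move=> i;have [M _ hM] := tf_bound (tf_dd i (tf_dd i (tf_kk j x))).
have : L1 (fun y=> dd i (dd i (kk j x)) y * f y).
 by apply: (L1_bM _ hM hf);exact: Sm_mf (tf_Sm (tf_dd i (tf_dd i (tf_kk j x)))).
by congr L1;apply/funext=> y;rewrite mulrC.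
Qed.
(** Consecutive kernels differ by the Laplacian of a compactly supported function, whose integral is
    zero; this replaces the change of variables under dilation. *)
Lemma I_rh j : I (rh j) = I rho.
have e : I (rh 0) = I rho by apply: eq_I=> y;rewrite /rh expr0 expr1n mul1r scale1r addr0.
have step j' : I (rh j') - I (rh j'.+1) = 0.
 have l1 := tf_L1 (tf_rh j');have l2 := tf_L1 (tf_rh j'.+1).
 have o1 := I_op 0 l1;have o2 := I_op 0 l2.
 transitivity (\I_y (rh j' (0 - y)) - \I_y (rh j'.+1 (0 - y)));first exact: (congr2 (fun a b=> a - b) (esym o1) (esym o2)).
 rewrite -(IB (L1_op 0 l1) (L1_op 0 l2)).
 rewrite (eq_I (g := fun y=> \sum_i dd i (dd i (kk j' 0)) y))=> [|y];last by rewrite lap_kk.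
 have l3 i : L1 (fun y=> dd i (dd i (kk j' 0)) y) by apply: tf_L1;apply: tf_dd;apply: tf_dd;exact: tf_kk.
 rewrite (I_sum l3);apply: big1=> i _;apply: I_dd;apply: tf_dd;exact: tf_kk.
elim: j=> [|j IH];first exact: e.
by rewrite -IH;apply/eqP;rewrite eq_sym -subr_eq0 step.
Qed.
Lemma rh_bound : exists2 C, 0 <= C & forall j y, `|rh j y| <= C * (2 ^+ j) ^+ 2.
have [C C0 hC] := tf_bound tf_rho;exists C=> // j y.
by rewrite /rh normrM ger0_norm ?sqr_ge0// mulrC;apply: ler_wpM2r;[exact: sqr_ge0|exact: hC].
Qed.
Lemma rh_ker j : ker (sc j) (rh j).
split;[exact: Sm_mf (tf_Sm (tf_rh j))|by have [M _ hM] := tf_bound (tf_rh j);exists M|exact: rh_supp].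
Qed.
Lemma I_rh_abs : exists2 C, 0 <= C & forall j, \I_y (`|rh j y|) <= C.
have [C C0 hC] := rh_bound;exists (C * 4)=> [|j];first by rewrite mulr_ge0.
apply: (letr (\I_y (C * (2 ^+ j) ^+ 2 * \1_(box 0 (sc j)) y))).
 apply: I_le;[exact: L1_abs (tf_L1 (tf_rh j))|exact: L1Z (L1_box _ _)|]=> y.
 have [hy|hy] := pselect (box 0 (sc j) y);first by rewrite indT// mulr1.
 by rewrite rh_supp// normr0 indF// mulr0.
rewrite (IZ _ (L1_box _ _)) I_box ?(ltW (sc_gt0 j))//.
have tn0 : (2 ^+ j : R) != 0 by rewrite gt_eqF// twoj0.
by rewrite (_ : C * (2 ^+ j) ^+ 2 * (4 * sc j ^+ 2) = C * 4)// /sc;field.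
Qed.
End Kernel.
#[global] Opaque dd rho k0.

(** * Local boundedness of the modulus and extension of the tangential equation *)

Section Local.
Context {R : realType}.
Implicit Types (f g phi psi k : R * R -> R) (x y v : R * R) (i : 'I_2).

Lemma geo (r : R) : r < 1 -> exists2 d, 0 < d & exists2 s, r < s < 1 &
 forall x y, E2 x <= r -> box x d y -> E2 y <= s.
move=> r1;have [||d d0 hd] := @geo2 R r ((1 + r) / 2);[lra|lra|].
by exists d=> //;exists ((1 + r) / 2)=> //;apply/andP;split;lra.
Qed.
Lemma sc_le j j' : (j <= j')%N -> sc j' <= sc j :> R.
by move=> h;rewrite /sc lef_pV2 ?posrE ?exprn_gt0//;apply: ler_weXn2l=> //;rewrite ler1n. Qed.
Lemma sc_small (d : R) : 0 < d -> exists m, sc m <= d.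
move=> d0;exists (Num.truncn d^-1);rewrite /sc invf_ple ?posrE ?exprn_gt0//.
by apply: ltW;apply: lt_le_trans (truncnS_gt _) _;rewrite -natrX ler_nat ltn_expl.
Qed.
Lemma box_W x (r s : R) y : r <= s -> box x r y -> box x s y.
by move=> rs [h1 h2];split;[exact: le_trans h1 rs|exact: le_trans h2 rs]. Qed.
Lemma geo_sc (r : R) : r < 1 -> exists m, exists2 s, r < s < 1 &
 forall j x y, (m <= j)%N -> E2 x <= r -> box x (sc j) y -> E2 y <= s.
move=> /geo[d d0 [s hs h]];have [m hm] := sc_small d0;exists m, s=> // j x y mj hx hy.
by apply: h hx _;apply: box_W hy;apply: le_trans hm;exact: sc_le.
Qed.
Lemma cd_of_box f x (r s : R) : Sm f -> s < 1 -> (forall y, box x r y -> E2 y <= s) ->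
 (forall y, ~ box x r y -> f y = 0) -> cd f.
move=> hf s1 h h0;split=> //;exists s=> // y hy;apply: h0=> hb.
by have := h _ hb;rewrite leNgt hy.
Qed.

Lemma clip_abs (M t : R) : `|Num.min `|M| (Num.max (- `|M|) t)| <= `|M|.
have M0 := normr_ge0 M;rewrite ler_norml;apply/andP;split;last by rewrite ge_min lexx.
by rewrite le_min le_max lexx /= andbT;lra.
Qed.
Lemma L2_aebM f g (M : R) : mf f -> {ae leb2, forall x, `|f x| <= M} -> L2 g -> L2 (fun x=> f x * g x).
move=> hf hM hg;pose c x := Num.min `|M| (Num.max (- `|M|) (f x)).
have bc x : `|c x| <= `|M| := clip_abs M (f x).
have mc : mf c.
 by apply: measurable_funTS;apply: measurable_minr;[exact: mfc|apply: measurable_maxr=> //;exact: mfc].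
apply: (L2_ae _ (L2_bM mc bc hg));first by apply: mfM=> //;case: hg.
apply: filterS hM=> x;rewrite ler_norml=> /andP[h1 h2];congr (_ * _);rewrite /c.
have a := ler_norm M.
rewrite max_r;last by lra.
by rewrite min_r//;lra.
Qed.
Lemma measurable_E2 (r : R) : measurable [set x : R * R | E2 x <= r].
rewrite (_ : [set _ | _] = E2 @^-1` `]-oo, r]%classic);last by apply/seteqP;split=> x;rewrite /= in_itv.
by rewrite -[X in measurable X]setTI;apply: (Sm_mf Sm_E2)=> //;exact: measurable_itv.
Qed.

(** [avg j f] converges to [I rho * f] in L^1, so the positive part of [I rho * f - M] on [S] has
    integral zero. Convergence in L^1 does the work of Lebesgue points. *)
Lemma avg_bound_ae f (S : set (R * R)) (M : R) (m : nat) : measurable S -> L1 f ->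
 (forall j x, (m <= j)%N -> S x -> avg j f x <= M) ->
 {ae leb2, forall x, S x -> I rho * f x <= M}.
move=> mS hf hM.
have [C C0 hC] := @I_rh_abs R.
pose w x := \1_S x * Num.max 0 (I rho * f x - M).
have mw : mf w.
 apply: mfM;first exact: mf_ind.
 apply: measurable_maxr;first exact: mfc.
 by apply: mfB;[apply: mfZ;exact: L1_mf|exact: mfc].
have w0 x : 0 <= w x.
 by apply: mulr_ge0;[case/andP: (ind01 S x)|rewrite le_max lexx].
have L1d j : L1 (fun x=> `|avg j f x - I rho * f x|).
 by apply: L1_abs;apply: L1B;[exact: L1_cv hf (rh_ker j)|exact: L1Z].
have wle j x : (m <= j)%N -> w x <= `|avg j f x - I rho * f x|.
 move=> mj;have [hx|hx] := pselect (S x);last by rewrite /w indF// mul0r.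
 rewrite /w indT// mul1r ge_max normr_ge0 /= distrC;apply: le_trans (ler_norm _).
 by apply: lerB=> //;exact: hM.
have L1w : L1 w by apply: (L1_le mw (L1d m))=> x;rewrite ger0_norm// wle.
have Iw : I w = 0.
 apply/eqP;rewrite eq_le I_ge0// andbT;apply: le_eps=> e e0;rewrite add0r.
 have C1 : 0 < C + 1 by rewrite ltr_wpDl.
 have [d d0 hd] := cv_L1_approx hf (divr_gt0 e0 C1).
 have [m' hm'] := sc_small d0;pose j := maxn m m'.
 have := hd _ _ (rh_ker j) (le_trans (sc_le (leq_maxr m m')) hm');rewrite I_rh -/(avg j f)=> h.
 apply: le_trans (I_le L1w (L1d j) (fun x=> wle j x (leq_maxl m m'))) _.
 apply: le_trans h _;apply: (letr (e / (C + 1) * C)).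
  by apply: ler_wpM2l;[rewrite divr_ge0 ?ltW|exact: hC].
 by rewrite mulrAC ler_pdivrMr//;apply: ler_wpM2l;[exact: ltW|rewrite lerDl].
have := I_eq0 L1w w0 Iw;apply: filterS=> x hx hr;move: hx.
rewrite /w indT// mul1r=> h;have : I rho * f x - M <= 0 by rewrite -h le_max lexx orbT.
by rewrite subr_le0.
Qed.

Lemma ext_arith (a b c d e : R) : `|a - b| <= e / 2 -> `|c - - d| <= e / 2 -> a + c = 0 -> `|b - d| <= e.
move=> h1 h2 hz;have -> : b - d = - (a - b) - (c - - d) by rewrite -[RHS]addr0 -[X in _ = _ + X]hz;ring.
by apply: le_normB;rewrite normrN [leRHS](splitr e);exact: lerD.
Qed.

Section Sta.
Variables (n : nat) (U : 'I_n -> R * R -> R) (G : 'I_n -> 'I_2 -> R * R -> R).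
Hypothesis st : stationary U G.
Local Notation lam := (en U).
Local Notation V := (pn U).
Local Notation DL := (pDm U G).
Local Notation DV := (pDn U G).
(** The energy density [|Dv|^2] of the direction. *)
Definition gv x := \sum_i \sum_k DV k i x ^+ 2.
Let hU := st_W2 st.
Let U1 := st_ge1 st.
Let lam0 x : 0 < lam x. Proof. exact: lt_le_trans (U1 x). Qed.
Let W2L i := W2_en ltr01 U1 hU i.
Let D2L : D2 lam. Proof. by case: (W2L ord0). Qed.
Let mV j : mf (V j) := pn_mf ltr01 U1 hU j.
Let bV j x : `|V j x| <= 1 := pn_abs ltr01 U1 j x.
Let D2lDV (k : 'I_n) i : D2 (fun x=> lam x * DV k i x) := D2_mDn ltr01 U1 hU k i.
Let mL : mf lam. Proof. by case: D2L. Qed.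

Lemma gv_ge0 x : 0 <= gv x. Proof. by apply: sumr_ge0=> i _;exact: ss_ge0. Qed.
Lemma mf_gv : mf gv.
by apply: mf_sum=> i;exact: mf_aa st i. Qed.
Lemma L1_l2gv : L1 (msk (fun x=> lam x ^+ 2 * gv x)).
rewrite (_ : (fun x=> _) = fun x=> \sum_i lam x ^+ 2 * \sum_k DV k i x ^+ 2).
 by apply: L1_msk_sum=> i;exact: L1_aa st i.
by apply/funext=> x;rewrite mulr_sumr.
Qed.
Lemma L1_le_gv f (B : R) : mf f -> (forall x, `|f x| <= B * (lam x ^+ 2 * gv x)) -> L1 (msk f).
move=> hf hB;apply: (L1_le _ (L1Z B L1_l2gv))=> [|x];first exact: mf_msk.
by have [dx|dx] := pselect (disk x);[rewrite !mskT|rewrite !mskF// normr0 mulr0].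
Qed.
Lemma L1_lgv : L1 (msk (fun x=> lam x * gv x)).
apply: (@L1_le_gv _ 1)=> [|x];first by apply: mfM=> //;exact: mf_gv.
rewrite normrM (ger0_norm (gv_ge0 x)) gtr0_norm// mul1r;apply: ler_wpM2r;first exact: gv_ge0.
by rewrite expr2 ler_peMl ?(ltW (lam0 x)).
Qed.
Lemma L1_gv : L1 (msk gv).
apply: (@L1_le_gv _ 1)=> [|x];first exact: mf_gv.
rewrite (ger0_norm (gv_ge0 x)) mul1r ler_peMl ?gv_ge0//;exact: exprn_ege1.
Qed.

(** Subharmonicity tested with the nonnegative kernels [kk j x] makes the averages nonincreasing in
    [j], so the one at the coarsest admissible scale, controlled by the L^1 norm, bounds all finer
    ones. *)
Lemma lam_avg (r : R) : r < 1 -> exists M, exists m, forall j x, (m <= j)%N -> E2 x <= r -> avg j (msk lam) x <= M.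
move=> r1;have [m [s /andP[rs s1] hm]] := geo_sc r1.
have L1L : L1 (msk lam) := K2_L1 (D2_K2 D2L).
have mono j x : (m <= j)%N -> E2 x <= r -> avg j.+1 (msk lam) x <= avg j (msk lam) x.
 move=> mj hx;have hc : cd (kk j x).
  apply: (cd_of_box (tf_Sm (tf_kk j x)) s1 (fun y=> hm j x y mj hx));exact: kk_supp.
 rewrite -subr_ge0 (avg_diff j x L1L).
 have -> : \sum_i \I_y (msk lam y * dd i (dd i (kk j x)) y) = - \sum_i \I_y (DL i y * dd i (kk j x) y).
  rewrite -sumrN;apply: eq_bigr=> i _;have [_ _ wL] := W2L i.
  rewrite -(wL _ (cd_dd i hc));apply: eq_I=> y;exact: msk_cd (cd_dd i (cd_dd i hc)).
 by rewrite oppr_ge0;apply: (subharmonic st hc);exact: kk_ge0.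
have [C C0 hC] := @rh_bound R.
exists (C * (2 ^+ m) ^+ 2 * \I_y (`|msk lam y|)), m=> j x mj hx.
apply: (letr (avg m (msk lam) x)).
 elim: j mj=> [|j IH];first by rewrite leqn0=> /eqP ->.
 rewrite leq_eqVlt=> /orP[/eqP -> //|mj];apply: le_trans (IH mj);exact: mono.
apply: le_trans (ler_norm _) _;rewrite (avgE _ _ L1L) -(IZ _ (L1_abs L1L));apply: I_absle.
- exact: L1_mf (L1_cv_tf x L1L (tf_rh m)).
- exact: L1Z (L1_abs L1L).
- by move=> y;rewrite normrM mulrC;apply: ler_wpM2r.
Qed.

Lemma lam_bounded (r : R) : r < 1 -> exists2 M, 1 <= M & {ae leb2, forall x, E2 x <= r -> lam x <= M}.
move=> r1;have [M0 [m hm]] := lam_avg r1;have c0 := @I_rho_gt0 R.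
have L1L : L1 (msk lam) := K2_L1 (D2_K2 D2L).
exists (Num.max 1 (M0 / I rho));first by rewrite le_max lexx.
have := avg_bound_ae (measurable_E2 r) L1L hm;apply: filterS=> x h hx;rewrite le_max;apply/orP;right.
rewrite ler_pdivlMr// mulrC;have := h hx;rewrite mskT//;apply/diskE;exact: le_lt_trans hx r1.
Qed.

(** Once [lambda] is bounded near the support, [lambda^2 Dv] is square integrable there, and the
    equation passes from smooth test functions to bounded H^1 ones by [test_approx]. *)
Lemma tangential_ext j phi (P : 'I_2 -> R * R -> R) (r B : R) : r < 1 -> (forall x, r < E2 x -> phi x = 0) ->
 (forall x, `|phi x| <= B) -> (forall i, wd i phi (P i)) ->
 (forall i x, r < E2 x -> P i x = 0) ->
 \sum_i \I_x (lam x ^+ 2 * DV j i x * P i x) = \I_x (lam x ^+ 2 * gv x * V j x * phi x).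
move=> r1 hr hB hP hPr.
have [s [t [rs s1 st' t1]]] := mid2 r1.
have hc : cd (chi s t) := chi_cd st' t1.
have [M M1 hM] := lam_bounded t1.
have M0 : 0 <= M by lra.
have chi0 x : t < E2 x -> chi s t x = 0.
 by move=> h;apply: stp0;rewrite pmulr_lle0 ?invr_gt0 ?subr_gt0//;lra.
pose A i x := chi s t x * lam x * (lam x * DV j i x).
have LA i : L2 (A i).
 have hcl : mf (fun x=> chi s t x * lam x) by apply: mfM=> //;exact: Sm_mf (cd_Sm hc).
 have := L2_aebM (M := M) hcl _ (proj2 (D2lDV j i))=> H.
 have {}H : L2 (fun x=> chi s t x * lam x * msk (fun y=> lam y * DV j i y) x).
  apply: H;apply: filterS hM=> x hx;have [h|h] := leP (E2 x) t;last by rewrite chi0// mul0r normr0.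
  have /andP[c0 c1] := chi01 s t x.
  rewrite (ger0_norm (mulr_ge0 c0 (ltW (lam0 x))));apply: (letr (lam x));last exact: hx h.
  by apply: ler_piMl=> //;exact: ltW.
 congr L2: H;apply/funext=> x;rewrite /A;have [dx|dx] := pselect (disk x);first by rewrite mskT.
 by rewrite (cd_off hc dx) !mul0r.
(* With the cutoff [chi] absorbed into the coefficients the equation holds for every test function
   of the disk. The terms where [chi] is differentiated vanish on the support of [phi] and disappear
   in the limit. *)
pose f x := \sum_i dd i (chi s t) x * lam x * (lam x * DV j i x) - chi s t x * lam x ^+ 2 * gv x * V j x.
have Lf1 i : L1 (fun x=> dd i (chi s t) x * lam x * (lam x * DV j i x)).
 have := D2M_L1 (cd_dd i hc) D2L (D2lDV j i);congr L1;apply/funext=> x;by ring.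
have Lf2 : L1 (fun x=> chi s t x * lam x ^+ 2 * gv x * V j x).
 have [B1 B10 hB1] := tf_bound (cd_tf hc).
 have : L1 (fun x=> (chi s t x * V j x) * msk (fun y=> lam y ^+ 2 * gv y) x).
  apply: (@L1_bM _ _ _ B1) L1_l2gv;first by apply: mfM=> //;exact: Sm_mf (cd_Sm hc).
  by move=> x;rewrite normrM -[leRHS]mulr1;apply: ler_pM.
 congr L1;apply/funext=> x;have [dx|dx] := pselect (disk x);first by rewrite mskT//;ring.
 by rewrite mskF// (cd_off hc dx) !mul0r.
have Lf : L1 f.
 by apply: (@L1B _ (fun x=> \sum_i dd i (chi s t) x * lam x * (lam x * DV j i x))) Lf2;exact: L1_sum.
have zero psi : cd psi -> \sum_i \I_x (A i x * dd i psi x) + \I_x (f x * psi x) = 0.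
 move=> hpsi;have hcp : cd (fun x=> chi s t x * psi x) := cd_M (cd_Sm hc) hpsi.
 rewrite -[RHS](st_tan st j hcp).
 have [B2 B20 hB2] := tf_bound (cd_tf hpsi).
 have mpsi := Sm_mf (cd_Sm hpsi).
 have LA1 i : L1 (fun x=> A i x * dd i psi x) by apply: L2M=> //;exact: tf_L2 (tf_dd i (cd_tf hpsi)).
 have Lfp : L1 (fun x=> f x * psi x).
  have := L1_bM mpsi hB2 Lf;congr L1;apply/funext=> x;exact: mulrC.
 have LS : L1 (fun x=> \sum_i A i x * dd i psi x) := L1_sum LA1.
 have ES : \I_x (\sum_i A i x * dd i psi x) = \sum_i \I_x (A i x * dd i psi x) := I_sum LA1.
 rewrite -ES -(ID LS Lfp);apply: eq_I=> x.
 have [dx|dx] := pselect (disk x);last first.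
  rewrite mskF// (cd_off hpsi dx) mulr0 addr0 big1// => i _.
  by rewrite /A (cd_off hc dx) !mul0r.
 rewrite mskT// /f mulrBl mulr_suml addrA -big_split /=.
 have -> : chi s t x * lam x ^+ 2 * gv x * V j x * psi x =
  \sum_i chi s t x * lam x ^+ 2 * (\sum_k DV k i x ^+ 2) * V j x * psi x.
  by rewrite /gv mulr_sumr !mulr_suml.
 rewrite -sumrB;apply: eq_bigr=> i _.
 rewrite (dd_M i x (cd_Sm hc) (cd_Sm hpsi)) /A;move: (dd i (chi s t) x) (dd i psi x)=> a b;ring.
have near x i : r < E2 x \/ dd i (chi s t) x = 0.
 by have [h|h] := ltP r (E2 x);[left|right;exact: dd_chi1 (le_lt_trans h rs)].
have LHSE : \sum_i \I_x (A i x * P i x) = \sum_i \I_x (lam x ^+ 2 * DV j i x * P i x).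
 apply: eq_bigr=> i _;apply: eq_I=> x;have [h|h] := ltP r (E2 x);first by rewrite hPr// !mulr0.
 by rewrite /A chi1//;[ring|lra].
have RHSE : \I_x (f x * phi x) = - \I_x (lam x ^+ 2 * gv x * V j x * phi x).
 have L1R : L1 (fun x=> lam x ^+ 2 * gv x * V j x * phi x).
  have : L1 (fun x=> V j x * phi x * msk (fun y=> lam y ^+ 2 * gv y) x).
   apply: (@L1_bM _ _ _ B) L1_l2gv;first by apply: mfM=> //;apply: K2_mf;case: (hP ord0).
   by move=> x;rewrite normrM -[leRHS]mul1r;apply: ler_pM.
  congr L1;apply/funext=> x;have [dx|dx] := pselect (disk x);first by rewrite mskT//;ring.
  rewrite mskF// hr ?mulr0//;rewrite ltNge;apply/negP=> h;apply: dx;apply/diskE;exact: le_lt_trans h r1.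
 rewrite -(IN L1R);apply: eq_I=> x;have [h|h] := ltP r (E2 x);first by rewrite hr// !mulr0 oppr0.
 rewrite /f big1=> [|i _];last by case: (near x i)=> [h'|->];[lra|rewrite !mul0r].
 by rewrite chi1//;[ring|lra].
rewrite -LHSE;apply/eqP;rewrite -subr_eq0 -normr_eq0 eq_le normr_ge0 andbT;apply: le_eps=> e e0;rewrite add0r.
have [psi [hpsi _ h1 h2]] := test_approx r1 hr hB hP LA Lf (divr_gt0 e0 (ltr0Sn R 1)).
rewrite RHSE in h2;have hz := zero _ hpsi.
exact: ext_arith h1 h2 hz.
Qed.

End Sta.
End Local.

(** * A Poincare inequality on squares *)

Section Poincare.
Context {R : realType}.
Implicit Types (f g phi psi k : R * R -> R) (x y v c : R * R) (i : 'I_2).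

Definition bx c (r : R) f x := \1_(box c r) x * f x.
Lemma bx_in c r f x : box c r x -> bx c r f x = f x.
by move=> h;rewrite /bx indT// mul1r. Qed.
Lemma bx_out c r f x : ~ box c r x -> bx c r f x = 0.
by move=> h;rewrite /bx indF// mul0r. Qed.
Lemma L2_bx c r f : L2 f -> L2 (bx c r f).
by move=> hf;apply: L2_bM (mf_ind (measurable_box _ _)) (@ind_abs R _) hf. Qed.
Lemma nrm_leK f g (K : R) : L2 f -> L2 g -> 0 <= K -> (forall x, `|f x| <= K * `|g x|) -> nrm f <= K * nrm g.
move=> hf hg K0 h;rewrite -[X in X * _](ger0_norm K0) -(nrmZ K hg).
apply: nrm_le=> //;first exact: L2Z.
by move=> x;rewrite normrM (ger0_norm K0).
Qed.
Lemma nrm_bx_le c (r s : R) f : r <= s -> L2 f -> nrm (bx c r f) <= nrm (bx c s f).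
move=> rs hf;apply: nrm_le;[exact: L2_bx|exact: L2_bx|]=> x.
have [h|h] := pselect (box c r x);last by rewrite (bx_out _ h) normr0.
by rewrite (bx_in _ h) (bx_in _ (box_W rs h)).
Qed.

(** In the mean value form only translates of [psi] by at most [a] occur, so just the gradient on
    the square enlarged by [a] is seen. *)
Lemma shift_local i f g c psi (s a h : R) : wd i f g -> K2 psi -> (forall x, ~ box c s x -> psi x = 0) ->
 `|h| <= a -> `|\I_x ((f (x + h *: dir i) - f x) * psi x)| <= a * (nrm (bx c (s + a) g) * nrm psi).
move=> hw hp hs ha;have a0 : 0 <= a := le_trans (normr_ge0 _) ha.
have [_ hg _] := hw;have Lg := K2_L2 hg;have Lp := K2_L2 hp.
apply: le_eps=> e e0;have [t th H] := wd_mvt2 h hw hp e0.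
have Lps := L2_sub (t *: dir i) Lp.
have E : \I_x (g x * psi (x - t *: dir i)) = \I_x (bx c (s + a) g x * psi (x - t *: dir i)).
 apply: eq_I=> x;have [hx|hx] := pselect (box c (s + a) x);first by rewrite bx_in.
 rewrite hs ?mulr0// => -[h1 h2];apply: hx.
 have [d1 d2] := dir_small i t.
 split.
  rewrite (_ : x.1 - c.1 = (x - t *: dir i).1 - c.1 + (t *: dir i).1);last by rewrite /=;ring.
  by apply: le_normD;apply: lerD=> //;exact: le_trans d1 (le_trans th ha).
 rewrite (_ : x.2 - c.2 = (x - t *: dir i).2 - c.2 + (t *: dir i).2);last by rewrite /=;ring.
 by apply: le_normD;apply: lerD=> //;exact: le_trans d2 (le_trans th ha).
have := CSn (L2_bx c (s + a) Lg) Lps;rewrite (nrm_sub _ Lp) -E=> H2.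
have H3 : `|h * \I_x (g x * psi (x - t *: dir i))| <= a * (nrm (bx c (s + a) g) * nrm psi).
 by rewrite normrM;apply: ler_pM.
by rewrite -[X in `|X|](subrK (h * \I_x (g x * psi (x - t *: dir i)))) addrC;apply: le_normD;exact: lerD.
Qed.

Lemma shift_local2 f (g : 'I_2 -> R * R -> R) c psi v (s a : R) : (forall i, wd i f (g i)) -> K2 psi ->
 (forall x, ~ box c s x -> psi x = 0) -> `|v.1| <= a -> `|v.2| <= a ->
 `|\I_x ((f (x + v) - f x) * psi x)| <= a * (\sum_i nrm (bx c (s + a + a) (g i)) * nrm psi).
move=> hw hp hs v1 v2;have a0 : 0 <= a := le_trans (normr_ge0 _) v1.
have Kf : K2 f by case: (hw ord0).
have Lg i : L2 (g i) by case: (hw i)=> _ /K2_L2.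
pose w := v.1 *: dir ord0 : R * R;pose psi' x := psi (x - w).
have Kp' : K2 psi'.
 have := K2_sh (- w) hp;congr K2.
have hs' x : ~ box c (s + a) x -> psi' x = 0.
 move=> hx;apply: hs=> -[h1 h2];apply: hx.
 have e1 : (x - w).1 = x.1 - v.1 by rewrite /w /dir /= /GRing.scale /= mulr1.
 have e2 : (x - w).2 = x.2 by rewrite /w /dir /= /GRing.scale /= mulr0 subr0.
 move: h1 h2;rewrite e1 e2=> h1 h2;split.
  rewrite (_ : x.1 - c.1 = x.1 - v.1 - c.1 + v.1);last by ring.
  by apply: le_normD;exact: lerD.
 by apply: le_trans h2 _;rewrite lerDl.
have S1 := shift_local (hw ord0) hp hs v1.
have S2 := shift_local (hw ord_max) Kp' hs' v2.
have np : nrm psi' = nrm psi := nrm_sub w (K2_L2 hp).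
rewrite np in S2.
have Kfs v' : K2 (fun x=> f (x + v')) by exact: K2_sh.
have E2' : \I_x ((f (x + v.2 *: dir ord_max) - f x) * psi' x) =
  \I_x ((f (x + v) - f (x + w)) * psi x).
 rewrite -(I_sh w (K2M (K2_B (Kfs (v.2 *: dir ord_max)) Kf) Kp'));apply: eq_I=> x.
 by rewrite /psi' addrK (_ : x + w + v.2 *: dir ord_max = x + v)// -addrA {2}(dirE v).
rewrite E2' in S2.
have -> : \I_x ((f (x + v) - f x) * psi x) = \I_x ((f (x + v) - f (x + w)) * psi x) + \I_x ((f (x + w) - f x) * psi x).
 rewrite -(ID (K2M (K2_B (Kfs v) (Kfs w)) hp) (K2M (K2_B (Kfs w) Kf) hp));apply: eq_I=> x;ring.
apply: le_normD;rewrite sum2E mulrDr addrC;apply: lerD=> //.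
apply: le_trans S1 _;apply: ler_wpM2l=> //;apply: ler_wpM2r;first exact: nrm_ge0.
by apply: nrm_bx_le=> //;rewrite lerDl.
Qed.

Lemma nrm_box c (r : R) : 0 < r -> nrm (\1_(box c r) : R * R -> R) = 2 * r.
move=> r0;rewrite /nrm /nsq (eq_I (g := \1_(box c r))).
 by rewrite I_box ?(ltW r0)// (_ : 4 * r ^+ 2 = (2 * r) ^+ 2) ?sqrtr_sqr ?ger0_norm// ?mulr_ge0 ?(ltW r0)//;ring.
move=> x;have [h|h] := pselect (box c r x);first by rewrite indT// expr1n.
by rewrite indF// expr0n.
Qed.
Lemma L2_box c (r : R) : L2 (\1_(box c r) : R * R -> R).
split;first exact: mf_ind (measurable_box _ _).
have := L1_box c r;congr L1;apply/funext=> x.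
have [h|h] := pselect (box c r x);first by rewrite indT// expr1n.
by rewrite indF// expr0n.
Qed.

(** The constant [m] is the value at the centre of [f * k], with [k] the normalized indicator of a
    square. By [shift_local2], [f * k] stays within [S / 2] of [m] on the square and [f] is within
    [r S] of [f * k] in L^2; the factors [4] and [5] leave a margin. *)
Lemma poincare f (g : 'I_2 -> R * R -> R) c (r : R) : 0 < r -> (forall i, wd i f (g i)) ->
 exists m, nrm (bx c r (fun x=> f x - m)) <= 4 * r * \sum_i nrm (bx c (5 * r) (g i)).
move=> r0 hw;have Kf : K2 f by case: (hw ord0).
have Lg i : L2 (g i) by case: (hw i)=> _ /K2_L2.
pose S := \sum_i nrm (bx c (5 * r) (g i)).
have S0 : 0 <= S by apply: sumr_ge0=> i _;exact: nrm_ge0.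
pose kq : R := (4 * r ^+ 2)^-1.
have kq0 : 0 < kq by rewrite invr_gt0 mulr_gt0 ?exprn_gt0.
pose k : R * R -> R := fun x=> kq * \1_(box 0 r) x.
have Lb := L2_box 0 r.
have mk : mf k by apply: mfZ;exact: Lb.1.
have kk : ker r k.
 split=> //;last by move=> x hx;rewrite /k indF// mulr0.
 by exists kq=> x;rewrite normrM gtr0_norm// ler_piMr ?(ltW kq0)// ind_abs.
have Ik : I k = 1.
 by rewrite (IZ _ (L1_box _ _)) I_box ?(ltW r0)// mulVf// gt_eqF// mulr_gt0 ?exprn_gt0.
have k0 x : 0 <= k x by rewrite mulr_ge0 ?(ltW kq0)//;case/andP: (ind01 (box 0 r) x).
have pkk : pk r k by split.
have Lcv : L2 (cv f k) := L2_cv (K2_L1 Kf) (K2_L2 Kf) kk.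
have nk : nrm k = (2 * r)^-1.
 by rewrite (nrmZ kq Lb) nrm_box// gtr0_norm// /kq;field;rewrite gt_eqF.
have key psi v : K2 psi -> (forall x, ~ box c r x -> psi x = 0) -> `|v.1| <= r -> `|v.2| <= r ->
  `|\I_x ((f (x + v) - f x) * psi x)| <= r * S * nrm psi.
 move=> hp hs v1 v2;have := shift_local2 hw hp hs v1 v2;rewrite -mulr_suml mulrA=> /le_trans;apply.
 apply: ler_wpM2r;first exact: nrm_ge0.
 apply: ler_wpM2l;first exact: ltW.
 by apply: ler_sum=> i _;apply: nrm_bx_le=> //;lra.
pose m := cv f k c;exists m.
have osc x : box c r x -> `|cv f k x - m| <= S / 2.
 move=> [x1 x2];pose psi z := k (c - z).
 have Lp : L2 psi := L2_op c (ker_L2 kk).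
 have hs z : ~ box c r z -> psi z = 0.
  by move=> hz;case: kk=> _ _;apply;rewrite box0E=> -[z1 z2];apply: hz;split;rewrite distrC.
 have Kp : K2 psi.
  split=> //;exists (`|c.1| + `|c.2| + r)=> z hz;apply: hs=> -[z1 z2];apply: hz;rewrite box0E.
  have hb (a b q : R) : `|a - b| <= r -> `|b| <= q -> `|a| <= q + r.
   by move=> p1 p2;rewrite -(subrK b a) addrC;apply: le_normD;exact: lerD.
  by split;[apply: hb z1 _;rewrite lerDl|apply: hb z2 _;rewrite lerDr].
 have H := @key psi (x - c) Kp hs x1 x2.
 have np : nrm psi = (2 * r)^-1 by rewrite -nk /nrm /nsq /psi (I_op c (ker_L2 kk).2).
 have E : \I_z ((f (z + (x - c)) - f z) * psi z) = cv f k x - m.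
  rewrite /m (cvE x (K2_L1 Kf) kk) (cvE c (K2_L1 Kf) kk).
  have L1a : L1 (fun z=> f (z + (x - c)) * psi z) := K2M (K2_sh (x - c) Kf) Kp.
  have L1b : L1 (fun z=> f z * psi z) := K2M Kf Kp.
  rewrite (eq_I (g := fun z=> f (z + (x - c)) * psi z - f z * psi z))=> [|z];last by ring.
  rewrite (IB L1a L1b) (I_shM _ Kf Kp);congr (_ - _);apply: eq_I=> z.
  by rewrite /psi;congr (_ * k _);rewrite opprB addrA [c + _]addrC subrK.
 rewrite E np in H;apply: le_trans H _;rewrite le_eqVlt;apply/orP;left;apply/eqP.
 by field;rewrite gt_eqF.
have n1 : nrm (bx c r (fun x=> cv f k x - f x)) <= r * S.
 pose psi := bx c r (fun x=> cv f k x - f x).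
 have Lp : L2 psi by apply: L2_bx;apply: L2B=> //;exact: K2_L2.
 have hs x : ~ box c r x -> psi x = 0 by move=> h;exact: bx_out.
 have Kp : K2 psi.
  split=> //;exists (`|c.1| + `|c.2| + r)=> z hz;apply: hs=> -[z1 z2];apply: hz;rewrite box0E.
  have hb (a b q : R) : `|a - b| <= r -> `|b| <= q -> `|a| <= q + r.
   by move=> p1 p2;rewrite -(subrK b a) addrC;apply: le_normD;exact: lerD.
  by split;[apply: hb z1 _;rewrite lerDl|apply: hb z2 _;rewrite lerDr].
 have := @cv_dual R r f k psi (nrm psi * nrm f) (r * S * nrm psi) (K2_L1 Kf) kk Lp.1
  (fun v=> (L2_L2_shift v (K2_L2 Kf) Lp).1) (fun v=> (L2_L2_shift v (K2_L2 Kf) Lp).2).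
 rewrite (pk_abs pkk) mul1r Ik=> H.
 have {}H : nsq psi <= r * S * nrm psi.
  apply: le_trans (ler_norm _) _;apply: le_trans (H _).
   rewrite le_eqVlt;apply/orP;left;apply/eqP;congr (`|_|);apply: eq_I=> x.
   have [hx|hx] := pselect (box c r x);first by rewrite /psi bx_in// mul1r expr2.
   by rewrite hs// mul0r expr0n.
  move=> v;rewrite box0E=> -[v1 v2].
  rewrite (eq_I (g := fun x=> (f (x + - v) - f x) * psi x))=> [|x];last by rewrite mulrC.
  by apply: key=> //;rewrite /= normrN.
 rewrite -nrm_sq expr2 in H;rewrite -/psi.
 have [p0|p0] := eqVneq (nrm psi) 0;first by rewrite p0 mulr_ge0 ?(ltW r0).
 by move: H;rewrite ler_pM2r// lt_neqAle eq_sym p0 nrm_ge0.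
have n2 : nrm (bx c r (fun x=> cv f k x - m)) <= S / 2 * (2 * r).
 rewrite -(@nrm_box c r r0).
 have Lb' := L2_box c r.
 have Lc : L2 (bx c r (fun x=> cv f k x - m)).
  have := L2B (L2_bx c r Lcv) (L2Z m Lb');congr L2;apply/funext=> x;rewrite /bx;ring.
 apply: nrm_leK=> //;first by rewrite divr_ge0.
 move=> x;have [hx|hx] := pselect (box c r x);last by rewrite bx_out// normr0 indF// normr0 mulr0.
 by rewrite bx_in// indT// normr1 mulr1;exact: osc.
have Lc : L2 (bx c r (fun x=> cv f k x - m)).
 have := L2B (L2_bx c r Lcv) (L2Z m (L2_box c r));congr L2;apply/funext=> x;rewrite /bx;ring.
have La : L2 (bx c r (fun x=> cv f k x - f x)) by apply: L2_bx;apply: L2B=> //;exact: K2_L2.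
rewrite (_ : bx c r (fun x=> f x - m) = fun x=> bx c r (fun x=> cv f k x - m) x - bx c r (fun x=> cv f k x - f x) x).
 apply: le_trans (nrmB Lc La) _;apply: le_trans (lerD n2 n1) _.
 by rewrite -/S;have := mulr_ge0 (ltW r0) S0;lra.
by apply/funext=> x;rewrite /bx;ring.
Qed.
End Poincare.

(** * The hole-filling inequality *)

Section HoleFilling.
Context {R : realType}.
Implicit Types (f g phi psi : R * R -> R) (x y v c : R * R) (i : 'I_2) (r : R).

Variables (n : nat) (U : 'I_n -> R * R -> R) (G : 'I_n -> 'I_2 -> R * R -> R).
Hypothesis st : stationary U G.
Local Notation lam := (en U).
Local Notation V := (pn U).
Local Notation DV := (pDn U G).
Local Notation gv := (gv U G).
Let hU := st_W2 st.
Let U1 := st_ge1 st.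
Let lam0 x : 0 < lam x. Proof. exact: lt_le_trans (U1 x). Qed.
Let W2V j i := W2_pn ltr01 U1 hU j i.
Let D2DV j i : D2 (DV j i). Proof. by case: (W2V j i). Qed.
Let mV j : mf (V j) := pn_mf ltr01 U1 hU j.
Let bV j x : `|V j x| <= 1 := pn_abs ltr01 U1 j x.
Let VDV i x : \sum_j V j x * DV j i x = 0 := pDn_orth G ltr01 U1 i x.
Let mL : mf lam. Proof. by apply: en_mf=> j;case: (hU j ord0)=> -[]. Qed.

(* A globally bounded substitute for the weight [lam ^+ 2] in the tangential equation. *)
Lemma kappa_exists (s : R) : s < 1 -> exists (kp : R * R -> R) (M : R),
 [/\ mf kp, forall x, 0 <= kp x <= M, forall x, E2 x <= s -> 1 <= kp x &
 forall j phi (P : 'I_2 -> R * R -> R) (B : R), (forall x, s < E2 x -> phi x = 0) ->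
  (forall x, `|phi x| <= B) -> (forall i, wd i phi (P i)) -> (forall i x, s < E2 x -> P i x = 0) ->
  \sum_i \I_x (kp x * DV j i x * P i x) = \I_x (kp x * gv x * V j x * phi x)].
move=> s1;have [M M1 hM] := lam_bounded st s1.
have M0 : 0 <= M by lra.
pose S := [set x : R * R | E2 x <= s].
pose kp x := \1_S x * Num.min (lam x ^+ 2) (M ^+ 2).
have mk : mf kp.
 apply: mfM;first by apply: mf_ind;exact: measurable_E2.
 by apply: measurable_minr;[exact: mfX|exact: mfc].
have kin x : S x -> kp x = Num.min (lam x ^+ 2) (M ^+ 2) by move=> h;rewrite /kp indT// mul1r.
have kout x : ~ S x -> kp x = 0 by move=> h;rewrite /kp indF// mul0r.
exists kp, (M ^+ 2);split=> //.
- move=> x;have [h|h] := pselect (S x);last by rewrite kout// lexx sqr_ge0.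
 by rewrite kin// le_min !sqr_ge0 /= ge_min lexx orbT.
- by move=> x h;rewrite kin// le_min;apply/andP;split;exact: exprn_ege1.
move=> j phi P B hs hB hP hPs.
have mphi : mf phi by apply: K2_mf;case: (hP ord0).
have mP i : mf (P i) by apply: K2_mf;case: (hP i).
have mDV i : mf (DV j i) by case: (D2DV j i).
have ae : {ae leb2, forall x, S x -> kp x = lam x ^+ 2}.
 apply: filterS hM=> x h hx;rewrite kin// min_l// ler_sqr ?nnegrE ?(ltW (lam0 x))//;exact: h.
have H := tangential_ext st j s1 hs hB hP hPs.
transitivity (\sum_i \I_x (lam x ^+ 2 * DV j i x * P i x)).
 apply: eq_bigr=> i _;apply: I_ae.
 - by apply: mfM=> //;apply: mfM.
 - by apply: mfM=> //;apply: mfM=> //;exact: mfX.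
 apply: filterS ae=> x h;have [hx|hx] := leP (E2 x) s;first by rewrite h.
 by rewrite hPs// !mulr0.
rewrite H;apply: I_ae.
- by apply: mfM=> //;apply: mfM=> //;apply: mfM;[exact: mfX|exact: mf_gv st].
- by apply: mfM=> //;apply: mfM=> //;apply: mfM=> //;exact: mf_gv st.
apply: filterS ae=> x h;have [hx|hx] := leP (E2 x) s;first by rewrite h.
by rewrite hs// !mulr0.
Qed.

Definition mu c r := I (bx c r (msk gv)).
Lemma L1_bx c r f : L1 f -> L1 (bx c r f).
by move=> hf;apply: L1_bM (mf_ind (measurable_box _ _)) (@ind_abs R _) hf. Qed.
Let L1gv := L1_gv st.
Lemma gvm_ge0 x : 0 <= msk gv x.
by have [h|h] := pselect (disk x);[rewrite mskT// gv_ge0|rewrite mskF]. Qed.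
Lemma mu_le c r s : r <= s -> mu c r <= mu c s.
move=> rs;apply: I_le=> [||x];[exact: L1_bx|exact: L1_bx|].
have [h|h] := pselect (box c r x);first by rewrite !bx_in//;exact: box_W h.
by rewrite bx_out//;apply: mulr_ge0;[case/andP: (ind01 (box c s) x)|exact: gvm_ge0].
Qed.
Lemma mu_ge0 c r : 0 <= mu c r.
by apply: I_ge0=> x;apply: mulr_ge0;[case/andP: (ind01 (box c r) x)|exact: gvm_ge0]. Qed.
Lemma DV_gv k i x : DV k i x ^+ 2 <= gv x.
have h1 : DV k i x ^+ 2 <= \sum_k DV k i x ^+ 2.
 by rewrite (bigD1 k)//= lerDl;apply: sumr_ge0=> j _;exact: sqr_ge0.
apply: le_trans h1 _;rewrite /gv (bigD1 i)//= lerDl;apply: sumr_ge0=> j _;exact: ss_ge0.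
Qed.
Lemma nrm_sqrt f (m : R) : nsq f <= m -> nrm f <= Num.sqrt m.
by move=> h;rewrite /nrm ler_wsqrtr. Qed.

Lemma hf_arith (M C1 Z nr r : R) (nn : R) : 0 < r -> 0 <= M -> 0 <= C1 -> 0 <= Z ->
 45 * (((1 + 48 * C1) * Z + (1 + 48 * C1) * Z) * (2 * M * Z + 2 * M * Z) +
  48 * r * Z * (2 * (C1 / r * (2 * M * Z)))) * ((1 + 48 * C1) * Z + (1 + 48 * C1) * Z) =
 90 * (1 + 48 * C1) * (8 * M * (1 + 48 * C1) + 192 * M * C1) * Z ^+ 3.
by move=> r0 *;field;rewrite gt_eqF. Qed.

(** The tangential equation is tested with [et^2 (V_j - m_j)]. The term where [et] is differentiated
    sees the gradient only on an annulus and gives the product of square roots; the right-hand side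
    is cubic in [Dv] by [trilinear] and gives the third power. The radius [30 r] is [5 * 6 r], from
    [poincare] on the square that supports the larger cutoff. *)
Lemma hole_filling (s0 : R) : s0 < 1 -> exists2 C5, 0 <= C5 & exists2 C6, 0 <= C6 & forall c r, 0 < r ->
 (forall y, box c (30 * r) y -> E2 y <= s0) ->
 mu c (r / 2) <= C5 * (Num.sqrt (mu c (2 * r) - mu c (r / 2)) * Num.sqrt (mu c (30 * r))) +
  C6 * Num.sqrt (mu c (30 * r)) ^+ 3.
move=> s01;have [kp [M [mk k0M k1 tang]]] := kappa_exists s01.
have [C1 C10 hC1] := @eta_dd R.
have M0 : 0 <= M by have /andP[a b] := k0M 0;exact: le_trans a b.
have k0 x : 0 <= kp x by case/andP: (k0M x).
have kM x : kp x <= M by case/andP: (k0M x).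
have kabs x : `|kp x| <= M by rewrite ger0_norm.
pose C7 := 90 * (1 + 48 * C1) * (8 * M * (1 + 48 * C1) + 192 * M * C1).
have C70 : 0 <= C7.
 have q1 : 0 <= 1 + 48 * C1 by lra.
 by apply: mulr_ge0;[rewrite mulr_ge0|apply: addr_ge0;rewrite ?mulr_ge0].
exists (n%:R * (192 * M * C1));first by rewrite mulr_ge0// mulr_ge0// mulr_ge0.
exists (n%:R * (n%:R * C7));first by rewrite mulr_ge0// mulr_ge0.
move=> c r r0 hbox.
have bW a x : a <= 30 * r -> box c a x -> box c (30 * r) x by move=> h;exact: box_W.
have bE a x : a <= 30 * r -> box c a x -> E2 x <= s0 by move=> h1 h2;apply: hbox;exact: bW h1 h2.
have bdisk a x : a <= 30 * r -> box c a x -> disk x.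
 by move=> h1 h2;apply/diskE;apply: le_lt_trans s01;exact: bE h1 h2.
have [r2 r6 r30] : [/\ 2 * r <= 30 * r, 6 * r <= 30 * r & 30 * r <= 30 * r] by split;lra.
pose Z := Num.sqrt (mu c (30 * r));pose Y := Num.sqrt (mu c (2 * r) - mu c (r / 2)).
have Z0 : 0 <= Z by exact: sqrtr_ge0.
have Y0 : 0 <= Y by exact: sqrtr_ge0.
rewrite -/Z -/Y.
have L2bDV a k i : a <= 30 * r -> L2 (bx c a (DV k i)).
 move=> ha;have [_ h] := D2DV k i;have := L2_bx c a h;congr L2;apply/funext=> x.
 have [hx|hx] := pselect (box c a x);last by rewrite !bx_out.
 by rewrite !bx_in// mskT//;exact: bdisk ha hx.
have nDV a k i : a <= 30 * r -> nrm (bx c a (DV k i)) <= Z.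
 move=> ha;apply: nrm_sqrt;apply: I_le=> [||x];[by case: (L2bDV a k i ha)|exact: L1_bx|].
 have [hx|hx] := pselect (box c a x);last first.
  by rewrite bx_out// expr0n;apply: mulr_ge0;[case/andP: (ind01 (box c (30 * r)) x)|exact: gvm_ge0].
 rewrite bx_in// bx_in;last exact: bW ha hx.
 by rewrite mskT ?DV_gv//;exact: bdisk ha hx.
(* The derivative restricted to the annulus between the squares of half-sides [r / 2] and [2 r],
   which contains the support of [D et]. *)
pose an k i x := bx c (2 * r) (DV k i) x - bx c (r / 2) (DV k i) x.
have rr : r / 2 <= 30 * r by lra.
have Lan k i : L2 (an k i) by apply: L2B;exact: L2bDV.
have nan k i : nrm (an k i) <= Y.
 apply: nrm_sqrt;rewrite -(IB (L1_bx _ _ L1gv) (L1_bx _ _ L1gv)).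
 apply: I_le=> [||x];[by case: (Lan k i)|by apply: L1B;exact: L1_bx|].
 rewrite /an;have [h1|h1] := pselect (box c (r / 2) x).
  have h2 : box c (2 * r) x by apply: box_W h1;lra.
  by rewrite !(bx_in _ h1) !(bx_in _ h2) !subrr expr0n.
 rewrite !(bx_out _ h1) !subr0;have [h2|h2] := pselect (box c (2 * r) x);last first.
  by rewrite !(bx_out _ h2) expr0n.
 by rewrite !(bx_in _ h2) mskT ?DV_gv//;exact: bdisk r2 h2.
(* [poincare] needs a function of the plane, so [V_k] is first cut off; the cutoff is [1], with zero
   gradient, on the squares involved. *)
have /choice[m hm] : forall k, exists m, nrm (bx c (6 * r) (fun x=> V k x - m)) <= 48 * r * Z.
 move=> k;have [s [t [ss s1 stt t1]]] := mid2 s01.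
 have hc := chi_cd stt t1.
 have r60 : 0 < 6 * r by rewrite mulr_gt0.
 have [m' hm'] := poincare c r60 (fun i=> W2_loc hc (W2V k i)).
 exists m'.
 have -> : bx c (6 * r) (fun x=> V k x - m') = bx c (6 * r) (fun x=> chi s t x * V k x - m').
  apply/funext=> x;have [hx|hx] := pselect (box c (6 * r) x);last by rewrite !bx_out.
  rewrite !bx_in// chi1 ?mul1r//;apply: le_trans (ltW ss);exact: bE r6 hx.
 apply: le_trans hm' _;rewrite sum2E.
 have e i : nrm (bx c (5 * (6 * r)) (fun x=> chi s t x * DV k i x + dd i (chi s t) x * V k x)) <= Z.
  have -> : bx c (5 * (6 * r)) (fun x=> chi s t x * DV k i x + dd i (chi s t) x * V k x) = bx c (30 * r) (DV k i).
   rewrite (_ : 5 * (6 * r) = 30 * r);last by ring.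
   apply/funext=> x;have [hx|hx] := pselect (box c (30 * r) x);last by rewrite !bx_out.
   have hs : E2 x < s by apply: le_lt_trans ss;exact: bE r30 hx.
   by rewrite !bx_in// chi1 ?(ltW hs)// mul1r (dd_chi1 i stt hs) mul0r addr0.
  exact: nDV.
 rewrite (_ : 48 * r * Z = 4 * (6 * r) * (Z + Z));last by ring.
 by apply: ler_wpM2l;[rewrite !mulr_ge0 ?(ltW r0)|exact: lerD].
pose W k x := V k x - m k.
have bWk k x : `|W k x| <= 1 + `|m k|.
 by apply: le_normB;apply: lerD.
have mW k : mf (W k) by apply: mfB=> //;exact: mfc.
have LW k : L2 (bx c (6 * r) (W k)).
 have := L2_bM (mW k) (bWk k) (L2_box c (6 * r));congr L2;apply/funext=> x;by rewrite /bx mulrC.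
have W2W k i : W2 i (W k) (DV k i).
 have := W2_D (W2V k i) (W2_cst i (- m k));congr W2;apply/funext=> x;by rewrite addr0.
pose et := eta c r;pose e3 := eta c (3 * r).
have r3 : 0 < 3 * r by rewrite mulr_gt0.
have Se : Sm et := Sm_eta c r. have Se3 : Sm e3 := Sm_eta c (3 * r).
have e01 x : 0 <= et x <= 1 := eta01 c r x.
have ea x : `|et x| <= 1 := eta_abs c r x.
have e3a x : `|e3 x| <= 1 := eta_abs c (3 * r) x.
have e0 x : ~ box c (2 * r) x -> et x = 0 := eta0 r0.
have e30 x : ~ box c (6 * r) x -> e3 x = 0.
 by move=> h;apply: eta0=> //;rewrite mulrA (_ : 2 * 3 = 6 :> R)//;ring.
have de0 i x : ~ box c (2 * r) x -> dd i et x = 0 by exact: dd_supp.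
have de30 i x : ~ box c (6 * r) x -> dd i e3 x = 0 by exact: dd_supp.
have dde i x : `|dd i et x| <= C1 / r by exact: hC1.
have C1r : 0 <= C1 / r by rewrite divr_ge0 ?(ltW r0).
have dde3 i x : `|dd i e3 x| <= C1 / r.
 apply: le_trans (hC1 _ _ _ _ r3) _;apply: ler_wpM2l=> //;rewrite lef_pV2 ?posrE//;lra.
have nr a b x f (k : R) i : 0 < a -> a < b -> box c a x -> (forall y, box c b y -> f y = k) -> dd i f x = 0.
 move=> a0 ab [x1 x2] hf;rewrite -[RHS](dd_c i k x);apply: dd_near.
 apply: (@box_near _ x (b - a));first by rewrite subr_gt0.
 move=> y y1 y2;apply: hf;split.
  rewrite (_ : y.1 - c.1 = (y.1 - x.1) + (x.1 - c.1));last by ring.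
  by apply: le_normD;lra.
 rewrite (_ : y.2 - c.2 = (y.2 - x.2) + (x.2 - c.2));last by ring.
 by apply: le_normD;lra.
have dehalf i x : box c (r / 2) x -> dd i et x = 0.
 by move=> h;apply: (nr (r / 2) r x et 1)=> //;[rewrite divr_gt0|lra|move=> y;exact: eta1].
have de3in i x : box c (2 * r) x -> dd i e3 x = 0.
 by move=> h;apply: (nr (2 * r) (3 * r) x e3 1)=> //;[rewrite mulr_gt0|lra|move=> y;exact: eta1].
have e3in x : box c (2 * r) x -> e3 x = 1.
 by move=> h;apply: eta1=> //;apply: box_W h;lra.
have cde : cd et := cd_of_box Se s01 (fun y=> bE _ y r2) e0.
have cde3 : cd e3 := cd_of_box Se3 s01 (fun y=> bE _ y r6) e30.
have box26 x : box c (2 * r) x -> box c (6 * r) x by apply: box_W;lra.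
have out x : s0 < E2 x -> ~ box c (2 * r) x by move=> hx /(bE _ _ r2);rewrite leNgt hx.
pose A j k i x := kp x * (V j x * DV k i x - V k x * DV j i x).
(* Equation [k] is tested with [zeta V_j] and equation [j] with [zeta V_k]: the right-hand sides
   agree, and the products of derivatives of [V_j] and [V_k] cancel in the difference. *)
have divA j k zeta : cd zeta -> (forall y, ~ box c (2 * r) y -> zeta y = 0) ->
  \sum_i \I_x (A j k i x * dd i zeta x) = 0.
 move=> hz z0;have [B _ hB] := tf_bound (cd_tf hz).
 have T p q : \sum_i \I_x (kp x * DV p i x * (zeta x * DV q i x + dd i zeta x * V q x)) =
   \I_x (kp x * gv x * V p x * (zeta x * V q x)).
  apply: (tang p (fun x=> zeta x * V q x) (fun i x=> zeta x * DV q i x + dd i zeta x * V q x) B).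
  - by move=> x /out hx;rewrite z0// mul0r.
  - by move=> x;rewrite normrM -[leRHS]mulr1;apply: ler_pM.
  - by move=> i;exact: W2_loc hz (W2V q i).
  - by move=> i x /out hx;rewrite z0// (dd_supp i z0)// !mul0r addr0.
 have L p q i : L1 (fun x=> kp x * DV p i x * (zeta x * DV q i x + dd i zeta x * V q x)).
  have [_ K _] := W2_loc hz (W2V q i).
  have := L1_bM mk kabs (L2M (L2bDV _ p i r6) (K2_L2 K));congr L1;apply/funext=> x.
  have [hx|hx] := pselect (box c (2 * r) x);first by rewrite bx_in ?mulrA//;exact: box26.
  by rewrite z0// (dd_supp i z0)// !mul0r addr0 !mulr0.
 have := T k j;have := T j k.
 have -> : \I_x (kp x * gv x * V j x * (zeta x * V k x)) = \I_x (kp x * gv x * V k x * (zeta x * V j x)).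
  by apply: eq_I=> x;ring.
 move=> <- /eqP;rewrite -subr_eq0 -sumrB=> /eqP E;rewrite -[RHS]E;apply: eq_bigr=> i _.
 rewrite -(IB (L k j i) (L j k i));apply: eq_I=> x;rewrite /A.
 by move: (dd i zeta x)=> d;ring.
have mA j k i : mf (A j k i).
 apply: mfM=> //;apply: mfB;apply: mfM=> //;[by case: (D2DV k i)|by case: (D2DV j i)].
have Ab j k i x : box c (2 * r) x -> A j k i x = kp x * V j x * bx c (6 * r) (DV k i) x - kp x * V k x * bx c (6 * r) (DV j i) x.
 by move=> h;rewrite /A !bx_in;[ring|exact: box26|exact: box26].
have LAw j k (w : R * R -> R) (B : R) i : mf w -> (forall x, `|w x| <= B) -> (forall x, ~ box c (2 * r) x -> w x = 0) ->
  L2 (fun x=> w x * A j k i x) /\ nrm (fun x=> w x * A j k i x) <= B * (2 * M * Z).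
 move=> mw wB w0;have B0 : 0 <= B := le_trans (normr_ge0 _) (wB 0).
 pose u1 x := (w x * kp x * V j x) * bx c (6 * r) (DV k i) x.
 pose u2 x := (w x * kp x * V k x) * bx c (6 * r) (DV j i) x.
 have bb p x : `|w x * kp x * V p x| <= B * M.
  rewrite normrM -[leRHS]mulr1;apply: ler_pM=> //;rewrite normrM;exact: ler_pM.
 have mm p : mf (fun x=> w x * kp x * V p x) by apply: mfM=> //;apply: mfM.
 have l1 : L2 u1 := L2_bM (mm j) (bb j) (L2bDV _ k i r6).
 have l2 : L2 u2 := L2_bM (mm k) (bb k) (L2bDV _ j i r6).
 have BM : 0 <= B * M by exact: mulr_ge0.
 have n1 : nrm u1 <= B * M * Z.
  apply: (letr (B * M * nrm (bx c (6 * r) (DV k i)))).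
   by apply: nrm_leK=> //;[exact: L2bDV|move=> x;rewrite normrM;apply: ler_wpM2r].
  by apply: ler_wpM2l=> //;exact: nDV.
 have n2 : nrm u2 <= B * M * Z.
  apply: (letr (B * M * nrm (bx c (6 * r) (DV j i)))).
   by apply: nrm_leK=> //;[exact: L2bDV|move=> x;rewrite normrM;apply: ler_wpM2r].
  by apply: ler_wpM2l=> //;exact: nDV.
 have -> : (fun x=> w x * A j k i x) = fun x=> u1 x - u2 x.
  apply/funext=> x;have [h|h] := pselect (box c (2 * r) x);last first.
   by rewrite /u1 /u2 w0// !mul0r subrr.
  by rewrite (Ab j k i x h) /u1 /u2;ring.
 split;first exact: L2B.
 apply: le_trans (nrmB l1 l2) _;rewrite (_ : B * (2 * M * Z) = B * M * Z + B * M * Z);last by ring.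
 exact: lerD.
(* [trilinear] is applied to [et W_j], to the field [et A], whose divergence is [D et . A], and to
   [e3 W_k]. The wider cutoff [e3] equals [1] where [et] lives and gives [W_k] bounded support. *)
have X1 j k : `|\sum_i \I_x ((et x * W j x) * (et x * A j k i x) * (e3 x * DV k i x + dd i e3 x * W k x))| <= C7 * Z ^+ 3.
 have met := Sm_mf Se.
 have LA i := LAw j k et 1 i met ea e0.
 have Lg i := LAw j k (dd i et) (C1 / r) i (Sm_mf (Sm_dd i Se)) (dde i) (de0 i).
 have bsA f : (forall x, ~ box c (2 * r) x -> f x = 0) -> bs f.
  move=> hf;exists (`|c.1| + `|c.2| + 2 * r)=> z hz;apply: hf=> -[z1 z2];apply: hz;rewrite box0E.
  have hb (a b q : R) : `|a - b| <= 2 * r -> `|b| <= q -> `|a| <= q + 2 * r.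
   by move=> p1 p2;rewrite -(subrK b a) addrC;apply: le_normD;exact: lerD.
  by split;[apply: hb z1 _;rewrite lerDl|apply: hb z2 _;rewrite lerDr].
 have KA i : K2 (fun x=> et x * A j k i x).
  by split;[case: (LA i)|apply: bsA=> x hx;rewrite e0// mul0r].
 have Kg : K2 (fun x=> \sum_i dd i et x * A j k i x).
  split;last by apply: bsA=> x hx;apply: big1=> i _;rewrite de0// mul0r.
  by apply: L2_sum=> i;case: (Lg i).
 have div psi : tf psi -> \sum_i \I_x (et x * A j k i x * dd i psi x) = - \I_x ((\sum_i dd i et x * A j k i x) * psi x).
  move=> hpsi;have hz : cd (fun x=> psi x * et x) := cd_M (tf_Sm hpsi) cde.
  have hz0 y : ~ box c (2 * r) y -> psi y * et y = 0 by move=> hy;rewrite e0// mulr0.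
  have := divA j k _ hz hz0.
  have l1 i : L1 (fun x=> et x * A j k i x * dd i psi x) := K2M (KA i) (tf_K2 (tf_dd i hpsi)).
  have l2 i : L1 (fun x=> dd i et x * A j k i x * psi x) by apply: L2M;[case: (Lg i)|exact: tf_L2].
  have -> : \I_x ((\sum_i dd i et x * A j k i x) * psi x) = \sum_i \I_x (dd i et x * A j k i x * psi x).
   by rewrite -(I_sum l2);apply: eq_I=> x;rewrite mulr_suml.
  move=> h;apply/eqP;rewrite -addr_eq0 -big_split /=;apply/eqP;rewrite -[RHS]h;apply: eq_bigr=> i _.
  rewrite -(ID (l1 i) (l2 i));apply: eq_I=> x;rewrite (dd_M i x (tf_Sm hpsi) Se).
  by move: (dd i psi x) (dd i et x)=> a b;ring.
 have wdp i := W2_loc cde (W2W j i);have wdb i := W2_loc cde3 (W2W k i).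
 have pB x : `|et x * W j x| <= 1 + `|m j|.
  by rewrite normrM -[leRHS]mul1r;apply: ler_pM.
 have := trilinear wdp pB wdb KA Kg div.
 have wide f g (B : R) : L2 f -> 0 <= B -> L2 g -> (forall x, box c (6 * r) x -> `|f x| <= B * `|g x|) ->
   (forall x, ~ box c (6 * r) x -> f x = 0) -> nrm f <= B * nrm g.
  move=> hf B0 hg h1 h2;apply: nrm_leK=> // x;have [hx|hx] := pselect (box c (6 * r) x);first exact: h1.
  by rewrite h2// normr0 mulr_ge0.
 (* A derivative of the cutoff costs [C1 / r], which the Poincare bound [48 r Z] for [W p] pays
    for. *)
 have DE (e : R * R -> R) p i : Sm e -> (forall x, `|e x| <= 1) -> (forall x, `|dd i e x| <= C1 / r) ->
   (forall x, ~ box c (6 * r) x -> e x = 0) -> nrm (fun x=> e x * DV p i x + dd i e x * W p x) <= (1 + 48 * C1) * Z.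
  move=> Sme h1 h2 h3;have de x : ~ box c (6 * r) x -> dd i e x = 0 by exact: dd_supp.
  have E : (fun x=> e x * DV p i x + dd i e x * W p x) = fun x=> e x * bx c (6 * r) (DV p i) x + dd i e x * bx c (6 * r) (W p) x.
   apply/funext=> x;have [hx|hx] := pselect (box c (6 * r) x);first by rewrite !bx_in.
   by rewrite h3// de// !mul0r.
  have l1 : L2 (fun x=> e x * bx c (6 * r) (DV p i) x) := L2_bM (Sm_mf Sme) h1 (L2bDV _ p i r6).
  have l2 : L2 (fun x=> dd i e x * bx c (6 * r) (W p) x) := L2_bM (Sm_mf (Sm_dd i Sme)) h2 (LW p).
  rewrite E;apply: le_trans (nrmD l1 l2) _.
  have n1 : nrm (fun x=> e x * bx c (6 * r) (DV p i) x) <= 1 * nrm (bx c (6 * r) (DV p i)).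
   by apply: nrm_leK=> //;[exact: L2bDV|move=> x;rewrite normrM;apply: ler_wpM2r].
  have n2 : nrm (fun x=> dd i e x * bx c (6 * r) (W p) x) <= C1 / r * nrm (bx c (6 * r) (W p)).
   by apply: nrm_leK=> // x;rewrite normrM;apply: ler_wpM2r.
  have n3 : C1 / r * nrm (bx c (6 * r) (W p)) <= C1 / r * (48 * r * Z) by apply: ler_wpM2l=> //;exact: hm.
  rewrite (_ : (1 + 48 * C1) * Z = Z + C1 / r * (48 * r * Z));last by field;rewrite gt_eqF.
  by apply: lerD;[apply: le_trans n1 _;rewrite mul1r;exact: nDV|exact: le_trans n2 n3].
 have out26 f x : (forall x, ~ box c (2 * r) x -> f x = 0) -> ~ box c (6 * r) x -> f x = 0.
  by move=> h hx;apply: h=> h';apply: hx;exact: box26.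
 have N1 i := DE et j i Se ea (dde i) (fun x=> out26 et x e0).
 have N2 i := DE e3 k i Se3 e3a (dde3 i) e30.
 have N3 i : nrm (fun x=> et x * A j k i x) <= 2 * M * Z by have [_] := LA i;rewrite mul1r.
 have N4 : nrm (fun x=> et x * W j x) <= 48 * r * Z.
  apply: le_trans (hm j);rewrite -[leRHS]mul1r;apply: wide=> //.
  - by apply: K2_L2;case: (wdp ord0).
  - exact: (LW j).
  - by move=> x hx;rewrite bx_in// normrM;apply: ler_wpM2r.
  - by move=> x hx;rewrite (out26 et x e0 hx) mul0r.
 have N5 : nrm (fun x=> \sum_i dd i et x * A j k i x) <= 2 * (C1 / r * (2 * M * Z)).
  have lg i : L2 (fun x=> dd i et x * A j k i x) by case: (Lg i).
  apply: le_trans (nrm_sum lg) _;rewrite sum2E (_ : forall t : R, 2 * t = t + t);last by move=> t;ring.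
  by apply: lerD;[case: (Lg ord0)|case: (Lg ord_max)].
 move=> /le_trans;apply;rewrite /C7 -(hf_arith 0 0 r0 M0 C10 Z0).
 rewrite !sum2E;apply: ler_pM.
 - by rewrite mulr_ge0// addr_ge0// mulr_ge0// ?addr_ge0// nrm_ge0.
 - by rewrite addr_ge0// nrm_ge0.
 - apply: ler_wpM2l=> //;apply: lerD;apply: ler_pM;rewrite ?addr_ge0 ?nrm_ge0//;exact: lerD.
 - exact: lerD.
have X2 j : `|\I_x (kp x * gv x * V j x * (et x * et x * W j x))| <= n%:R * (C7 * Z ^+ 3).
 pose t k i x := (et x * W j x) * (et x * A j k i x) * (e3 x * DV k i x + dd i e3 x * W k x).
 have Lt k i : L1 (t k i).
  have [_ K3 _] := W2_loc cde3 (W2W k i);have [K1 _ _] := W2_loc cde (W2W j ord0).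
  have [LA _] := LAw j k et 1 i (Sm_mf Se) ea e0.
  have pB x : `|et x * W j x| <= 1 + `|m j| by rewrite normrM -[leRHS]mul1r;apply: ler_pM.
  have := L1_tri LA (K2_L2 K3) (K2_mf K1) pB;congr L1;apply/funext=> x;rewrite /t;ring.
 have Ls k : L1 (fun x=> \sum_i t k i x) := L1_sum (Lt k).
 have -> : \I_x (kp x * gv x * V j x * (et x * et x * W j x)) = \sum_k \sum_i I (t k i).
  transitivity (\sum_k \I_x (\sum_i t k i x));last by apply: eq_bigr=> k _;exact: I_sum (Lt k).
  rewrite -(I_sum Ls);apply: eq_I=> x.
  have [h|h] := pselect (box c (2 * r) x);last first.
   by rewrite e0// !mul0r mulr0 big1// => k _;rewrite big1// => i _;rewrite /t e0// !mul0r.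
  have -> : \sum_k \sum_i t k i x = \sum_i (et x * et x * W j x * kp x * (V j x * \sum_k DV k i x ^+ 2 - DV j i x * \sum_k V k x * DV k i x)).
   rewrite exchange_big /=;apply: eq_bigr=> i _;rewrite !mulr_sumr -sumrB mulr_sumr;apply: eq_bigr=> k _.
   by rewrite /t /A (e3in x h) (de3in i x h);ring.
  have -> : \sum_i (et x * et x * W j x * kp x * (V j x * \sum_k DV k i x ^+ 2 - DV j i x * \sum_k V k x * DV k i x)) =
    \sum_i (et x * et x * W j x * kp x * V j x) * \sum_k DV k i x ^+ 2.
   by apply: eq_bigr=> i _;rewrite VDV mulr0 subr0 mulrA.
  by rewrite -mulr_sumr /gv;move: (\sum_i _)=> S;ring.
 apply: le_trans (ler_norm_sum _ _ _) _.
 apply: (letr (\sum_(k < n) C7 * Z ^+ 3));first by apply: ler_sum=> k _;exact: X1.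
 rewrite sumr_const card_ord [leRHS]mulr_natl;exact: lexx.
have cdee : cd (fun x=> et x * et x) := cd_M Se cde.
have ddee i x : dd i (fun x=> et x * et x) x = 2 * (et x * dd i et x).
 by rewrite (dd_M i x Se Se);move: (dd i et x)=> d;ring.
have ee0 x : ~ box c (2 * r) x -> et x * et x = 0 by move=> h;rewrite e0// mul0r.
(* Equation [j] tested with [et^2 W_j], an H^1 function with compact support in the disk. *)
have H j : \sum_i \I_x (kp x * DV j i x * (et x * et x * DV j i x + dd i (fun x=> et x * et x) x * W j x)) =
  \I_x (kp x * gv x * V j x * (et x * et x * W j x)).
 apply: (tang j (fun x=> et x * et x * W j x) (fun i x=> et x * et x * DV j i x + dd i (fun x=> et x * et x) x * W j x) (1 + `|m j|)).
 - by move=> x /out hx;rewrite ee0// mul0r.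
 - by move=> x;rewrite normrM -[leRHS]mul1r;apply: ler_pM=> //;rewrite normrM mulr_ile1.
 - by move=> i;exact: W2_loc cdee (W2W j i).
 - by move=> i x /out hx;rewrite ddee ee0// e0// !(mul0r, mulr0) addr0.
pose E j i x := kp x * (et x * DV j i x) ^+ 2.
have LE j i : L1 (E j i).
 have l : L2 (fun x=> et x * bx c (6 * r) (DV j i) x) := L2_bM (Sm_mf Se) ea (L2bDV _ j i r6).
 have := L1_bM mk kabs l.2;congr L1;apply/funext=> x;rewrite /E.
 have [h|h] := pselect (box c (2 * r) x);last by rewrite e0// !mul0r.
 by rewrite bx_in//;exact: box26.
(* The cross term. Since [D et] vanishes on the inner square, [DV j i] may be replaced by its
   restriction [an j i] to the annulus. *)
pose J j i x := an j i x * bx c (6 * r) (W j) x * (kp x * (2 * (et x * dd i et x))).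
have q0 : 0 <= M * (2 * (C1 / r)) by rewrite mulr_ge0// mulr_ge0.
have bq i x : `|kp x * (2 * (et x * dd i et x))| <= M * (2 * (C1 / r)).
 rewrite normrM;apply: ler_pM=> //;rewrite normrM (ger0_norm (ler0n R 2));apply: ler_wpM2l=> //.
 by rewrite normrM -[leRHS]mul1r;apply: ler_pM.
have mq i : mf (fun x=> kp x * (2 * (et x * dd i et x))).
 by apply: mfM=> //;apply: mfZ;apply: mfM;[exact: Sm_mf|exact: Sm_mf (Sm_dd i Se)].
have LJ j i : L1 (J j i) := L1_tri (Lan j i) (LW j) (mq i) (bq i).
have bJ j i : `|I (J j i)| <= 96 * M * C1 * (Y * Z).
 apply: le_trans (I_tri (Lan j i) (LW j) (mq i) (bq i)) _.
 rewrite (_ : 96 * M * C1 * (Y * Z) = M * (2 * (C1 / r)) * (Y * (48 * r * Z)));last by field;rewrite gt_eqF.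
 by apply: ler_wpM2l=> //;apply: ler_pM;rewrite ?nrm_ge0//;exact: hm.
have HE j : \sum_i I (E j i) = \I_x (kp x * gv x * V j x * (et x * et x * W j x)) - \sum_i I (J j i).
 rewrite -(H j) -sumrB;apply: eq_bigr=> i _;apply/eqP;rewrite eq_sym subr_eq;apply/eqP.
 rewrite -(ID (LE j i) (LJ j i));apply: eq_I=> x;rewrite ddee /E /J /an.
 have [h|h] := pselect (box c (2 * r) x);last by rewrite e0// !(mul0r, mulr0, add0r, expr0n, addr0).
 rewrite (bx_in _ h) (bx_in _ (box26 x h));have [h2|h2] := pselect (box c (r / 2) x).
  by rewrite (dehalf i x h2) !(mulr0, mul0r, addr0);ring.
 rewrite (bx_out _ h2);move: (dd i et x)=> d;ring.
have bE' j : \sum_i I (E j i) <= n%:R * (C7 * Z ^+ 3) + 192 * M * C1 * (Y * Z).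
 rewrite HE;apply: le_trans (ler_norm _) _;apply: le_normB;apply: lerD;first exact: X2.
 apply: le_trans (ler_norm_sum _ _ _) _;rewrite sum2E (_ : 192 * M * C1 * (Y * Z) = 96 * M * C1 * (Y * Z) + 96 * M * C1 * (Y * Z));last by ring.
 exact: lerD.
have LEs j : L1 (fun x=> \sum_i E j i x) := L1_sum (LE j).
have final : mu c (r / 2) <= \sum_j \sum_i I (E j i).
 have -> : \sum_j \sum_i I (E j i) = \I_x (\sum_j \sum_i E j i x).
  rewrite (I_sum LEs);apply: eq_bigr=> j _;by rewrite (I_sum (LE j)).
 apply: I_le=> [||x];[exact: L1_bx|exact: L1_sum LEs|].
 have E0 j i : 0 <= E j i x by rewrite mulr_ge0// sqr_ge0.
 have [h|h] := pselect (box c (r / 2) x);last first.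
  by rewrite bx_out//;apply: sumr_ge0=> j _;apply: sumr_ge0=> i _.
 rewrite bx_in// mskT;last exact: bdisk rr h.
 rewrite /gv exchange_big /=;apply: ler_sum=> j _;apply: ler_sum=> i _.
 rewrite /E (_ : et x = 1);last by apply: eta1=> //;apply: box_W h;lra.
 rewrite mul1r ler_peMl ?sqr_ge0//;apply: k1;exact: bE rr h.
apply: le_trans final _;apply: (letr (\sum_(j < n) (n%:R * (C7 * Z ^+ 3) + 192 * M * C1 * (Y * Z)))).
 by apply: ler_sum=> j _;exact: bE'.
rewrite sumr_const card_ord -[leLHS]mulr_natl le_eqVlt;apply/orP;left;apply/eqP;ring.
Qed.
End HoleFilling.

(** * Energy decay at some rate, and the bound on the Laplacian *)

Section Decay.
Context {R : realType}.
Implicit Types (f g phi psi : R * R -> R) (x y v c : R * R) (i : 'I_2) (r : R).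

(** Absolute continuity of the integral, uniform in the centre: after truncation of [f] at height
    [k] the mass of a square is at most [4 k r^2], and the truncation error is independent of the
    square. *)
Lemma small_mass f : L1 f -> (forall x, 0 <= f x) -> forall e, 0 < e -> exists2 d, 0 < d &
 forall c r, 0 <= r -> r <= d -> I (bx c r f) <= e.
move=> hf f0 e e0;pose F (k : nat) x := Num.min (f x) k%:R.
have mF k : mf (F k) by apply: measurable_minr;[exact: L1_mf|exact: mfc].
have F0 k x : 0 <= F k x by rewrite le_min f0 ler0n.
have Ff k x : F k x <= f x by rewrite ge_min lexx.
have dct := I_dct mF (L1_mf hf) hf (fun k x=> ltac:(by rewrite ger0_norm)).
have cv x : F k x @[k --> \oo] --> f x.
 apply: cvg_near_cst;near=> k;rewrite /F min_l//.
 apply: le_trans (ltW (truncnS_gt (f x))) _;rewrite ler_nat;near: k;exact: nbhs_infty_ge.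
have {}dct := dct cv.
have e2 : 0 < e / 2 by rewrite divr_gt0.
have /cvgrPdist_lt/(_ _ e2)[k _ /(_ k (leqnn k))] := dct.
rewrite /= sub0r normrN=> hk.
have LF : L1 (F k) by apply: (L1_le (mF k) hf)=> x;rewrite ger0_norm.
pose C : R := 8 * k.+1%:R / e;have C0 : 0 < C by rewrite divr_gt0// mulr_gt0.
pose d := Num.min 1 C^-1;have d0 : 0 < d by rewrite lt_min ltr01 invr_gt0.
exists d=> // c r r0;rewrite le_min=> /andP[r1 rC].
have LD : L1 (fun x=> `|F k x - f x|) by apply: L1_abs;exact: L1B.
have L1k := L1Z k%:R (L1_box c r).
apply: (letr (\I_x (`|F k x - f x| + k%:R * \1_(box c r) x))).
 apply: I_le=> [||x];[exact: L1_bx|exact: L1D|].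
 have [hx|hx] := pselect (box c r x);last by rewrite bx_out// addr_ge0// mulr_ge0//;case/andP: (ind01 (box c r) x).
 rewrite bx_in// indT// mulr1 -[leLHS](subrK (F k x));apply: lerD;last by rewrite /F ge_min lexx orbT.
 by rewrite distrC ler_norm.
rewrite (ID LD L1k) (IZ _ (L1_box c r)) (I_box c r0).
have h1 : \I_x (`|F k x - f x|) <= e / 2.
 by apply: ltW;apply: le_lt_trans hk;exact: ler_norm.
have h2 : k%:R * (4 * r ^+ 2) <= e / 2.
 have rr : r ^+ 2 <= C^-1.
  by rewrite expr2;apply: le_trans rC;rewrite ler_piMr.
 have kk : k%:R <= k.+1%:R :> R by rewrite ler_nat.
 apply: (letr (k.+1%:R * (4 * C^-1))).
  by apply: ler_pM=> //;[rewrite mulr_ge0// sqr_ge0|rewrite ler_pM2l].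
 rewrite /C (_ : k.+1%:R * (4 * (8 * k.+1%:R / e)^-1) = e / 2)//.
 have : k.+1%:R != 0 :> R by rewrite pnatr_eq0.
 by move: (k.+1%:R)=> K K0;field;rewrite K0 gt_eqF.
by rewrite [leRHS](splitr e);exact: lerD.
Unshelve. all: by end_near.
Qed.

(** Young's inequality bounds the product of roots by [C5^2 (b - a) + b / 4], and smallness of [b]
    bounds the cubic term by [b / 4]. Moving [C5^2 a] to the left fills the hole. *)
Lemma theta_arith (a b C5 C6 : R) : 0 <= C5 -> 0 <= C6 -> 0 <= a -> a <= b -> C6 * Num.sqrt b <= 4^-1 ->
 a <= C5 * (Num.sqrt (b - a) * Num.sqrt b) + C6 * Num.sqrt b ^+ 3 ->
 a <= (C5 ^+ 2 + 2^-1) / (C5 ^+ 2 + 1) * b.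
move=> C50 C60 a0 ab hs H;have b0 : 0 <= b by exact: le_trans ab.
have z2 : Num.sqrt b ^+ 2 = b by rewrite sqr_sqrtr.
have y2 : Num.sqrt (b - a) ^+ 2 = b - a by rewrite sqr_sqrtr ?subr_ge0.
have z0 := sqrtr_ge0 b;have y0 := sqrtr_ge0 (b - a).
move: z2 y2 z0 y0 hs H;move: (Num.sqrt b) (Num.sqrt (b - a))=> z y z2 y2 z0 y0 hs H.
have h1 : C6 * z ^+ 3 <= b / 4.
 rewrite (_ : C6 * z ^+ 3 = C6 * z * z ^+ 2);last by ring.
 by rewrite z2 mulrC;apply: ler_wpM2l.
have h2 : C5 * (y * z) <= C5 ^+ 2 * (b - a) + b / 4.
 by rewrite -y2 -z2;have := sqr_ge0 (C5 * y - z / 2);nra.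
have C1 : 0 < C5 ^+ 2 + 1 by rewrite ltr_wpDl// sqr_ge0.
by rewrite mulrAC ler_pdivlMr//;nra.
Qed.
Lemma bernoulli (t : R) k : 0 <= t -> t <= 1 -> 1 - k%:R * t <= (1 - t) ^+ k.
move=> t0 t1;elim: k=> [|k IH];first by rewrite mul0r subr0 expr0.
rewrite exprS;apply: (letr ((1 - t) * (1 - k%:R * t))).
 rewrite -natr1;have : 0 <= k%:R * t ^+ 2 by rewrite mulr_ge0 ?sqr_ge0.
 by lra.
by apply: ler_wpM2l;rewrite ?subr_ge0.
Qed.

Lemma lapl_arith (S T a b : R) : - (a + 1 * b) <= S -> S <= 0 -> - (a + -1 * b) <= T -> T <= 0 -> `|b| <= a ->
 `|2^-1 * (S - T) + b| <= a.
by rewrite !ler_norml=> h1 h2 h3 h4 /andP[h5 h6];apply/andP;split;lra. Qed.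

Section D.
Variables (n : nat) (U : 'I_n -> R * R -> R) (G : 'I_n -> 'I_2 -> R * R -> R).
Hypothesis st : stationary U G.
Local Notation lam := (en U).
Local Notation V := (pn U).
Local Notation DL := (pDm U G).
Local Notation DV := (pDn U G).
Local Notation gv := (gv U G).
Local Notation mu := (mu U G).
Let hU := st_W2 st.
Let U1 := st_ge1 st.
Let lam0 x : 0 < lam x. Proof. exact: lt_le_trans (U1 x). Qed.
Let W2V j i := W2_pn ltr01 U1 hU j i.
Let W2L i := W2_en ltr01 U1 hU i.
Let D2DL i : D2 (DL i). Proof. by case: (W2L i). Qed.
Let D2DV j i : D2 (DV j i). Proof. by case: (W2V j i). Qed.
Let mV j : mf (V j) := pn_mf ltr01 U1 hU j.
Let bV j x : `|V j x| <= 1 := pn_abs ltr01 U1 j x.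
Let D2lDV (k : 'I_n) i : D2 (fun x=> lam x * DV k i x) := D2_mDn ltr01 U1 hU k i.
Let GE j i x : G j i x = DL i x * V j x + lam x * DV j i x := pDzE G ltr01 U1 j i x.
(** Morrey decay of the energy of [v] along dyadic squares, uniform over the centres in a smaller
    disk. *)
Definition decay (q s : R) := exists2 C, 0 <= C & forall x, E2 x <= s -> forall j, mu x (sc j) <= C * q ^+ j.

Lemma mu_total c r : mu c r <= I (msk gv).
apply: I_le=> [||x];[by apply: L1_bx;exact: L1_gv st|exact: L1_gv st|].
by rewrite /bx ler_piMl ?gvm_ge0//;case/andP: (ind01 (box c r) x).
Qed.

(** Six dyadic generations gain the factor [th]: with [r = 2^-(j+5)] the square of half-side
    [2^-j = 32 r] contains the one of half-side [30 r], and [2^-(j+6) = r / 2]. By Bernoulli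
    [q = 1 - (1 - th) / 6] satisfies [q^6 >= th]. Scales too coarse for the smallness of the mass
    are absorbed in the constant. *)
Lemma decay_exists (s : R) : s < 1 -> exists2 q, 0 < q < 1 & decay q s.
move=> s1;have [d0 d00 [s0 /andP[ss0 s01] hgeo]] := geo s1.
have [C5 C50 [C6 C60 hf]] := hole_filling st s01.
pose e := (4 * (C6 + 1))^-1 ^+ 2.
have C61 : 0 < 4 * (C6 + 1) by rewrite mulr_gt0// ltr_wpDl.
have e0 : 0 < e by rewrite exprn_gt0// invr_gt0.
have [d1 d10 hd1] := small_mass (L1_gv st) (gvm_ge0 U G) e0.
have [m hm] := sc_small (ltac:(by rewrite lt_min d00 d10) : 0 < Num.min d0 d1).
move: hm;rewrite le_min=> /andP[m0 m1].
pose th := (C5 ^+ 2 + 2^-1) / (C5 ^+ 2 + 1).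
have C51 : 0 < C5 ^+ 2 + 1 by rewrite ltr_wpDl// sqr_ge0.
have th0 : 0 <= th by rewrite divr_ge0 ?(ltW C51)// addr_ge0// sqr_ge0.
have th1 : th < 1 by rewrite ltr_pdivrMr// mul1r ltrD2l;lra.
pose q := 1 - (1 - th) / 6.
have q0 : 0 < q by rewrite /q;lra.
have q1 : q < 1 by rewrite /q;lra.
have thq : th <= q ^+ 6.
 apply: le_trans (@bernoulli ((1 - th) / 6) 6 _ _);lra.
exists q;first by rewrite q0 q1.
pose T := I (msk gv);have T0 : 0 <= T by apply: I_ge0=> x;exact: gvm_ge0.
exists (T / q ^+ (m + 6));first by rewrite divr_ge0// exprn_ge0// ltW.
move=> x hx.
have step j : (m <= j)%N -> mu x (sc (j + 6)) <= th * mu x (sc j).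
 move=> mj;have hj : sc j <= d0 :> R by apply: le_trans m0;exact: sc_le.
 have hj1 : sc j <= d1 :> R by apply: le_trans m1;exact: sc_le.
 pose r : R := sc (j + 5);have r0 : 0 < r by exact: sc_gt0.
 have e32 : sc j = 32 * r.
  by rewrite /r /sc exprD;field;rewrite expf_neq0.
 have e6 : sc (j + 6) = r / 2 by rewrite addnS scS.
 have hb y : box x (30 * r) y -> E2 y <= s0.
  by move=> h;apply: hgeo hx _;apply: box_W h;apply: le_trans hj;rewrite e32;lra.
 have H := hf x r r0 hb.
 have b1 : mu x (2 * r) <= mu x (sc j) by apply: (mu_le st);rewrite e32;lra.
 have b2 : mu x (30 * r) <= mu x (sc j) by apply: (mu_le st);rewrite e32;lra.
 have ab : mu x (sc (j + 6)) <= mu x (sc j) by apply: (mu_le st);apply: sc_le;exact: leq_addr.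
 apply: (theta_arith C50 C60 (mu_ge0 _ _ _ _) ab).
  have hs := hd1 x (sc j) (ltW (sc_gt0 j)) hj1;rewrite -/(mu x (sc j)) in hs.
  have : Num.sqrt (mu x (sc j)) <= (4 * (C6 + 1))^-1.
   by apply: le_trans (ler_wsqrtr hs) _;rewrite /e sqrtr_sqr ger0_norm// invr_ge0 ltW.
  move=> h;apply: (letr (C6 * (4 * (C6 + 1))^-1));first exact: (ler_wpM2l C60 h).
  by rewrite ler_pdivrMr//;lra.
 rewrite e6 in ab *;apply: le_trans H _;apply: lerD;apply: ler_wpM2l=> //.
  by apply: ler_pM;rewrite ?sqrtr_ge0//;apply: ler_wsqrtr=> //;apply: lerB.
 by rewrite lerXn2r ?nnegrE ?sqrtr_ge0// ler_wsqrtr.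
have qn k : q ^+ k != 0 by rewrite expf_neq0// gt_eqF.
elim/ltn_ind=> j IH;have [jm|jm] := ltnP j (m + 6).
 apply: le_trans (mu_total _ _) _;rewrite -/T -mulrA ler_peMr//.
 rewrite mulrC ler_pdivlMr ?exprn_gt0// mul1r.
 by rewrite -(subnKC (ltnW jm)) exprD ler_piMr ?exprn_ge0 ?(ltW q0)// exprn_ile1// ltW.
have j6 : (6 <= j)%N by apply: leq_trans jm;exact: leq_addl.
have mj : (m <= j - 6)%N by rewrite leq_subRL// addnC.
have := step _ mj;rewrite subnK// => h;apply: le_trans h _.
have lt : (j - 6 < j)%N by rewrite ltn_subrL /= (leq_trans _ j6).
have -> : T / q ^+ (m + 6) * q ^+ j = q ^+ 6 * (T / q ^+ (m + 6) * q ^+ (j - 6)).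
 by rewrite mulrCA -exprD subnKC.
exact: (ler_pM th0 (mu_ge0 U G x _) thq (IH _ lt)).
Qed.

Lemma subharmonic_ext phi (P : 'I_2 -> R * R -> R) (r B : R) : r < 1 -> (forall x, r < E2 x -> phi x = 0) ->
 (forall x, `|phi x| <= B) -> (forall i, wd i phi (P i)) -> (forall x, 0 <= phi x) ->
 \sum_i \I_x (msk (DL i) x * P i x) <= 0.
move=> r1 hr hB hP p0;apply: le_eps=> e e0;rewrite add0r.
have LA i : L2 (msk (DL i)) := proj2 (D2DL i).
have [psi [hpsi psi0 h1 _]] := test_approx r1 hr hB hP LA (@L10 R) e0.
have h2 : \sum_i \I_x (msk (DL i) x * dd i psi x) <= 0.
 rewrite (eq_bigr (fun i=> \I_x (DL i x * dd i psi x)))=> [|i _].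
  by apply: (subharmonic st hpsi);exact: psi0.
 by apply: eq_I=> x;exact: msk_cd (cd_dd i hpsi).
move: h1;rewrite distrC=> /(le_trans (ler_norm _));move: (\sum_i _) (\sum_i _) h2=> a b;lra.
Qed.

Lemma wd_W2 i f g : wd i f g -> W2 i f g.
move=> [hf hg hw];split;[exact: L2_msk_D2'|exact: L2_msk_D2'|].
by move=> phi hp;apply: hw;exact: cd_tf.
Qed.

(** The density [lambda |Dv|^2], extended by zero, which dominates the Laplacian of every
    component. *)
Definition Fl x := msk (fun y=> lam y * gv y) x.
Lemma L1_Fl : L1 Fl. Proof. exact: L1_lgv st. Qed.
Lemma Fl_ge0 x : 0 <= Fl x.
rewrite /Fl;have [h|h] := pselect (disk x);last by rewrite mskF.
by rewrite mskT// mulr_ge0 ?gv_ge0// ltW.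
Qed.

(** Half the difference of the integrals of [D lambda . D(phi (1 + V_j))] and
    [D lambda . D(phi (1 - V_j))] is the integral of [D lambda . D(phi V_j)]; adding the tangential
    equation tested with [phi / lambda] produces the pairing of [D u_j] with [D phi]. The two
    integrals are confined to intervals ending at [0], and [lapl_arith] combines the bounds. *)
Lemma laplacian_bound_cd j phi : cd phi -> (forall x, 0 <= phi x) ->
 `|\sum_i \I_x (G j i x * dd i phi x)| <= \I_x (Fl x * phi x).
move=> hphi p0;have [B B0 hB] := tf_bound (cd_tf hphi).
have [r r1 hr] := hphi.2.
have hdr i x : r < E2 x -> dd i phi x = 0 by exact: dd_supp_E2.
have mphi := Sm_mf (cd_Sm hphi).
have LF f : mf f -> (forall x, `|f x| <= 1) -> L1 (fun x=> Fl x * (phi x * f x)).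
 move=> mf1 b1;have : L1 (fun x=> (phi x * f x) * Fl x).
  apply: (@L1_bM _ _ _ B) L1_Fl;first exact: mfM.
  by move=> x;rewrite normrM -[leRHS]mulr1;apply: ler_pM.
 by congr L1;apply/funext=> x;rewrite mulrC.
have LFV := LF _ (mV j) (bV j).
have LF1 : L1 (fun x=> Fl x * phi x).
 have := LF (fun=> 1) (mfc 1) (fun x=> ltac:(by rewrite normr1));congr L1;apply/funext=> x;by rewrite mulr1.
have W2s (sg : R) i : W2 i (fun x=> 1 + sg * V j x) (fun x=> 0 + sg * DV j i x) := W2_D (W2_cst i 1) (W2_Z sg (W2V j i)).
(* [phi (1 + sg V_j)] is nonnegative: the upper bound is subharmonicity, the lower one the radial
   inequality for an outward variation. *)
have key (sg : R) : sg ^+ 2 = 1 ->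
  - \I_x (Fl x * (phi x * (1 + sg * V j x))) <=
  \sum_i \I_x (msk (DL i) x * (phi x * (0 + sg * DV j i x) + dd i phi x * (1 + sg * V j x))) <= 0.
 move=> sg1;have sa : `|sg| = 1.
  by apply/eqP;rewrite -sqrp_eq1 ?normr_ge0// real_normK ?num_real// sg1.
 have V2 x : `|sg * V j x| <= 1 by rewrite normrM sa mul1r.
 have e0 x : 0 <= phi x * (1 + sg * V j x).
  by apply: mulr_ge0=> //;have := V2 x;rewrite ler_norml=> /andP[];lra.
 have hr' x : r < E2 x -> phi x * (1 + sg * V j x) = 0 by move=> /hr ->;rewrite mul0r.
 have b' x : `|phi x * (1 + sg * V j x)| <= B * 2.
  rewrite normrM;apply: ler_pM=> //;apply: le_normD;rewrite normr1.
  by have := V2 x;lra.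
 have wdP i := W2_loc hphi (W2s sg i).
 apply/andP;split;last exact: subharmonic_ext r1 hr' b' wdP e0.
 have := st_rad st r1 hr' b' (fun i=> wd_W2 (wdP i)) ltr01.
 have ad e x : 0 < e -> e <= 1 -> 1 <= lam x + e * (phi x * (1 + sg * V j x)).
  by move=> ep _;apply: le_trans (U1 x) _;rewrite lerDl mulr_ge0// ltW.
 move=> /(_ ad).
 have L1a i : L1 (fun x=> msk (DL i) x * (phi x * (0 + sg * DV j i x) + dd i phi x * (1 + sg * V j x))).
  by apply: L2M;[exact: proj2 (D2DL i)|by case: (wdP i)=> _ /K2_L2].
 have Ls : L1 (fun x=> \sum_i msk (DL i) x * (phi x * (0 + sg * DV j i x) + dd i phi x * (1 + sg * V j x))) := L1_sum L1a.
 have L1b : L1 (fun x=> Fl x * (phi x * (1 + sg * V j x))).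
  have : L1 (fun x=> Fl x * phi x + sg * (Fl x * (phi x * V j x))) by apply: L1D=> //;exact: L1Z.
  by congr L1;apply/funext=> x;ring.
 rewrite (eq_I (g := fun x=> \sum_i msk (DL i) x * (phi x * (0 + sg * DV j i x) + dd i phi x * (1 + sg * V j x)) +
  Fl x * (phi x * (1 + sg * V j x)))).
  by rewrite (ID Ls L1b) (I_sum L1a) -lerBlDr sub0r.
 move=> x;rewrite msk_sum /Fl;have [dx|dx] := pselect (disk x);last first.
  by rewrite (mskF _ dx) mul0r addr0;apply: eq_bigr=> i _;rewrite !(mskF _ dx) mul0r.
 rewrite (mskT _ dx) /gv mulr_sumr mulr_suml -big_split /=;apply: eq_bigr=> i _.
 by rewrite !(mskT _ dx);ring.
have hm1 : (-1 : R) ^+ 2 = 1 by rewrite sqrrN expr1n.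
have /andP[kp1 kp2] := key 1 (expr1n _ _);have /andP[km1 km2] := key (-1) hm1.
have W2v i := @W2_inv R i lam (DL i) 1 ltr01 U1 (W2L i).
have b2 x : `|phi x * (lam x)^-1| <= B.
 rewrite normrM -[leRHS]mulr1;apply: ler_pM=> //.
 by rewrite normfV (gtr0_norm (lam0 x)) invf_le1.
have hr2 x : r < E2 x -> phi x * (lam x)^-1 = 0 by move=> /hr ->;rewrite mul0r.
have hr3 i x : r < E2 x -> phi x * (- (lam x ^+ 2)^-1 * DL i x) + dd i phi x * (lam x)^-1 = 0.
 by move=> h;rewrite (hr x h) (hdr i x h) !mul0r addr0.
(* The weight [lambda^2] of the tangential equation, with the test function [phi / lambda], leaves
   [lambda DV_j . D phi] and a term [- phi DV_j . D lambda]; the latter cancels the one produced by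
   [D(phi V_j)]. *)
have T := tangential_ext st j r1 hr2 b2 (fun i=> W2_loc hphi (W2v i)) hr3.
have T2 : \I_x (lam x ^+ 2 * gv x * V j x * (phi x * (lam x)^-1)) = \I_x (Fl x * (phi x * V j x)).
 apply: eq_I=> x;rewrite /Fl;have [dx|dx] := pselect (disk x);last first.
  by rewrite (cd_off hphi dx) !(mul0r, mulr0).
 by rewrite (mskT _ dx);field;rewrite gt_eqF.
rewrite {}T2 in T.
pose Q (sg : R) i x := msk (DL i) x * (phi x * (0 + sg * DV j i x) + dd i phi x * (1 + sg * V j x)).
pose X i x := lam x ^+ 2 * DV j i x * (phi x * (- (lam x ^+ 2)^-1 * DL i x) + dd i phi x * (lam x)^-1).
have LQ sg i : L1 (Q sg i).
 by apply: L2M;[exact: proj2 (D2DL i)|case: (W2_loc hphi (W2s sg i))=> _ /K2_L2].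
have LX i : L1 (X i).
 have h1 : L1 (fun x=> dd i phi x * (lam x * DV j i x)) := K2_L1 (D2_cd (cd_dd i hphi) (D2lDV j i)).
 have h2 : L1 (fun x=> msk (DV j i) x * (phi x * DL i x)).
  by apply: L2M;[exact: proj2 (D2DV j i)|exact: K2_L2 (D2_cd hphi (D2DL i))].
 have := L1B h1 h2;congr L1;apply/funext=> x;rewrite /X.
 have [dx|dx] := pselect (disk x);last by rewrite (cd_off hphi dx) (cd_off (cd_dd i hphi) dx);ring.
 rewrite (mskT _ dx);field;by rewrite gt_eqF.
(* By the polar form [G = D lambda V + lambda DV] this identity holds under the integral sign. *)
have E : \sum_i \I_x (G j i x * dd i phi x) =
  2^-1 * (\sum_i I (Q 1 i) - \sum_i I (Q (-1) i)) + \sum_i I (X i).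
 rewrite mulrBr !mulr_sumr -sumrB -big_split /=;apply: eq_bigr=> i _.
 rewrite -(IZ _ (LQ _ i)) -(IZ _ (LQ _ i)) -(IB (L1Z _ (LQ 1 i)) (L1Z _ (LQ (-1) i))).
 rewrite -(ID (L1B (L1Z _ (LQ 1 i)) (L1Z _ (LQ (-1) i))) (LX i));apply: eq_I=> x.
 rewrite /Q /X GE;have [dx|dx] := pselect (disk x);last first.
  by rewrite (cd_off hphi dx) (cd_off (cd_dd i hphi) dx);ring.
 rewrite (mskT _ dx);field;by rewrite gt_eqF.
have ZV sg : \I_x (Fl x * (phi x * (1 + sg * V j x))) =
  \I_x (Fl x * phi x) + sg * \I_x (Fl x * (phi x * V j x)).
 by rewrite -(IZ _ LFV) -(ID LF1 (L1Z _ LFV));apply: eq_I=> x;ring.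
have bV2 : `|\I_x (Fl x * (phi x * V j x))| <= \I_x (Fl x * phi x).
 apply: le_trans (I_abs LFV) _;apply: I_le=> [||x] //;first exact: L1_abs.
 rewrite normrM [ `|phi x * _|]normrM (ger0_norm (Fl_ge0 x)) (ger0_norm (p0 x));apply: (ler_wpM2l (Fl_ge0 x)).
 by rewrite ler_piMr.
rewrite E T;move: kp1 kp2 km1 km2 bV2;rewrite !ZV -/(Q _ _).
exact: lapl_arith.
Qed.
End D.
End Decay.

(** * Lipschitz bounds for kernels and summation over dyadic scales *)

Section Boot.
Context {R : realType}.
Implicit Types (f g phi psi : R * R -> R) (x y v w c h : R * R) (i : 'I_2) (r d t : R).

Lemma Sm_shf f v : Sm f -> Sm (fun y=> f (y + v)).
by move=> hf;apply: Sm_ext (Sm_aff 1 v hf)=> y;rewrite scale1r. Qed.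
Lemma dd_shf f v i x : Sm f -> dd i (fun y=> f (y + v)) x = dd i f (x + v).
move=> hf;have := dd_aff 1 v i x hf;rewrite mul1r scale1r=> <-.
by congr (dd i _ x);apply/funext=> y;rewrite scale1r.
Qed.

Lemma Sm_lip_box f (M : R) : 0 <= M -> Sm f -> (forall i x, `|dd i f x| <= M) ->
 forall x h d, box 0 d h -> `|f (x + h) - f x| <= 2 * M * d.
move=> M0 hf hM x h d;rewrite box0E=> -[h1 h2];apply: le_trans (Sm_lip2 hf hM x h) _.
by rewrite -mulrA mulrCA mulrA -mulrA;apply: ler_wpM2l=> //;lra.
Qed.
Lemma tf_lip f : tf f -> exists2 C, 0 <= C & forall x h d, box 0 d h -> `|f (x + h) - f x| <= C * d.
move=> hf;have [M M0 hM] := tf_dd_bound hf;exists (2 * M);first by rewrite mulr_ge0.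
exact: Sm_lip_box M0 (tf_Sm hf) hM.
Qed.
Lemma tf_lip2 f : tf f -> exists2 C, 0 <= C & forall x v h d t, box 0 t v -> box 0 d h ->
 `|(f (x + h + v) - f (x + h)) - (f (x + v) - f x)| <= C * t * d.
move=> hf;have [C1 C10 h1] := tf_lip (tf_dd ord0 hf);have [C2 C20 h2] := tf_lip (tf_dd ord_max hf).
exists (2 * (C1 + C2));first by rewrite mulr_ge0// addr_ge0.
move=> x v h d t hv hh;have t0 : 0 <= t by move: hv;rewrite box0E=> -[/(le_trans (normr_ge0 _))].
have Sf := tf_Sm hf;pose g z := f (z + v) - f z.
have Sg : Sm g by apply: Sm_B=> //;exact: Sm_shf.
rewrite -(mulrA 2);apply: (@Sm_lip_box g)=> //;first by rewrite mulr_ge0// addr_ge0.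
move=> i z;rewrite (dd_B _ _ (Sm_shf v Sf) Sf) (dd_shf _ _ _ Sf).
case: (ord2P i)=> ->;[apply: le_trans (h1 _ _ _ hv) _|apply: le_trans (h2 _ _ _ hv) _];
 by apply: ler_wpM2r=> //;rewrite ?lerDl ?lerDr.
Qed.
Lemma box0Z (a d : R) h : 0 <= a -> box 0 d h -> box 0 (a * d) (a *: h).
move=> a0;rewrite !box0E /= => -[h1 h2].
by rewrite !normrM (ger0_norm a0);split;apply: ler_wpM2l.
Qed.
Lemma kk_sh j x h y : kk j (x + h) y = k0 (- 2 ^+ j *: y + 2 ^+ j *: x + 2 ^+ j *: h).
by rewrite /kk scalerDr addrA. Qed.
Lemma kk_lip : exists2 C, 0 <= C & forall j x h d y, box 0 d h -> `|kk j (x + h) y - kk j x y| <= C * (2 ^+ j * d).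
have [C C0 hC] := tf_lip (@tf_k0 R);exists C=> // j x h d y hh.
by rewrite kk_sh;apply: hC;apply: box0Z=> //;exact: exprn_ge0.
Qed.
Lemma kk_lip2 : exists2 C, 0 <= C & forall j x v h d t y, box 0 t v -> box 0 d h ->
 `|(kk j (x + h + v) y - kk j (x + h) y) - (kk j (x + v) y - kk j x y)| <= C * (2 ^+ j * t) * (2 ^+ j * d).
have [C C0 hC] := tf_lip2 (@tf_k0 R);exists C=> // j x v h d t y hv hh.
rewrite !kk_sh scalerDr addrA;apply: hC;apply: box0Z=> //;exact: exprn_ge0.
Qed.
Lemma cv_lip f phi : L1 f -> tf phi -> exists2 C, 0 <= C & forall x h d, box 0 d h ->
 `|cv f phi (x + h) - cv f phi x| <= C * d.
move=> hf hp;have [M M0 hM] := tf_dd_bound hp.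
have J0 : 0 <= M * \I_y (`|f y|) by rewrite mulr_ge0// I_ge0.
exists (2 * (M * \I_y (`|f y|)));first by rewrite mulr_ge0.
apply: Sm_lip_box=> // [|i x];first exact: Sm_cv.
rewrite (dd_cv _ _ hf hp) (cv_tfE _ hf (tf_dd i hp)) -(IZ _ (L1_abs hf));apply: I_absle.
- exact: L1_mf (L1_cv_tf x hf (tf_dd i hp)).
- exact: L1Z (L1_abs hf).
- by move=> y;rewrite normrM mulrC;apply: ler_wpM2r.
Qed.

(** Converts difference bounds for small positive steps into a bound on the derivative, so that
    gradients of averages inherit what is known for increments. *)
Lemma dd_le f i x (C e : R) : Sm f -> 0 < e ->
 (forall t, 0 < t -> t <= e -> `|f (x + t *: dir i) - f x| <= C * t) -> `|dd i f x| <= C.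
move=> hf e0 hC;apply: le_eps=> d d0.
have cf := Sm_cont (Sm_dd i hf).
have /cvgrPdist_lt/(_ _ d0) := cf x;move=> /nbhs_ballP[s /= s0 hs];pose t := Num.min e (s / 2).
have t0 : 0 < t by rewrite lt_min e0 divr_gt0.
have [u tu hu] := line_MVT i x t hf.
have := hC t t0;rewrite hu normrM (gtr0_norm t0) mulrC (ler_pM2r t0)=> /(_ ltac:(by rewrite ge_min lexx)) H.
have us : `|u| < s.
 have ts : t <= s / 2 by rewrite /t ge_min lexx orbT.
 by apply: le_lt_trans tu _;rewrite (gtr0_norm t0);lra.
have /hs /= hb : ball x s (x + u *: dir i).
 have db (a : bool) : `|u * a%:R| < s by case: a;rewrite ?mulr1// mulr0 normr0.
 by split;rewrite /ball /= opprD addNKr normrN;exact: db.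
rewrite -[dd i f x](subrK (dd i f (x + u *: dir i)));apply: le_normD.
by rewrite addrC;apply: lerD=> //;exact: ltW.
Qed.

Lemma geom_step (th C : R) (k j : nat) : th < 1 -> 
 C * (th ^+ k - th ^+ j) / (1 - th) + C * th ^+ j = C * (th ^+ k - th ^+ j.+1) / (1 - th).
by move=> h;rewrite exprS;field;rewrite subr_eq0 eq_sym lt_eqF. Qed.
Lemma tail_bound (th C : R) (a : nat -> R) (m k : nat) : th < 1 -> 0 <= th -> 0 <= C ->
 (forall j, (m <= j)%N -> `|a j - a j.+1| <= C * th ^+ j) -> (m <= k)%N ->
 forall j, (k <= j)%N -> `|a k - a j| <= C / (1 - th) * th ^+ k.
move=> th1 th0 C0 ha mk.
have H j : (k <= j)%N -> `|a k - a j| <= C * (th ^+ k - th ^+ j) / (1 - th).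
 elim: j=> [|j IH];first by rewrite leqn0=> /eqP ->;rewrite !subrr mulr0 mul0r normr0.
 rewrite leq_eqVlt=> /orP[/eqP <-|kj];first by rewrite !subrr mulr0 mul0r normr0.
 have -> : a k - a j.+1 = (a k - a j) + (a j - a j.+1) by ring.
 rewrite -(geom_step C k j th1);apply: le_normD;apply: lerD;first exact: IH.
 by apply: ha;exact: leq_trans mk kj.
have h1 : 0 <= (1 - th)^-1 by rewrite invr_ge0 subr_ge0 ltW.
move=> j kj;apply: le_trans (H j kj) _;rewrite mulrAC;apply: ler_wpM2l;first exact: mulr_ge0.
by rewrite lerBlDr lerDl exprn_ge0.
Qed.

(* Increments are summed at scales coarser than d by their Lipschitz bound
 and at finer scales by their size. *)
Lemma dyadic_osc (th C d : R) (a b : nat -> R) (m k : nat) : 1 < 2 * th -> th < 1 -> 0 <= C ->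
 0 <= d -> d <= sc k -> (m <= k)%N ->
 (forall j, (m <= j)%N -> `|a j - a j.+1| <= C * th ^+ j) ->
 (forall j, (m <= j)%N -> `|b j - b j.+1| <= C * th ^+ j) ->
 `|a m - b m| <= C * d ->
 (forall j, (m <= j)%N -> (j < k)%N -> `|(a j - a j.+1) - (b j - b j.+1)| <= C * (2 * th) ^+ j * d) ->
 forall j, (m <= j)%N -> `|a j - b j| <= (C + C / (2 * th - 1) + 2 * (C / (1 - th))) * th ^+ k.
move=> t2 th1 C0 d0 dk mk ha hb hm hd.
have th0 : 0 <= th by lra.
(* [K] is chosen so that [C + K <= 2 th K]: the Lipschitz bound with constant [K (2 th)^j] then
   passes from scale [j] to [j + 1]. This is where [2 th > 1] enters. *)
pose K := C + C / (2 * th - 1).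
have K1 : C + K <= K * (2 * th).
 have -> : K * (2 * th) = C * (2 * th - 1) + (C + K) by rewrite /K;field;rewrite subr_eq0 gt_eqF.
 by rewrite lerDr mulr_ge0// subr_ge0 ltW.
have KC : C <= K by rewrite /K lerDl divr_ge0// subr_ge0 ltW.
have K0 : 0 <= K by exact: le_trans KC.
have H j : (m <= j)%N -> (j <= k)%N -> `|a j - b j| <= K * (2 * th) ^+ j * d.
 elim: j=> [|j IH].
  rewrite leqn0=> /eqP m0 _;rewrite m0 in hm;apply: le_trans hm _.
  by rewrite expr0 mulr1;apply: ler_wpM2r.
 rewrite leq_eqVlt=> /orP[/eqP <- _|mj jk].
  apply: le_trans hm _;apply: ler_wpM2r=> //;apply: le_trans KC _.
  by apply: ler_peMr=> //;apply: exprn_ege1;exact: ltW.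
 have -> : a j.+1 - b j.+1 = (a j - b j) - ((a j - a j.+1) - (b j - b j.+1)) by ring.
 apply: le_normB;apply: le_trans (lerD (IH mj (ltnW jk)) (hd _ mj jk)) _.
 have -> : K * (2 * th) ^+ j * d + C * (2 * th) ^+ j * d = (C + K) * ((2 * th) ^+ j * d) by ring.
 have -> : K * (2 * th) ^+ j.+1 * d = K * (2 * th) * ((2 * th) ^+ j * d) by rewrite exprS;ring.
 by apply: ler_wpM2r=> //;rewrite mulr_ge0// exprn_ge0// mulr_ge0.
have d2 j : (j <= k)%N -> (2 * th) ^+ j * d <= th ^+ k.
 move=> jk;apply: (letr ((2 * th) ^+ k * sc k)).
  by apply: ler_pM=> //;[apply: exprn_ge0;lra|apply: ler_weXn2l=> //;exact: ltW].
 by rewrite exprMn /sc mulrAC mulfV ?mul1r// expf_neq0.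
have Hk j : (m <= j)%N -> (j <= k)%N -> `|a j - b j| <= K * th ^+ k.
 by move=> mj jk;apply: le_trans (H j mj jk) _;rewrite -mulrA;apply: ler_wpM2l=> //;exact: d2.
have T0 : 0 <= C / (1 - th) by rewrite divr_ge0// subr_ge0 ltW.
move=> j mj;have [jk|/ltnW kj] := leqP j k.
 apply: le_trans (Hk j mj jk) _;apply: ler_wpM2r;first exact: exprn_ge0.
 by rewrite lerDl mulr_ge0.
have ta := tail_bound th1 th0 C0 ha mk kj;have tb := tail_bound th1 th0 C0 hb mk kj.
have -> : a j - b j = (a k - b k) - (a k - a j) + (b k - b j) by ring.
apply: le_normD;apply: le_trans (lerD (ler_normB _ _) (lexx _)) _.
apply: le_trans (lerD (lerD (Hk k mk (leqnn _)) ta) tb) _.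
rewrite -/K;move: (C / (1 - th)) (th ^+ k)=> T z.
by rewrite (_ : K * z + T * z + T * z = (K + 2 * T) * z)//;ring.
Qed.

Lemma wd_ae i f f' g g' : wd i f g -> mf f' -> bs f' -> {ae leb2, forall x, f' x = f x} ->
 mf g' -> bs g' -> {ae leb2, forall x, g' x = g x} -> wd i f' g'.
move=> [hf hg hw] mf' bf' e mg' bg' e'.
have K a b : K2 a -> mf b -> bs b -> {ae leb2, forall x, b x = a x} -> K2 b.
 by move=> Ka mb bb ab;split=> //;exact: (L2_ae mb (K2_L2 Ka) ab).
have E a b phi : K2 a -> K2 b -> {ae leb2, forall x, b x = a x} -> tf phi ->
  \I_x (b x * phi x) = \I_x (a x * phi x).
 move=> Ka Kb ab hp;have mp := Sm_mf (tf_Sm hp).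
 by apply: I_ae;[exact: mfM (K2_mf Kb) mp|exact: mfM (K2_mf Ka) mp|apply: filterS ab=> x ->].
have Kf' := K _ _ hf mf' bf' e;have Kg' := K _ _ hg mg' bg' e'.
split=> // phi hp;rewrite (E _ _ _ hf Kf' e (tf_dd i hp)) (E _ _ _ hg Kg' e' hp);exact: hw.
Qed.
End Boot.

(** * Increments of averages of [u] in terms of its Laplacian *)

Section Reg.
Context {R : realType}.
Implicit Types (f g phi psi : R * R -> R) (x y v w c h : R * R) (i : 'I_2) (r d t : R).
Variables (n : nat) (U : 'I_n -> R * R -> R) (G : 'I_n -> 'I_2 -> R * R -> R).
Hypothesis st : stationary U G.
Local Notation lam := (en U).
Local Notation gv := (gv U G).
Local Notation mu := (mu U G).
Local Notation Fl := (Fl U G).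
Let hU := st_W2 st.
Let U1 := st_ge1 st.
Let lam0 x : 0 < lam x. Proof. exact: lt_le_trans (U1 x). Qed.
Let D2U l : D2 (U l). Proof. by case: (hU l ord0). Qed.
Let D2G l i : D2 (G l i). Proof. by case: (hU l i). Qed.
Let mL : mf lam. Proof. by case: (W2_en ltr01 U1 hU ord0)=> -[]. Qed.
Let L1F : L1 Fl := L1_Fl st.
Let F0 x : 0 <= Fl x := Fl_ge0 st x.

Lemma L1_FlM f (B : R) : mf f -> (forall x, `|f x| <= B) -> L1 (fun x=> Fl x * f x).
move=> mf1 hB;rewrite (_ : (fun x=> _) = fun x=> f x * Fl x);first exact: L1_bM mf1 hB L1F.
by apply/funext=> x;rewrite mulrC.
Qed.

(** The distribution [- Delta u_l] evaluated at [K], in weak form. *)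
Definition Tst l (K : R * R -> R) := \sum_i \I_x (G l i x * dd i K x).
Let L1T l i K : cd K -> L1 (fun x=> G l i x * dd i K x).
move=> hK;have := K2_L1 (D2_cd (cd_dd i hK) (D2G l i));congr L1;apply/funext=> x;exact: mulrC.
Qed.
Lemma cd_B f g : cd f -> cd g -> cd (fun x=> f x - g x).
move=> hf hg;have := cd_D hf (cd_Z (-1) hg).
by rewrite (_ : (fun x=> f x + -1 * g x) = fun x=> f x - g x)//;apply/funext=> x;rewrite mulN1r.
Qed.
Lemma Tst_B l K K' : cd K -> cd K' -> Tst l (fun x=> K x - K' x) = Tst l K - Tst l K'.
move=> hK hK';rewrite /Tst -sumrB;apply: eq_bigr=> i _.
rewrite -(IB (L1T l i hK) (L1T l i hK'));apply: eq_I=> x.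
by rewrite (dd_B i x (cd_Sm hK) (cd_Sm hK')) mulrBr.
Qed.

(** The bound on the Laplacian is for nonnegative functions. Writing [K = th - (th - K)] with
    [0 <= th - K <= 2 th] extends it to signed [K], with constant [1 + 2 = 3]. *)
Lemma Tst_le l K th : cd K -> cd th -> (forall x, `|K x| <= th x) -> `|Tst l K| <= 3 * \I_x (Fl x * th x).
move=> hK ht le;have [B _ hB] := tf_bound (cd_tf hK);have [B' _ hB'] := tf_bound (cd_tf ht).
have LK := L1_FlM (Sm_mf (cd_Sm hK)) hB;have Lt := L1_FlM (Sm_mf (cd_Sm ht)) hB'.
have t0 x : 0 <= th x by exact: le_trans (le x).
have b x : 0 <= th x - K x by rewrite subr_ge0;exact: le_trans (ler_norm _) (le x).
have h1 := laplacian_bound_cd st l ht t0;have h2 := laplacian_bound_cd st l (cd_B ht hK) b.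
rewrite -/(Tst l _) in h1;rewrite -/(Tst l _) (Tst_B l ht hK) in h2.
have h3 : \I_x (Fl x * (th x - K x)) <= 2 * \I_x (Fl x * th x).
 rewrite -(IZ _ Lt);apply: I_le=> [||x];[|exact: L1Z|].
  by have := L1B Lt LK;congr L1;apply/funext=> x;rewrite mulrBr.
 rewrite mulrCA;apply: ler_wpM2l=> //.
 by have := le x;rewrite ler_norml=> /andP[hx _];move: (K x) (th x) hx=> a e;lra.
rewrite -[Tst l K](subKr (Tst l th));apply: le_normB.
apply: le_trans (lerD h1 (le_trans h2 h3)) _;move: (I _)=> z;lra.
Qed.

(** Near the square [lambda] is at most [M] almost everywhere; replacing it by its truncation at [M]
    changes only a null set and makes the pointwise comparison with [M |Dv|^2] possible. *)
Lemma Fl_mu (s : R) : s < 1 -> exists2 M, 1 <= M & forall c r f (B : R), mf f ->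
 (forall y, box c r y -> E2 y <= s) -> (forall y, ~ box c r y -> f y = 0) -> (forall y, `|f y| <= B) ->
 \I_x (Fl x * f x) <= B * (M * mu c r).
move=> s1;have [M M1 hM] := lam_bounded st s1;exists M=> // c r f B mf1 hb f0 fB.
have M0 : 0 <= M by exact: le_trans M1. have B0 : 0 <= B by exact: le_trans (fB 0).
pose L x := Num.min (lam x) M.
have mLm : mf L by apply: measurable_minr=> //;exact: mfc.
have gm : mf (msk gv) := L1_mf (L1_gv st).
have L0 x : 0 <= L x by rewrite le_min M0 ltW.
have LLf : L1 (fun x=> L x * f x * msk gv x).
 apply: (@L1_bM _ _ _ (M * B)) (L1_gv st)=> [|x];first exact: mfM.
 rewrite normrM;apply: ler_pM=> //;rewrite ger0_norm//;by rewrite ge_min lexx orbT.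
rewrite (I_ae (g := fun x=> L x * f x * msk gv x)).
- rewrite -(IZ _ (L1_bx c r (L1_gv st))) -(IZ _ (L1Z _ (L1_bx c r (L1_gv st)))).
 apply: I_le=> // [|x];first by do 2 apply: L1Z;exact: L1_bx (L1_gv st).
 have [hx|hx] := pselect (box c r x);last by rewrite (f0 x hx) (bx_out _ hx) !(mulr0, mul0r).
 rewrite (bx_in _ hx) mulrA;apply: ler_wpM2r;first exact: gvm_ge0.
 apply: le_trans (ler_norm _) _;rewrite normrM mulrC;apply: ler_pM=> //;rewrite ger0_norm//;by rewrite ge_min lexx orbT.
- by apply: mfM=> //;exact: L1_mf L1F.
- exact: L1_mf LLf.
apply: filterS hM=> x hx;have [bx|bx] := pselect (box c r x);last by rewrite (f0 x bx) !(mulr0, mul0r).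
have xs := hb x bx;have dx : disk x by apply/diskE;exact: le_lt_trans xs s1.
by rewrite /Fl /L !mskT// min_l ?hx// mulrAC.
Qed.

(** The majorant of [K] is [c] times a cutoff supported one dyadic scale higher, which accounts for
    the division by [q] and for the shift in [m]. *)
Lemma Tst_bound (q s : R) : 0 < q -> s < 1 -> decay U G q s -> exists2 C, 0 <= C & exists m : nat,
 forall l x j K (c : R), (m <= j)%N -> E2 x <= s -> Sm K -> (forall y, ~ box x (sc j) y -> K y = 0) ->
 (forall y, `|K y| <= c) -> cd K /\ `|Tst l K| <= C * (c * q ^+ j).
move=> q0 s1 [C0 C00 hC];have [m [s' /andP[ss' s1'] hm]] := geo_sc s1.
have [M M1 hM] := Fl_mu s1';have M0 : 0 <= M by exact: le_trans M1.
exists (3 * (M * C0) / q);first by rewrite divr_ge0 ?mulr_ge0// ltW.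
exists m.+1=> l x [//|j] K c mj hx SK K0 Kc;have c0 : 0 <= c by exact: le_trans (Kc 0).
have s0 : 0 < sc j.+1 :> R := sc_gt0 _.
pose th y := c * eta x (sc j.+1) y.
have Sth : Sm th by apply: Sm_Z;exact: Sm_eta.
have e2 : 2 * sc j.+1 = sc j :> R by rewrite scS;field.
have th0 y : ~ box x (sc j) y -> th y = 0 by move=> hy;rewrite /th (@eta0 R x (sc j.+1) y s0) ?mulr0// e2.
have hb y : box x (sc j) y -> E2 y <= s' by exact: hm.
have hth : cd th := cd_of_box Sth s1' hb th0.
have hK : cd K by apply: (cd_of_box SK s1' _ K0)=> y hy;apply: hm hx hy;exact: ltnW.
split=> //;apply: le_trans (Tst_le l hK hth _) _=> [y|].
 have [hy|hy] := pselect (box x (sc j.+1) y);first by rewrite /th eta1// mulr1.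
 by rewrite K0// normr0 mulr_ge0//;case/andP: (eta01 x (sc j.+1) y).
have tb y : `|th y| <= c.
 by rewrite /th normrM (ger0_norm c0) ler_piMr//;exact: eta_abs.
have := hM x (sc j) th c (Sm_mf Sth) hb th0 tb.
have := hC x hx j;rewrite exprS;move: (I _) (mu x _)=> a z hz ha.
apply: (letr (3 * (c * (M * (C0 * q ^+ j))))).
 by apply: ler_wpM2l=> //;apply: le_trans ha _;apply: ler_wpM2l=> //;exact: ler_wpM2l.
rewrite le_eqVlt;apply/orP;left;apply/eqP;field;by rewrite gt_eqF.
Qed.

Lemma avg_Tst l j x : cd (kk j x) -> avg j (msk (U l)) x - avg j.+1 (msk (U l)) x = - Tst l (kk j x).
move=> hc;rewrite (avg_diff j x (K2_L1 (D2_K2 (D2U l)))) -sumrN;apply: eq_bigr=> i _.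
have [_ _ wL] := hU l i;rewrite -(wL _ (cd_dd i hc));apply: eq_I=> y.
exact: msk_cd (cd_dd i (cd_dd i hc)).
Qed.

Definition dl l j x := avg j (msk (U l)) x - avg j.+1 (msk (U l)) x.

Lemma box_tri x v (a b e : R) y : box 0 a v -> a + b <= e -> box (x + v) b y -> box x e y.
rewrite box0E /box /= => -[h1 h2] ab [h3 h4].
by split;[rewrite (_ : y.1 - x.1 = (y.1 - (x.1 + v.1)) + v.1)|
 rewrite (_ : y.2 - x.2 = (y.2 - (x.2 + v.2)) + v.2)];try ring;
 apply: le_normD;lra.
Qed.
Lemma box0D v w (a b : R) : box 0 a v -> box 0 b w -> box 0 (a + b) (v + w).
rewrite !box0E /= => -[h1 h2] [h3 h4].
by split;apply: le_normD;exact: lerD.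
Qed.

Lemma opp4 (a b e z : R) : `|(- a - - b) - (- e - - z)| = `|a - b - (e - z)|.
by rewrite -normrN;congr `|_|;ring. Qed.
(** [dl] is [Tst] of the kernel [kk], whose first and second differences in the centre gain factors
    [2^j d] and [4^j t d]. All four shifted kernels at scale [J] fit into the square of half-side
    [4 sc J], two scales coarser, which explains the division by [q^2]. *)
Lemma deltas (q s : R) l : 0 < q -> s < 1 -> decay U G q s -> exists2 C, 0 <= C & exists m : nat,
 forall j x v h d t, (m <= j)%N -> E2 x <= s -> box 0 t v -> box 0 d h -> t <= sc j -> d <= sc j ->
 [/\ `|dl l j x| <= C * q ^+ j, `|dl l j (x + h) - dl l j x| <= C * (2 * q) ^+ j * d &
 `|(dl l j (x + h + v) - dl l j (x + h)) - (dl l j (x + v) - dl l j x)| <= C * (4 * q) ^+ j * (t * d)].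
move=> q0 s1 hd;have [C C0 [m hm]] := Tst_bound q0 s1 hd.
have [B0 B00 hB0] := tf_bound (@tf_k0 R);have [B1 B10 hB1] := @kk_lip R;have [B2 B20 hB2] := @kk_lip2 R.
pose B := B0 + B1 + B2;have BB : 0 <= B by rewrite !addr_ge0.
exists (C * (B / q ^+ 2));first by rewrite mulr_ge0// divr_ge0// exprn_ge0// ltW.
exists m.+2=> -[//|[//|j]] x v h d t mj hx hv hh tj dj.
have t0 : 0 <= t by move: hv;rewrite box0E=> -[/(le_trans (normr_ge0 _))].
have d0 : 0 <= d by move: hh;rewrite box0E=> -[/(le_trans (normr_ge0 _))].
have {mj}mj : (m <= j)%N by [].
pose J := j.+2;have e4 : sc j = 4 * sc J :> R by rewrite /J !scS;field.
have J0 : 0 < sc J :> R := sc_gt0 J.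
have W a b w : box 0 a w -> a <= b -> box 0 b w by move=> h1 h2;exact: box_W h2 h1.
have sup w : box 0 (2 * sc J) w -> forall y, ~ box x (sc j) y -> kk J (x + w) y = 0.
 move=> hw y hy;apply: kk_supp=> hb;apply: hy;apply: (box_tri hw _ hb);rewrite e4;lra.
have Sk w : Sm (kk J w) := tf_Sm (tf_kk J w).
have b0 w y : `|kk J w y| <= B0 by exact: hB0.
have cdw w : box 0 (2 * sc J) w -> cd (kk J (x + w)).
 by move=> hw;case: (hm l x j _ B0 mj hx (Sk _) (sup w hw) (b0 _)).
have z0 : box 0 (2 * sc J) (0 : R * R) by rewrite box0E normr0;split;lra.
have z1 : box 0 (2 * sc J) h by apply: W hh _;lra.
have z2 : box 0 (2 * sc J) v by apply: W hv _;lra.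
have z3 : box 0 (2 * sc J) (h + v) by apply: W (box0D hh hv) _;lra.
have c0 := cdw _ z0;have c1 := cdw _ z1;have c2 := cdw _ z2;have c3 := cdw _ z3.
have s0 := sup _ z0;have s1' := sup _ z1;have s2 := sup _ z2;have s3 := sup _ z3.
rewrite addr0 in c0 s0;rewrite addrA in c3 s3.
have qj : q ^+ j = q ^+ J / q ^+ 2.
 by rewrite /J -addn2 exprD mulfK// expf_neq0// gt_eqF.
have fin (z b p : R) : b <= B * p -> z <= C * (b * q ^+ j) -> z <= C * (B / q ^+ 2) * (p * q ^+ J).
 move=> hb hz;apply: le_trans hz _.
 rewrite (_ : C * (B / q ^+ 2) * (p * q ^+ J) = C * (B * p * q ^+ j));last by rewrite qj;ring.
 by apply: ler_wpM2l=> //;apply: ler_wpM2r=> //;rewrite exprn_ge0// ltW.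
have pw : 2 ^+ J * 2 ^+ J = 4 ^+ J :> R by rewrite -exprMn;congr (_ ^+ _);ring.
have pj0 : 0 <= 2 ^+ J :> R by rewrite exprn_ge0.
rewrite /dl !(avg_Tst l c0, avg_Tst l c1, avg_Tst l c2, avg_Tst l c3);split.
- have [_ H] := hm l x j _ B0 mj hx (Sk _) s0 (b0 _).
 rewrite normrN -/J -[q ^+ J]mul1r;apply: (fin _ _ _ _ H);rewrite mulr1 /B;lra.
- have K0 y : ~ box x (sc j) y -> kk J (x + h) y - kk J x y = 0 by move=> hy;rewrite s1'// s0// subrr.
 have [_] := hm l x j _ _ mj hx (Sm_B (Sk _) (Sk _)) K0 (fun y=> hB1 J x h d y hh).
 rewrite (Tst_B l c1 c0)=> H;rewrite opprK -normrN opprD opprK.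
 rewrite (_ : _ * (2 * q) ^+ J * d = C * (B / q ^+ 2) * (2 ^+ J * d * q ^+ J));last by rewrite exprMn;ring.
 apply: (fin _ _ _ _ H);apply: ler_wpM2r;[exact: mulr_ge0|rewrite /B;lra].
- have K0 y : ~ box x (sc j) y -> kk J (x + h + v) y - kk J (x + h) y - (kk J (x + v) y - kk J x y) = 0.
  by move=> hy;rewrite s3// s2// s1'// s0// !subrr.
 have [_] := hm l x j _ _ mj hx (Sm_B (Sm_B (Sk _) (Sk _)) (Sm_B (Sk _) (Sk _))) K0
  (fun y=> hB2 J x v h d t y hv hh).
 rewrite (Tst_B l (cd_B c3 c1) (cd_B c2 c0)) (Tst_B l c3 c1) (Tst_B l c2 c0)=> H.
 rewrite (_ : C * (B / q ^+ 2) * (4 * q) ^+ J * (t * d) = C * (B / q ^+ 2) * (2 ^+ J * t * (2 ^+ J * d) * q ^+ J));last first.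
  by rewrite exprMn -pw;ring.
 rewrite opp4;apply: (fin _ _ _ _ H).
 have e0 : 0 <= 2 ^+ J * t * (2 ^+ J * d) by apply: mulr_ge0;exact: mulr_ge0.
 have eB : B2 <= B by rewrite /B;lra.
 by rewrite -(mulrA B2);exact: ler_wpM2r e0 _ _ eB.
Qed.
End Reg.

(** * Oscillation of the averages, of their gradients, and of [u] *)

Section Osc.
Context {R : realType}.
Implicit Types (f g phi psi : R * R -> R) (x y v w c h : R * R) (i : 'I_2) (r d t : R).

(** The common core of [osc], where [D] are the averages and [th = q], and of [gosc], where [D] are
    their derivatives and [th = 2 q]. *)
Lemma osc_gen (D : nat -> R * R -> R) (s th C1 : R) (m : nat) : 1 < 2 * th -> th < 1 -> 0 <= C1 ->
 (forall j x h d, (m <= j)%N -> E2 x <= s -> box 0 d h -> d <= sc j ->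
  `|D j x - D j.+1 x| <= C1 * th ^+ j /\
  `|(D j (x + h) - D j.+1 (x + h)) - (D j x - D j.+1 x)| <= C1 * (2 * th) ^+ j * d) ->
 (exists2 C2, 0 <= C2 & forall x h d, box 0 d h -> `|D m (x + h) - D m x| <= C2 * d) ->
 exists2 C, 0 <= C & forall k j x h, (m <= k)%N -> (m <= j)%N -> E2 x <= s -> E2 (x + h) <= s ->
  box 0 (sc k) h -> `|D j x - D j (x + h)| <= C * th ^+ k /\
  ((k <= j)%N -> `|D k x - D j x| <= C * th ^+ k).
move=> t2 t1 C10 H [C2 C20 L];pose C3 := C1 + C2;have th0 : 0 < th by lra.
have C30 : 0 <= C3 by exact: addr_ge0.
have T1 : 0 <= C3 / (1 - th) by rewrite divr_ge0// subr_ge0 ltW.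
have T2 : 0 <= C3 / (2 * th - 1) by rewrite divr_ge0// subr_ge0 ltW.
have C13 : C1 <= C3 by rewrite lerDl.
have z0 j : box (0 : R * R) (sc j) 0 by rewrite box0E normr0 ltW// sc_gt0.
have Ha x j : E2 x <= s -> (m <= j)%N -> `|D j x - D j.+1 x| <= C3 * th ^+ j.
 move=> hx mj;have [h1 _] := H j x 0 (sc j) mj hx (z0 j) (lexx _);apply: le_trans h1 _.
 by apply: ler_wpM2r=> //;rewrite exprn_ge0// ltW.
exists (C3 + C3 / (2 * th - 1) + 2 * (C3 / (1 - th)));first by apply: addr_ge0;[exact: addr_ge0|exact: mulr_ge0].
move=> k j x h mk mj hx hxh hh;split.
 apply: (dyadic_osc (m := m) (d := sc k) (a := D^~ x) (b := D^~ (x + h)) t2 t1 C30)=> //.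
 - by rewrite ltW// sc_gt0.
 - by move=> j';exact: Ha.
 - by move=> j';exact: Ha.
 - rewrite distrC;apply: le_trans (L _ _ _ hh) _;apply: ler_wpM2r;first by rewrite ltW// sc_gt0.
  by rewrite /C3 lerDr.
 move=> j' mj' jk;have [_] := H j' x h (sc k) mj' hx hh (sc_le (ltnW jk));rewrite distrC=> h2.
 apply: le_trans h2 _;apply: ler_wpM2r;first by rewrite ltW// sc_gt0.
 by apply: ler_wpM2r=> //;apply: exprn_ge0;rewrite mulr_ge0// ltW.
move=> kj;have := tail_bound (a := D^~ x) t1 (ltW th0) C30 (fun j=> Ha x j hx) mk kj=> h1.
apply: le_trans h1 _;apply: ler_wpM2r;first by rewrite exprn_ge0// ltW.
by move: T1 T2 C30;move: (C3 / _) (C3 / _)=> a b;lra.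
Qed.

Section S.
Variables (n : nat) (U : 'I_n -> R * R -> R) (G : 'I_n -> 'I_2 -> R * R -> R).
Hypothesis st : stationary U G.
Local Notation lam := (en U).
Local Notation V := (pn U).
Local Notation gv := (gv U G).
Local Notation mu := (mu U G).
Local Notation Fl := (Fl U G).
Let hU := st_W2 st.
Let D2U l : D2 (U l). Proof. by case: (hU l ord0). Qed.
Let L1f l : L1 (msk (U l)) := K2_L1 (D2_K2 (D2U l)).
Let Savg l j : Sm (avg j (msk (U l))). Proof. by apply: Sm_cv=> //;exact: tf_rh. Qed.

Lemma osc (q s : R) l : 1 < 2 * q -> q < 1 -> s < 1 -> decay U G q s -> exists2 C, 0 <= C & exists m : nat,
 forall k j x h, (m <= k)%N -> (m <= j)%N -> E2 x <= s -> E2 (x + h) <= s -> box 0 (sc k) h ->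
 `|avg j (msk (U l)) x - avg j (msk (U l)) (x + h)| <= C * q ^+ k /\
 ((k <= j)%N -> `|avg k (msk (U l)) x - avg j (msk (U l)) x| <= C * q ^+ k).
move=> q2 q1 s1 hd;have q0 : 0 < q by lra.
have [C C0 [m hm]] := deltas st l q0 s1 hd.
have [C' C'0 h'] := osc_gen q2 q1 C0 (D := fun j=> avg j (msk (U l))) (m := m) (s := s)
 (fun j x h d mj hx hh dj=> let: And3 a b _ := hm j x 0 h d 0 mj hx
  (ltac:(by rewrite box0E normr0)) hh (ltW (sc_gt0 j)) dj in conj a b) (cv_lip (L1f l) (tf_rh m)).
by exists C'=> //;exists m.
Qed.

(** The increments of the derivatives, and their differences, are bounded through [dd_le] by first
    and second differences of [dl]. One derivative multiplies the ratio by [2], so [4 q > 1] and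
    [2 q < 1] take the place of [2 q > 1] and [q < 1]. *)
Lemma gosc (q s : R) l i : 1 < 4 * q -> 2 * q < 1 -> s < 1 -> decay U G q s -> exists2 C, 0 <= C & exists m : nat,
 forall k j x h, (m <= k)%N -> (m <= j)%N -> E2 x <= s -> E2 (x + h) <= s -> box 0 (sc k) h ->
 `|dd i (avg j (msk (U l))) x - dd i (avg j (msk (U l))) (x + h)| <= C * (2 * q) ^+ k /\
 ((k <= j)%N -> `|dd i (avg k (msk (U l))) x - dd i (avg j (msk (U l))) x| <= C * (2 * q) ^+ k).
move=> q2 q1 s1 hd;have q0 : 0 < q by lra.
have [C C0 [m hm]] := deltas st l q0 s1 hd.
have Sd j : Sm (dl U l j) by exact: Sm_B.
have dE j x : dd i (avg j (msk (U l))) x - dd i (avg j.+1 (msk (U l))) x = dd i (dl U l j) x.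
 by rewrite (dd_B i x (Savg l j) (Savg l j.+1)).
have bd t : 0 <= t -> box (0 : R * R) t (t *: dir i) by move=> t0;apply: box0_dir;rewrite ger0_norm.
have q4 : 1 < 2 * (2 * q) by lra.
have H j x h d : (m <= j)%N -> E2 x <= s -> box 0 d h -> d <= sc j ->
  `|dd i (avg j (msk (U l))) x - dd i (avg j.+1 (msk (U l))) x| <= C * (2 * q) ^+ j /\
  `|(dd i (avg j (msk (U l))) (x + h) - dd i (avg j.+1 (msk (U l))) (x + h)) -
   (dd i (avg j (msk (U l))) x - dd i (avg j.+1 (msk (U l))) x)| <= C * (2 * (2 * q)) ^+ j * d.
 move=> mj hx hh dj;rewrite !dE;split.
  apply: (dd_le (e := sc j))=> // [|t t0 tj];first exact: sc_gt0.
  by have [_ h2 _] := hm j x _ _ t t mj hx (bd t (ltW t0)) (bd t (ltW t0)) tj tj.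
 have Sh : Sm (fun z=> dl U l j (z + h) - dl U l j z) by apply: Sm_B=> //;exact: Sm_shf.
 rewrite -(dd_shf _ _ _ (Sd j)) -(dd_B i x (Sm_shf h (Sd j)) (Sd j)).
 apply: (dd_le (e := sc j))=> // [|t t0 tj];first exact: sc_gt0.
 have [_ _] := hm j x _ _ d t mj hx (bd t (ltW t0)) hh tj dj.
 rewrite (addrAC x h) (mulrA 2 2) (_ : 2 * 2 = 4);last by ring.
 rewrite (mulrC t) mulrA=> h3;apply: le_trans _ h3;rewrite le_eqVlt;apply/orP;left;apply/eqP;congr `|_|.
 by move: (dl _ _ _ _) (dl _ _ _ _) (dl _ _ _ _) (dl _ _ _ _)=> a1 a2 a3 a4;ring.
have L : exists2 C2, 0 <= C2 & forall x h d, box 0 d h ->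
  `|dd i (avg m (msk (U l))) (x + h) - dd i (avg m (msk (U l))) x| <= C2 * d.
 have [C2 C20 h2] := cv_lip (L1f l) (tf_dd i (tf_rh m));exists C2=> // x h d hh.
 by rewrite !(dd_cv _ _ (L1f l) (tf_rh m));exact: h2.
have [C' C'0 h'] := osc_gen q4 q1 C0 (D := fun j=> dd i (avg j (msk (U l)))) (m := m) (s := s) H L.
by exists C'=> //;exists m.
Qed.

Lemma avgN j f x : L1 f -> avg j (fun y=> -1 * f y) x = - avg j f x.
move=> hf;rewrite (avgE _ _ (L1Z _ hf)) (avgE _ _ hf) -[RHS]mulN1r -(IZ _ (L1_cv_tf x hf (tf_rh j))).
by apply: eq_I=> y;rewrite mulrA.
Qed.

Lemma osc_arith (K u a c q : R) : 0 < K -> K * u <= a + 2 * (c * q) -> u - (a - 2 * (c * q)) / K <= 4 * c / K * q.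
move=> K0 h;have -> : 4 * c / K * q = 4 * c * q / K by ring.
by rewrite lerBlDr -mulrDl ler_pdivlMr// mulrC;lra.
Qed.

(** All fine averages on the square are close to [avg k] at its centre; [avg_bound_ae], applied to
    the function and to its opposite, transfers this to [U] almost everywhere. The constant [c] is
    taken at the lower end so that [U - c] is nonnegative, as the Caccioppoli test function must
    be. *)
Lemma osc_ae (q s s1 : R) l : 1 < 2 * q -> q < 1 -> s < s1 -> s1 < 1 -> decay U G q s1 ->
 exists2 C, 0 <= C & exists m : nat, forall k x, (m <= k)%N -> E2 x <= s ->
 (forall y, box x (sc k) y -> E2 y <= s1) /\
 exists c : R, {ae leb2, forall y, box x (sc k) y -> 0 <= U l y - c <= C * q ^+ k}.
move=> q2 q1 ss1 s1' hd;have [C C0 [m hm]] := osc l q2 q1 s1' hd.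
have [d0 d00 hg] := geo2 ss1 s1'.
have [m' hm'] := sc_small d00;have K0 := @I_rho_gt0 R.
exists (4 * C / I rho);first by rewrite divr_ge0 ?mulr_ge0// ltW.
exists (maxn m m')=> k x mk hx.
have hb y : box x (sc k) y -> E2 y <= s1.
 move=> hy;apply: hg hx _;apply: box_W hy;apply: le_trans hm';apply: sc_le.
 exact: leq_trans (leq_maxr _ _) mk.
have {}mk := leq_trans (leq_maxl _ _) mk.
split=> //;pose f := msk (U l);pose a := avg k f x;pose e := 2 * (C * q ^+ k).
exists ((a - e) / I rho).
have key j y : (maxn m k <= j)%N -> box x (sc k) y -> `|avg j f y - a| <= e.
 rewrite geq_max=> /andP[mj kj] hy.
 have hy' : box 0 (sc k) (y - x) by rewrite box0E.
 have yx : x + (y - x) = y by rewrite addrC subrK.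
 have [h1 h2] := hm k j x (y - x) mk mj (le_trans hx (ltW ss1)) (ltac:(by rewrite yx;exact: hb)) hy'.
 rewrite yx in h1;have {}h2 := h2 kj.
 have -> : avg j f y - a = - (avg j f x - avg j f y) - (a - avg j f x) by ring.
 apply: le_normB;rewrite normrN /e mulr_natl mulr2n;exact: lerD.
have up := @avg_bound_ae R f (box x (sc k)) (a + e) (maxn m k) (measurable_box _ _) (L1f l).
have dn := @avg_bound_ae R (fun y=> -1 * f y) (box x (sc k)) (- a + e) (maxn m k) (measurable_box _ _) (L1Z _ (L1f l)).
have {}up := up (fun j y mj hy=> ltac:(by have := key j y mj hy;rewrite ler_norml=> /andP[_];rewrite lerBlDl)).
have {}dn := dn (fun j y mj hy=> ltac:(by rewrite (avgN _ _ (L1f l));have := key j y mj hy;rewrite ler_norml=> /andP[h _];lra)).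
apply: filterS2 up dn=> y h1 h2 hy;have {}h1 := h1 hy;have {}h2 := h2 hy.
have dy : disk y by apply/diskE;exact: le_lt_trans (hb y hy) s1'.
move: h1 h2;rewrite /f !mskT// => h1 h2;apply/andP;split.
 by rewrite subr_ge0 ler_pdivrMr// mulrC;lra.
exact: osc_arith K0 h1.
Qed.
End S.
End Osc.

(** * The Caccioppoli inequality and the improvement of the decay rate *)

Section Cacc.
Context {R : realType}.
Implicit Types (f g phi psi : R * R -> R) (x y v w c h : R * R) (i : 'I_2) (r d t : R).

(* Completing the square absorbs the cross term. *)
Lemma absorb (e g z a k M : R) : `|a| <= k -> 0 <= z -> z <= M ->
 2^-1 * (e * g) ^+ 2 <= g * (e * e * g + (e * a + a * e) * z) + 2 * k ^+ 2 * M ^+ 2.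
move=> ak z0 zM;have M0 : 0 <= M by exact: le_trans zM.
have h : (a * z) ^+ 2 <= (k * M) ^+ 2.
 rewrite -(real_normK (num_real (a * z))) normrM (ger0_norm z0) lerXn2r ?nnegrE ?mulr_ge0//.
  exact: le_trans ak.
 exact: ler_pM.
move: h;have := sqr_ge0 (e * g + 2 * (a * z));lra.
Qed.

Lemma cacc_arith (A B M0 m M C : R) : 0 <= M0 -> 0 <= M -> 0 <= m -> B <= M * (M0 * m) ->
 2^-1 * A <= B + 64 * C ^+ 2 * M ^+ 2 -> A <= (2 * M0 + 128 * C ^+ 2) * (M * m + M ^+ 2).
move=> M00 Mp m0 h1 h2.
have h3 : 0 <= C ^+ 2 * (M * m) by apply: mulr_ge0;[exact: sqr_ge0|exact: mulr_ge0].
have h4 : 0 <= M0 * M ^+ 2 by apply: mulr_ge0=> //;exact: sqr_ge0.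
lra.
Qed.

Variables (n : nat) (U : 'I_n -> R * R -> R) (G : 'I_n -> 'I_2 -> R * R -> R).
Hypothesis st : stationary U G.
Local Notation lam := (en U).
Local Notation V := (pn U).
Local Notation gv := (gv U G).
Local Notation mu := (mu U G).
Local Notation Fl := (Fl U G).
Let hU := st_W2 st.
Let U1 := st_ge1 st.
Let D2U l : D2 (U l). Proof. by case: (hU l ord0). Qed.
Let D2G l i : D2 (G l i). Proof. by case: (hU l i). Qed.
Let L1F : L1 Fl := L1_Fl st.
Let LG l i : L2 (msk (G l i)) := proj2 (D2G l i).

Lemma laplacian_bound l phi (P : 'I_2 -> R * R -> R) (r B : R) : r < 1 -> (forall x, r < E2 x -> phi x = 0) ->
 (forall x, `|phi x| <= B) -> (forall i, wd i phi (P i)) -> (forall x, 0 <= phi x) ->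
 `|\sum_i \I_x (msk (G l i) x * P i x)| <= \I_x (Fl x * phi x).
move=> r1 hr hB hP p0;apply: le_eps=> e e0;have e2 : 0 < e / 2 by rewrite divr_gt0.
have [psi [hpsi psi0 h1 h2]] := test_approx r1 hr hB hP (LG l) L1F e2.
have := laplacian_bound_cd st l hpsi (psi0 p0).
have -> : \sum_i \I_x (G l i x * dd i psi x) = \sum_i \I_x (msk (G l i) x * dd i psi x).
 by apply: eq_bigr=> i _;apply: eq_I=> x;rewrite msk_cd//;exact: cd_dd.
move=> h3;apply: le_trans (dist_le h3 h1) _.
by move: (le_trans (ler_norm _) h2);move: (I _) (I _)=> a b;lra.
Qed.

(** Orthogonality of the polar decomposition together with [lambda >= 1]. *)
Lemma gv_le x : gv x <= \sum_l \sum_i G l i x ^+ 2.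
rewrite exchange_big /=;apply: ler_sum=> i _.
have := polar_sq (lam x) (pDm U G i x) (pn_sq ltr01 U1 x) (pDn_orth G ltr01 U1 i x).
rewrite (eq_bigr (fun l=> G l i x ^+ 2))=> [->|l _];last by rewrite -(pDzE G ltr01 U1).
apply: (letr (lam x ^+ 2 * \sum_l pDn U G l i x ^+ 2));last by rewrite lerDr sqr_ge0.
by apply: ler_peMl;[exact: ss_ge0|exact: exprn_ege1].
Qed.

(** The test function is [eta^2 (U - c)]: the bound on the Laplacian contributes [M] times the
    energy of [v], the cutoff contributes [M^2], since [r^-2] is offset by the area of the square.
    The truncation [z] of [U - c] to [[0, M]] secures sign and bound at every point. *)
Lemma caccioppoli (s : R) l : s < 1 -> exists2 C, 0 <= C & forall x k (c M : R),
 (forall y, box x (sc k) y -> E2 y <= s) -> 0 <= M ->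
 {ae leb2, forall y, box x (sc k) y -> 0 <= U l y - c <= M} ->
 \sum_i \I_y ((eta x (sc k.+1) y * msk (G l i) y) ^+ 2) <= C * (M * mu x (sc k) + M ^+ 2).
move=> s1;have [M0 M1 hM0] := Fl_mu st s1;have [Ce Ce0 hCe] := @eta_dd R.
have M00 : 0 <= M0 by exact: le_trans M1.
exists (2 * M0 + 128 * Ce ^+ 2);first by rewrite addr_ge0// mulr_ge0// sqr_ge0.
move=> x k c M hb Mp hae;pose r : R := sc k.+1;have r0 : 0 < r := sc_gt0 _.
have e2 : 2 * r = sc k by rewrite /r scS;field.
pose e := eta x r;have Se : Sm e := Sm_eta x r;have Se2 : Sm (fun y=> e y * e y) := Sm_M Se Se.
have e0 y : ~ box x (sc k) y -> e y = 0 by move=> hy;rewrite /e eta0// e2.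
have ee0 y : ~ box x (sc k) y -> e y * e y = 0 by move=> hy;rewrite e0// mul0r.
have de0 i : forall y, ~ box x (sc k) y -> dd i e y = 0 := dd_supp i e0.
have dE i y : dd i (fun y=> e y * e y) y = e y * dd i e y + dd i e y * e y by rewrite (dd_M i y Se Se) [X in _ + X]mulrC.
have he : cd (fun y=> e y * e y) := cd_of_box Se2 s1 hb ee0.
pose z y := Num.min M (Num.max 0 (U l y - c)).
have z0 y : 0 <= z y by rewrite le_min Mp le_max lexx.
have zM y : z y <= M by rewrite ge_min lexx.
have mU : mf (U l) by case: (D2U l).
have mz : mf z.
 apply: measurable_minr;first exact: mfc.
 by apply: measurable_maxr;[exact: mfc|exact: mfB mU (mfc c)].
have ze : {ae leb2, forall y, box x (sc k) y -> z y = U l y - c}.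
 by apply: filterS hae=> y hy /hy /andP[h1 h2];rewrite /z max_r// min_r.
pose phi y := e y * e y * z y;pose P i y := e y * e y * G l i y + (e y * dd i e y + dd i e y * e y) * z y.
have bsb f : (forall y, ~ box x (sc k) y -> f y = 0) -> bs f.
 move=> h0;exists 1=> y hy;apply: h0=> hyb;apply: hy;apply: E2_box=> //.
 by rewrite expr1n;exact: le_trans (hb y hyb) (ltW s1).
have p0 y : ~ box x (sc k) y -> phi y = 0 by move=> hy;rewrite /phi ee0// mul0r.
have P0 i y : ~ box x (sc k) y -> P i y = 0 by move=> hy;rewrite /P e0// de0// !(mul0r, mulr0, addr0).
have mG i : mf (G l i) by case: (D2G l i).
have me := Sm_mf Se;have mde i := Sm_mf (Sm_dd i Se).
have wP i : wd i phi (P i).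
 have := W2_loc he (W2_D (hU l i) (W2_cst i (- c)))=> W.
 apply: (wd_ae W).
 - by apply: mfM=> //;apply: mfM.
 - exact: bsb p0.
 - apply: filterS ze=> y hy;have [/hy zy|by_] := pselect (box x (sc k) y);first by rewrite /phi zy.
  by rewrite p0// ee0// mul0r.
 - by apply: mfD;apply: mfM=> //;[exact: mfM|apply: mfD;exact: mfM].
 - exact: bsb (P0 i).
 apply: filterS ze=> y hy;rewrite dE addr0;have [/hy zy|by_] := pselect (box x (sc k) y);first by rewrite /P zy.
 by rewrite P0// ee0// e0// de0// !(mul0r, addr0).
have e1 y : 0 <= e y <= 1 := eta01 x r y.
have ph0 y : 0 <= phi y by rewrite mulr_ge0// -expr2 sqr_ge0.
have phM y : `|phi y| <= M.
 rewrite ger0_norm// -[M]mul1r;apply: ler_pM=> //;first by rewrite -expr2 sqr_ge0.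
 by have /andP[a b] := e1 y;exact: mulr_ile1.
have hs y : s < E2 y -> phi y = 0 by move=> hy;apply: p0=> /hb;rewrite leNgt hy.
have H1 := le_trans (ler_norm _) (laplacian_bound l s1 hs phM wP ph0).
have {H1}H1 := le_trans H1 (hM0 x (sc k) phi M (K2_mf (let: And3 a _ _ := wP ord0 in a)) hb p0 phM).
have LP i : L1 (fun y=> msk (G l i) y * P i y) by apply: L2M=> //;case: (wP i)=> _ /K2_L2.
have Lb := L1_box x (sc k);pose K := 2 * (Ce / r) ^+ 2 * M ^+ 2.
have Leg i : L1 (fun y=> (e y * msk (G l i) y) ^+ 2).
 by case: (L2_bM me (eta_abs x r) (LG l i)).
have H2 i : 2^-1 * \I_y ((e y * msk (G l i) y) ^+ 2) <=
  \I_y (msk (G l i) y * P i y) + K * (4 * (sc k) ^+ 2).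
 rewrite -(IZ _ (Leg i)) -(I_box x (ltW (sc_gt0 k))) -(IZ _ Lb) -(ID (LP i) (L1Z _ Lb)).
 apply: I_le;[exact: L1Z|by apply: L1D=> //;exact: L1Z|]=> y.
 have [yb|yb] := pselect (box x (sc k) y);last by rewrite e0// P0// indF// !(mul0r, mulr0) expr0n mulr0 addr0.
 have dy : disk y by apply/diskE;exact: le_lt_trans (hb y yb) s1.
 rewrite !mskT// indT// mulr1;exact: (absorb (e y) (G l i y) (hCe x r i y r0) (z0 y) (zM y)).
have H3 := ler_sum (index_enum _) (fun i (_ : true)=> H2 i).
rewrite -mulr_sumr big_split /= in H3.
have KE : \sum_(i : 'I_2) K * (4 * (sc k) ^+ 2) = 64 * Ce ^+ 2 * M ^+ 2.
 by rewrite sum2E /K -e2;field;rewrite gt_eqF.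
rewrite KE in H3;move: H1 H3;rewrite -/r -/e.
have mu0 : 0 <= mu x (sc k) := mu_ge0 _ _ _ _.
exact: cacc_arith.
Qed.

Lemma decay_tail (p s : R) (C : R) (m : nat) : 0 < p -> p < 1 -> 0 <= C ->
 (forall x k, (m <= k)%N -> E2 x <= s -> mu x (sc k.+1) <= C * p ^+ k) -> decay U G p s.
move=> p0 p1 C0 H;pose T := I (msk gv);have T0 : 0 <= T by apply: I_ge0=> x;exact: gvm_ge0.
have pn k : 0 < p ^+ k by exact: exprn_gt0.
exists (C / p + T / p ^+ m);first by rewrite addr_ge0// divr_ge0// ltW.
move=> x hx j;have [jm|] := leqP j m.
 apply: le_trans (mu_total st _ _) _;rewrite -/T mulrDl;apply: ler_wpDl.
  by rewrite mulr_ge0 ?divr_ge0// ltW.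
 rewrite -mulrA ler_peMr// mulrC ler_pdivlMr// mul1r.
 by rewrite -(subnKC jm) exprD ler_piMr ?(ltW (pn _))// exprn_ile1// ltW.
case: j=> [//|j] mj;apply: le_trans (H x j mj hx) _;rewrite mulrDl exprS mulrA divfK ?gt_eqF// lerDl.
by apply: mulr_ge0;[rewrite divr_ge0// ltW|apply: mulr_ge0;exact: ltW].
Qed.

Lemma decay_le (p q s s1 : R) : s <= s1 -> 0 <= p -> p <= q -> decay U G p s1 -> decay U G q s.
move=> ss p0 pq [C C0 hC];exists C=> // x hx j;apply: le_trans (hC x (le_trans hx ss) j) _.
by apply: ler_wpM2l=> //;apply: lerXn2r=> //;rewrite nnegrE// (le_trans p0).
Qed.

(** On squares of half-side [2^-k] the oscillation and the energy are both of order [q^k], so both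
    terms of the Caccioppoli bound are of order [q^(2k)]. The assumption [2 q > 1] is that of the
    oscillation estimate, and the disk shrinks because squares around its points must stay in the
    larger one. *)
Lemma decay_step (q s s1 : R) : 1 < 2 * q -> q < 1 -> s < s1 -> s1 < 1 -> decay U G q s1 -> decay U G (q ^+ 2) s.
move=> q2 q1 ss1 s1' hd;have q0 : 0 < q by lra.
have q20 : 0 < q ^+ 2 by rewrite exprn_gt0.
have [C0 C00 hC0] := hd.
have key l : exists Cm : R * nat, 0 <= Cm.1 /\ forall x k, (Cm.2 <= k)%N -> E2 x <= s ->
  \sum_i \I_y ((eta x (sc k.+1) y * msk (G l i) y) ^+ 2) <= Cm.1 * (q ^+ 2) ^+ k.
 have [C C0' [m hm]] := osc_ae st l q2 q1 ss1 s1' hd.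
 have [C' C'0 hC'] := caccioppoli l s1'.
 exists (C' * (C * C0 + C ^+ 2), m);split=> [|x k mk hx] /=.
  by rewrite mulr_ge0// addr_ge0 ?sqr_ge0// mulr_ge0.
 have [hb [c hc]] := hm k x mk hx;have qk : 0 <= q ^+ k by rewrite exprn_ge0// ltW.
 apply: le_trans (hC' x k c (C * q ^+ k) hb (mulr_ge0 C0' qk) hc) _;rewrite -[leRHS]mulrA;apply: ler_wpM2l=> //.
 have := hC0 x (le_trans hx (ltW ss1)) k;rewrite exprAC=> hmu.
 rewrite mulrDl exprMn lerD2r (_ : C * C0 * _ = C * q ^+ k * (C0 * q ^+ k));last by ring.
 by apply: ler_wpM2l=> //;exact: mulr_ge0.
have [Cm hCm] := choice key.
apply: (@decay_tail _ _ (\sum_l (Cm l).1) (\max_l (Cm l).2))=> //.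
- by rewrite exprn_ilt1// ltW.
- by apply: sumr_ge0=> l _;case: (hCm l).
move=> x k mk hx;rewrite mulr_suml.
have Leg l i : L1 (fun y=> (eta x (sc k.+1) y * msk (G l i) y) ^+ 2).
 by case: (L2_bM (Sm_mf (Sm_eta x (sc k.+1))) (eta_abs x (sc k.+1)) (LG l i)).
apply: (letr (\sum_l \sum_i \I_y ((eta x (sc k.+1) y * msk (G l i) y) ^+ 2)));last first.
 by apply: ler_sum=> l _;apply: (proj2 (hCm l))=> //;apply: leq_trans mk;exact: leq_bigmax.
have L1s l : L1 (fun y=> \sum_i (eta x (sc k.+1) y * msk (G l i) y) ^+ 2) := L1_sum (Leg l).
have L1ss : L1 (fun y=> \sum_l \sum_i (eta x (sc k.+1) y * msk (G l i) y) ^+ 2) := L1_sum L1s.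
rewrite (eq_bigr (fun l=> \I_y (\sum_i (eta x (sc k.+1) y * msk (G l i) y) ^+ 2)))=> [|l _];last first.
 by rewrite (I_sum (Leg l)).
rewrite -(I_sum L1s);apply: I_le=> // [|y];first exact: L1_bx (L1_gv st).
have [yb|yb] := pselect (box x (sc k.+1) y);last first.
 by rewrite bx_out//;do 2 apply: sumr_ge0=> ? _;exact: sqr_ge0.
rewrite bx_in//;have [dy|dy] := pselect (disk y);last first.
 by rewrite mskF//;do 2 apply: sumr_ge0=> ? _;exact: sqr_ge0.
rewrite mskT//;apply: le_trans (gv_le y) _;apply: ler_sum=> l _;apply: ler_sum=> i _.
by rewrite mskT// eta1 ?mul1r// sc_gt0.
Qed.

(** The rate is squared until it falls below [w = sqrt Q], which exceeds [1/2]; it is then relaxed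
    to [w], and one more step lands exactly on [Q]. Each step halves the distance between the two
    disks, and the number of steps is bounded in advance by [q^(2^k) <= Q]. *)
Lemma decay_target (Q s : R) : 4^-1 < Q -> Q < 1 -> s < 1 -> decay U G Q s.
move=> Q4 Q1 s1.
have Q0 : 0 < Q by lra.
pose w := Num.sqrt Q;have w2 : w ^+ 2 = Q by rewrite sqr_sqrtr// ltW.
have w0 : 0 <= w := sqrtr_ge0 Q.
have w12 : 1 < 2 * w by rewrite ltNge;apply/negP=> h;nra.
have w1 : w < 1 by rewrite ltNge;apply/negP=> h;nra.
have P k : forall q s s1 : R, s < s1 -> s1 < 1 -> 0 < q -> q < 1 -> q ^+ (2 ^ k) <= Q ->
  decay U G q s1 -> decay U G Q s.
 elim: k=> [|k IH] q a b ab b1 q0 q1 hq hd.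
  by rewrite expn0 expr1 in hq;exact: decay_le (ltW ab) (ltW q0) hq hd.
 pose ab2 := (a + b) / 2.
 have a2 : a < ab2 by rewrite /ab2;lra. have b2 : ab2 < b by rewrite /ab2;lra.
 have [qw|wq] := leP q w.
  have := decay_step w12 w1 b2 b1 (decay_le (lexx _) (ltW q0) qw hd);rewrite w2=> H.
  exact: decay_le (ltW a2) (ltW Q0) (lexx _) H.
 have q2 : 1 < 2 * q by lra.
 have := decay_step q2 q1 b2 b1 hd;apply: IH=> //;first exact: lt_trans b1.
 - by rewrite exprn_gt0.
 - by rewrite exprn_ilt1// ltW.
 by rewrite -exprM -expnS.
pose b := (s + 1) / 2;have sb : s < b by rewrite /b;lra. have b1 : b < 1 by rewrite /b;lra.
have [q /andP[q0 q1] hd] := decay_exists st b1.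
have [k hk] : exists k : nat, q ^+ k <= Q.
 have := cvg_expr (ltac:(by rewrite ger0_norm// ltW) : `|q| < 1).
 move=> /cvgrPdist_lt/(_ _ Q0)[k _ /(_ k (leqnn k))] /=;rewrite sub0r normrN=> h.
 by exists k;apply: ltW;apply: le_lt_trans h;exact: ler_norm.
apply: (P k q s b)=> //;apply: le_trans hk;apply: ler_wiXn2l;[exact: ltW|exact: ltW|].
by apply: ltnW;exact: ltn_expl.
Qed.
End Cacc.

(** * The limits of the averages and of their gradients *)

Section Final.
Context {R : realType}.
Implicit Types (f g phi psi : R * R -> R) (x y v w c h : R * R) (i : 'I_2) (r d t : R).

Lemma is_derive_small f x v (l : R) :
 (forall e, 0 < e -> exists2 d, 0 < d & forall t, `|t| < d -> `|f (x + t *: v) - f x - t * l| <= e * `|t|) ->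
 is_derive x v f l.
move=> H.
have L : (fun t : R=> t^-1 *: (f (t *: v + x) - f x)) @ 0^' --> l.
 apply/cvgrPdist_le=> e e0;have [d d0 hd] := H e e0.
 apply/nbhs_ballP;exists d=> // t /=;rewrite /ball /= sub0r normrN=> td t0.
 have tn : 0 < `|t| by rewrite normr_gt0.
 rewrite -(ler_pM2r tn) distrC -normrM mulrBl /GRing.scale /= mulrAC mulVf// mul1r [l * t]mulrC.
 by rewrite (addrC _ x);exact: hd.
by split;[apply/cvg_ex;exists l|exact/cvg_lim].
Qed.

Lemma small_pow (th e : R) : 0 <= th -> th < 1 -> 0 < e -> exists k : nat, th ^+ k < e.
move=> t0 t1 e0;have t1' : `|th| < 1 by rewrite ger0_norm.
have /cvgrPdist_lt/(_ _ e0)[k _ /(_ k (leqnn k))] := cvg_expr t1'.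
by rewrite /= sub0r normrN=> h;exists k;apply: le_lt_trans h;exact: ler_norm.
Qed.
Lemma small_geo (C th e : R) : 0 <= C -> 0 <= th -> th < 1 -> 0 < e ->
 exists k0 : nat, forall k, (k0 <= k)%N -> C * th ^+ k < e.
move=> C0 t0 t1 e0;have C1 : 0 < C + 1 by rewrite ltr_wpDl.
have [k hk] := small_pow t0 t1 (divr_gt0 e0 C1);exists k=> j kj.
apply: (@le_lt_trans _ _ ((C + 1) * th ^+ k)).
 apply: ler_pM=> //;[exact: exprn_ge0|by rewrite lerDl|by apply: ler_wiXn2l=> //;exact: ltW].
by rewrite mulrC -ltr_pdivlMr.
Qed.
Lemma geo_cvg (a : nat -> R) (C th : R) (m : nat) : 0 <= C -> 0 <= th -> th < 1 ->
 (forall k j, (m <= k)%N -> (k <= j)%N -> `|a k - a j| <= C * th ^+ k) -> cvgn a.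
move=> C0 t0 t1 H;apply/cauchy_cvgP/cauchy_exP=> e e0.
have [k0 hk] := small_geo C0 t0 t1 e0;exists (a (maxn k0 m)).
exists (maxn k0 m)=> // j /= kj;rewrite /ball /=.
by apply: le_lt_trans (H _ _ (leq_maxr _ _) kj) _;apply: hk;exact: leq_maxl.
Qed.
Lemma lim_dist (a b : nat -> R) (l l' C : R) (m : nat) : a @ \oo --> l -> b @ \oo --> l' ->
 (forall j, (m <= j)%N -> `|a j - b j| <= C) -> `|l - l'| <= C.
move=> ha hb H;apply: (@cvgr_to_le _ \oo _ _ (fun j=> `|a j - b j|)).
 by apply: cvg_norm;exact: cvgB.
by exists m.
Qed.

Lemma box_enorm2 x y : box 0 (enorm2 (x - y)) (y - x).
rewrite box0E /enorm2 /=;have h (a b p q : R) : p = a ^+ 2 + b ^+ 2 -> q ^+ 2 = a ^+ 2 \/ q ^+ 2 = b ^+ 2 -> `|q| <= Num.sqrt p.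
 move=> -> hq;rewrite -sqrtr_sqr;apply: ler_wsqrtr.
 by case: hq=> ->;rewrite ?lerDl ?lerDr sqr_ge0.
split;apply: (h (x.1 - y.1) (x.2 - y.2))=> //;[left|right];by rewrite -sqrrN opprB.
Qed.

Lemma dyadic_scale d : 0 < d -> d <= 1 -> exists2 k : nat, sc k.+1 <= d & d <= sc k.
move=> d0 d1;have [m hm] := sc_small d0.
have ex : exists k : nat, sc k.+1 <= d by exists m;apply: le_trans hm;apply: sc_le.
case: (ex_minnP ex)=> k hk kmin;exists k=> //.
case: k kmin {hk} => [|k] kmin;first by rewrite /sc expr0 invr1.
by rewrite leNgt;apply/negP=> /ltW /kmin;rewrite ltnn.
Qed.

Lemma powR_sc (al : R) k : (2 `^ (- al)) ^+ k = sc k `^ al :> R.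
rewrite /sc -powR_mulrn ?powR_ge0// -powRrM -[2 ^+ k]powR_mulrn// -powR_inv1 ?powR_ge0//.
by rewrite -!powRrM;congr (_ `^ _);ring.
Qed.

Lemma mf_lim (F : nat -> R * R -> R) f : (forall j, mf (F j)) -> (forall x, F j x @[j --> \oo] --> f x) -> mf f.
move=> mF cF;have : measurable_fun setT (EFin \o f).
 apply: (emeasurable_fun_cvg (fun j=> EFin \o F j))=> [j|x _];first by apply/measurable_EFinP;exact: mF.
 by apply: cvg_EFin;[exact: nearW|exact: cF].
by move/measurable_EFinP.
Qed.

Section S.
Variables (n : nat) (U : 'I_n -> R * R -> R) (G : 'I_n -> 'I_2 -> R * R -> R).
Hypothesis st : stationary U G.
Let D2U l : D2 (U l). Proof. by case: (st_W2 st l ord0). Qed.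
Let L1f l : L1 (msk (U l)) := K2_L1 (D2_K2 (D2U l)).
Let Savg l j : Sm (avg j (msk (U l))). Proof. by apply: Sm_cv=> //;exact: tf_rh. Qed.
Variable (l : 'I_n).
Let kap := (I rho : R).
Let kap0 : 0 < kap := I_rho_gt0.
Let a j x := kap^-1 * avg j (msk (U l)) x.
(** Dividing by [I rho] normalizes the averages. This limit and the next one are meaningful on the
    disk, where both sequences converge. *)
Definition repr x := lim (a j x @[j --> \oo]).
Definition reprD i x := lim (dd i (a j) x @[j --> \oo]).
Let Sa j : Sm (a j). Proof. exact: Sm_Z. Qed.
Let ka0 : 0 <= kap^-1. Proof. by rewrite invr_ge0 ltW. Qed.
Let daE i j x : dd i (a j) x = kap^-1 * dd i (avg j (msk (U l))) x.
by rewrite (dd_Z i (kap^-1) x (Savg l j)). Qed.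

Let kle (p q C t : R) : `|p - q| <= C * t -> `|kap^-1 * p - kap^-1 * q| <= kap^-1 * C * t.
by move=> H;rewrite -mulrBr normrM (ger0_norm ka0) -mulrA;apply: ler_wpM2l. Qed.

Let kle2 (p q p' q' C t : R) : p' = kap^-1 * p -> q' = kap^-1 * q -> `|p - q| <= C * t -> `|p' - q'| <= kap^-1 * C * t.
by move=> -> ->;exact: kle. Qed.

Lemma repr_cvg (s : R) : s < 1 -> exists2 C, 0 <= C & exists m : nat, forall x, E2 x <= s ->
 [/\ a j x @[j --> \oo] --> repr x, forall k, (m <= k)%N -> `|a k x - repr x| <= C * (3 / 4) ^+ k &
 forall k h, (m <= k)%N -> E2 (x + h) <= s -> box 0 (sc k) h -> `|repr x - repr (x + h)| <= C * (3 / 4) ^+ k].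
(* For convergence and continuity any rate in []1/2, 1[] serves; [3/4] is one. *)
move=> s1;have q2 : 1 < 2 * (3 / 4) :> R by lra. have q1 : 3 / 4 < 1 :> R by lra.
have q4 : 4^-1 < 3 / 4 :> R by lra.
have [C C0 [m hm]] := osc st l q2 q1 s1 (decay_target st q4 q1 s1).
have q0 : 0 <= 3 / 4 :> R by lra.
have tail x k j : E2 x <= s -> (m <= k)%N -> (k <= j)%N -> `|a k x - a j x| <= kap^-1 * C * (3 / 4) ^+ k.
 move=> hx mk kj;have z0 : box (0 : R * R) (sc k) 0 by rewrite box0E normr0 ltW// sc_gt0.
 have [_ /(_ kj) H] := hm k j x 0 mk (leq_trans mk kj) hx (ltac:(by rewrite addr0)) z0.
 exact: kle H.
have cva x : E2 x <= s -> a j x @[j --> \oo] --> repr x.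
 by move=> hx;apply: (geo_cvg (mulr_ge0 ka0 C0) q0 q1)=> k j;exact: tail.
exists (kap^-1 * C);first exact: mulr_ge0.
exists m=> x hx;split;first exact: cva.
 by move=> k mk;apply: (lim_dist (m := k) (cvg_cst _) (cva x hx))=> j kj;exact: tail.
move=> k h mk hxh hh;apply: (lim_dist (m := m) (cva x hx) (cva _ hxh))=> j mj.
have [H _] := hm k j x h mk mj hx hxh hh.
exact: kle H.
Qed.

(** The distance from [repr] to [U] is at most the uniform tail [C (3/4)^j] plus the distance from
    the normalized average to [U], and the latter tends to zero in L^1. Countably many concentric
    disks exhaust the whole one. *)
Lemma repr_ae : {ae leb2, forall x, disk x -> repr x = U l x}.
have H (k : nat) : {ae leb2, forall x, E2 x <= 1 - sc k -> repr x = U l x}.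
 pose s : R := 1 - sc k;have s1 : s < 1 by rewrite /s ltrBlDr ltrDl sc_gt0.
 pose S := [set x : R * R | E2 x <= s];have mS : measurable S := measurable_E2 s.
 have [C C0 [m hm]] := repr_cvg s1.
 have cva x : S x -> a j x @[j --> \oo] --> repr x by move=> /hm[].
 have tl x j : S x -> (m <= j)%N -> `|a j x - repr x| <= C * (3 / 4) ^+ j by move=> /hm[_ + _];exact.
 pose F x := \1_S x * (repr x - U l x).
 have mF : mf F.
  apply: (mf_lim (F := fun j x=> \1_S x * (a j x - U l x)))=> [j|x].
   apply: mfM;first exact: mf_ind.
   by apply: mfB;[exact: Sm_mf (Sa j)|case: (D2U l)].
  rewrite /F;have [hx|hx] := pselect (S x);last by rewrite indF// !mul0r;under eq_cvg do rewrite mul0r;exact: cvg_cst.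
  by rewrite indT// mul1r;under eq_cvg do rewrite mul1r;apply: cvgB;[exact: cva|exact: cvg_cst].
 have La j : L1 (fun x=> `|a j x - msk (U l) x|).
  by apply: L1_abs;apply: L1B=> //;apply: L1Z;exact: L1_cv (L1f l) (rh_ker j).
 have Lb := L1_box (0 : R * R) 1;have dS x : S x -> disk x by move=> hx;apply/diskE;exact: le_lt_trans hx s1.
 have FB j x : (m <= j)%N -> `|F x| <= C * (3 / 4) ^+ j * \1_(box 0 1) x + `|a j x - msk (U l) x|.
  have cc : 0 <= C * (3 / 4) ^+ j by rewrite mulr_ge0// exprn_ge0//;lra.
  move=> mj;have [hx|hx] := pselect (S x);last first.
   rewrite /F indF// mul0r normr0 addr_ge0// mulr_ge0//;by case/andP: (ind01 (box 0 1) x).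
  have bx1 : box 0 1 x by apply: E2_box=> //;rewrite expr1n ltW//;exact: le_lt_trans hx s1.
  rewrite /F !indT// mul1r mulr1 mskT;last exact: dS.
  rewrite (_ : repr x - U l x = - (a j x - repr x) + (a j x - U l x));last by ring.
  by apply: le_normD;rewrite normrN lerD2r;exact: tl.
 have LF : L1 (fun x=> `|F x|).
  apply: L1_abs;apply: (L1_le mF _ (fun x=> FB m x (leqnn m)));apply: L1D=> //;exact: L1Z.
 have IF : \I_x (`|F x|) = 0.
  apply/eqP;rewrite eq_le I_ge0// andbT;apply: le_eps=> e e0;rewrite add0r.
  have [C' C'0 hC'] := @I_rh_abs R;have C1 : 0 < C' + 1 by rewrite ltr_wpDl.
  have q0 : 0 <= 3 / 4 :> R by lra. have q1 : 3 / 4 < 1 :> R by lra.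
  have e2 : 0 < e / 2 by rewrite divr_gt0.
  have [d d0 hd] := cv_L1_approx (L1f l) (divr_gt0 (mulr_gt0 kap0 e2) C1).
  have [m' hm'] := sc_small d0;have [k0 hk0] := small_geo (mulr_ge0 (ler0n R 4) C0) q0 q1 e2.
  pose j := maxn m (maxn m' k0);have mj : (m <= j)%N := leq_maxl _ _.
  have m'j : (m' <= j)%N by apply: leq_trans (leq_maxr _ _);exact: leq_maxl.
  have kj : (k0 <= j)%N by apply: leq_trans (leq_maxr _ _);exact: leq_maxr.
  have := hd _ _ (rh_ker j) (le_trans (sc_le m'j) hm');rewrite I_rh -/kap -/(avg j (msk (U l)))=> h1.
  have h2 : \I_x (`|a j x - msk (U l) x|) <= e / 2.
   have -> : \I_x (`|a j x - msk (U l) x|) = kap^-1 * \I_x (`|avg j (msk (U l)) x - kap * msk (U l) x|).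
    rewrite -IZ;last by apply: L1_abs;apply: L1B;[exact: L1_cv (L1f l) (rh_ker j)|exact: L1Z].
    apply: eq_I=> x;rewrite -[X in X * _](ger0_norm ka0) -normrM mulrBr mulrA mulVf ?mul1r//.
    by rewrite gt_eqF.
   rewrite mulrC ler_pdivrMr// mulrC;apply: le_trans h1 _;rewrite mulrAC ler_pdivrMr//.
   by apply: ler_wpM2l;[rewrite mulr_ge0 ?ltW|apply: le_trans (hC' j) _;rewrite lerDl].
  apply: le_trans (I_le LF (L1D (L1Z _ Lb) (La j)) (fun x=> FB j x mj)) _.
  rewrite (ID (L1Z _ Lb) (La j)) (IZ _ Lb) (I_box _ ler01) expr1n mulr1 [leRHS](splitr e).
  by apply: lerD=> //;rewrite mulrC mulrA;apply: ltW;exact: hk0.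
 have := I_eq0 LF (fun x=> normr_ge0 _) IF;apply: filterS=> x hx xs;move: hx.
 by rewrite /F indT// mul1r=> /normr0_eq0/eqP;rewrite subr_eq0=> /eqP.
have : {ae leb2, forall x (k : nat), E2 x <= 1 - sc k -> repr x = U l x} by apply: ae_foralln=> k;exact: H.
apply: filterS=> x hx /diskE dx;have [k hk] := sc_small (ltac:(by rewrite subr_gt0) : 0 < 1 - E2 x).
by apply: (hx k);move: hk;lra.
Qed.

Lemma reprD_cvg (al s : R) i : 0 < al -> al < 1 -> s < 1 -> exists2 C, 0 <= C & exists m : nat, forall x, E2 x <= s ->
 [/\ dd i (a j) x @[j --> \oo] --> reprD i x, `|reprD i x| <= C &
 forall k h, (m <= k)%N -> E2 (x + h) <= s -> box 0 (sc k) h ->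
  (forall j, (m <= j)%N -> `|dd i (a j) x - dd i (a j) (x + h)| <= C * (2 `^ (- al)) ^+ k) /\
  `|reprD i x - reprD i (x + h)| <= C * (2 `^ (- al)) ^+ k].
(* [q = 2^-(1 + al)] lies strictly between [1/4] and [1/2]: within reach of [decay_target], while
   [gosc] has ratio [2 q = 2^-al], so that its [k]-th power is the [al]-th power of the half-side
   [2^-k]. *)
move=> al0 al1 s1;pose th : R := 2 `^ (- al);pose q := th / 2.
have t2 : 2 * q = th by rewrite /q;field.
have ln2 : 0 < ln 2 :> R by rewrite ln_gt0// ltr1n.
have thE : th = expR (- al * ln 2) by rewrite /th /powR pnatr_eq0.
have th1 : th < 1 by rewrite thE expR_lt1 mulNr oppr_lt0 mulr_gt0.
have th2 : 1 < 2 * th.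
 rewrite thE -[X in X * _](@lnK R 2) ?posrE// -expRD -{1}(mul1r (ln 2)) -mulrDl expR_gt1 mulr_gt0//.
 by rewrite subr_gt0.
have th0 : 0 <= th by exact: powR_ge0.
have q4 : 1 < 4 * q by rewrite /q;lra.
have q1 : 2 * q < 1 by rewrite t2.
have hd : decay U G q s by apply: (decay_target st)=> //;rewrite /q;lra.
have [C C0 [m hm]] := gosc st l i q4 q1 s1 hd;rewrite t2 in hm.
have tail k j x : (m <= k)%N -> (k <= j)%N -> E2 x <= s -> `|dd i (a k) x - dd i (a j) x| <= kap^-1 * C * th ^+ k.
 move=> mk kj hx;have z0 : box (0 : R * R) (sc k) 0 by rewrite box0E normr0 ltW// sc_gt0.
 have [_ /(_ kj) H] := hm k j x 0 mk (leq_trans mk kj) hx (ltac:(by rewrite addr0)) z0.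
 exact: kle2 (daE i k x) (daE i j x) H.
have Hh k j x h : (m <= k)%N -> (m <= j)%N -> E2 x <= s -> E2 (x + h) <= s -> box 0 (sc k) h ->
  `|dd i (a j) x - dd i (a j) (x + h)| <= kap^-1 * C * th ^+ k.
 move=> mk mj hx hxh hh;have [H _] := hm k j x h mk mj hx hxh hh.
 exact: kle2 (daE i j x) (daE i j (x + h)) H.
have kC : 0 <= kap^-1 * C by exact: mulr_ge0.
have cva x : E2 x <= s -> dd i (a j) x @[j --> \oo] --> reprD i x.
 by move=> hx;apply: (@geo_cvg _ (kap^-1 * C) th m)=> // k j mk kj;exact: tail.
have [B B0 hB] : exists2 B, 0 <= B & forall x, `|dd i (a m) x| <= B.
 have Lr := tf_dd i (@tf_rh R m);have [M M0 hM] := tf_bound Lr.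
 exists (kap^-1 * (M * \I_y (`|msk (U l) y|)));first by rewrite mulr_ge0// mulr_ge0// I_ge0.
 move=> x;rewrite daE normrM (ger0_norm ka0);apply: ler_wpM2l=> //.
 rewrite (dd_cv _ _ (L1f l) (tf_rh m)) (cv_tfE _ (L1f l) Lr) -(IZ _ (L1_abs (L1f l)));apply: I_absle.
 - exact: L1_mf (L1_cv_tf x (L1f l) Lr).
 - exact: L1Z (L1_abs (L1f l)).
 - by move=> y;rewrite normrM mulrC;apply: ler_wpM2r.
exists (B + kap^-1 * C);first exact: addr_ge0.
have leC k : kap^-1 * C * th ^+ k <= (B + kap^-1 * C) * th ^+ k.
 by apply: ler_wpM2r;[exact: exprn_ge0|rewrite lerDr].
exists m=> x hx;split;first exact: cva.
 apply: (@dist_le _ (dd i (a m) x))=> //.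
 apply: (lim_dist (m := m) (cvg_cst _) (cva x hx))=> j mj;apply: le_trans (tail _ _ _ (leqnn m) mj hx) _.
 by rewrite ler_piMr// exprn_ile1// ltW.
move=> k h mk hxh hh;split.
 by move=> j mj;apply: le_trans (Hh k j x h mk mj hx hxh hh) (leC k).
apply: le_trans _ (leC k).
by apply: (lim_dist (m := m) (cva x hx) (cva _ hxh))=> j mj;exact: Hh.
Qed.
End S.
End Final.

(** * Differentiability, Hoelder continuity, and assembly of the components *)

Section Rows.
Context {R : realType}.
Implicit Types (f g : R * R -> R) (x y h : R * R) (i : 'I_2) (d t : R).

Lemma cvg_osc f x (s C th : R) (m : nat) : E2 x < s -> 0 <= C -> 0 <= th -> th < 1 ->
 (forall k h, (m <= k)%N -> E2 (x + h) <= s -> box 0 (sc k) h -> `|f x - f (x + h)| <= C * th ^+ k) ->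
 f y @[y --> x] --> f x.
move=> hx C0 t0 t1 H;apply/cvgrPdist_lt=> e e0.
have [k0 hk] := small_geo C0 t0 t1 e0;pose k := maxn k0 m.
near=> y;have yx : x + (y - x) = y by rewrite addrC subrK.
apply: le_lt_trans (hk k (leq_maxl _ _));rewrite -{1}yx;apply: H;first exact: leq_maxr.
 by rewrite yx ltW//;near: y;exact: E2_near_lt.
near: y;apply: (@box_near _ _ (sc k))=> [|y h1 h2];first exact: sc_gt0.
by rewrite box0E;split;exact: ltW.
Unshelve. all: by end_near.
Qed.

Lemma cvg_rowsum n (V : normedModType R) (F : 'I_n -> R * R -> V) (L : 'I_n -> V) x :
 (forall l, F l y @[y --> x] --> L l) -> (\sum_l F l y) @[y --> x] --> \sum_l L l.
elim: n F L=> [|n IH] F L h.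
 by rewrite big_ord0;under eq_cvg do rewrite big_ord0;exact: cvg_cst.
rewrite big_ord_recl;under eq_cvg do rewrite big_ord_recl.
by apply: cvgD;[exact: h|apply: IH=> l;exact: h].
Qed.

Lemma row_delta n (F : 'I_n -> R) : \row_l F l = \sum_l F l *: delta_mx ord0 l :> 'rV[R]_n.
by rewrite [LHS]row_sum_delta;apply: eq_bigr=> l _;rewrite mxE. Qed.

(** A row is a finite sum of scalar functions times basis vectors, so limits and derivatives pass to
    it; for the Hoelder bound the Euclidean norm is at most the sum of the absolute values of the
    entries, and compact sets sit in concentric smaller disks. *)
Lemma C1alpha_rows N (f : 'I_N -> R * R -> R) (g : 'I_N -> 'I_2 -> R * R -> R) (al : R) :
 (forall l x, disk x -> f l y @[y --> x] --> f l x) ->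
 (forall l i x, disk x -> is_derive x (dir i) (f l) (g l i x)) ->
 (forall l i x, disk x -> g l i y @[y --> x] --> g l i x) ->
 (forall l i (s : R), s < 1 -> exists2 C, 0 <= C & forall x y, E2 x <= s -> E2 y <= s ->
  `|g l i x - g l i y| <= C * enorm2 (x - y) `^ al) ->
 C1alpha_loc al (fun x=> \row_l f l x).
move=> cf df cg hg;pose W (F : 'I_N -> R * R -> R) x : 'rV[R]_N := \row_l F l x.
have cW (F : 'I_N -> R * R -> R) (x : R * R) : (forall l, F l y @[y --> x] --> F l x) -> W F y @[y --> x] --> W F x.
 move=> h;rewrite /W row_delta;under eq_cvg do rewrite row_delta.
 by apply: cvg_rowsum=> l;apply: cvgZr_tmp;exact: h.
have dW i x : disk x -> is_derive x (dir i) (W f) (W (fun l=> g l i) x).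
 move=> dx.
 have -> : W f = \sum_l (fun y=> f l y *: (delta_mx ord0 l : 'rV[R]_N)).
  by apply/funext=> y;rewrite /W row_delta fct_sumE.
 rewrite /W row_delta.
 by apply: is_derive_sum=> l;apply: is_derive_scalew;exact: df.
have DE i x : disk x -> 'D_(dir i) (W f) x = W (fun l=> g l i) x.
 by move=> dx;case: (dW i x dx).
split.
 split=> [x /set_mem dx|i];first by apply: cW=> l;exact: cf.
 split=> [x /set_mem dx|];first by case: (dW i x dx).
 split=> // x /set_mem dx;rewrite /continuous_at (DE i x dx).
 apply: cvg_trans (cW (fun l=> g l i) x (fun l=> cg l i x dx));apply: near_eq_cvg.
 by move/diskE: (dx)=> /E2_near_lt;apply: filterS=> y /diskE dy;rewrite DE.
move=> K cK Kd;have [s s1 hs] := compact_disk_E2 cK Kd.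
have [C hC] : exists C : 'I_N -> 'I_2 -> R, forall l i, 0 <= C l i /\ forall x y, E2 x <= s -> E2 y <= s ->
  `|g l i x - g l i y| <= C l i * enorm2 (x - y) `^ al.
 have H l : exists c : 'I_2 -> R, forall i, 0 <= c i /\ forall x y, E2 x <= s -> E2 y <= s ->
  `|g l i x - g l i y| <= c i * enorm2 (x - y) `^ al.
  have key i : exists c : R, 0 <= c /\ forall x y, E2 x <= s -> E2 y <= s ->
   `|g l i x - g l i y| <= c * enorm2 (x - y) `^ al by have [c c0 hc] := hg l i s s1;exists c.
  by have [c hc] := choice key;exists c.
 by have [C hC] := choice H;exists C.
exists (\sum_l \sum_i C l i)=> i x y Kx Ky.
rewrite (DE i x (Kd x Kx)) (DE i y (Kd y Ky)).
pose z l (_ : R * R) := g l i x - g l i y.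
have -> : enorm (W (fun l=> g l i) x - W (fun l=> g l i) y) = en z 0.
 by rewrite /enorm /en;congr Num.sqrt;apply: eq_bigr=> l _;rewrite !mxE.
apply: le_trans (en_le _ _) _;rewrite mulr_suml;apply: ler_sum=> l _.
have [_ H] := hC l i;apply: le_trans (H x y (hs x Kx) (hs y Ky)) _.
apply: ler_wpM2r;first exact: powR_ge0.
by rewrite (bigD1 i)//= lerDl;apply: sumr_ge0=> i' _;case: (hC l i').
Qed.

Section S.
Variables (n : nat) (U : 'I_n -> R * R -> R) (G : 'I_n -> 'I_2 -> R * R -> R).
Hypothesis st : stationary U G.

Lemma half_lt (s : R) : s < 1 -> s < (s + 1) / 2 /\ (s + 1) / 2 < 1.
by move=> s1;split;lra. Qed.

Lemma repr_cont l x : disk x -> repr U l y @[y --> x] --> repr U l x.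
move=> /diskE /half_lt[h1 h2];have [C C0 [m hm]] := repr_cvg st l h2.
have [_ _ H] := hm x (ltW h1);apply: (cvg_osc h1 C0 _ _ H);lra.
Qed.

Lemma powR2_lt1 (al : R) : 0 < al -> 2 `^ (- al) < 1 :> R.
move=> a0;have l2 : 0 < ln 2 :> R by rewrite ln_gt0// ltr1n.
by rewrite /powR pnatr_eq0 /= expR_lt1 mulNr oppr_lt0 mulr_gt0.
Qed.

Lemma reprD_cont l i x : disk x -> reprD U l i y @[y --> x] --> reprD U l i x.
move=> /diskE /half_lt[h1 h2].
have a0 : 0 < 2^-1 :> R by []. have a1 : 2^-1 < 1 :> R by lra.
have [C C0 [m hm]] := reprD_cvg st l i a0 a1 h2.
have [_ _ H] := hm x (ltW h1).
apply: (@cvg_osc _ _ _ C (2 `^ (- 2^-1)) m h1 C0 (powR_ge0 _ _) (powR2_lt1 a0))=> k h mk hh bh.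
by have [_] := H k h mk hh bh.
Qed.

(** For the smooth averages the mean value theorem bounds the first-order error by the oscillation
    of their derivative on the segment, uniformly in the scale [j]; the bound survives as [j] tends
    to infinity. *)
Lemma repr_derive l i x : disk x -> is_derive x (dir i) (repr U l) (reprD U l i x).
move=> /diskE /half_lt[];set s := (_ + 1) / 2=> h1 h2.
have [d d0 hd] := geo2 h1 h2.
have a0 : 0 < 2^-1 :> R by []. have a1 : 2^-1 < 1 :> R by lra.
have [C C0 [m hm]] := reprD_cvg st l i a0 a1 h2;have [C' _ [m' hm']] := repr_cvg st l h2.
have [c1 _ H] := hm x (ltW h1).
apply: is_derive_small=> e e0.
have [k0 hk] := small_geo C0 (powR_ge0 2 (- 2^-1)) (powR2_lt1 a0) e0;pose k := maxn k0 m.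
exists (Num.min d (sc k));first by rewrite lt_min d0 sc_gt0.
move=> t;rewrite lt_min=> /andP[td tk].
have E2u (u : R) : `|u| <= `|t| -> E2 (x + u *: dir i) <= s.
 by move=> ut;apply: hd (lexx _) _;apply: box_add;apply: box0_dir (le_trans ut (ltW td)).
have [ct _ _] := hm' _ (E2u t (lexx _));have [cx _ _] := hm' x (ltW h1).
pose a j y := (I rho)^-1 * avg j (msk (U l)) y.
have lim1 : (a j (x + t *: dir i) - a j x - t * dd i (a j) x) @[j --> \oo] -->
  repr U l (x + t *: dir i) - repr U l x - t * reprD U l i x.
 by apply: cvgB;[exact: cvgB ct cx|apply: cvgM c1;exact: cvg_cst].
rewrite -[X in `|X| <= _]subr0;apply: (lim_dist (m := m) lim1 (cvg_cst _))=> j mj;rewrite subr0.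
have Sa : Sm (a j).
 apply: Sm_Z;apply: Sm_cv;last exact: tf_rh.
 by apply: K2_L1;apply: D2_K2;case: (st_W2 st l i).
have [u ut ->] := line_MVT i x t Sa;rewrite -mulrBr normrM mulrC;apply: ler_wpM2r=> //.
have uk : `|u| <= sc k by apply: le_trans ut (ltW tk).
have [Hj _] := H k _ (leq_maxr _ _) (E2u u ut) (box0_dir i uk).
by rewrite distrC;apply: le_trans (Hj j mj) _;apply: ltW;apply: hk;exact: leq_maxl.
Qed.

Lemma powR_double (al p q : R) : 0 <= al -> 0 <= p -> p / 2 <= q -> p `^ al <= 2 `^ al * q `^ al.
move=> a0 p0 pq;have q0 : 0 <= q by apply: le_trans pq;rewrite divr_ge0.
by rewrite -powRM//;apply: ge0_ler_powR;rewrite ?nnegrE ?mulr_ge0//;lra.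
Qed.

(** A distance [d] below [2^-m] lies in some [[2^-(k+1), 2^-k]], and the estimate at scale [k] costs
    the factor [2^al]. Larger distances are covered by the sup bound divided by [(2^-m)^al]. *)
Lemma reprD_holder l i (al s : R) : 0 < al -> al < 1 -> s < 1 -> exists2 C, 0 <= C & forall x y,
 E2 x <= s -> E2 y <= s -> `|reprD U l i x - reprD U l i y| <= C * enorm2 (x - y) `^ al.
move=> a0 a1 s1;have [C C0 [m hm]] := reprD_cvg st l i a0 a1 s1.
have sm0 : 0 < sc m :> R := sc_gt0 m.
have K1 : 0 <= 2 * C / sc m `^ al by rewrite divr_ge0 ?powR_ge0// mulr_ge0.
have K2 : 0 <= C * 2 `^ al by rewrite mulr_ge0// powR_ge0.
exists (C * 2 `^ al + 2 * C / sc m `^ al);first exact: addr_ge0.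
move=> x y hx hy;set d := enorm2 (x - y);have d0 : 0 <= d := sqrtr_ge0 _.
have hb : box 0 d (y - x) := box_enorm2 x y;have yx : x + (y - x) = y by rewrite addrC subrK.
have [_ bx H] := hm x hx;have [_ by_ _] := hm y hy.
have [->|dn0] := eqVneq x y;first by rewrite subrr normr0 mulr_ge0 ?powR_ge0// addr_ge0.
have dp : 0 < d.
 rewrite lt_neqAle d0 andbT eq_sym;apply/eqP=> dz;move/eqP: dn0;apply;move: hb;rewrite dz box0E /=.
 rewrite !normr_le0 !subr_eq0=> -[/eqP e1 /eqP e2];move: e1 e2;case: (x) (y)=> ? ? [? ?] /= -> ->//.
rewrite mulrDl;have [dm|dm] := ltP d (sc m).
 have d1 : d <= 1.
  have sc0 : sc 0 = 1 :> R by rewrite /sc expr0 invr1.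
  by apply: ltW (lt_le_trans dm _);rewrite -sc0;exact: sc_le.
 have [k hk1 hk2] := dyadic_scale dp d1.
 have mk : (m <= k)%N.
  rewrite leqNgt;apply/negP=> km;have h : sc m <= sc k.+1 :> R := sc_le km.
  by have := lt_le_trans (le_lt_trans hk1 dm) h;rewrite ltxx.
 have [_] := H k (y - x) mk (ltac:(by rewrite yx)) (box_W hk2 hb);rewrite yx powR_sc=> h.
 apply: le_trans h _;rewrite -[leLHS]addr0;apply: lerD;last by rewrite mulr_ge0 ?powR_ge0.
 rewrite -mulrA;apply: ler_wpM2l=> //;rewrite scS in hk1.
 exact: powR_double (ltW a0) (ltW (sc_gt0 k)) hk1.
have b2 : `|reprD U l i x - reprD U l i y| <= 2 * C.
 have -> : 2 * C = C + C by ring.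
 exact: le_trans (ler_normB _ _) (lerD bx by_).
apply: le_trans b2 _;rewrite -[leLHS]add0r;apply: lerD;first by rewrite mulr_ge0 ?powR_ge0.
rewrite mulrAC ler_pdivlMr ?powR_gt0//;apply: ler_wpM2l;first exact: mulr_ge0.
by apply: ge0_ler_powR;rewrite ?nnegrE ?(ltW a0) ?(ltW sm0).
Qed.
End S.
End Rows.

Theorem theorem1p2 (R : realType) (N : nat) (hN : (2 <= N)%N)
  (u : R * R -> 'rV[R]_N)
  (huX : X_space (solid_ball N) u)
  (hu : critical u) :
 forall alpha : R, 0 < alpha < 1 ->
  exists2 w : R * R -> 'rV[R]_N,
   {ae leb2, forall x, disk x -> w x = u x} & C1alpha_loc alpha w.
Proof.
move=> al /andP[a0 a1]; have [U [G [hU U1 uU mu]]] := good_repr (ltnW hN) huX.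
have st : stationary U G.
 split => //; first exact: (radial_variation hU U1 uU mu hu).
 by move=> j psi hp; exact: (tangential hU U1 uU mu hu).
(* The representative is a limit of averages and does not involve the exponent [al]. *)
exists (fun x => \row_l repr U l x).
 have hr : {ae leb2, forall x, forall l, disk x -> repr U l x = U l x}.
  by apply: ae_all_fin => l; exact: repr_ae st l.
 apply: filterS2 uU hr => x h1 h2 dx; apply/rowP => l; rewrite mxE (h2 l dx) -(h1 dx l).
 by rewrite /component.
apply: (@C1alpha_rows _ _ (repr U) (reprD U)).
- by move=> l x; exact: repr_cont st l x.
- by move=> l i x; exact: repr_derive st l i x.
- by move=> l i x; exact: reprD_cont st l i x.
by move=> l i s; exact: (reprD_holder st l i a0 a1).
Qed.
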